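(* Let $\nu>0$, $\kappa>0$ be in one of the five regimes below ($\nu_0,\kappa_0>0$ constants), and let $\mathcal{W}^0_{\rm inc}=(u_{\rm inc},w_{\rm inc},b_{\rm inc})^T$ be an incident wave packet (defined in the context). There exists an approximate solution to the system (S) in $\mathbb{R}^2_+$, which exactly satisfies the boundary conditions (BC), of the form $$\mathcal{W}^{\rm app}:=\mathcal{W}^0_{\rm inc}+\mathcal{W}^0_{\rm BL},$$ where $\mathcal{W}^0_{\rm BL}=(u_{\rm BL},w_{\rm BL},b_{\rm BL})^T$ is a boundary layer wave packet of the following form. - Case 1 ($\nu=\nu_0\varepsilon^6$, $\kappa=\kappa_0\varepsilon^\beta$, $0<\beta<6$): $\mathcal{W}^0_{\rm BL}=\mathcal{W}^0_{{\rm BL},\varepsilon^3}+\mathcal{W}^0_{{\rm BL},\varepsilon^{\beta/3}}$, where $\mathcal{W}^0_{{\rm BL},\varepsilon^{\beta/3}}$ has decay $\varepsilon^{-\beta/3}$ and amplitude $\varepsilon^{-\beta/3}$, and $\mathcal{W}^0_{{\rm BL},\varepsilon^3}$ has decay $\varepsilon^{-3}$ and amplitude $\varepsilon^{\beta/3-3}$ if $\beta>9/2$ and $\varepsilon^{-\beta/3}$ if $\beta<9/2$. - Case 2 ($\nu=\nu_0\varepsilon^6$, $\kappa=\kappa_0\varepsilon^\beta$, $\beta>6$): $\mathcal{W}^0_{\rm BL}=\mathcal{W}^0_{{\rm BL},\varepsilon^2}+\mathcal{W}^0_{{\rm BL},\varepsilon^{\beta/2}}$, where $\mathcal{W}^0_{{\rm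 BL},\varepsilon^2}$ has decay $\varepsilon^{-2}$ and amplitude $\varepsilon^{-2}$, and $\mathcal{W}^0_{{\rm BL},\varepsilon^{\beta/2}}$ has decay $\varepsilon^{-\beta/2}$ and amplitude $\varepsilon^{3\beta/2-10}$. - Case 3 ($\nu=\nu_0\varepsilon^\beta$, $\kappa=\kappa_0\varepsilon^6$, $0<\beta<6$): $\mathcal{W}^0_{\rm BL}=\mathcal{W}^0_{{\rm BL},\varepsilon^{\beta/3}}+\mathcal{W}^0_{{\rm BL},\varepsilon^3}$, where $\mathcal{W}^0_{{\rm BL},\varepsilon^{\beta/3}}$ has decay $\varepsilon^{-\beta/3}$ and amplitude $\varepsilon^{-\beta/3}$, and $\mathcal{W}^0_{{\rm BL},\varepsilon^3}$ has decay $\varepsilon^{-3}$ and amplitude $\varepsilon^{9-5\beta/3}$. - Case 4 ($\nu=\nu_0\varepsilon^\beta$, $\kappa=\kappa_0\varepsilon^6$, $\beta>6$): $\mathcal{W}^0_{\rm BL}=\mathcal{W}^0_{{\rm BL},\varepsilon^2}+\mathcal{W}^0_{{\rm BL},\varepsilon^{\beta/2}}$, where $\mathcal{W}^0_{{\rm BL},\varepsilon^2}$ has decay $\varepsilon^{-2}$ and amplitude $\varepsilon^{-2}$, and $\mathcal{W}^0_{{\rm BL},\varepsilon^{\beta/2}}$ has decay $\varepsilon^{-\beta/2}$ and amplitude $\varepsilon^{2-\beta/2}$ if $\beta<8$ and $\varepsilon^{-2}$ if $\beta>8$. - Case 5 ($\nu=\nu_0\varepsilon^\beta$, $\kappa=\kappa_0\varepsilon^\beta$,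 $\beta>6$): $\mathcal{W}^0_{\rm BL}=\mathcal{W}^0_{{\rm BL},\varepsilon^2}+\mathcal{W}^0_{{\rm BL},\varepsilon^{\beta/2-1}}+\mathcal{W}^0_{{\rm BL},\varepsilon^{\beta/2}}$, where $\mathcal{W}^0_{{\rm BL},\varepsilon^2}$ is a packet with $\lambda=O(\varepsilon^{-2})$, with decay (i.e. $\mathrm{Re}(\lambda)$) of order $\varepsilon^{\beta-8}$ and amplitude $\varepsilon^{-2}$; $\mathcal{W}^0_{{\rm BL},\varepsilon^{\beta/2-1}}$ has decay $\varepsilon^{1-\beta/2}$ and amplitude $\varepsilon^{-2}$; and $\mathcal{W}^0_{{\rm BL},\varepsilon^{\beta/2}}$ has decay $\varepsilon^{-\beta/2}$ and amplitude $\varepsilon^{-1}$. Moreover: (a) $\mathcal{W}^0_{\rm BL}$ is an exact solution to (S) with boundary conditions $$u_{\rm BL}|_{y=0}=-u_{\rm inc}|_{y=0},\quad w_{\rm BL}|_{y=0}=-w_{\rm inc}|_{y=0},\quad \partial_yb_{\rm BL}|_{y=0}=-\partial_yb_{\rm inc}|_{y=0}.$$ (b) $\mathcal{W}^{\rm app}=(u^{\rm app},w^{\rm app},b^{\rm app})^T$ is a consistent approximate solution: with a suitable pressure $p^{\rm app}$ it solves $$\begin{aligned} \partial_t u^{\rm app}-b^{\rm app}\sin\gamma+\partial_x p^{\rm app}&=\nu\Delta u^{\rm app}+R_u^{\rm app},\\ \partial_t w^{\rm app}-b^{\rm app}\cos\gamma+\partial_y p^{\rm app}&=\nu\Delta w^{\rm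 app}+R_w^{\rm app},\\ \partial_t b^{\rm app}+u^{\rm app}\sin\gamma+w^{\rm app}\cos\gamma&=\kappa\Delta b^{\rm app}+R_b^{\rm app},\\ \partial_x u^{\rm app}+\partial_y w^{\rm app}&=0, \end{aligned}$$ with (BC), and $R_{\rm app}=(R_u^{\rm app},R_w^{\rm app},R_b^{\rm app})^T$ satisfies $\|R_u^{\rm app}\|_{L^2(\mathbb{R}^2_+)}=O(\nu)$, $\|R_w^{\rm app}\|_{L^2(\mathbb{R}^2_+)}=O(\nu)$, $\|R_b^{\rm app}\|_{L^2(\mathbb{R}^2_+)}=O(\kappa)$, hence $\|R_{\rm app}\|_{L^2(\mathbb{R}^2_+)}=O(\nu+\kappa)$. Precisely, $\|R_{\rm app}\|_{L^2(\mathbb{R}^2_+)}$ is $O(\varepsilon^\beta)$ in Case 1, $O(\varepsilon^6)$ in Case 2, $O(\varepsilon^\beta)$ in Case 3, $O(\varepsilon^6)$ in Case 4, and $O(\varepsilon^\beta)$ in Case 5.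
   Context: **System.** $\gamma\in(0,\pi/2)$ is a fixed slope angle, and $\mathbb{R}^2_+=\{(x,y):y>0\}$. The system (S) for $(u,w,b,p)$ is $$\begin{aligned} \partial_t u-b\sin\gamma+\partial_xp&=\nu\Delta u,\qquad \partial_t w-b\cos\gamma+\partial_yp=\nu\Delta w,\\ \partial_t b+u\sin\gamma+w\cos\gamma&=\kappa\Delta b,\qquad \partial_xu+\partial_yw=0, \end{aligned}$$ in $\mathbb{R}^2_+$, with boundary conditions (BC): $u|_{y=0}=w|_{y=0}=\partial_yb|_{y=0}=0$. **Small parameter and $O$.** $\varepsilon>0$ is an arbitrarily small parameter. $a=O(b)$ means $a\le Cb$ with $C$ independent of $\varepsilon$. **Incident wave packet.** $$\mathcal{W}^0_{\rm inc}(t,x,y)=\int_{\mathbb{R}^2}\widehat A(k,m)\,X_{k,m}\,e^{-i\omega_{k,m}t+ikx+imy}\,dk\,dm,$$ where: - $\widehat A(k,m)=\frac1{\varepsilon^2}\sum_\pm\chi(\varepsilon^{-2}(k\pm k_0))\,\chi(\varepsilon^{-2}(m\pm m_0))$ with $\chi\in C_0^\infty(\mathbb{R})$ and a central wavenumber $(k_0,m_0)$ with $k_0,m_0\ne0$; - $X_{k,m}=\big(1,\,-\tfrac km,\,\tfrac{i(k\cos\gamma-m\sin\gamma)}{m\,\omega_{k,m}}\big)^T$; the associated pressure coefficient is $\widehat p=\frac1k\big[\omega_{k,m}+\sin\gamma\,\frac{k\cos\gamma-m\sin\gamma}{m\omega_{k,m}}\big]$, so that each plane wave solves (S) with $\nu=\kappa=0$;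 - $\omega_{k,m}=\omega^+_{k,m}$ or $\omega^-_{k,m}$, with $\omega^\pm_{k,m}=\pm\frac{k\cos\gamma-m\sin\gamma}{\sqrt{k^2+m^2}}$, the sign being the one for which $\partial_m\omega^\pm_{k,m}<0$ (downward propagation). **Near-criticality.** The criticality parameter $\zeta:=\omega_{k,m}^2-\sin^2\gamma$ is of leading order exactly $\varepsilon^2$ as $\varepsilon\to0$ (for $(k,m)$ in the support of $\widehat A$). **Boundary layer wave packet.** For $\beta_j>0$, $\alpha_j\in\mathbb{R}$, a boundary layer wave packet is $$\int_{\mathbb{R}^2}\widehat A(k,m)\,a_j\,X_{k,\lambda}\,e^{-i\omega_{k,m}t+ikx-\lambda y}\,dk\,dm,\qquad \mathrm{Re}(\lambda)>0,$$ with $\lambda=\lambda(k,m,\varepsilon)=O(\varepsilon^{-\beta_j})$, amplitude $a_j=a_j(k,m,\varepsilon)=O(\varepsilon^{\alpha_j})$, the same function $\widehat A(k,m)=\frac1{\varepsilon^2}\sum_\pm\chi(\varepsilon^{-2}(k\pm k_0))\,\chi(\varepsilon^{-2}(m\pm m_0))$ and the same time frequency $\omega_{k,m}\in\big\{\pm\frac{k\cos\gamma-m\sin\gamma}{\sqrt{k^2+m^2}}\big\}$ (with the sign for which $\partial_m\omega_{k,m}<0$) that define the incident wave packet $\mathcal{W}^0_{\rm inc}$, and $X_{k,\lambda}=(U_\lambda,W_\lambda,B_\lambda)^T=\big(1,\,\frac{ik}{\lambda},\,\frac{\sin\gamma+ik\lambda^{-1}\cos\gamma}{i\omega_{k,m}-\kappa(k^2-\lambda^2)}\big)^T$,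 where $\lambda$ is such that $(U_\lambda,W_\lambda,B_\lambda,P_\lambda)^Te^{-i\omega_{k,m}t+ikx-\lambda y}$ solves the equations (S) for some pressure coefficient $P_\lambda$. **Terminology.** A packet is said to have decay $\varepsilon^{-\beta_j}$ and amplitude $\varepsilon^{\alpha_j}$ if $\lambda$ is of order $\varepsilon^{-\beta_j}$ and $a_j=O(\varepsilon^{\alpha_j})$. The packets $\mathcal{W}^0_{{\rm BL},\varepsilon^{\beta/3}}$ in Cases 1, 3 and $\mathcal{W}^0_{{\rm BL},\varepsilon^2}$ in Cases 2, 4 may be sums of two such packets with two distinct values of $\lambda$ (called $\lambda_2,\lambda_3$) of the same order and amplitudes $a_2,a_3$ of the same order. *)

(* Defs.v *)
From HB Require Import structures.
From mathcomp Require Import all_boot all_order all_algebra.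
From mathcomp Require Import complex.
From mathcomp Require Import all_classical all_reals all_analysis.

Set Implicit Arguments.
Unset Strict Implicit.
Unset Printing Implicit Defensive.
Import Order.TTheory GRing.Theory Num.Theory.
Import numFieldNormedType.Exports.

Local Open Scope classical_set_scope.
Local Open Scope complex_scope.
Local Open Scope ring_scope.

(* Num.Theory also exports an Re and an Im, with values in the closed field. *)
Local Notation Re := complex.Re.
Local Notation Im := complex.Im.

Section complex_calculus.
Context {R : realType}.

Definition cexp (z : R[i]) : R[i] :=
  (expR (Re z) * cos (Im z)) +i* (expR (Re z) * sin (Im z)).

(* Functions of a real variable with values in R[i] are differentiated and
   integrated componentwise. *)
Definition cderivable (f : R -> R[i]) (s : R) : Prop :=
  derivable (fun r => Re (f r)) s 1 /\ derivable (fun r => Im (f r)) s 1.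

Definition cderive (f : R -> R[i]) (s : R) : R[i] :=
  derive1 (fun r => Re (f r)) s +i* derive1 (fun r => Im (f r)) s.

Definition leb2 :
    {measure set (measurableTypeR R * measurableTypeR R) -> \bar R} :=
  (@lebesgue_measure R \x @lebesgue_measure R)%E.

Definition cintegrable2 (f : R * R -> R[i]) : Prop :=
  leb2.-integrable setT (fun z => (Re (f z))%:E) /\
  leb2.-integrable setT (fun z => (Im (f z))%:E).

Definition cintegral2 (f : R * R -> R[i]) : R[i] :=
  Rintegral leb2 setT (fun z => Re (f z)) +i*
  Rintegral leb2 setT (fun z => Im (f z)).

End complex_calculus.

Section fields.
Context {R : realType}.

(* A field is a function of (t, x, y). Wave packets are given by formulas which
   make sense for every real y, so traces at y = 0 are values at y = 0. *)
Definition field := R -> R -> R -> R[i].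

Record wave := Wave { u_ : field; w_ : field; b_ : field }.

Definition addw (V W : wave) : wave :=
  Wave (fun t x y => u_ V t x y + u_ W t x y)
       (fun t x y => w_ V t x y + w_ W t x y)
       (fun t x y => b_ V t x y + b_ W t x y).

Definition wave0 : wave :=
  Wave (fun _ _ _ => 0) (fun _ _ _ => 0) (fun _ _ _ => 0).

Definition dt (F : field) : field := fun t x y => cderive (fun s => F s x y) t.
Definition dx (F : field) : field := fun t x y => cderive (fun s => F t s y) x.
Definition dy (F : field) : field := fun t x y => cderive (fun s => F t x s) y.

Definition laplacian (F : field) : field :=
  fun t x y => dx (dx F) t x y + dy (dy F) t x y.

Definition has_dt (F : field) : Prop :=
  forall t x y, 0 <= y -> cderivable (fun s => F s x y) t.
Definition has_dx (F : field) : Prop :=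
  forall t x y, 0 <= y -> cderivable (fun s => F t s y) x.
Definition has_dy (F : field) : Prop :=
  forall t x y, 0 <= y -> cderivable (fun s => F t x s) y.

(* All derivatives occurring in the equations exist up to the boundary:
   without this [derive1] could return a meaningless default value. *)
Definition regular (F : field) : Prop :=
  [/\ has_dt F, has_dx F, has_dy F, has_dx (dx F) & has_dy (dy F)].

(* The system (S) in the upper half-plane, with a right-hand side [Q] added to
   its first three equations. *)
Definition system_rhs (gamma nu kappa : R) (W : wave) (p : field) (Q : wave) :
    Prop :=
  [/\ regular (u_ W), regular (w_ W) & regular (b_ W)] /\
  (has_dx p /\ has_dy p) /\
  forall t x y, 0 < y ->
  [/\ dt (u_ W) t x y - b_ W t x y * (sin gamma)%:C + dx p t x y
        = nu%:C * laplacian (u_ W) t x y + u_ Q t x y,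
      dt (w_ W) t x y - b_ W t x y * (cos gamma)%:C + dy p t x y
        = nu%:C * laplacian (w_ W) t x y + w_ Q t x y,
      dt (b_ W) t x y + u_ W t x y * (sin gamma)%:C
                      + w_ W t x y * (cos gamma)%:C
        = kappa%:C * laplacian (b_ W) t x y + b_ Q t x y &
      dx (u_ W) t x y + dy (w_ W) t x y = 0].

Definition system (gamma nu kappa : R) (W : wave) (p : field) : Prop :=
  system_rhs gamma nu kappa W p wave0.

Definition boundary_conditions (W : wave) : Prop :=
  forall t x,
  [/\ u_ W t x 0 = 0, w_ W t x 0 = 0,
      cderivable (fun y => b_ W t x y) 0 & dy (b_ W) t x 0 = 0].

Definition upper_half_plane : set (measurableTypeR R * measurableTypeR R) :=
  [set z | 0 < z.2].

Definition L2norm (f : R * R -> R) : \bar R :=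
  'N[leb2]_(2%:E)[(EFin \o f) \_ upper_half_plane].

(* Size of a field in L^2 of the half-plane, uniformly in time: the constant
   depends neither on e nor on t. *)
Definition L2_bigO (F : R -> field) (g : R -> R) : Prop :=
  exists C : R, \forall e \near 0^'+, forall t : R,
    [/\ measurable_fun upper_half_plane (fun z => Re (F e t z.1 z.2)),
        measurable_fun upper_half_plane (fun z => Im (F e t z.1 z.2)) &
        (L2norm (fun z => Normc.normc (F e t z.1 z.2)) <= (C * g e)%:E)%E].

Definition wave_L2_bigO (W : R -> wave) (g : R -> R) : Prop :=
  exists C : R, \forall e \near 0^'+, forall t : R,
    (L2norm (fun z => Num.sqrt (Normc.normc (u_ (W e) t z.1 z.2) ^+ 2 +
                                Normc.normc (w_ (W e) t z.1 z.2) ^+ 2 +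
                                Normc.normc (b_ (W e) t z.1 z.2) ^+ 2))
       <= (C * g e)%:E)%E.

End fields.
Arguments field R : clear implicits.
Arguments wave R : clear implicits.

Definition C0_infty {R : realType} (chi : R -> R) : Prop :=
  (forall n x, derivable (derive1n n chi) x 1) /\
  compact (closure [set x | chi x != 0]).

(* The data of an incident packet and the diffusivities. [e] is the small
   parameter. The central wavenumber may depend on [e]: the frequency has to be
   within O(e^2) of the critical one while the slope is fixed. *)
Record setting (R : realType) := Setting {
  slope : R;
  chi : R -> R;
  k0 : R -> R;
  m0 : R -> R;
  nu : R -> R;
  kappa : R -> R
}.

Section packets.
Context {R : realType} (S : setting R).

Definition omega_plus (k m : R) : R :=
  (k * cos (slope S) - m * sin (slope S)) / Num.sqrt (k ^+ 2 + m ^+ 2).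
Definition omega_minus (k m : R) : R := - omega_plus k m.

(* The branch with negative vertical group velocity. *)
Definition omega (k m : R) : R :=
  if derive1 (omega_plus k) m < 0 then omega_plus k m else omega_minus k m.

Definition Ahat (e k m : R) : R :=
  e ^- 2 * (chi S (e ^- 2 * (k + k0 S e)) * chi S (e ^- 2 * (m + m0 S e)) +
            chi S (e ^- 2 * (k - k0 S e)) * chi S (e ^- 2 * (m - m0 S e))).

Definition supp_Ahat (e : R) : set (R * R) :=
  closure [set z | Ahat e z.1 z.2 != 0].

(* |f| <= C g, with C independent of e and of (k, m) in the support. *)
Definition bigO (f : R -> R -> R -> R) (g : R -> R) : Prop :=
  exists C : R, \forall e \near 0^'+, forall k m,
    supp_Ahat e (k, m) -> `|f e k m| <= C * g e.

Definition of_order (f : R -> R -> R -> R) (g : R -> R) : Prop :=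
  exists c C : R, 0 < c /\
    \forall e \near 0^'+, forall k m, supp_Ahat e (k, m) ->
      c * g e <= `|f e k m| <= C * g e.

Definition criticality (k m : R) : R := omega k m ^+ 2 - sin (slope S) ^+ 2.

Definition near_critical : Prop :=
  of_order (fun _ k m => criticality k m) (fun e => e ^+ 2).

Definition admissible_wavenumber : Prop :=
  exists c C : R, 0 < c /\
    \forall e \near 0^'+, c <= `|k0 S e| <= C /\ c <= `|m0 S e| <= C.

Definition inc_b (k m : R) : R[i] :=
  'i%C * (k * cos (slope S) - m * sin (slope S))%:C / (m * omega k m)%:C.

Definition inc_phase (k m t x y : R) : R[i] :=
  cexp ('i%C * (- omega k m * t + k * x + m * y)%:C).

Definition W_inc (e : R) : wave R :=
  let packet (X : R -> R -> R[i]) : field R := fun t x y =>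
    cintegral2 (fun z =>
      (Ahat e z.1 z.2)%:C * X z.1 z.2 * inc_phase z.1 z.2 t x y) in
  Wave (packet (fun _ _ => 1)) (packet (fun k m => (- (k / m))%:C))
       (packet inc_b).

Definition bl_w (k : R) (lam : R[i]) : R[i] := 'i%C * k%:C / lam.

Definition bl_b (e k m : R) (lam : R[i]) : R[i] :=
  ((sin (slope S))%:C + 'i%C * k%:C * lam^-1 * (cos (slope S))%:C) /
  ('i%C * (omega k m)%:C - (kappa S e)%:C * ((k ^+ 2)%:C - lam ^+ 2)).

Definition bl_phase (k m : R) (lam : R[i]) (t x y : R) : R[i] :=
  cexp ('i%C * (- omega k m * t + k * x)%:C - lam * y%:C).

Definition bl_mode (e k m : R) (lam : R[i]) : wave R :=
  Wave (fun t x y => bl_phase k m lam t x y)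
       (fun t x y => bl_w k lam * bl_phase k m lam t x y)
       (fun t x y => bl_b e k m lam * bl_phase k m lam t x y).

Definition bl_root (e k m : R) (lam : R[i]) : Prop :=
  0 < Re lam /\
  exists P : R[i], system (slope S) (nu S e) (kappa S e)
    (bl_mode e k m lam) (fun t x y => P * bl_phase k m lam t x y).

Definition bl_integrand (lam a : R -> R -> R -> R[i]) (F : wave R -> field R)
    (e t x y : R) (z : R * R) : R[i] :=
  (Ahat e z.1 z.2)%:C * a e z.1 z.2 *
  F (bl_mode e z.1 z.2 (lam e z.1 z.2)) t x y.

Definition bl_packet (lam a : R -> R -> R -> R[i]) (e : R) : wave R :=
  let packet F : field R := fun t x y =>
    cintegral2 (bl_integrand lam a F e t x y) in
  Wave (packet (@u_ R)) (packet (@w_ R)) (packet (@b_ R)).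

Definition bl_wellformed (lam a : R -> R -> R -> R[i]) : Prop :=
  \forall e \near 0^'+,
    (forall k m, supp_Ahat e (k, m) -> bl_root e k m (lam e k m)) /\
    (forall t x y, 0 <= y ->
      [/\ cintegrable2 (bl_integrand lam a (@u_ R) e t x y),
          cintegrable2 (bl_integrand lam a (@w_ R) e t x y) &
          cintegrable2 (bl_integrand lam a (@b_ R) e t x y)]).

Definition has_decay (lam : R -> R -> R -> R[i]) (d : R) : Prop :=
  of_order (fun e k m => Normc.normc (lam e k m)) (fun e => e `^ d).

Definition has_amplitude (a : R -> R -> R -> R[i]) (alpha : R) : Prop :=
  bigO (fun e k m => Normc.normc (a e k m)) (fun e => e `^ alpha).

(* Packet with decay e^d and amplitude e^alpha. *)
Definition bl_wave (d alpha : R) (W : R -> wave R) : Prop :=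
  exists lam a : R -> R -> R -> R[i],
    [/\ bl_wellformed lam a, has_decay lam d, has_amplitude a alpha &
        W = bl_packet lam a].

(* Possibly a sum of two packets with distinct lambda_2, lambda_3. *)
Definition bl_wave12 (d alpha : R) (W : R -> wave R) : Prop :=
  bl_wave d alpha W \/
  exists lam2 lam3 a2 a3 : R -> R -> R -> R[i],
    [/\ bl_wellformed lam2 a2 /\ bl_wellformed lam3 a3,
        has_decay lam2 d /\ has_decay lam3 d,
        has_amplitude a2 alpha /\ has_amplitude a3 alpha,
        \forall e \near 0^'+, forall k m,
          supp_Ahat e (k, m) -> lam2 e k m != lam3 e k m &
        W = fun e => addw (bl_packet lam2 a2 e) (bl_packet lam3 a3 e)].

(* Packet with lambda = O(e^d), Re lambda of order e^r, amplitude e^alpha. *)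
Definition bl_wave_slow (d r alpha : R) (W : R -> wave R) : Prop :=
  exists lam a : R -> R -> R -> R[i],
    [/\ bl_wellformed lam a,
        bigO (fun e k m => Normc.normc (lam e k m)) (fun e => e `^ d),
        of_order (fun e k m => Re (lam e k m)) (fun e => e `^ r),
        has_amplitude a alpha & W = bl_packet lam a].

End packets.

Inductive regime := Case1 | Case2 | Case3 | Case4 | Case5.

Section regimes.
Context {R : realType}.

Definition regime_range (c : regime) (beta : R) : Prop :=
  match c with
  | Case1 | Case3 => 0 < beta < 6
  | Case2 | Case4 | Case5 => 6 < beta
  end.

Definition regime_nu (c : regime) (nu0 beta e : R) : R :=
  match c with
  | Case1 | Case2 => nu0 * e ^+ 6
  | Case3 | Case4 | Case5 => nu0 * e `^ beta
  end.

Definition regime_kappa (c : regime) (kappa0 beta e : R) : R :=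
  match c with
  | Case1 | Case2 | Case5 => kappa0 * e `^ beta
  | Case3 | Case4 => kappa0 * e ^+ 6
  end.

Definition regime_rate (c : regime) (beta e : R) : R :=
  match c with
  | Case1 | Case3 | Case5 => e `^ beta
  | Case2 | Case4 => e ^+ 6
  end.

(* At beta = 9/2 in Case 1 and beta = 8 in Case 4 the exponent [alpha] of one
   amplitude is not prescribed. *)
Definition regime_form (S : setting R) (c : regime) (beta : R)
    (WBL : R -> wave R) : Prop :=
  match c with
  | Case1 => exists W1 W2 : R -> wave R, exists alpha : R,
      [/\ WBL = (fun e => addw (W1 e) (W2 e)),
          bl_wave12 S (- (beta / 3)) (- (beta / 3)) W2,
          bl_wave S (- 3) alpha W1,
          9 / 2 < beta -> alpha = beta / 3 - 3 &
          beta < 9 / 2 -> alpha = - (beta / 3)]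
  | Case2 => exists W1 W2 : R -> wave R,
      [/\ WBL = (fun e => addw (W1 e) (W2 e)),
          bl_wave12 S (- 2) (- 2) W1 &
          bl_wave S (- (beta / 2)) (3 * beta / 2 - 10) W2]
  | Case3 => exists W1 W2 : R -> wave R,
      [/\ WBL = (fun e => addw (W1 e) (W2 e)),
          bl_wave12 S (- (beta / 3)) (- (beta / 3)) W1 &
          bl_wave S (- 3) (9 - 5 * beta / 3) W2]
  | Case4 => exists W1 W2 : R -> wave R, exists alpha : R,
      [/\ WBL = (fun e => addw (W1 e) (W2 e)),
          bl_wave12 S (- 2) (- 2) W1,
          bl_wave S (- (beta / 2)) alpha W2,
          beta < 8 -> alpha = 2 - beta / 2 &
          8 < beta -> alpha = - 2]
  | Case5 => exists W1 W2 W3 : R -> wave R,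
      [/\ WBL = (fun e => addw (addw (W1 e) (W2 e)) (W3 e)),
          bl_wave_slow S (- 2) (beta - 8) (- 2) W1,
          bl_wave S (1 - beta / 2) (- 2) W2 &
          bl_wave S (- (beta / 2)) (- 1) W3]
  end.

End regimes.

(* Main.v *)
(* Write [s], [c] for the sine and cosine of the slope angle. A mode
   [exp (- i w t + i k x - lam y)] solves (S) iff, with [d = lam^2 - k^2],
     (i w + nu d) (i w + kappa d) d + (s lam + i k c)^2 = 0.
   Near criticality [w^2 - s^2] is of order [e^2], and after a rescaling
   [lam = tau L] this sextic is, for each of the relevant scales [tau], a small
   perturbation of an explicit polynomial with simple roots: [L^2 = - i w] for
   the fast layer, a depressed cubic (solved by Cardano's formula) for the slow
   layers of Cases 1 to 4, and [L^2 = - i C], [L = i B / C] in Case 5. A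
   contraction iteration started at these roots converges to exact roots which
   depend measurably on [(k, m)]. In Case 5 the slowest root is imaginary to
   leading order, and the size of its real part is read off the real part of
   the equation.

   The three boundary conditions determine the three amplitudes by Cramer's
   rule. The buoyancy coefficient of a mode is close to [s / (i w)] for the slow
   layers and to [- (nu / kappa) s / (i w)] for the fast one, which bounds the
   determinant from below and gives the orders of the amplitudes.

   The incident packet solves the inviscid system, so the remainder is
   [- nu Laplacian] (resp. [- kappa Laplacian]) of the packet. By an upper
   Plancherel inequality its L^2 norm is O(nu) (resp. O(kappa)), uniformly in
   time: the symbol is of size [e^-2] on a set of area [O(e^4)]. *)
Require Import Defs.
From HB Require Import structures.
From mathcomp Require Import all_boot all_order all_algebra.
From mathcomp Require Import complex ring lra.
From mathcomp Require Import measurable_realfun.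
From mathcomp Require Import all_classical all_reals all_analysis.

Set Implicit Arguments.
Unset Strict Implicit.
Unset Printing Implicit Defensive.
Import Order.TTheory GRing.Theory Num.Theory.
Import numFieldNormedType.Exports.

Local Open Scope classical_set_scope.
Local Open Scope ring_scope.

Local Notation Re := complex.Re.
Local Notation Im := complex.Im.
Local Notation normc := Normc.normc.
Local Notation "x %:C" := (real_complex _ x) (format "x %:C").
Local Notation "x +i* y" := (Complex x y).
Local Notation "R [i]" := (complex R) (format "R [i]").

(** * Complex-valued functions and wave packets *)

(** In Cases 1 to 4 one exponent, [mu], is at most 6 and the other, [M], at least 6, and all four
    are instances of one statement. Balancing [(nu + kappa) lam ^ 3] against the coupling
    [2 k s c / w] gives the slow scale [lam ~ e ^ (- mu / 3)], and [mu <= 6] is precisely what keeps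
    the criticality, of order [e ^ 2], bounded in the rescaled cubic. In Case 5 both exponents
    exceed 6, the criticality dominates and the slow scale splits in two. The delicate points are
    signs. The roots must decay: the cubic has an imaginary linear coefficient and a constant term
    that is positive because [k w > 0], and this confines its roots to sectors which leave exactly
    two of them in the right half-plane. The determinant must not vanish: the fast mode enters with
    the opposite sign, [- nu / kappa], so its contribution adds to that of the slow layers instead
    of cancelling it, whatever the ratio of the diffusivities. The two candidate exponents for the
    fast amplitude come from the denominator [1 + eta tau nu / kappa] of this estimate. *)

Section complex_numbers.
Context {R : realType}.
Implicit Types (x y z : R[i]) (a b : R).

Lemma normc_sqrt z : normc z = Num.sqrt (Re z ^+ 2 + Im z ^+ 2).
Proof. by case: z. Qed.

Lemma normc_ge0 z : 0 <= normc z.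
Proof. by rewrite normc_sqrt sqrtr_ge0. Qed.

Lemma sqr_normc z : normc z ^+ 2 = Re z ^+ 2 + Im z ^+ 2.
Proof. by rewrite normc_sqrt sqr_sqrtr// addr_ge0// sqr_ge0. Qed.

Lemma ler_normcD x y : normc (x + y) <= normc x + normc y.
Proof. by have := ler_normD x y; rewrite !normc_def -rmorphD lecR -!normc_sqrt. Qed.

Lemma normcN x : normc (- x) = normc x.
Proof. by rewrite !normc_sqrt !raddfN/= !sqrrN. Qed.

Lemma ler_normcB x y : normc (x - y) <= normc x + normc y.
Proof. by rewrite -(normcN y) ler_normcD. Qed.

Lemma normcBC x y : normc (x - y) = normc (y - x).
Proof. by rewrite -normcN opprB. Qed.

Lemma lerB_normcD x y : normc x - normc y <= normc (x + y).
Proof. by rewrite lerBlDr -{1}(addrK y x) ler_normcB. Qed.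

Lemma lerB_normcB x y : normc x - normc y <= normc (x - y).
Proof. by rewrite -(normcN y) lerB_normcD. Qed.

Lemma normcX x n : normc (x ^+ n) = normc x ^+ n.
Proof.
by elim: n => [|n ih]; rewrite ?expr0 ?Normc.normc1// !exprS Normc.normcM ih.
Qed.

Lemma normc_real a : normc a%:C = `|a|.
Proof. by rewrite normc_sqrt/= expr0n addr0 sqrtr_sqr. Qed.

Lemma normc_i : normc 'i%C = 1 :> R.
Proof. by rewrite normc_sqrt/= expr0n add0r expr1n sqrtr1. Qed.

Lemma normc_eq0 z : (normc z == 0) = (z == 0).
Proof.
by apply/eqP/eqP => [/Normc.eq0_normc//|->]; rewrite Normc.normc0.
Qed.

Lemma normc_gt0 z : (0 < normc z) = (z != 0).
Proof. by rewrite lt_neqAle normc_ge0 andbT eq_sym normc_eq0. Qed.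

Lemma ler_Re_normc z : `|Re z| <= normc z.
Proof. by rewrite normc_sqrt -sqrtr_sqr ler_sqrt ?lerDl ?addr_ge0 ?sqr_ge0. Qed.

Lemma ler_Im_normc z : `|Im z| <= normc z.
Proof. by rewrite normc_sqrt -sqrtr_sqr ler_sqrt ?lerDr ?addr_ge0 ?sqr_ge0. Qed.

Lemma ler_normcReIm z : normc z <= `|Re z| + `|Im z|.
Proof.
rewrite {1}(complexE z) (le_trans (ler_normcD _ _))// Normc.normcM.
by rewrite normc_i mul1r !normc_real.
Qed.

Lemma Re_addc x y : Re (x + y) = Re x + Re y.
Proof. by case: x; case: y. Qed.

Lemma Im_addc x y : Im (x + y) = Im x + Im y.
Proof. by case: x; case: y. Qed.

Lemma Re_oppc x : Re (- x) = - Re x.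
Proof. by case: x. Qed.

Lemma Im_oppc x : Im (- x) = - Im x.
Proof. by case: x. Qed.

Lemma Re_mulc x y : Re (x * y) = Re x * Re y - Im x * Im y.
Proof. by case: x; case: y. Qed.

Lemma Im_mulc x y : Im (x * y) = Re x * Im y + Im x * Re y.
Proof. by case: x; case: y. Qed.

Lemma Re_invc z : Re z^-1 = Re z / (Re z ^+ 2 + Im z ^+ 2).
Proof. by case: z. Qed.

Lemma Im_invc z : Im z^-1 = - (Im z / (Re z ^+ 2 + Im z ^+ 2)).
Proof. by case: z. Qed.

Lemma complex_eqP x y : Re x = Re y -> Im x = Im y -> x = y.
Proof. by case: x; case: y => ? ? ? ? /= -> ->. Qed.

Lemma sqri : 'i%C * 'i%C = -1 :> R[i].
Proof. by rewrite -expr2 sqr_i. Qed.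

Lemma cexpD x y : cexp (x + y) = cexp x * cexp y.
Proof.
apply: complex_eqP; rewrite ?Re_mulc ?Im_mulc/= !raddfD/= expRD ?cosD ?sinD; ring.
Qed.

Lemma cexp0 : cexp 0 = 1 :> R[i].
Proof. by rewrite /cexp/= expR0 cos0 sin0 !mulr1 mulr0. Qed.

Lemma normc_cexp z : normc (cexp z) = expR (Re z).
Proof.
rewrite normc_sqrt/= !exprMn -mulrDr cos2Dsin2 mulr1 sqrtr_sqr ger0_norm//.
Qed.

Lemma cexpMn z n : cexp (z *+ n) = cexp z ^+ n.
Proof.
by elim: n => [|n ih]; rewrite ?mulr0n ?cexp0// mulrS exprS cexpD ih.
Qed.

Lemma is_derive_Re_cexp (G A B : R[i]) (s : R) :
  is_derive s 1 (fun r => Re (G * cexp (A * r%:C + B)))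
    (Re (G * A * cexp (A * s%:C + B))).
Proof.
have eA r : Re (A * r%:C + B) = Re A * r + Re B.
  by rewrite raddfD/= Re_mulc/= mulr0 subr0.
have eB r : Im (A * r%:C + B) = Im A * r + Im B.
  by rewrite raddfD/= Im_mulc/= mulr0 add0r.
under eq_fun do rewrite Re_mulc /= eA eB.
rewrite Re_mulc /= eA eB Re_mulc Im_mulc.
apply: is_derive_eq; rewrite /GRing.scale/=; ring.
Qed.

Lemma is_derive_Im_cexp (G A B : R[i]) (s : R) :
  is_derive s 1 (fun r => Im (G * cexp (A * r%:C + B)))
    (Im (G * A * cexp (A * s%:C + B))).
Proof.
(* The imaginary part is the real part after multiplication by [- 'i], a factor which the constant
   [G] absorbs. *)
have iM z : Im z = Re (- 'i%C * z) by rewrite Re_mulc/=; ring.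
under eq_fun do rewrite iM mulrA.
by rewrite iM !mulrA; exact: is_derive_Re_cexp.
Qed.

Lemma cderivable_cexp (G A B : R[i]) (s : R) :
  cderivable (fun r => G * cexp (A * r%:C + B)) s.
Proof.
by split; [have [] := is_derive_Re_cexp G A B s|
           have [] := is_derive_Im_cexp G A B s].
Qed.

Lemma cderive_cexp (G A B : R[i]) (s : R) :
  cderive (fun r => G * cexp (A * r%:C + B)) s = G * A * cexp (A * s%:C + B).
Proof.
by apply: complex_eqP => /=; rewrite derive1E; apply: derive_val;
  [exact: is_derive_Re_cexp|exact: is_derive_Im_cexp].
Qed.

End complex_numbers.

(** * Measurability, bounded symbols and differentiation under the integral sign *)

Section measurable_real_functions.
Context {R : realType} d (T : measurableType d).
Implicit Type D : set T.

(** Real powers invert only nonnegative numbers, hence the detour [1 / x = x * (x ^ 2) ^ (-1)],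
    which also returns the convention [0^-1 = 0]. *)
Lemma measurable_funV D (f : T -> R) : measurable_fun D f ->
  measurable_fun D (fun z => (f z)^-1).
Proof.
move=> mf.
rewrite [X in measurable_fun D X](_ : _ = (fun z => f z * (f z ^+ 2) `^ (-1))).
  apply: measurable_funM => //.
  apply: (@measurableT_comp _ _ _ _ _ _ (@powR R ^~ (-1))).
    exact: measurable_powR.
  exact: measurable_funX.
apply/funext => z; rewrite powR_inv1 ?sqr_ge0//.
have [->|fz0] := eqVneq (f z) 0; first by rewrite invr0 mul0r.
by rewrite expr2 invfM mulrA divff// mul1r.
Qed.

Lemma measurable_fun_cos D (f : T -> R) : measurable_fun D f ->
  measurable_fun D (fun z => cos (f z)).
Proof.
apply: measurableT_comp; apply: continuous_measurable_fun.
exact: continuous_cos.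
Qed.

Lemma measurable_fun_sin D (f : T -> R) : measurable_fun D f ->
  measurable_fun D (fun z => sin (f z)).
Proof.
apply: measurableT_comp; apply: continuous_measurable_fun.
exact: continuous_sin.
Qed.

End measurable_real_functions.

Section complex_measurability.
Context {R : realType}.
Local Notation T := (measurableTypeR R * measurableTypeR R)%type.
Implicit Types (D : set T) (f g : T -> R[i]).

Definition cmeasurable D f :=
  measurable_fun D (fun z => Re (f z)) /\ measurable_fun D (fun z => Im (f z)).

Lemma eq_cmeasurable D f g : (forall z, D z -> f z = g z) ->
  cmeasurable D f -> cmeasurable D g.
Proof.
move=> fg [m1 m2]; split.
  by apply: eq_measurable_fun m1 => z /[!inE] /fg ->.
by apply: eq_measurable_fun m2 => z /[!inE] /fg ->.
Qed.

Lemma cmeasurable_cst D (a : R[i]) : cmeasurable D (fun=> a).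
Proof. by split; exact: measurable_cst. Qed.

Lemma cmeasurable_real D (f : T -> R) : measurable_fun D f ->
  cmeasurable D (fun z => (f z)%:C).
Proof. by move=> mf; split => //=; exact: measurable_cst. Qed.

Lemma cmeasurableD D f g : cmeasurable D f -> cmeasurable D g ->
  cmeasurable D (fun z => f z + g z).
Proof.
move=> [f1 f2] [g1 g2]; split.
  by under eq_fun do rewrite raddfD; exact: measurable_funD.
by under eq_fun do rewrite raddfD; exact: measurable_funD.
Qed.

Lemma cmeasurableM D f g : cmeasurable D f -> cmeasurable D g ->
  cmeasurable D (fun z => f z * g z).
Proof.
move=> [f1 f2] [g1 g2]; split.
  by under eq_fun do rewrite Re_mulc; apply: measurable_funB; exact: measurable_funM.
by under eq_fun do rewrite Im_mulc; apply: measurable_funD; exact: measurable_funM.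
Qed.

Lemma cmeasurableN D f : cmeasurable D f -> cmeasurable D (fun z => - f z).
Proof.
move=> mf; apply: (@eq_cmeasurable _ (fun z => (-1) * f z)).
  by move=> z _; rewrite mulN1r.
by apply: cmeasurableM mf; exact: cmeasurable_cst.
Qed.

Lemma cmeasurableB D f g : cmeasurable D f -> cmeasurable D g ->
  cmeasurable D (fun z => f z - g z).
Proof. by move=> mf mg; apply: cmeasurableD => //; exact: cmeasurableN. Qed.

Lemma cmeasurableX D f n : cmeasurable D f -> cmeasurable D (fun z => f z ^+ n).
Proof.
move=> mf; elim: n => [|n ih]; first exact: cmeasurable_cst.
by under eq_fun do rewrite exprS; exact: cmeasurableM.
Qed.

Lemma cmeasurable_sum D n (F : 'I_n -> T -> R[i]) :
  (forall j, cmeasurable D (F j)) ->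
  cmeasurable D (fun z => \sum_(j < n) F j z).
Proof.
elim: n F => [|n ih] F mF.
  by under eq_fun do rewrite big_ord0; exact: cmeasurable_cst.
under eq_fun do rewrite big_ord_recr.
by apply: cmeasurableD => //; exact: ih.
Qed.

Lemma cmeasurableV D f : cmeasurable D f -> cmeasurable D (fun z => (f z)^-1).
Proof.
move=> [m1 m2].
have mn : measurable_fun D (fun z => (Re (f z) ^+ 2 + Im (f z) ^+ 2)^-1).
  by apply: measurable_funV; apply: measurable_funD; exact: measurable_funX.
split; first by under eq_fun do rewrite Re_invc; exact: measurable_funM.
under eq_fun do rewrite Im_invc; apply: measurableT_comp => //.
exact: measurable_funM.
Qed.

Lemma cmeasurable_cexp D f : cmeasurable D f ->
  cmeasurable D (fun z => cexp (f z)).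
Proof.
move=> [m1 m2]; split => /=; apply: measurable_funM.
- exact: measurableT_comp m1.
- exact: measurable_fun_cos.
- exact: measurableT_comp m1.
- exact: measurable_fun_sin.
Qed.

Lemma measurable_normc D f : cmeasurable D f ->
  measurable_fun D (fun z => normc (f z)).
Proof.
move=> [m1 m2].
rewrite [X in measurable_fun D X](_ : _ =
   (fun z => (Re (f z) ^+ 2 + Im (f z) ^+ 2) `^ (2^-1))).
  apply: (@measurableT_comp _ _ _ _ _ _ (@powR R ^~ (2^-1))).
    exact: measurable_powR.
  by apply: measurable_funD; exact: measurable_funX.
apply/funext => z; rewrite normc_sqrt powR12_sqrt//.
by rewrite addr_ge0 ?sqr_ge0.
Qed.

Definition cbounded D f :=
  cmeasurable D f /\ exists M : R, forall z, D z -> normc (f z) <= M.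

Lemma cbounded_gt0 D f : cbounded D f ->
  exists2 M : R, 0 < M & forall z, D z -> normc (f z) <= M.
Proof.
move=> [_ [M fM]]; exists (`|M| + 1); first by rewrite ltr_wpDl.
by move=> z /fM/le_trans; apply; rewrite (le_trans (ler_norm _))// lerDl.
Qed.

Lemma cbounded_cst D (a : R[i]) : cbounded D (fun=> a).
Proof. by split; [exact: cmeasurable_cst|exists (normc a)]. Qed.

Lemma cboundedD D f g : cbounded D f -> cbounded D g ->
  cbounded D (fun z => f z + g z).
Proof.
move=> [f1 [M fM]] [g1 [N gN]]; split; first exact: cmeasurableD.
by exists (M + N) => z Dz; rewrite (le_trans (ler_normcD _ _))// lerD ?fM ?gN.
Qed.

Lemma cboundedM D f g : cbounded D f -> cbounded D g ->
  cbounded D (fun z => f z * g z).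
Proof.
move=> [f1 [M fM]] [g1 [N gN]]; split; first exact: cmeasurableM.
exists (M * N) => z Dz.
by rewrite Normc.normcM ler_pM ?normc_ge0 ?fM ?gN.
Qed.

Lemma cboundedN D f : cbounded D f -> cbounded D (fun z => - f z).
Proof.
move=> [f1 [M fM]]; split; first exact: cmeasurableN.
by exists M => z Dz; rewrite normcN fM.
Qed.

Lemma cbounded_cexp D f : cbounded D f -> cbounded D (fun z => cexp (f z)).
Proof.
move=> [f1 [M fM]]; split; first exact: cmeasurable_cexp.
exists (expR M) => z Dz; rewrite normc_cexp ler_expR.
by rewrite (le_trans _ (fM z Dz))// (le_trans _ (ler_Re_normc _))// ler_norm.
Qed.

(** The amplitudes of packets: vanishing outside a set of finite measure turns boundedness into
    integrability over the plane. *)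
Definition csymbol D f := cbounded D f /\ forall z, ~ D z -> f z = 0.

Lemma csymbolM D f g : csymbol D f -> cbounded D g ->
  csymbol D (fun z => f z * g z).
Proof.
move=> [f1 f0] g1; split; first exact: cboundedM.
by move=> z /f0 ->; rewrite mul0r.
Qed.

Lemma csymbolD D f g : csymbol D f -> csymbol D g ->
  csymbol D (fun z => f z + g z).
Proof.
move=> [f1 f0] [g1 g0]; split; first exact: cboundedD.
by move=> z /[dup] /f0 -> /g0 ->; rewrite addr0.
Qed.

End complex_measurability.

Section integrable_bounded_support.
Context {R : realType} d (T : measurableType d) (mu : {measure set T -> \bar R}).
Variable D : set T.
Hypotheses (mD : measurable D) (D_fin : (mu D < +oo)%E).

Lemma integrable_bounded_support (h : T -> R) (M : R) : measurable_fun D h ->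
  (forall z, D z -> `|h z| <= M) -> (forall z, ~ D z -> h z = 0) ->
  mu.-integrable setT (EFin \o h).
Proof.
move=> mh hM h0.
have -> : EFin \o h = (EFin \o h) \_ D.
  apply/funext => z; rewrite patchE; case: ifPn => // /negP zD.
  by rewrite /= h0// => Dz; apply: zD; rewrite inE.
apply/(integrable_mkcond _ mD).
apply: (@le_integrable _ _ _ _ _ mD _ (EFin \o cst M)).
- exact/measurable_EFinP.
- by move=> z Dz /=; rewrite lee_fin (le_trans (hM z Dz))// ler_norm.
- by apply: measurable_bounded_integrable => //; exact: bounded_cst.
Qed.

Lemma normr_Rintegral_le (h : T -> R) (M : R) : measurable_fun D h ->
  (forall z, D z -> `|h z| <= M) -> (forall z, ~ D z -> h z = 0) ->
  `|Rintegral mu setT h| <= M * fine (mu D).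
Proof.
move=> mh hM h0.
have ih := integrable_bounded_support mh hM h0.
have ihD : mu.-integrable D (EFin \o h).
  exact: (integrableS measurableT mD (@subsetT _ _)).
have -> : Rintegral mu setT h = Rintegral mu D h.
  rewrite [RHS]Rintegral_mkcond; congr Rintegral; apply/funext => z.
  rewrite patchE; case: ifPn => // /negP zB.
  by rewrite h0// => Bz; apply: zB; rewrite inE.
apply: le_trans (le_normr_Rintegral mD ihD) _.
rewrite -Rintegral_cst//; apply: le_Rintegral => //.
- by have := integrable_norm ihD.
- by apply: measurable_bounded_integrable => //; exact: bounded_cst.
Qed.

End integrable_bounded_support.

Section complex_integrals.
Context {R : realType}.
Local Notation T := (measurableTypeR R * measurableTypeR R)%type.
Variable D : set T.
Hypotheses (mD : measurable D) (D_fin : (leb2 D < +oo)%E).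
Implicit Types (f g G A : T -> R[i]).

Lemma cintegrable_symbol f : csymbol D f -> cintegrable2 f.
Proof.
move=> [[[m1 m2] [M fM]] f0]; split; apply: (@integrable_bounded_support _ _ _ _ D mD D_fin _ M).
- exact: m1.
- by move=> z Dz; rewrite (le_trans (ler_Re_normc _)) ?fM.
- by move=> z /f0 ->.
- exact: m2.
- by move=> z Dz; rewrite (le_trans (ler_Im_normc _)) ?fM.
- by move=> z /f0 ->.
Qed.

Lemma cintegral2D f g : cintegrable2 f -> cintegrable2 g ->
  cintegral2 (fun z => f z + g z) = cintegral2 f + cintegral2 g.
Proof.
move=> [f1 f2] [g1 g2]; apply: complex_eqP; rewrite raddfD/=.
  rewrite -[RHS]RintegralD//.
  by congr (Rintegral _ _ _); apply/funext => z; rewrite raddfD.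
rewrite -[RHS]RintegralD//.
by congr (Rintegral _ _ _); apply/funext => z; rewrite raddfD.
Qed.

Lemma cintegral2Z (r : R) f : cintegrable2 f ->
  cintegral2 (fun z => r%:C * f z) = r%:C * cintegral2 f.
Proof.
move=> [f1 f2]; apply: complex_eqP; rewrite ?Re_mulc ?Im_mulc/= mul0r.
  rewrite subr0 -[RHS]RintegralZl//.
  by congr (Rintegral _ _ _); apply/funext => z; rewrite Re_mulc/= mul0r subr0.
rewrite addr0 -[RHS]RintegralZl//.
by congr (Rintegral _ _ _); apply/funext => z; rewrite Im_mulc/= mul0r addr0.
Qed.

Lemma cbounded_expM A (s : R) : cbounded D A ->
  cbounded D (fun z => cexp (A z * s%:C)).
Proof.
by move=> bA; apply/cbounded_cexp/cboundedM => //; exact: cbounded_cst.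
Qed.

(** Domination for differentiating under the integral: for [r] within distance 1 of [a] the exponent
    has real part at most [L (|a| + 1)], and since [G] vanishes off [D] the bound is a multiple of
    an indicator of finite integral. *)
Let derive_bound G A (a : R) : csymbol D G -> cbounded D A ->
  exists2 M : R, 0 <= M & forall (r : R) z, `]a - 1, a + 1[%classic r ->
    normc (G z * A z * cexp (A z * r%:C)) <= M * \1_D z.
Proof.
move=> [bG G0] bA.
have [M M0 GM] := cbounded_gt0 bG; have [L L0 AL] := cbounded_gt0 bA.
exists (M * L * expR (L * (`|a| + 1))).
  by rewrite !mulr_ge0 ?expR_ge0// ltW.
move=> r z /=; rewrite in_itv/= => /andP[ar ra].
rewrite indicE; have [Dz|nDz] := pselect (D z); last first.
  by rewrite G0// !mul0r Normc.normc0 memNset// mulr0.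
rewrite mem_set// mulr1 !Normc.normcM normc_cexp.
apply: ler_pM; rewrite ?mulr_ge0 ?normc_ge0 ?expR_ge0//.
  by rewrite ler_pM ?normc_ge0 ?GM ?AL.
rewrite ler_expR Re_mulc/= mulr0 subr0 (le_trans (ler_norm _))// normrM.
apply: ler_pM => //; first by rewrite (le_trans (ler_Re_normc _))// AL.
have : `|r - a| <= 1 by rewrite ler_norml; lra.
have := ler_normD (r - a) a; rewrite subrK; lra.
Qed.

Lemma integrable_cindic (M : R) :
  leb2.-integrable setT (EFin \o (fun z => M * \1_D z)).
Proof.
apply: (@integrable_bounded_support _ _ _ _ D mD D_fin _ `|M|).
- by apply: measurable_funM => //; exact: measurable_indic.
- by move=> z Dz; rewrite indicE mem_set// mulr1.
- by move=> z nDz; rewrite indicE memNset// mulr0.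
Qed.

(** [Rp] stands for the real or the imaginary part, so that one application of the real theorem
    serves both components. *)
Let under (Rp : R[i] -> R) G A (a : R) :
  (forall z, `|Rp z| <= normc z) ->
  (forall r : R, leb2.-integrable setT
     (EFin \o (fun z => Rp (G z * cexp (A z * r%:C))))) ->
  (forall (z : T) (s : R), is_derive s 1 (fun r : R => Rp (G z * cexp (A z * r%:C)))
    (Rp (G z * A z * cexp (A z * s%:C)))) ->
  csymbol D G -> cbounded D A ->
  derivable (fun s : R => Rintegral leb2 setT
     (fun z => Rp (G z * cexp (A z * s%:C)))) a 1 /\
  derive1 (fun s : R => Rintegral leb2 setT
     (fun z => Rp (G z * cexp (A z * s%:C)))) a =
  Rintegral leb2 setT (fun z => Rp (G z * A z * cexp (A z * a%:C))).
Proof.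
move=> Rple intf dRp sG bA.
have [M M0 bd] := derive_bound a sG bA.
have aI : `]a - 1, a + 1[%classic a by rewrite /= in_itv/=; lra.
pose f (r : R) (z : T) := Rp (G z * cexp (A z * r%:C)).
have intf' x : `]a - 1, a + 1[%classic x -> leb2.-integrable setT (EFin \o f x).
  by move=> _; exact: intf.
have derf x z : `]a - 1, a + 1[%classic x -> setT z -> derivable (f ^~ z) x 1.
  by move=> _ _; have [] := dRp z x.
have df x z : partial1of2 f x z = Rp (G z * A z * cexp (A z * x%:C)).
  by rewrite partial1of2E; apply: derive_val; exact: dRp.
have Mge0 (z : T) : 0 <= M * \1_D z by rewrite mulr_ge0// indicE.
have ub x z : `]a - 1, a + 1[%classic x -> setT z ->
    `|partial1of2 f x z| <= M * \1_D z.
  by move=> Ix _; rewrite df (le_trans (Rple _))// bd.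
split.
  exact: (@derivable_under_integral _ _ _ _ f setT measurableT a _ _ aI
    intf' derf _ Mge0 (integrable_cindic M) ub).
rewrite (@differentiation_under_integral _ _ _ _ f setT measurableT a _ _ aI
    intf' derf _ Mge0 (integrable_cindic M) ub).
by apply: eq_Rintegral => z _; rewrite -df.
Qed.

Lemma cderive_cintegral2 G A (a : R) : csymbol D G -> cbounded D A ->
  cderivable (fun s : R => cintegral2 (fun z => G z * cexp (A z * s%:C))) a /\
  cderive (fun s : R => cintegral2 (fun z => G z * cexp (A z * s%:C))) a =
  cintegral2 (fun z => G z * A z * cexp (A z * a%:C)).
Proof.
move=> sG bA.
have sGA r : csymbol D (fun z => G z * cexp (A z * r%:C)).
  by apply: csymbolM => //; exact: cbounded_expM.
have [] := @under (@Re R) G A a (@ler_Re_normc R) _ _ sG bA.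
- by move=> r; have [] := cintegrable_symbol (sGA r).
- move=> z s; have := is_derive_Re_cexp (G z) (A z) 0 s.
  by rewrite addr0; under eq_fun do rewrite addr0.
move=> dR eR.
have [] := @under (@Im R) G A a (@ler_Im_normc R) _ _ sG bA.
- by move=> r; have [] := cintegrable_symbol (sGA r).
- move=> z s; have := is_derive_Im_cexp (G z) (A z) 0 s.
  by rewrite addr0; under eq_fun do rewrite addr0.
move=> dI eI; split; first exact: (conj dR dI).
by apply: complex_eqP; [rewrite /= eR|rewrite /= eI].
Qed.

End complex_integrals.

(** * Smooth fields and superposition of solutions *)

Section smooth_fields.
Context {R : realType}.
Implicit Types (F G p : field R) (V W Q : wave R).

(* Unlike [regular], also below the boundary, so that second normal derivatives
   at [y = 0] can be computed from formulas valid on both sides. *)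
Definition smooth F :=
  [/\ forall t x y, cderivable (fun r => F r x y) t,
      forall t x y, cderivable (fun r => F t r y) x,
      forall t x y, cderivable (fun r => F t x r) y,
      forall t x y, cderivable (fun r => dx F t r y) x &
      forall t x y, cderivable (fun r => dy F t x r) y].

Lemma smooth_regular F : smooth F -> regular F.
Proof. by move=> [h1 h2 h3 h4 h5]; split => t x y _. Qed.

Lemma cderivableD (f g : R -> R[i]) (a : R) : cderivable f a -> cderivable g a ->
  cderivable (fun r => f r + g r) a /\
  cderive (fun r => f r + g r) a = cderive f a + cderive g a.
Proof.
move=> [f1 f2] [g1 g2].
have eR : (fun r => Re (f r + g r)) = (fun r => Re (f r)) + (fun r => Re (g r)).
  by apply/funext => r; rewrite raddfD.
have eI : (fun r => Im (f r + g r)) = (fun r => Im (f r)) + (fun r => Im (g r)).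
  by apply/funext => r; rewrite raddfD.
split.
  by rewrite /cderivable eR eI; exact: conj (derivableD f1 g1) (derivableD f2 g2).
apply: complex_eqP; rewrite raddfD/= !derive1E.
  by rewrite eR (deriveD f1 g1).
by rewrite eI (deriveD f2 g2).
Qed.

Let addF F G : field R := fun t x y => F t x y + G t x y.

Lemma smoothD F G : smooth F -> smooth G -> smooth (addF F G) /\
  [/\ dt (addF F G) = addF (dt F) (dt G), dx (addF F G) = addF (dx F) (dx G),
      dy (addF F G) = addF (dy F) (dy G) &
      laplacian (addF F G) = addF (laplacian F) (laplacian G)].
Proof.
move=> [f1 f2 f3 f4 f5] [g1 g2 g3 g4 g5].
have et : dt (addF F G) = addF (dt F) (dt G).
  by do 3 apply/funext => ?; exact: (cderivableD (f1 _ _ _) (g1 _ _ _)).2.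
have ex : dx (addF F G) = addF (dx F) (dx G).
  by do 3 apply/funext => ?; exact: (cderivableD (f2 _ _ _) (g2 _ _ _)).2.
have ey : dy (addF F G) = addF (dy F) (dy G).
  by do 3 apply/funext => ?; exact: (cderivableD (f3 _ _ _) (g3 _ _ _)).2.
have el : laplacian (addF F G) = addF (laplacian F) (laplacian G).
  rewrite /laplacian ex ey; apply/funext => t; apply/funext => x; apply/funext => y.
  have h1 := (cderivableD (f4 t x y) (g4 t x y)).2.
  have h2 := (cderivableD (f5 t x y) (g5 t x y)).2.
  transitivity (cderive (fun r => dx F t r y + dx G t r y) x +
    cderive (fun r => dy F t x r + dy G t x r) y); first exact: erefl.
  by rewrite h1 h2; exact: addrACA.
split; [split; rewrite ?ex ?ey|exact: And4].
- by move=> t x y; exact: (cderivableD (f1 _ _ _) (g1 _ _ _)).1.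
- by move=> t x y; exact: (cderivableD (f2 _ _ _) (g2 _ _ _)).1.
- by move=> t x y; exact: (cderivableD (f3 _ _ _) (g3 _ _ _)).1.
- by move=> t x y; exact: (cderivableD (f4 _ _ _) (g4 _ _ _)).1.
- by move=> t x y; exact: (cderivableD (f5 _ _ _) (g5 _ _ _)).1.
Qed.

(** Asked for all real [y], where the formulas for packets remain valid: additivity of the
    derivatives then holds as an equality of functions, which can be differentiated again, also at
    the boundary. *)
Definition smooth_system (gamma nu kappa : R) W p Q : Prop :=
  [/\ smooth (u_ W), smooth (w_ W) & smooth (b_ W)] /\
  ((forall t x y, cderivable (fun r => p t r y) x) /\
   (forall t x y, cderivable (fun r => p t x r) y)) /\
  forall t x y,
  [/\ dt (u_ W) t x y - b_ W t x y * (sin gamma)%:C + dx p t x y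
        = nu%:C * laplacian (u_ W) t x y + u_ Q t x y,
      dt (w_ W) t x y - b_ W t x y * (cos gamma)%:C + dy p t x y
        = nu%:C * laplacian (w_ W) t x y + w_ Q t x y,
      dt (b_ W) t x y + u_ W t x y * (sin gamma)%:C
                      + w_ W t x y * (cos gamma)%:C
        = kappa%:C * laplacian (b_ W) t x y + b_ Q t x y &
      dx (u_ W) t x y + dy (w_ W) t x y = 0].

Lemma smooth_systemP gamma nu kappa W p Q :
  smooth_system gamma nu kappa W p Q -> system_rhs gamma nu kappa W p Q.
Proof.
move=> [[u1 w1 b1] [[p1 p2] eqs]]; split; first by split; exact: smooth_regular.
by split; [split => t x y _|move=> t x y _].
Qed.

Let lin0 (a b a' b' : R[i]) : a + b = 0 -> a' + b' = 0 ->
  (a + a') + (b + b') = 0.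
Proof. by move=> h1 h2; rewrite addrACA h1 h2 addr0. Qed.

Let lin1 (n s a b c l q a' b' c' l' q' : R[i]) : a - b * s + c = n * l + q ->
  a' - b' * s + c' = n * l' + q' ->
  (a + a') - (b + b') * s + (c + c') = n * (l + l') + (q + q').
Proof.
move=> h1 h2; transitivity ((a - b * s + c) + (a' - b' * s + c')); first ring.
by rewrite h1 h2; ring.
Qed.

Let lin2 (n s c a u w l q a' u' w' l' q' : R[i]) :
  a + u * s + w * c = n * l + q -> a' + u' * s + w' * c = n * l' + q' ->
  (a + a') + (u + u') * s + (w + w') * c = n * (l + l') + (q + q').
Proof.
move=> h1 h2; transitivity ((a + u * s + w * c) + (a' + u' * s + w' * c)).
  by ring.
by rewrite h1 h2; ring.
Qed.

Lemma smooth_systemD gamma nu kappa V W p q P Q :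
  smooth_system gamma nu kappa V p P -> smooth_system gamma nu kappa W q Q ->
  smooth_system gamma nu kappa (addw V W) (addF p q) (addw P Q).
Proof.
move=> [[u1 w1 b1] [[p1 p2] e1]] [[u2 w2 b2] [[q1 q2] e2]].
have [su [eut eux euy eul]] := smoothD u1 u2.
have [sw [ewt ewx ewy ewl]] := smoothD w1 w2.
have [sb [ebt ebx eby ebl]] := smoothD b1 b2.
split; first exact: (And3 su sw sb).
split.
  split => t x y; first exact: (cderivableD (p1 t x y) (q1 t x y)).1.
  exact: (cderivableD (p2 t x y) (q2 t x y)).1.
move=> t x y; have [a1 a2 a3 a4] := e1 t x y; have [d1 d2 d3 d4] := e2 t x y.
have epx : dx (addF p q) t x y = dx p t x y + dx q t x y.
  exact: (cderivableD (p1 t x y) (q1 t x y)).2.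
have epy : dy (addF p q) t x y = dy p t x y + dy q t x y.
  exact: (cderivableD (p2 t x y) (q2 t x y)).2.
rewrite epx epy /= -!/(addF _ _) eut ewt ebt eux ewy eul ewl ebl /addF.
split.
- exact: lin1 a1 d1.
- exact: lin1 a2 d2.
- exact: lin2 a3 d3.
- exact: lin0 a4 d4.
Qed.

End smooth_fields.

(** * Differential calculus of packets *)

Section packet_fields.
Context {R : realType}.
Local Notation T := (measurableTypeR R * measurableTypeR R)%type.
Variable D : set T.
Hypotheses (mD : measurable D) (D_fin : (leb2 D < +oo)%E).
Implicit Types (G : T -> R[i]).

(** The exponents are complex functions, so that one calculus covers the oscillating factor
    [exp (i m y)] of the incident packet and the decaying factor [exp (- lam y)] of the layers. *)
Definition packet_integrand (A B C G : T -> R[i]) (t x y : R) (z : T) : R[i] :=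
  G z * cexp (A z * t%:C + B z * x%:C + C z * y%:C).

Definition packet (A B C G : T -> R[i]) : field R :=
  fun t x y => cintegral2 (packet_integrand A B C G t x y).

Variables A B C : T -> R[i].
Hypotheses (bA : cbounded D A) (bB : cbounded D B) (bC : cbounded D C).
Local Notation pk := (packet A B C).

Lemma csymbol_packet G (t x y : R) : csymbol D G ->
  csymbol D (packet_integrand A B C G t x y).
Proof.
move=> sG; apply: csymbolM => //; apply: cbounded_cexp.
by repeat apply: cboundedD; apply: cboundedM => //; exact: cbounded_cst.
Qed.

Lemma packet_integrable G (t x y : R) : csymbol D G ->
  cintegrable2 (packet_integrand A B C G t x y).
Proof.
by move=> sG; apply: (cintegrable_symbol mD D_fin); exact: csymbol_packet.
Qed.

Lemma packetD G1 G2 t x y : csymbol D G1 -> csymbol D G2 ->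
  pk (fun z => G1 z + G2 z) t x y = pk G1 t x y + pk G2 t x y.
Proof.
move=> s1 s2; rewrite /packet -cintegral2D; try exact: packet_integrable.
by congr cintegral2; apply/funext => z; rewrite /packet_integrand mulrDl.
Qed.

Lemma packetZ (r : R) G t x y : csymbol D G ->
  pk (fun z => r%:C * G z) t x y = r%:C * pk G t x y.
Proof.
move=> sG; rewrite /packet -cintegral2Z; last exact: packet_integrable.
by congr cintegral2; apply/funext => z; rewrite /packet_integrand mulrA.
Qed.

Let packet_derivative (E F : T -> R[i]) (s : R) G : csymbol D G ->
  cbounded D E -> cbounded D F ->
  cderivable (fun r : R => cintegral2
     (fun z => G z * cexp (E z * r%:C + F z))) s /\
  cderive (fun r : R => cintegral2
     (fun z => G z * cexp (E z * r%:C + F z))) s =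
  cintegral2 (fun z => G z * E z * cexp (E z * s%:C + F z)).
Proof.
move=> sG bE bF.
have sG' : csymbol D (fun z => G z * cexp (F z)).
  by apply: csymbolM => //; exact: cbounded_cexp.
have [d1 d2] := cderive_cintegral2 mD D_fin s sG' bE.
have eqf : (fun r : R => cintegral2 (fun z => G z * cexp (E z * r%:C + F z))) =
  (fun r : R => cintegral2 (fun z => G z * cexp (F z) * cexp (E z * r%:C))).
  apply/funext => r; congr cintegral2; apply/funext => z; rewrite cexpD; ring.
rewrite eqf; split => //; rewrite d2.
by congr cintegral2; apply/funext => z; rewrite cexpD; ring.
Qed.

Let bM (E : T -> R[i]) (s : R) : cbounded D E ->
  cbounded D (fun z => E z * s%:C).
Proof. by move=> bE; apply: cboundedM => //; exact: cbounded_cst. Qed.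

Lemma packet_dt G t x y : csymbol D G ->
  cderivable (fun s => pk G s x y) t /\
  dt (pk G) t x y = pk (fun z => G z * A z) t x y.
Proof.
move=> sG.
have bF : cbounded D (fun z => B z * x%:C + C z * y%:C).
  by apply: cboundedD; exact: bM.
have [d1 d2] := packet_derivative t sG bA bF.
have e (H : T -> R[i]) r : pk H r x y = cintegral2
    (fun z => H z * cexp (A z * r%:C + (B z * x%:C + C z * y%:C))).
  by congr cintegral2; apply/funext => z; rewrite /packet_integrand addrA.
rewrite /dt (funext (e G)); split => //.
by rewrite d2 e.
Qed.

Lemma packet_dx G t x y : csymbol D G ->
  cderivable (fun s => pk G t s y) x /\
  dx (pk G) t x y = pk (fun z => G z * B z) t x y.
Proof.
move=> sG.
have bF : cbounded D (fun z => A z * t%:C + C z * y%:C).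
  by apply: cboundedD; exact: bM.
have [d1 d2] := packet_derivative x sG bB bF.
have e (H : T -> R[i]) r : pk H t r y = cintegral2
    (fun z => H z * cexp (B z * r%:C + (A z * t%:C + C z * y%:C))).
  congr cintegral2; apply/funext => z; rewrite /packet_integrand.
  by congr (_ * cexp _); ring.
rewrite /dx (funext (e G)); split => //.
by rewrite d2 e.
Qed.

Lemma packet_dy G t x y : csymbol D G ->
  cderivable (fun s => pk G t x s) y /\
  dy (pk G) t x y = pk (fun z => G z * C z) t x y.
Proof.
move=> sG.
have bF : cbounded D (fun z => A z * t%:C + B z * x%:C).
  by apply: cboundedD; exact: bM.
have [d1 d2] := packet_derivative y sG bC bF.
have e (H : T -> R[i]) r : pk H t x r = cintegral2
    (fun z => H z * cexp (C z * r%:C + (A z * t%:C + B z * x%:C))).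
  congr cintegral2; apply/funext => z; rewrite /packet_integrand.
  by congr (_ * cexp _); ring.
rewrite /dy (funext (e G)); split => //.
by rewrite d2 e.
Qed.

Lemma packet_dxE G : csymbol D G -> dx (pk G) = pk (fun z => G z * B z).
Proof. by move=> sG; do 3 apply/funext => ?; rewrite (packet_dx _ _ _ sG).2. Qed.

Lemma packet_dyE G : csymbol D G -> dy (pk G) = pk (fun z => G z * C z).
Proof. by move=> sG; do 3 apply/funext => ?; rewrite (packet_dy _ _ _ sG).2. Qed.

Lemma packet_smooth G : csymbol D G -> smooth (pk G).
Proof.
move=> sG; split => t x y.
- exact: (packet_dt _ _ _ sG).1.
- exact: (packet_dx _ _ _ sG).1.
- exact: (packet_dy _ _ _ sG).1.
- rewrite packet_dxE//; apply: (packet_dx _ _ _ _).1.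
  exact: csymbolM.
- rewrite packet_dyE//; apply: (packet_dy _ _ _ _).1.
  exact: csymbolM.
Qed.

Lemma laplacian_packet G t x y : csymbol D G ->
  laplacian (pk G) t x y =
  pk (fun z => G z * (B z ^+ 2 + C z ^+ 2)) t x y.
Proof.
move=> sG; rewrite /laplacian packet_dxE// packet_dyE//.
rewrite (packet_dx _ _ _ (csymbolM sG bB)).2.
rewrite (packet_dy _ _ _ (csymbolM sG bC)).2.
rewrite -packetD; first by congr (pk _ t x y); apply/funext => z; ring.
- exact: (csymbolM (csymbolM sG bB) bB).
- exact: (csymbolM (csymbolM sG bC) bC).
Qed.

(** Derivatives act on packets by multiplying the symbol by [A], [B] or [C]. Once all terms of an
    equation are gathered under one integral, it suffices that their symbols agree at every
    wavenumber. *)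
Lemma packet_system (gamma nu kappa : R) (U W B' P QU QW QB : T -> R[i]) :
  csymbol D U -> csymbol D W -> csymbol D B' -> csymbol D P ->
  csymbol D QU -> csymbol D QW -> csymbol D QB ->
  (forall z, U z * A z - B' z * (sin gamma)%:C + P z * B z =
     nu%:C * (U z * (B z ^+ 2 + C z ^+ 2)) + QU z) ->
  (forall z, W z * A z - B' z * (cos gamma)%:C + P z * C z =
     nu%:C * (W z * (B z ^+ 2 + C z ^+ 2)) + QW z) ->
  (forall z, B' z * A z + U z * (sin gamma)%:C + W z * (cos gamma)%:C =
     kappa%:C * (B' z * (B z ^+ 2 + C z ^+ 2)) + QB z) ->
  (forall z, U z * B z + W z * C z = 0) ->
  smooth_system gamma nu kappa (Wave (pk U) (pk W) (pk B'))
    (pk P) (Wave (pk QU) (pk QW) (pk QB)).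
Proof.
move=> sU sW sB sP sQU sQW sQB e1 e2 e3 e4; split; [|split].
- by split; exact: packet_smooth.
- by split=> t x y; [exact: (packet_dx _ _ _ sP).1|exact: (packet_dy _ _ _ sP).1].
have sL (F : T -> R[i]) : csymbol D F -> csymbol D (fun z => F z * (B z ^+ 2 + C z ^+ 2)).
  by move=> sF; apply: csymbolM => //; apply: cboundedD; exact: cboundedM.
have sZ (r : R) (F : T -> R[i]) : csymbol D F -> csymbol D (fun z : T => r%:C * F z).
  move=> sF; have -> : (fun z => r%:C * F z) = (fun z => F z * r%:C).
    by apply/funext => z; rewrite mulrC.
  by apply: csymbolM => //; exact: cbounded_cst.
move=> t x y /=; split.
- rewrite (packet_dt _ _ _ sU).2 (packet_dx _ _ _ sP).2 laplacian_packet//.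
  rewrite mulrC -mulNr -rmorphN -!packetZ; try by [|exact: sL].
  rewrite -!packetD; try by
    do ?[exact: sL|apply: csymbolD|apply: sZ|exact: csymbolM].
  by congr (pk _ t x y); apply/funext => z; rewrite -e1 rmorphN/=; ring.
- rewrite (packet_dt _ _ _ sW).2 (packet_dy _ _ _ sP).2 laplacian_packet//.
  rewrite mulrC -mulNr -rmorphN -!packetZ; try by [|exact: sL].
  rewrite -!packetD; try by
    do ?[exact: sL|apply: csymbolD|apply: sZ|exact: csymbolM].
  by congr (pk _ t x y); apply/funext => z; rewrite -e2 rmorphN/=; ring.
- rewrite (packet_dt _ _ _ sB).2 laplacian_packet//.
  rewrite (mulrC (pk U t x y)) (mulrC (pk W t x y)).
  rewrite -!packetZ; try by [|exact: sL].
  rewrite -!packetD; try by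
    do ?[exact: sL|apply: csymbolD|apply: sZ|exact: csymbolM].
  by congr (pk _ t x y); apply/funext => z; rewrite -e3; ring.
- rewrite (packet_dx _ _ _ sU).2 (packet_dy _ _ _ sW).2 -packetD;
    try by exact: csymbolM.
  rewrite /packet /packet_integrand.
  under eq_fun do rewrite e4 mul0r.
  by rewrite /cintegral2/= /Rintegral integral0.
Qed.

End packet_fields.

(** * A Plancherel inequality *)

Section iterated_integrals.
Context {R : realType} d1 d2 (X : measurableType d1) (Z : measurableType d2).
Variable mX : {sigma_finite_measure set X -> \bar R}.
Variable mZ : {sigma_finite_measure set Z -> \bar R}.

(** Tonelli's theorem gives measurability for nonnegative integrands, whence the splitting into
    positive and negative parts. *)
Lemma measurable_Rintegral_section (h : X * Z -> R) : measurable_fun setT h ->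
  measurable_fun setT (fun x => Rintegral mZ setT (fun z => h (x, z))).
Proof.
move=> mh; rewrite /Rintegral.
apply: (@measurableT_comp _ _ _ _ _ _ (@fine R)); first exact: fine_measurable.
have mEh : measurable_fun setT (EFin \o h) by exact/measurable_EFinP.
rewrite (_ : (fun x => _) =
  (fun x => \int[mZ]_z (EFin \o h)^\+ (x, z)) \-
  (fun x => \int[mZ]_z (EFin \o h)^\- (x, z)))%E; last first.
  apply/funext=> x; rewrite [LHS]integralE.
  by congr (_ - _)%E; apply: eq_integral => z _; rewrite ?funeposE ?funenegE.
apply: emeasurable_funB.
  by apply: measurable_fun_fubini_tonelli_F => //; exact: measurable_funepos.
by apply: measurable_fun_fubini_tonelli_F => //; exact: measurable_funeneg.
Qed.

Variables (A : set X) (B : set Z).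
Hypotheses (mA : measurable A) (A_fin : (mX A < +oo)%E).
Hypotheses (mB : measurable B) (B_fin : (mZ B < +oo)%E).

Lemma integrable_section1 (h : X * Z -> R) (M : R) x : measurable_fun setT h ->
  (forall z, `|h z| <= M) -> (forall z, ~ (A `*` B) z -> h z = 0) ->
  mZ.-integrable setT (EFin \o (fun z => h (x, z))).
Proof.
move=> mh hM h0; apply: (@integrable_bounded_support _ _ _ _ B _ _ _ M) => //.
  apply: measurable_funS (measurableT_comp mh (pair1_measurable x)) => //.
by move=> z nBz; rewrite h0// => -[].
Qed.

Lemma integrable_section2 (h : X * Z -> R) (M : R) z : measurable_fun setT h ->
  (forall z, `|h z| <= M) -> (forall z, ~ (A `*` B) z -> h z = 0) ->
  mX.-integrable setT (EFin \o (fun x => h (x, z))).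
Proof.
move=> mh hM h0; apply: (@integrable_bounded_support _ _ _ _ A _ _ _ M) => //.
  apply: measurable_funS (measurableT_comp mh (pair2_measurable z)) => //.
by move=> x nBz; rewrite h0// => -[].
Qed.

Lemma Rfubini (h : X * Z -> R) (M : R) : measurable_fun setT h ->
  (forall z, `|h z| <= M) -> (forall z, ~ (A `*` B) z -> h z = 0) ->
  Rintegral mX setT (fun x => Rintegral mZ setT (fun z => h (x, z))) =
  Rintegral mZ setT (fun z => Rintegral mX setT (fun x => h (x, z))).
Proof.
move=> mh hM h0.
have mAB : measurable (A `*` B) by exact: measurableX.
have ABfin : ((mX \x mZ) (A `*` B) < +oo)%E.
  by rewrite product_measure1E// lte_mul_pinfty// ge0_fin_numE.
have ih : (mX \x mZ)%E.-integrable setT (EFin \o h).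
  apply: (@integrable_bounded_support _ _ _ _ _ mAB ABfin _ M) => //.
  exact: measurable_funS mh.
rewrite /Rintegral; congr fine.
under eq_integral => x _.
  rewrite fineK; last by apply: integrable_fin_num => //;
    exact: (integrable_section1 _ mh hM h0).
  over.
under [RHS]eq_integral => z _.
  rewrite fineK; last by apply: integrable_fin_num => //;
    exact: (integrable_section2 _ mh hM h0).
  over.
exact: (Fubini ih).
Qed.

End iterated_integrals.

Section quadratic_form_bound.
Context {R : realType} d1 d2 (X : measurableType d1) (Z : measurableType d2).
Variable mX : {sigma_finite_measure set X -> \bar R}.
Variable mZ : {sigma_finite_measure set Z -> \bar R}.
Variables (A : set X) (B : set Z).
Hypotheses (mA : measurable A) (A_fin : (mX A < +oo)%E).
Hypotheses (mB : measurable B) (B_fin : (mZ B < +oo)%E).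
Variables (W : X -> R) (g : Z -> R) (phi : X * Z -> R) (M L : R).
Hypotheses (M0 : 0 <= M) (L0 : 0 <= L).
Hypotheses (mW : measurable_fun setT W) (W01 : forall x, 0 <= W x <= 1).
Hypothesis W0 : forall x, ~ A x -> W x = 0.
Hypotheses (mg : measurable_fun setT g) (gM : forall z, `|g z| <= M).
Hypothesis g0 : forall z, ~ B z -> g z = 0.
Hypothesis mphi : measurable_fun setT phi.
Hypothesis kernelL : forall z, `|Rintegral mZ setT (fun z' =>
  g z' * Rintegral mX setT (fun x => W x * cos (phi (x, z) - phi (x, z'))))|
  <= L.

(** [P] and [Q] are the real and imaginary parts of the oscillatory transform of [g] with phase
    [phi]. *)
Let P x := Rintegral mZ setT (fun z => g z * cos (phi (x, z))).
Let Q x := Rintegral mZ setT (fun z => g z * sin (phi (x, z))).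

Let mgZ : measurable_fun setT (fun p : X * Z => g p.2).
Proof. exact: measurableT_comp. Qed.

Let mcosphi : measurable_fun setT (fun p => cos (phi p)).
Proof.
apply: (measurableT_comp _ mphi); apply: continuous_measurable_fun.
exact: continuous_cos.
Qed.

Let msinphi : measurable_fun setT (fun p => sin (phi p)).
Proof.
apply: (measurableT_comp _ mphi); apply: continuous_measurable_fun.
exact: continuous_sin.
Qed.

Let integrable_g (f : Z -> R) (c : R) : measurable_fun setT f ->
  (forall z, `|f z| <= c) ->
  mZ.-integrable setT (EFin \o (fun z => g z * f z)).
Proof.
move=> mf fc; apply: (@integrable_bounded_support _ _ _ _ B _ _ _ (M * c)) => //.
- by apply: (@measurable_funS _ _ _ _ setT) => //; exact: measurable_funM.
- by move=> z Bz; rewrite normrM ler_pM.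
- by move=> z nBz; rewrite g0// mul0r.
Qed.

Let integrable_normg : mZ.-integrable setT (EFin \o (fun z => `|g z|)).
Proof.
apply: (@integrable_bounded_support _ _ _ _ B mB B_fin _ M) => //.
- apply: (@measurable_funS _ _ _ _ setT) => //.
  exact: (@measurableT_comp _ _ _ _ _ _ (@Num.norm R R)).
- by move=> z _; rewrite normr_id.
- by move=> z nBz; rewrite g0// normr0.
Qed.

Let section1 (f : X * Z -> R) x : measurable_fun setT f ->
  measurable_fun setT (fun z => f (x, z)).
Proof. by move=> mf; exact: (measurableT_comp mf (pair1_measurable x)). Qed.

Let section2 (f : X * Z -> R) z : measurable_fun setT f ->
  measurable_fun setT (fun x => f (x, z)).
Proof. by move=> mf; exact: (measurableT_comp mf (pair2_measurable z)). Qed.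

Let mP : measurable_fun setT P.
Proof.
apply: (@measurable_Rintegral_section _ _ _ _ _ mZ
  (fun p => g p.2 * cos (phi p))).
exact: measurable_funM.
Qed.

Let mQ : measurable_fun setT Q.
Proof.
apply: (@measurable_Rintegral_section _ _ _ _ _ mZ
  (fun p => g p.2 * sin (phi p))).
exact: measurable_funM.
Qed.

Let bound_of (f : Z -> R) : measurable_fun setT f -> (forall z, `|f z| <= 1) ->
  `|Rintegral mZ setT (fun z => g z * f z)| <=
  Rintegral mZ setT (fun z => `|g z|).
Proof.
move=> mf f1; apply: le_trans.
  by apply: le_normr_Rintegral => //; exact: (integrable_g mf f1).
apply: le_Rintegral => //.
- by have := integrable_norm (integrable_g mf f1).
- by move=> z _; rewrite normrM ler_piMr.
Qed.

Let V := Rintegral mZ setT (fun z => `|g z|).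

Let V_le : V <= M * fine (mZ B).
Proof.
apply: le_trans (ler_norm _) _; apply: normr_Rintegral_le => //.
- apply: (@measurable_funS _ _ _ _ setT) => //.
  exact: (@measurableT_comp _ _ _ _ _ _ (@Num.norm R R)).
- by move=> z _; rewrite normr_id.
- by move=> z nBz; rewrite g0// normr0.
Qed.

Let cos_le1 (a : R) : `|cos a| <= 1.
Proof. by rewrite ler_norml cos_geN1 cos_le1. Qed.

Let sin_le1 (a : R) : `|sin a| <= 1.
Proof. by rewrite ler_norml sin_geN1 sin_le1. Qed.

Let P_le x : `|P x| <= V.
Proof.
by apply: bound_of => [|z]; [exact: (section1 x mcosphi)|exact: cos_le1].
Qed.

Let Q_le x : `|Q x| <= V.
Proof.
by apply: bound_of => [|z]; [exact: (section1 x msinphi)|exact: sin_le1].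
Qed.

Let W_le1 x : `|W x| <= 1.
Proof. by have /andP[? ?] := W01 x; rewrite ger0_norm. Qed.

Let igc x : mZ.-integrable setT (EFin \o (fun z => g z * cos (phi (x, z)))).
Proof. by apply: (@integrable_g _ 1) => //; exact: (section1 x mcosphi). Qed.

Let igs x : mZ.-integrable setT (EFin \o (fun z => g z * sin (phi (x, z)))).
Proof. by apply: (@integrable_g _ 1) => //; exact: (section1 x msinphi). Qed.

Let RintegralZD (a b : R) (f1 f2 : Z -> R) :
  mZ.-integrable setT (EFin \o f1) -> mZ.-integrable setT (EFin \o f2) ->
  Rintegral mZ setT (fun z => a * f1 z + b * f2 z) =
  a * Rintegral mZ setT f1 + b * Rintegral mZ setT f2.
Proof.
move=> i1 i2; rewrite -!RintegralZl// -RintegralD//.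
- by have := integrableZl measurableT a i1.
- by have := integrableZl measurableT b i2.
Qed.

Let mWX : measurable_fun setT (fun p : X * Z => W p.1).
Proof. exact: measurableT_comp. Qed.

(** Since [cos a cos b + sin a sin b = cos (a - b)], applying the adjoint of the transform to the
    weighted transform of [g] gives an integral operator whose kernel sees only differences of
    phases. *)
Let kernelE z : Rintegral mX setT
  (fun x => W x * (P x * cos (phi (x, z)) + Q x * sin (phi (x, z)))) =
  Rintegral mZ setT (fun z' => g z' *
    Rintegral mX setT (fun x => W x * cos (phi (x, z) - phi (x, z')))).
Proof.
pose h (p : X * Z) := W p.1 * g p.2 * cos (phi (p.1, z) - phi p).
have mphiz : measurable_fun setT (fun p : X * Z => phi (p.1, z)).
  exact: (measurableT_comp (section2 z mphi) measurable_fst).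
have mh : measurable_fun setT h.
  apply: measurable_funM; first exact: measurable_funM.
  apply: (@measurableT_comp _ _ _ _ _ _ (@cos R)).
    by apply: continuous_measurable_fun; exact: continuous_cos.
  exact: measurable_funB.
have hM p : `|h p| <= M.
  rewrite /h !normrM -[leRHS]mulr1; apply: ler_pM => //.
  by rewrite -[leRHS]mul1r; exact: ler_pM.
have h0 p : ~ (A `*` B) p -> h p = 0.
  rewrite /h => nAB; have [Ap|nAp] := pselect (A p.1); last first.
    by rewrite W0// !mul0r.
  by rewrite g0 ?mulr0 ?mul0r// => Bp; apply: nAB.
rewrite -[LHS](_ : Rintegral mX setT
    (fun x => Rintegral mZ setT (fun z' => h (x, z'))) = _); last first.
  congr Rintegral; apply/funext => x.
  rewrite mulrDr !mulrA (mulrAC _ (P x)) (mulrAC _ (Q x)).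
  rewrite -RintegralZD//; congr Rintegral; apply/funext => z'.
  by rewrite /h/= cosB; ring.
rewrite (Rfubini mA A_fin mB B_fin mh hM h0).
congr Rintegral; apply/funext => z'.
rewrite -RintegralZl//; first by congr Rintegral; apply/funext => x; rewrite /h/=; ring.
apply: (@integrable_bounded_support _ _ _ _ A mA A_fin _ 1) => //.
- apply: (@measurable_funS _ _ _ _ setT) => //.
  apply: measurable_funM => //.
  apply: (@measurableT_comp _ _ _ _ _ _ (@cos R)).
    by apply: continuous_measurable_fun; exact: continuous_cos.
  by apply: measurable_funB; exact: (section2 _ mphi).
- by move=> x _; rewrite normrM -[leRHS]mulr1; exact: ler_pM.
- by move=> x nAx; rewrite W0// mul0r.
Qed.

(** A [T T*] argument: the weighted integral of the squared transform is a double integral of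
    [g z * g z'] against the kernel of [kernelE]. The integral in [z'] is at most [L] by [kernelL],
    and what remains is the L1 norm of [g], at most [M] times the measure of [B]. *)
Lemma weighted_quadratic_bound :
  Rintegral mX setT (fun x => W x * (P x ^+ 2 + Q x ^+ 2)) <=
  M * fine (mZ B) * L.
Proof.
pose h (p : X * Z) :=
  W p.1 * g p.2 * (P p.1 * cos (phi p) + Q p.1 * sin (phi p)).
have mh : measurable_fun setT h.
  apply: measurable_funM; first exact: measurable_funM.
  apply: measurable_funD; apply: measurable_funM => //.
    exact: (measurableT_comp mP measurable_fst).
  exact: (measurableT_comp mQ measurable_fst).
have V0 : 0 <= V by apply: Rintegral_ge0.
have hM p : `|h p| <= M * (V + V).
  rewrite /h normrM; apply: ler_pM => //.
    by rewrite normrM -[leRHS]mul1r; exact: ler_pM.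
  rewrite (le_trans (ler_normD _ _))// lerD// normrM -[leRHS]mulr1;
    exact: ler_pM.
have h0 p : ~ (A `*` B) p -> h p = 0.
  rewrite /h => nAB; have [Ap|nAp] := pselect (A p.1); last first.
    by rewrite W0// !mul0r.
  by rewrite g0 ?mulr0 ?mul0r// => Bp; apply: nAB.
rewrite (_ : Rintegral mX setT _ = Rintegral mX setT
    (fun x => Rintegral mZ setT (fun z => h (x, z)))); last first.
  congr Rintegral; apply/funext => x.
  rewrite mulrDr !expr2 !mulrA -RintegralZD//.
  by congr Rintegral; apply/funext => z; rewrite /h/=; ring.
rewrite (Rfubini mA A_fin mB B_fin mh hM h0).
pose F z := Rintegral mX setT (fun x => h (x, z)).
have FE z : F z = g z * Rintegral mZ setT (fun z' => g z' *
    Rintegral mX setT (fun x => W x * cos (phi (x, z) - phi (x, z')))).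
  rewrite -kernelE -RintegralZl//.
    by congr Rintegral; apply/funext => x; rewrite /h/=; ring.
  apply: (@integrable_bounded_support _ _ _ _ A mA A_fin _ (V + V)) => //.
  - apply: (@measurable_funS _ _ _ _ setT) => //.
    apply: measurable_funM => //; apply: measurable_funD;
      apply: measurable_funM => //; first exact: (section2 _ mcosphi).
    exact: (section2 _ msinphi).
  - move=> x _; rewrite normrM -[leRHS]mul1r; apply: ler_pM => //.
    rewrite (le_trans (ler_normD _ _))// lerD// normrM -[leRHS]mulr1;
      exact: ler_pM.
  - by move=> x nAx; rewrite W0// mul0r.
have F_le z : `|F z| <= L * `|g z|.
  by rewrite FE normrM mulrC ler_wpM2r.
have mF : measurable_fun setT F.
  apply: (@measurable_Rintegral_section _ _ _ _ _ mX (h \o (fun p => (p.2, p.1)))).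
  by apply: measurableT_comp => //; exact: measurable_fun_pair.
have iF : mZ.-integrable setT (EFin \o F).
  apply: (@integrable_bounded_support _ _ _ _ B mB B_fin _ (L * M)) => //.
  - exact: measurable_funS mF.
  - by move=> z _; rewrite (le_trans (F_le z))// ler_wpM2l.
  - by move=> z nBz; rewrite FE g0// mul0r.
apply: (@le_trans _ _ (L * V)); last by rewrite mulrC ler_wpM2r.
rewrite -RintegralZl//; apply: le_Rintegral => //.
  by have := integrableZl measurableT L integrable_normg.
by move=> z _; exact: le_trans (ler_norm _) (F_le z).
Qed.

End quadratic_form_bound.

(** * A window of compact support and its Fourier transform *)

Section fejer_kernel.
Context {R : realType}.
Local Notation mu := (@lebesgue_measure R).

Lemma derivable_continuous (f : R -> R) : (forall x : R, derivable f x 1) ->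
  continuous f.
Proof.
by move=> df x; apply: differentiable_continuous; exact/derivable1_diffP.
Qed.

Lemma Rintegral_FTC (F f : R -> R) (a b : R) : a < b ->
  (forall x : R, is_derive x 1 F (f x)) -> continuous f ->
  Rintegral mu `[a, b] f = F b - F a.
Proof.
move=> ab dF cf.
have dFx x : derivable F x 1 by have [] := dF x.
have cF : continuous F by exact: derivable_continuous.
rewrite /Rintegral (@continuous_FTC2 _ f F)//.
- exact: continuous_subspaceT.
- split => [x _||]; [exact: dFx|..].
  + by apply: cvg_at_right_filter; exact: cF.
  + by apply: cvg_at_left_filter; exact: cF.
- by move=> x _; rewrite derive1E; apply: derive_val.
Qed.

(** A window that increases to 1 with [N]. The truncated parabola is chosen because its Fourier
    transform is elementary and decays quadratically, hence is absolutely integrable; the transform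
    of a sharp cutoff is not. *)
Definition weight (N x : R) : R := Num.max 0 (1 - (x / N) ^+ 2).

Lemma weight_in N x : 0 < N -> `|x| <= N -> weight N x = 1 - (x / N) ^+ 2.
Proof.
move=> N0 xN; apply/max_idPr; rewrite subr_ge0 -real_normK ?num_real// normrM normfV.
by rewrite (gtr0_norm N0) expr_le1 ?divr_ge0 ?(ltW N0)// ler_pdivrMr// mul1r.
Qed.

Lemma weight_out N x : 0 < N -> N < `|x| -> weight N x = 0.
Proof.
move=> N0 xN; apply/max_idPl; rewrite subr_le0 -real_normK ?num_real// normrM normfV.
rewrite (gtr0_norm N0) expr_ge1 ?divr_ge0 ?(ltW N0)//.
by rewrite ler_pdivlMr// mul1r ltW.
Qed.

Lemma weight_ge0 N x : 0 <= weight N x.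
Proof. by rewrite le_max lexx. Qed.

Lemma weight_le1 N x : weight N x <= 1.
Proof. by rewrite ge_max ler01/= lerBlDr lerDl sqr_ge0. Qed.

Lemma measurable_weight N : measurable_fun setT (weight N).
Proof.
apply: measurable_maxr => //; apply: measurable_funB => //.
by apply: measurable_funX; apply: measurable_funM.
Qed.

Lemma weight_nondecreasing (N N' x : R) : 0 < N -> N <= N' ->
  weight N x <= weight N' x.
Proof.
move=> N0 NN'; rewrite /weight ge_max le_max lexx/= le_max; apply/orP; right.
rewrite lerD2l lerN2 -real_normK ?num_real// -[leRHS]real_normK ?num_real// !normrM !normfV.
have N'0 := lt_le_trans N0 NN'.
rewrite ler_sqr ?nnegrE ?mulr_ge0 ?invr_ge0//.
by rewrite ler_wpM2l// lef_pV2 ?posrE ?normr_gt0 ?gt_eqF// !gtr0_norm.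
Qed.

Lemma Rintegral_weight N (f : R -> R) : 0 < N ->
  Rintegral mu setT (fun x => weight N x * f x) =
  Rintegral mu `[- N, N] (fun x => (1 - (x / N) ^+ 2) * f x).
Proof.
move=> N0; rewrite [RHS]Rintegral_mkcond; congr Rintegral; apply/funext => x.
rewrite patchE; case: ifPn => [|/negP]; rewrite inE/= in_itv/= -ler_norml.
  by move=> xN; rewrite weight_in.
by move/negP; rewrite -ltNge => xN; rewrite weight_out// mul0r.
Qed.

Lemma Rintegral_weight_sin N k : 0 < N ->
  Rintegral mu setT (fun x => weight N x * sin (k * x)) = 0.
Proof.
move=> N0; rewrite Rintegral_weight//.
have [->|k0] := eqVneq k 0.
  rewrite /Rintegral integral0_eq// => x _; rewrite mul0r sin0 mulr0//.
(* A primitive found by repeated integration by parts; it is even, so its values at [N] and [- N]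
   cancel. *)
pose F x : R := - (1 - (x / N) ^+ 2) * cos (k * x) / k
   - 2 * x * sin (k * x) / (N ^+ 2 * k ^+ 2)
   - 2 * cos (k * x) / (N ^+ 2 * k ^+ 3).
have dF (x : R) : is_derive x 1 F ((1 - (x / N) ^+ 2) * sin (k * x)).
  apply: is_derive_eq; rewrite /GRing.scale/=; field.
  by rewrite k0 gt_eqF.
rewrite (Rintegral_FTC _ dF).
- by rewrite /F mulrN cosN sinN; field; rewrite k0 gt_eqF.
- lra.
- by apply: derivable_continuous => x; exact: ex_derive.
Qed.

(** Put [u = N k]. For [u ^ 2 >= 1] the transform is [4 N (sin u / u - cos u) / u ^ 2] and
    [1 + u ^ 2 <= 2 u ^ 2]; for smaller [u] the length [2 N] of the interval suffices, as
    [1 + u ^ 2 < 2]. Both cases fit under one Lorentzian, whose mass is computed next. *)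
Lemma Rintegral_weight_cos_le N k : 0 < N ->
  `|Rintegral mu setT (fun x => weight N x * cos (k * x))| <=
  16 * N / (1 + N ^+ 2 * k ^+ 2).
Proof.
move=> N0.
have cts : continuous (fun x : R => (1 - (x / N) ^+ 2) * cos (k * x)).
  by apply: derivable_continuous => x; exact: ex_derive.
have d0 : 0 < 1 + N ^+ 2 * k ^+ 2 by rewrite ltr_pwDl// mulr_ge0// sqr_ge0.
rewrite Rintegral_weight// ler_pdivlMr//.
have [Nk|Nk] := leP 1 (N ^+ 2 * k ^+ 2).
  have k0 : k != 0.
    by apply/eqP => k0; move: Nk; rewrite k0 expr0n mulr0 ler10.
  have NN0 : N != 0 by rewrite gt_eqF.
  pose F x : R := (1 - (x / N) ^+ 2) * sin (k * x) / k
     - 2 * x * cos (k * x) / (N ^+ 2 * k ^+ 2)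
     + 2 * sin (k * x) / (N ^+ 2 * k ^+ 3).
  have dF (x : R) : is_derive x 1 F ((1 - (x / N) ^+ 2) * cos (k * x)).
    apply: is_derive_eq; rewrite /GRing.scale/=; field.
    by rewrite k0 NN0.
  have NN : - N < N by lra.
  rewrite (Rintegral_FTC NN dF cts) /F.
  set u := N * k.
  have u1 : 1 <= `|u|.
    rewrite -(@expr_ge1 _ 2)// -normrX ger0_norm ?sqr_ge0//.
    by rewrite /u exprMn.
  rewrite [X in `|X|](_ : _ = 4 * N * ((sin u / u - cos u) / u ^+ 2)); last first.
    rewrite mulrN cosN sinN (mulrC k N) -/u.
    have -> : k = u / N by rewrite /u mulrC mulKf.
    have u0 : u != 0 by rewrite mulf_neq0.
    by field; rewrite u0 NN0.
  have -> : N ^+ 2 * k ^+ 2 = u ^+ 2 by rewrite /u exprMn.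
  have u20 : 0 < u ^+ 2 by rewrite -exprMn -/u in Nk; lra.
  have sc : `|sin u / u - cos u| <= 2.
    have : `|sin u / u| <= 1.
      rewrite normrM normfV ler_pdivrMr ?(lt_le_trans ltr01)// mul1r.
      by rewrite (le_trans _ u1)// ler_norml sin_geN1 sin_le1.
    have : `|cos u| <= 1 by rewrite ler_norml cos_geN1 cos_le1.
    have := ler_normB (sin u / u) (cos u); lra.
  rewrite 3!normrM normfV (gtr0_norm u20) (gtr0_norm N0) ger0_norm//.
  rewrite -!mulrA; apply: (@le_trans _ _ (4 * (N * (2 * ((u ^+ 2)^-1 * (2 * u ^+ 2)))))).
    rewrite !ler_wpM2l//; first exact: ltW.
    apply: ler_pM => //; first by rewrite mulr_ge0 ?invr_ge0 ?ltW ?addr_gt0.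
    rewrite ler_wpM2l ?invr_ge0 ?(ltW u20)//.
    by move: Nk; rewrite -exprMn -/u; lra.
  have -> : (u ^+ 2)^-1 * (2 * u ^+ 2) = 2 by rewrite mulrC mulfK ?gt_eqF.
  lra.
apply: (@le_trans _ _ (2 * N * 2)); last by lra.
apply: ler_pM => //; [exact: ltW|..|by lra].
have ci f : continuous f -> mu.-integrable `[- N, N] (EFin \o f).
  move=> cf; apply: continuous_compact_integrable; first exact: segment_compact.
  exact: continuous_subspaceT.
apply: le_trans (le_normr_Rintegral _ (ci _ cts)) _ => //.
apply: (@le_trans _ _ (Rintegral mu `[- N, N] (fun=> 1))).
  apply: le_Rintegral => //.
  - by have := integrable_norm (ci _ cts).
  - by apply: ci => x; exact: cvg_cst.
  - move=> x /=; rewrite in_itv/= -ler_norml => xN.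
    rewrite normrM -[leRHS]mulr1 ler_pM//.
      by rewrite -weight_in// ger0_norm ?weight_le1 ?weight_ge0.
    by rewrite ler_norml cos_geN1 cos_le1.
have NN : - N < N by lra.
rewrite (@Rintegral_FTC id (fun=> 1) _ _ NN); first lra.
by move=> x; exact: cvg_cst.
Qed.

(** The primitive is [16 atan (N (x - a))], so the mass is bounded independently of the window [N]
    and of the centre [a]. This makes the Plancherel bound uniform in [N]. *)
Lemma Rintegral_kernel_le (N a b : R) : 0 < N -> 0 < b ->
  Rintegral mu `[- b, b] (fun x => 16 * N / (1 + N ^+ 2 * (a - x) ^+ 2)) <=
  16 * pi.
Proof.
move=> N0 b0.
have d0 x : 1 + (N * (x - a)) ^+ 2 != 0.
  by rewrite gt_eqF// ltr_pwDl// sqr_ge0.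
rewrite (_ : (fun x => _) = (fun x => 16 * (N / (1 + (N * (x - a)) ^+ 2)))).
  pose F x : R := 16 * atan (N * (x - a)).
  have dF (x : R) : is_derive x 1 F (16 * (N / (1 + (N * (x - a)) ^+ 2))).
    apply: is_derive_eq; rewrite /GRing.scale/= ?oppr0 ?addr0.
    by rewrite mulr1 [_^-1 * _]mulrC.
  have bb : - b < b by lra.
  rewrite (Rintegral_FTC bb dF).
    rewrite -mulrBr ler_wpM2l//.
    have := atan_ltpi2 (N * (b - a)); have := atan_gtNpi2 (N * (- b - a)); lra.
  apply: derivable_continuous => x; exact: ex_derive.
apply/funext => x; rewrite exprMn -mulrA; congr (16 * (N / (1 + _ * _))).
by rewrite -sqrrN opprB.
Qed.

End fejer_kernel.

(** * The Plancherel inequality in the plane *)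

Section plancherel.
Context {R : realType}.
Local Notation T := (measurableTypeR R * measurableTypeR R)%type.
Local Notation mu := (@lebesgue_measure R).

Let mu_itv (u v : R) : u <= v -> mu `[u, v]%classic = (v - u)%:E.
Proof.
move=> uv; rewrite lebesgue_measure_itv/= lte_fin.
have [uv'|uv'] := ltP u v; first by rewrite -EFinB.
have -> : u = v by apply/eqP; rewrite eq_le uv uv'.
by rewrite subrr.
Qed.

Lemma leb2_box (a b c d : R) : a <= b -> c <= d ->
  leb2 (`[a, b]%classic `*` `[c, d]%classic) = ((b - a) * (d - c))%:E.
Proof.
move=> ab cd; transitivity (mu `[a, b]%classic * mu `[c, d]%classic)%E.
  exact: product_measure1E.
by rewrite !mu_itv.
Qed.

Lemma leb2_sigma_finite : sigma_finite setT (leb2 : set T -> \bar R).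
Proof.
exists (fun n : nat => `[- n%:R, n%:R]%classic `*` `[- n%:R, n%:R]%classic).
  apply/esym; rewrite -subTset => -[x y] _.
  pose n := Num.bound (Num.max `|x| `|y|).
  have nB : Num.max `|x| `|y| <= n%:R by rewrite ltW// archi_boundP// le_max normr_ge0.
  exists n => //; split; rewrite /= in_itv/= -ler_norml.
    by rewrite (le_trans _ nB)// le_max lexx.
  by rewrite (le_trans _ nB)// le_max lexx orbT.
move=> n; split; first exact: measurableX.
have nn : - n%:R <= n%:R :> R by rewrite (@le_trans _ _ 0)// oppr_le0.
by rewrite leb2_box// ltry.
Qed.

(** [leb2] repackaged with its sigma-finiteness, which exchanging integrals over pairs of points of
    the plane requires. *)
Definition sleb2 : {sigma_finite_measure set T -> \bar R} :=
  HB.pack (leb2 : set T -> \bar R) (Measure.class leb2)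
    (@Measure_isSigmaFinite.Build _ _ _ (leb2 : set T -> \bar R)
       leb2_sigma_finite).

Lemma Rintegral_tensor (b B1 B2 : R) (f h : R -> R) : 0 < b ->
  measurable_fun setT f -> measurable_fun setT h ->
  (forall x, `|f x| <= B1) -> (forall x, `|h x| <= B2) ->
  (forall x, ~ `[- b, b]%classic x -> f x = 0) ->
  (forall x, ~ `[- b, b]%classic x -> h x = 0) ->
  leb2.-integrable setT (EFin \o (fun x : T => f x.1 * h x.2)) /\
  Rintegral leb2 setT (fun x => f x.1 * h x.2) =
  Rintegral mu setT f * Rintegral mu setT h.
Proof.
move=> b0 mf mh fB hB f0 h0.
have bb : - b <= b by lra.
have fin1 : (mu `[(- b)%R, b]%classic < +oo)%E.
  by rewrite mu_itv// ltry.
have ifh : leb2.-integrable setT (EFin \o (fun x : T => f x.1 * h x.2)).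
  apply: (@integrable_bounded_support _ _ _ _
    (`[- b, b]%classic `*` `[- b, b]%classic : set T) _ _ _ (B1 * B2)).
  - exact: measurableX.
  - by rewrite leb2_box// ltry.
  - apply: (@measurable_funS _ _ _ _ setT) => //; apply: measurable_funM.
      exact: (measurableT_comp mf measurable_fst).
    exact: (measurableT_comp mh measurable_snd).
  - by move=> z _; rewrite normrM ler_pM.
  - move=> [x y] nbox; have [bx|nbx] := pselect (`[- b, b]%classic x).
      by rewrite h0 ?mulr0// => bdy; apply: nbox.
    by rewrite f0// mul0r.
split=> //.
have i1 : mu.-integrable setT (EFin \o f).
  apply: (@integrable_bounded_support _ _ _ _ (`[- b, b]%classic : set (measurableTypeR R)) _ _ _ B1) => //.
  exact: measurable_funS mf.
have i2 : mu.-integrable setT (EFin \o h).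
  apply: (@integrable_bounded_support _ _ _ _ (`[- b, b]%classic : set (measurableTypeR R)) _ _ _ B2) => //.
  exact: measurable_funS mh.
have e12 := @integral12_prod_meas1 _ _ _ _ R mu mu
  (EFin \o (fun x => f x.1 * h x.2)) ifh.
rewrite {1}/Rintegral -[X in fine X]e12 /fubini_F/=.
have inner x : (\int[mu]_y (f x * h y)%:E = (Rintegral mu setT h * f x)%:E)%E.
  rewrite mulrC EFinM /Rintegral fineK; last exact: integrable_fin_num.
  by rewrite -integralZl//; apply: eq_integral => y _; rewrite EFinM.
rewrite (_ : (fun x => _) = (fun x => (Rintegral mu setT h * f x)%:E)); last first.
  by apply/funext => x; exact: inner.
by rewrite -[LHS]/(Rintegral _ _ _) RintegralZl// mulrC.
Qed.

Lemma kernel2_le (N : R) (z z' : T) : 0 < N ->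
  `|Rintegral leb2 setT (fun x : T => weight N x.1 * weight N x.2 *
     cos (x.1 * z.1 + x.2 * z.2 - (x.1 * z'.1 + x.2 * z'.2)))| <=
  16 * N / (1 + N ^+ 2 * (z.1 - z'.1) ^+ 2) *
  (16 * N / (1 + N ^+ 2 * (z.2 - z'.2) ^+ 2)).
Proof.
move=> N0.
have mw (f : R -> R) k : continuous f ->
    measurable_fun setT (fun x => weight N x * f (k * x)).
  move=> cf; apply: measurable_funM; first exact: measurable_weight.
  apply: (@measurableT_comp _ _ _ _ _ _ f).
    exact: continuous_measurable_fun.
  exact: measurable_funM.
have bw (f : R -> R) k x : (forall y, `|f y| <= 1) ->
    `|weight N x * f (k * x)| <= 1.
  move=> f1; rewrite normrM -[leRHS]mulr1 ler_pM//.
  by rewrite ger0_norm ?weight_ge0 ?weight_le1.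
have w0 (f : R -> R) k x : ~ `[- N, N]%classic x -> weight N x * f (k * x) = 0.
  rewrite /= in_itv/= -ler_norml => /negP; rewrite -ltNge => xN.
  by rewrite weight_out// mul0r.
have c1 (y : R) : `|cos y| <= 1 by rewrite ler_norml cos_geN1 cos_le1.
have s1 (y : R) : `|sin y| <= 1 by rewrite ler_norml sin_geN1 sin_le1.
have mc := mw _ _ (@continuous_cos R); have ms := mw _ _ (@continuous_sin R).
have [ic ec] := Rintegral_tensor N0 (mc (z.1 - z'.1)) (mc (z.2 - z'.2))
  (fun x => bw _ _ x c1) (fun x => bw _ _ x c1) (w0 _ _) (w0 _ _).
have [iS es] := Rintegral_tensor N0 (ms (z.1 - z'.1)) (ms (z.2 - z'.2))
  (fun x => bw _ _ x s1) (fun x => bw _ _ x s1) (w0 _ _) (w0 _ _).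
rewrite (_ : Rintegral leb2 setT _ =
  Rintegral mu setT (fun x => weight N x * cos ((z.1 - z'.1) * x)) *
  Rintegral mu setT (fun x => weight N x * cos ((z.2 - z'.2) * x))).
  by rewrite normrM ler_pM// Rintegral_weight_cos_le.
rewrite -ec -[RHS]subr0.
(* The product of sines in the expansion of the cosine of a sum integrates to 0, because the window
   is even. *)
have <- : Rintegral leb2 setT (fun x : T => weight N x.1 *
   sin ((z.1 - z'.1) * x.1) * (weight N x.2 * sin ((z.2 - z'.2) * x.2))) = 0.
  by rewrite es Rintegral_weight_sin// mul0r.
rewrite -RintegralB//; congr Rintegral; apply/funext => x.
have -> : x.1 * z.1 + x.2 * z.2 - (x.1 * z'.1 + x.2 * z'.2) =
  (z.1 - z'.1) * x.1 + (z.2 - z'.2) * x.2 by ring.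
by rewrite cosD; ring.
Qed.

Variables (D : set T) (b : R).
Hypotheses (mD : measurable D) (b0 : 0 < b).
Hypothesis Db : D `<=` `[- b, b]%classic `*` `[- b, b]%classic.

Lemma leb2_bounded_lty : (leb2 D < +oo)%E.
Proof.
apply: (@le_lt_trans _ _ (leb2 (`[- b, b]%classic `*` `[- b, b]%classic))).
  by apply: le_measure; rewrite ?inE//; exact: measurableX.
have bb : - b <= b by rewrite (@le_trans _ _ 0) ?oppr_le0 ?ltW.
by rewrite leb2_box ?ltry.
Qed.

(** One factor [16 pi] for each variable; the sharp constant would be [(2 pi) ^ 2], but only its
    independence of the amplitude matters. *)
Definition plancherel_cst : R := (16 * pi) ^+ 2.

Section real_amplitude.
Variables (g : T -> R) (M : R).
Hypotheses (mg : measurable_fun setT g) (M0 : 0 <= M).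
Hypotheses (gM : forall z, `|g z| <= M) (g0 : forall z, ~ D z -> g z = 0).

Definition fourier_cos (x : T) : R :=
  Rintegral leb2 setT (fun z => g z * cos (x.1 * z.1 + x.2 * z.2)).

Definition fourier_sin (x : T) : R :=
  Rintegral leb2 setT (fun z => g z * sin (x.1 * z.1 + x.2 * z.2)).

Let mphase : measurable_fun setT
  (fun p : T * T => p.1.1 * p.2.1 + p.1.2 * p.2.2).
Proof.
have m11 : measurable_fun setT (fun p : T * T => p.1.1).
  exact: (measurableT_comp measurable_fst measurable_fst).
have m12 : measurable_fun setT (fun p : T * T => p.1.2).
  exact: (measurableT_comp measurable_snd measurable_fst).
have m21 : measurable_fun setT (fun p : T * T => p.2.1).
  exact: (measurableT_comp measurable_fst measurable_snd).
have m22 : measurable_fun setT (fun p : T * T => p.2.2).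
  exact: (measurableT_comp measurable_snd measurable_snd).
by apply: measurable_funD; exact: measurable_funM.
Qed.

Lemma measurable_fourier_cos : measurable_fun setT fourier_cos.
Proof.
rewrite /fourier_cos /fourier_sin.
apply: (@measurable_Rintegral_section _ _ _ _ _ sleb2
  (fun p : T * T => g p.2 * cos (p.1.1 * p.2.1 + p.1.2 * p.2.2))).
apply: measurable_funM; first exact: (measurableT_comp mg measurable_snd).
apply: (measurableT_comp _ mphase); apply: continuous_measurable_fun.
exact: continuous_cos.
Qed.

Lemma measurable_fourier_sin : measurable_fun setT fourier_sin.
Proof.
rewrite /fourier_cos /fourier_sin.
apply: (@measurable_Rintegral_section _ _ _ _ _ sleb2
  (fun p : T * T => g p.2 * sin (p.1.1 * p.2.1 + p.1.2 * p.2.2))).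
apply: measurable_funM; first exact: (measurableT_comp mg measurable_snd).
apply: (measurableT_comp _ mphase); apply: continuous_measurable_fun.
exact: continuous_sin.
Qed.

Let fourier_le (f : R -> R) (x : T) : continuous f ->
  (forall y, `|f y| <= 1) ->
  `|Rintegral leb2 setT (fun z => g z * f (x.1 * z.1 + x.2 * z.2))| <=
  M * fine (leb2 D).
Proof.
move=> cf f1; apply: (normr_Rintegral_le mD leb2_bounded_lty).
- apply: (@measurable_funS _ _ _ _ setT) => //; apply: measurable_funM => //.
  apply: (@measurableT_comp _ _ _ _ _ _ f).
    exact: continuous_measurable_fun.
  by apply: measurable_funD; exact: measurable_funM.
- by move=> z _; rewrite normrM -[leRHS]mulr1 ler_pM.
- by move=> z nDz; rewrite g0// mul0r.
Qed.

Lemma integrable_weighted_fourier (N : R) : 0 < N ->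
  leb2.-integrable setT (EFin \o (fun x : T => weight N x.1 * weight N x.2 *
    (fourier_cos x ^+ 2 + fourier_sin x ^+ 2))).
Proof.
move=> N0.
have NN : - N <= N by rewrite (@le_trans _ _ 0) ?oppr_le0 ?ltW.
set V := M * fine (leb2 D).
have V0 : 0 <= V by rewrite mulr_ge0// fine_ge0.
have c1 (y : R) : `|cos y| <= 1 by rewrite ler_norml cos_geN1 cos_le1.
have s1 (y : R) : `|sin y| <= 1 by rewrite ler_norml sin_geN1 sin_le1.
have sq (y : R) : `|y| <= V -> y ^+ 2 <= V ^+ 2.
  by move=> yV; rewrite -real_normK ?num_real// ler_sqr ?nnegrE.
apply: (@integrable_bounded_support _ _ _ _
  (`[- N, N]%classic `*` `[- N, N]%classic : set T) _ _ _ (V ^+ 2 + V ^+ 2)).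
- exact: measurableX.
- by rewrite leb2_box// ltry.
- apply: (@measurable_funS _ _ _ _ setT) => //; apply: measurable_funM.
    apply: measurable_funM.
      exact: (measurableT_comp (measurable_weight _) measurable_fst).
    exact: (measurableT_comp (measurable_weight _) measurable_snd).
  by apply: measurable_funD; apply: measurable_funX;
    [exact: measurable_fourier_cos|exact: measurable_fourier_sin].
- move=> x _; rewrite ger0_norm; last first.
    by rewrite !mulr_ge0 ?weight_ge0// addr_ge0 ?sqr_ge0.
  rewrite -[leRHS]mul1r; apply: ler_pM.
  + by rewrite mulr_ge0 ?weight_ge0.
  + by rewrite addr_ge0 ?sqr_ge0.
  + by rewrite -[leRHS]mulr1 ler_pM ?weight_ge0 ?weight_le1.
  + by rewrite lerD// sq//; apply: fourier_le => //;
      [exact: continuous_cos|exact: continuous_sin].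
- move=> [x y] /= nbox.
  have w0 u : ~ `[- N, N]%classic u -> weight N u = 0.
    rewrite /= in_itv/= -ler_norml => /negP; rewrite -ltNge => xN.
    by rewrite weight_out.
  have [bx|nbx] := pselect (`[- N, N]%classic x); last by rewrite w0// !mul0r.
  by rewrite (w0 y) ?mulr0 ?mul0r// => bdy; apply: nbox.
Qed.

(** A Schur test: on the box containing [D] the kernel is dominated by a product of two Lorentzians,
    each of mass at most [16 pi] wherever it is centred. *)
Let kernel_bound (N : R) (z : T) : 0 < N ->
  `|Rintegral leb2 setT (fun z' => g z' * Rintegral leb2 setT
     (fun x : T => weight N x.1 * weight N x.2 *
     cos (x.1 * z.1 + x.2 * z.2 - (x.1 * z'.1 + x.2 * z'.2))))| <=
  M * plancherel_cst.
Proof.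
move=> N0.
pose K (a x : R) := 16 * N / (1 + N ^+ 2 * (a - x) ^+ 2).
have K_ge0 a x : 0 <= K a x.
  rewrite divr_ge0//; first by rewrite mulr_ge0// ltW.
  by rewrite addr_ge0// mulr_ge0// sqr_ge0.
have d1 c x : 1 <= 1 + N ^+ 2 * (c - x) ^+ 2.
  by rewrite lerDl mulr_ge0 ?sqr_ge0.
have K_le c x : `|K c x| <= 16 * N.
  rewrite ger0_norm// ler_pdivrMr ?(lt_le_trans ltr01 (d1 _ _))//.
  by apply: ler_peMr => //; rewrite mulr_ge0// ltW.
(* Cutting the Lorentzian to [[- b, b]] gives it the bounded support which [Rintegral_tensor] asks
   for, and loses nothing since [g] vanishes outside the box. *)
pose Kb a := (K a) \_ `[- b, b].
have mK c : measurable_fun setT (K c).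
  apply: measurable_funM => //; apply: measurable_funV.
  apply: measurable_funD => //; apply: measurable_funM => //.
  by apply: measurable_funX; exact: measurable_funB.
have mKb c : measurable_fun setT (Kb c).
  by apply/measurable_restrict => //; exact: measurable_funS (mK c).
have Kb_le c x : `|Kb c x| <= 16 * N.
  rewrite /Kb patchE; case: ifP => // _.
  by rewrite normr0 mulr_ge0// ltW.
have Kb0 c x : ~ `[- b, b]%classic x -> Kb c x = 0.
  by move=> nbx; rewrite /Kb patchE memNset.
have Kbi c : 0 <= Rintegral mu setT (Kb c) <= 16 * pi.
  rewrite -Rintegral_mkcond Rintegral_kernel_le// andbT.
  by apply: Rintegral_ge0 => x _.
have [iKK eKK] := Rintegral_tensor b0 (mKb z.1) (mKb z.2) (Kb_le _) (Kb_le _)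
  (Kb0 _) (Kb0 _).
pose k (z' : T) := Rintegral leb2 setT (fun x : T => weight N x.1 * weight N x.2 *
     cos (x.1 * z.1 + x.2 * z.2 - (x.1 * z'.1 + x.2 * z'.2))).
have mk : measurable_fun setT k.
  rewrite /k; apply: (@measurable_Rintegral_section _ _ _ _ _ sleb2
    (fun p : T * T => weight N p.2.1 * weight N p.2.2 * cos
      (p.2.1 * z.1 + p.2.2 * z.2 - (p.2.1 * p.1.1 + p.2.2 * p.1.2)))).
  have m21 : measurable_fun setT (fun p : T * T => p.2.1).
    exact: (measurableT_comp measurable_fst measurable_snd).
  have m22 : measurable_fun setT (fun p : T * T => p.2.2).
    exact: (measurableT_comp measurable_snd measurable_snd).
  have m11 : measurable_fun setT (fun p : T * T => p.1.1).
    exact: (measurableT_comp measurable_fst measurable_fst).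
  have m12 : measurable_fun setT (fun p : T * T => p.1.2).
    exact: (measurableT_comp measurable_snd measurable_fst).
  apply: measurable_funM.
    apply: measurable_funM.
      exact: (measurableT_comp (measurable_weight N) m21).
    exact: (measurableT_comp (measurable_weight N) m22).
  apply: measurable_fun_cos; apply: measurable_funB.
    by apply: measurable_funD; exact: measurable_funM.
  by apply: measurable_funD; exact: measurable_funM.
have gk z' : `|g z' * k z'| <= M * (Kb z.1 z'.1 * Kb z.2 z'.2).
  have [Dz'|nDz'] := pselect (D z'); last first.
    rewrite g0// mul0r normr0 !mulr_ge0// /Kb patchE; case: ifP => //.
  have [b1 b2] := Db Dz'.
  rewrite normrM ler_pM// /Kb !patchE !mem_set//.
  exact: kernel2_le.
have igk : leb2.-integrable setT (EFin \o (fun z' => g z' * k z')).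
  apply: (@integrable_bounded_support _ _ _ _ D mD leb2_bounded_lty _
    (M * (16 * N * (16 * N)))).
  - by apply: (@measurable_funS _ _ _ _ setT) => //; exact: measurable_funM.
  - move=> z' _; rewrite (le_trans (gk z'))// ler_wpM2l//.
    by rewrite (le_trans (ler_norm _))// normrM ler_pM.
  - by move=> z' nDz'; rewrite g0// mul0r.
apply: le_trans (le_normr_Rintegral measurableT igk) _.
apply: (@le_trans _ _ (M * (Rintegral mu setT (Kb z.1) *
    Rintegral mu setT (Kb z.2)))).
  rewrite -eKK -RintegralZl//; apply: le_Rintegral => //.
  - by have := integrable_norm igk.
  - by have := integrableZl measurableT M iKK.
rewrite ler_wpM2l// /plancherel_cst expr2.
have /andP[? ?] := Kbi z.1; have /andP[? ?] := Kbi z.2.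
exact: ler_pM.
Qed.

Lemma weighted_fourier_bound (N : R) : 0 < N ->
  Rintegral leb2 setT (fun x : T => weight N x.1 * weight N x.2 *
    (fourier_cos x ^+ 2 + fourier_sin x ^+ 2)) <=
  M ^+ 2 * fine (leb2 D) * plancherel_cst.
Proof.
move=> N0.
have bN : 0 <= plancherel_cst by rewrite /plancherel_cst sqr_ge0.
have -> : M ^+ 2 * fine (leb2 D) * plancherel_cst =
  M * fine (leb2 D) * (M * plancherel_cst) by ring.
have NN : - N <= N by lra.
rewrite /fourier_cos /fourier_sin.
apply: (@weighted_quadratic_bound _ _ _ T T sleb2 sleb2
  (`[- N, N]%classic `*` `[- N, N]%classic) D _ _ mD leb2_bounded_lty
  (fun x => weight N x.1 * weight N x.2) g
  (fun p : T * T => p.1.1 * p.2.1 + p.1.2 * p.2.2) M (M * plancherel_cst)) => //.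
- exact: measurableX.
- by rewrite leb2_box// ltry.
- exact: mulr_ge0.
- apply: measurable_funM.
    exact: (measurableT_comp (measurable_weight N) measurable_fst).
  exact: (measurableT_comp (measurable_weight N) measurable_snd).
- move=> x; rewrite mulr_ge0 ?weight_ge0//= -[leRHS]mulr1.
  by rewrite ler_pM ?weight_ge0 ?weight_le1.
- move=> [x y] /= nbox.
  have w0 u : ~ `[- N, N]%classic u -> weight N u = 0.
    rewrite /= in_itv/= -ler_norml => /negP; rewrite -ltNge => xN.
    by rewrite weight_out.
  have [bx|nbx] := pselect (`[- N, N]%classic x); last by rewrite w0// mul0r.
  by rewrite (w0 y) ?mulr0// => bdy; apply: nbox.
- by move=> z; exact: kernel_bound.
Qed.

End real_amplitude.
End plancherel.

Section plancherel_L2.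
Context {R : realType}.
Local Notation T := (measurableTypeR R * measurableTypeR R)%type.
Variables (D : set T) (b : R).
Hypotheses (mD : measurable D) (b0 : 0 < b).
Hypothesis Db : D `<=` `[- b, b]%classic `*` `[- b, b]%classic.

Lemma weight_cvg (x : R) : weight n.+1%:R x @[n --> \oo] --> (1 : R).
Proof.
have h : x / n.+1%:R @[n --> \oo] --> (0 : R).
  by rewrite -(mulr0 x); apply: cvgMr; exact: cvg_harmonic.
have h2 : (x / n.+1%:R) ^+ 2 @[n --> \oo] --> (0 : R).
  by under eq_fun do rewrite expr2; rewrite -(mulr0 0); exact: cvgM.
have h3 : 1 - (x / n.+1%:R) ^+ 2 @[n --> \oo] --> (1 : R).
  by rewrite -[X in _ --> X](subr0 (1 : R)); apply: cvgB => //; exact: cvg_cst.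
apply: (@squeeze_cvgr _ _ _ _ (fun n => 1 - (x / n.+1%:R) ^+ 2) (cst 1) _ _ _ h3).
- by apply: nearW => n; rewrite weight_le1 andbT le_max lexx orbT.
- exact: cvg_cst.
Qed.

(** The bound for the windowed integrals does not depend on the window, which monotone convergence
    therefore removes. *)
Lemma fourier_integral_le (g : T -> R) (M : R) : measurable_fun setT g ->
  0 <= M -> (forall z, `|g z| <= M) -> (forall z, ~ D z -> g z = 0) ->
  (\int[leb2]_x (fourier_cos g x ^+ 2 + fourier_sin g x ^+ 2)%:E <=
   (M ^+ 2 * fine (leb2 D) * plancherel_cst)%:E)%E.
Proof.
move=> mg M0 gM g0.
have mF : measurable_fun setT (fun x => fourier_cos g x ^+ 2 + fourier_sin g x ^+ 2).
  by apply: measurable_funD; apply: measurable_funX;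
    [exact: measurable_fourier_cos|exact: measurable_fourier_sin].
have F0 x : 0 <= fourier_cos g x ^+ 2 + fourier_sin g x ^+ 2.
  by rewrite addr_ge0 ?sqr_ge0.
set F := fun x => fourier_cos g x ^+ 2 + fourier_sin g x ^+ 2 in mF F0 *.
pose f (n : nat) (x : T) := (weight n.+1%:R x.1 * weight n.+1%:R x.2 * F x)%:E.
have mw n : measurable_fun setT (fun x : T => weight n.+1%:R x.1 * weight n.+1%:R x.2).
  apply: measurable_funM.
    exact: (measurableT_comp (measurable_weight _) measurable_fst).
  exact: (measurableT_comp (measurable_weight _) measurable_snd).
have mf n : measurable_fun setT (f n).
  by apply/measurable_EFinP; exact: measurable_funM.
have f0 n x : setT x -> (0 <= f n x)%E.
  move=> _; rewrite lee_fin; apply: mulr_ge0; last exact: F0.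
  by apply: mulr_ge0; exact: weight_ge0.
have ndf x : setT x -> {homo f ^~ x : n m / (n <= m)%N >-> (n <= m)%E}.
  move=> _ n m nm; rewrite lee_fin; apply: ler_wpM2r; first exact: F0.
  by apply: ler_pM; rewrite ?weight_ge0// weight_nondecreasing// ler_nat.
have cf x : f n x @[n --> \oo] --> (F x)%:E.
  apply: cvg_EFin; first exact: nearW.
  have c : weight n.+1%:R x.1 * weight n.+1%:R x.2 * F x @[n --> \oo] -->
      1 * 1 * F x.
    by apply: cvgMl; apply: cvgM; exact: weight_cvg.
  by rewrite !mul1r in c.
have -> : (\int[leb2]_x (F x)%:E = \int[leb2]_x limn (f ^~ x))%E.
  by apply: eq_integral => x _; apply/esym/cvg_lim => //; exact: cf.
have cv := @cvg_monotone_convergence _ _ _ leb2 _ measurableT _ mf f0 ndf.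
rewrite -(cvg_lim _ cv)//; apply: lime_le.
  by apply: cvgP cv.
apply: nearW => n.
have nb := weighted_fourier_bound mD b0 Db mg M0 gM g0 (ltr0Sn R n).
have ifn := integrable_weighted_fourier mD b0 Db mg M0 gM g0 (ltr0Sn R n).
by rewrite -(fineK (integrable_fin_num measurableT ifn)) lee_fin.
Qed.

Lemma measurable_upper_half_plane : measurable (@upper_half_plane R).
Proof.
rewrite (_ : upper_half_plane = setT `&` (snd @^-1` `]0, +oo[)); last first.
  by apply/seteqP; split => z /=; rewrite in_itv/= andbT => // -[].
exact: measurable_snd.
Qed.

(** The square is integrated over the whole plane, where the Plancherel bound lives; restricting to
    the half-plane only loses mass. *)
Lemma L2norm_le (f : T -> R) (C : R) : measurable_fun setT f -> 0 <= C ->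
  (\int[leb2]_x (f x ^+ 2)%:E <= (C ^+ 2)%:E)%E -> (L2norm f <= C%:E)%E.
Proof.
move=> mf C0 fC; rewrite /L2norm unlock.
have -> : (C%:E = ((C ^+ 2)%:E `^ (2^-1)))%E.
  by rewrite /= powR12_sqrt ?sqr_ge0// sqrtr_sqr ger0_norm.
have i0 : (0 <= \int[leb2]_x
    `|((EFin \o f) \_ upper_half_plane) x| `^ 2)%E.
  by apply: integral_ge0 => x _; exact: poweR_ge0.
apply: gt0_ler_poweR; rewrite ?invr_ge0//.
- by rewrite in_itv/= i0 leey.
- by rewrite in_itv/= leey lee_fin sqr_ge0.
apply: le_trans fC.
rewrite (eq_integral ((fun x => (f x ^+ 2)%:E) \_ (@upper_half_plane R))).
  rewrite -integral_mkcond; apply: ge0_subset_integral => //.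
  - exact: measurable_upper_half_plane.
  - by apply/measurable_EFinP; exact: measurable_funX.
  - by move=> x _; rewrite lee_fin sqr_ge0.
move=> x _; rewrite !patchE; case: ifP => _ /=.
  by rewrite powR_mulrn// real_normK ?num_real.
by rewrite normr0 powR0// pnatr_eq0.
Qed.

Variables (G : T -> R[i]) (M : R).
Hypotheses (sG : csymbol D G) (M0 : 0 <= M).
Hypothesis GM : forall z, D z -> normc (G z) <= M.

Let GM' z : normc (G z) <= M.
Proof.
have [Dz|nDz] := pselect (D z); first exact: GM.
by have [_ ->//] := sG; rewrite Normc.normc0.
Qed.

Let mG0 (h : T -> R) : measurable_fun D h -> (forall z, ~ D z -> h z = 0) ->
  measurable_fun setT h.
Proof.
move=> mh h0; have -> : h = h \_ D.
  apply/funext => z; rewrite patchE; case: ifPn => // /negP zD.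
  by rewrite h0// => Dz; apply: zD; rewrite inE.
by apply/measurable_restrict => //; rewrite setTI.
Qed.

Let mReG : measurable_fun setT (fun z => Re (G z)).
Proof.
by have [[[m1 _] _] G0] := sG; apply: mG0 => // z /G0 ->.
Qed.

Let mImG : measurable_fun setT (fun z => Im (G z)).
Proof.
by have [[[_ m1] _] G0] := sG; apply: mG0 => // z /G0 ->.
Qed.

Definition fourier (x : T) : R[i] :=
  cintegral2 (fun z => G z * cexp ('i%C * (x.1 * z.1 + x.2 * z.2)%:C)).

Let ReG := fun z => Re (G z).
Let ImG := fun z => Im (G z).

Let integrable_trig (f : R -> R) (p : T -> R) (x : T) : continuous f ->
  (forall y, `|f y| <= 1) -> measurable_fun setT p ->
  (forall z, `|p z| <= M) -> (forall z, ~ D z -> p z = 0) ->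
  leb2.-integrable setT (EFin \o (fun z => p z * f (x.1 * z.1 + x.2 * z.2))).
Proof.
move=> cf f1 mp pM p0.
apply: (integrable_bounded_support mD (leb2_bounded_lty mD b0 Db) (M := M)).
- apply: (@measurable_funS _ _ _ _ setT) => //; apply: measurable_funM => //.
  apply: (@measurableT_comp _ _ _ _ _ _ f).
    exact: continuous_measurable_fun.
  by apply: measurable_funD; exact: measurable_funM.
- by move=> z _; rewrite normrM -[leRHS]mulr1 ler_pM.
- by move=> z nDz; rewrite p0// mul0r.
Qed.

Let ReG_le z : `|ReG z| <= M.
Proof. exact: le_trans (ler_Re_normc _) (GM' z). Qed.

Let ImG_le z : `|ImG z| <= M.
Proof. exact: le_trans (ler_Im_normc _) (GM' z). Qed.

Let ReG0 z : ~ D z -> ReG z = 0.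
Proof. by have [_ G0] := sG; move=> /G0 e; rewrite /ReG e. Qed.

Let ImG0 z : ~ D z -> ImG z = 0.
Proof. by have [_ G0] := sG; move=> /G0 e; rewrite /ImG e. Qed.

Lemma fourierE (x : T) : fourier x =
  (fourier_cos ReG x - fourier_sin ImG x) +i*
  (fourier_sin ReG x + fourier_cos ImG x).
Proof.
have c1 (y : R) : `|cos y| <= 1 by rewrite ler_norml cos_geN1 cos_le1.
have s1 (y : R) : `|sin y| <= 1 by rewrite ler_norml sin_geN1 sin_le1.
have iRc := integrable_trig x (@continuous_cos R) c1 mReG ReG_le ReG0.
have iRs := integrable_trig x (@continuous_sin R) s1 mReG ReG_le ReG0.
have iIc := integrable_trig x (@continuous_cos R) c1 mImG ImG_le ImG0.
have iIs := integrable_trig x (@continuous_sin R) s1 mImG ImG_le ImG0.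
rewrite /fourier /fourier_cos /fourier_sin -RintegralB// -RintegralD//.
apply: complex_eqP => /=; congr Rintegral; apply/funext => z.
  rewrite Re_mulc /cexp/= mul0r mul1r mul0r subrr expR0 !mul1r add0r.
  by [].
rewrite Im_mulc /cexp/= mul0r mul1r mul0r subrr expR0 !mul1r add0r.
by [].
Qed.

Lemma measurable_fourier : cmeasurable setT fourier.
Proof.
split.
  under eq_fun do rewrite fourierE/=.
  by apply: measurable_funB;
    [exact: measurable_fourier_cos|exact: measurable_fourier_sin].
under eq_fun do rewrite fourierE/=.
by apply: measurable_funD;
  [exact: measurable_fourier_sin|exact: measurable_fourier_cos].
Qed.

(** Real and imaginary parts of the amplitude are treated apart and recombined by [(p - q) ^ 2 + (r
    + t) ^ 2 <= 2 (p ^ 2 + r ^ 2) + 2 (q ^ 2 + t ^ 2)], whence the factor 4. *)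
Lemma plancherel_le : (\int[leb2]_x (normc (fourier x) ^+ 2)%:E <=
  (4 * plancherel_cst * (M ^+ 2 * fine (leb2 D)))%:E)%E.
Proof.
have hR := fourier_integral_le mReG M0 ReG_le ReG0.
have hI := fourier_integral_le mImG M0 ImG_le ImG0.
set K := M ^+ 2 * fine (leb2 D) in hR hI *.
have mS p : measurable_fun setT p -> measurable_fun setT
    (fun x => (fourier_cos p x ^+ 2 + fourier_sin p x ^+ 2)%:E).
  move=> mp; apply/measurable_EFinP.
  by apply: measurable_funD; apply: measurable_funX;
    [exact: measurable_fourier_cos|exact: measurable_fourier_sin].
have S0 p x : (0 <= (fourier_cos p x ^+ 2 + fourier_sin p x ^+ 2)%:E)%E.
  by rewrite lee_fin addr_ge0 ?sqr_ge0.
apply: (@le_trans _ _ (\int[leb2]_x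
    (2%:E * (fourier_cos ReG x ^+ 2 + fourier_sin ReG x ^+ 2)%:E +
     2%:E * (fourier_cos ImG x ^+ 2 + fourier_sin ImG x ^+ 2)%:E))%E).
  apply: ge0_le_integral => //.
  - by move=> x _; rewrite lee_fin sqr_ge0.
  - apply/measurable_EFinP; apply: measurable_funX.
    exact: measurable_normc measurable_fourier.
  - by apply: emeasurable_funD; apply: measurable_funeM; exact: mS.
  - move=> x _; rewrite -!EFinM -EFinD lee_fin sqr_normc fourierE/=.
    set p := fourier_cos ReG x; set q := fourier_sin ImG x.
    set r := fourier_sin ReG x; set t := fourier_cos ImG x.
    have := sqr_ge0 (p + q); have := sqr_ge0 (r - t).
    rewrite !sqrrD !sqrrN mulrN; lra.
rewrite ge0_integralD//; last 4 first.
- by move=> x _; rewrite mule_ge0.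
- by apply: measurable_funeM; exact: mS.
- by move=> x _; rewrite mule_ge0.
- by apply: measurable_funeM; exact: mS.
rewrite !ge0_integralZl//; try by [exact: mS|move=> x _; exact: S0].
have -> : 4 * plancherel_cst * K =
  2 * (K * plancherel_cst) + 2 * (K * plancherel_cst) by ring.
have dbl (X : \bar R) (r : R) : (X <= r%:E)%E -> (2%:E * X <= (2 * r)%:E)%E.
  by move=> Xr; rewrite EFinM; exact: lee_wpmul2l.
rewrite [leRHS]EFinD; exact: (leeD (dbl _ _ hR) (dbl _ _ hI)).
Qed.

End plancherel_L2.

(** * Perturbation of the roots of a polynomial *)

Section geometric_sequences.
Context {R : realType}.

(** The sequences [v n + r / 2 ^ n] and [v n - r / 2 ^ n] are monotone and enclose [v n]; the limit
    and the rate both come from monotone convergence. *)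
Lemma geometric_cvg (v : nat -> R) (r : R) :
  (forall n, `|v n.+1 - v n| <= r / 2 ^+ n.+1) ->
  exists2 l : R, v n @[n --> \oo] --> l & forall n, `|l - v n| <= r / 2 ^+ n.
Proof.
move=> vr.
have p2 n : (2 : R) ^+ n != 0 by rewrite expf_neq0.
have half n : r / 2 ^+ n = 2 * (r / 2 ^+ n.+1).
  by rewrite exprS; field.
pose up n := v n + r / 2 ^+ n; pose dn n := v n - r / 2 ^+ n.
have step n : up n.+1 <= up n /\ dn n <= dn n.+1.
  have h := half n; have := vr n; rewrite ler_norml /up /dn => /andP[]; lra.
have up_ni : nonincreasing_seq up.
  by apply/nonincreasing_seqP => n; case: (step n).
have dn_nd : nondecreasing_seq dn.
  by apply/nondecreasing_seqP => n; case: (step n).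
have r0 : 0 <= r.
  have := le_trans (normr_ge0 _) (vr 0%N).
  by rewrite pmulr_lge0// invr_gt0 exprn_gt0.
have dn_up n : dn n <= up n.
  have : 0 <= r / 2 ^+ n by rewrite divr_ge0// exprn_ge0.
  rewrite /dn /up; lra.
have c0 : r / 2 ^+ n @[n --> \oo] --> (0 : R).
  rewrite -(mulr0 r); apply: cvgMr.
  under eq_fun do rewrite -exprVn; apply: cvg_expr.
  by rewrite ger0_norm ?invr_ge0// invf_lt1// ltr1n.
have cup : cvgn up.
  apply: nonincreasing_is_cvgn => //; exists (dn 0%N) => _ [n _ <-].
  by rewrite (le_trans _ (dn_up n))// dn_nd.
exists (limn up).
  have -> : v = (fun n => up n - r / 2 ^+ n) by apply/funext => n; rewrite /up addrK.
  by rewrite -[X in _ --> X]subr0; apply: cvgB.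
have cdn : dn @ \oo --> limn up.
  have -> : dn = (fun n => up n - (r / 2 ^+ n + r / 2 ^+ n)).
    by apply/funext => n; rewrite /up /dn; lra.
  rewrite -[X in _ --> X]subr0 -[X in _ --> _ - X](addr0 0).
  by apply: cvgB => //; exact: cvgD.
move=> n; rewrite ler_norml.
have h1 := nonincreasing_cvgn_ge up_ni cup n.
have h2 : dn n <= limn up.
  by rewrite -(cvg_lim _ cdn)//; apply: nondecreasing_cvgn_le => //; apply: cvgP cdn.
rewrite /up /dn in h1 h2; apply/andP; split; lra.
Qed.

Lemma le_geometric (x y r : R) : (forall n, x <= y + r / 2 ^+ n) -> x <= y.
Proof.
move=> xy; have c0 : y + r / 2 ^+ n @[n --> \oo] --> y.
  rewrite -[X in _ --> X](addr0 y) -(mulr0 r); apply: cvgD; first exact: cvg_cst.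
  apply: cvgMr; under eq_fun do rewrite -exprVn; apply: cvg_expr.
  by rewrite ger0_norm ?invr_ge0// invf_lt1// ltr1n.
rewrite -(cvg_lim _ c0)//; apply: limr_ge; first by apply: cvgP c0.
by apply: nearW => n; exact: xy.
Qed.

End geometric_sequences.

(** * Newton iteration with a frozen derivative *)

Section parametric_roots.
Context {R : realType}.
Local Notation T := (measurableTypeR R * measurableTypeR R)%type.
Variables (D E : set T) (f : T -> R[i] -> R[i]) (L0 q : T -> R[i]) (rho : R).
Hypothesis DE : D `<=` E.
Hypothesis mf : forall L, cmeasurable D L -> cmeasurable D (fun z => f z (L z)).
Hypotheses (mL0 : cmeasurable D L0) (mq : cmeasurable D q).
Hypothesis q0 : forall z, E z -> q z != 0.
Hypothesis fL0 : forall z, E z -> normc (f z (L0 z)) <= normc (q z) * rho / 2.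
Hypothesis fq : forall z a b, E z ->
  normc (a - L0 z) <= rho -> normc (b - L0 z) <= rho ->
  normc (f z a - f z b - q z * (a - b)) <= normc (q z) * normc (a - b) / 2.

(** The derivative is frozen at a value [q] attached to the starting point. The iterates are then
    measurable in [z] one after the other, and [fq] makes the map a contraction of ratio one
    half. *)
Fixpoint newton n (z : T) : R[i] :=
  if n is m.+1 then newton m z - f z (newton m z) / q z else L0 z.

Let measurable_newton n : cmeasurable D (newton n).
Proof.
elim: n => //= n ih; apply: cmeasurableB => //.
by apply: cmeasurableM; [exact: mf|exact: cmeasurableV].
Qed.

Let newton_bound z n : E z -> normc (newton n z - L0 z) <= rho - rho / 2 ^+ n /\
  normc (newton n.+1 z - newton n z) <= rho / 2 ^+ n.+1.
Proof.
move=> Ez; have nq : 0 < normc (q z) by rewrite normc_gt0 q0.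
have p2 m : (2 : R) ^+ m != 0 by rewrite expf_neq0.
have half m : rho / 2 ^+ m = 2 * (rho / 2 ^+ m.+1) by rewrite exprS; field.
have rho0 : 0 <= rho.
  have := le_trans (normc_ge0 _) (fL0 Ez).
  by rewrite pmulr_lge0 ?invr_gt0// pmulr_rge0.
have rge0 m : 0 <= rho / 2 ^+ m by rewrite divr_ge0// exprn_ge0.
elim: n => [|n [ih1 ih2]].
  split; first by rewrite /= subrr Normc.normc0 expr0 divr1 subrr.
  rewrite /= addrAC subrr add0r normcN Normc.normcM Normc.normcV.
  by rewrite ler_pdivrMr// expr1 (le_trans (fL0 Ez))//; lra.
have b1 : normc (newton n.+1 z - L0 z) <= rho - rho / 2 ^+ n.+1.
  have -> : newton n.+1 z - L0 z =
    (newton n.+1 z - newton n z) + (newton n z - L0 z) by rewrite addrA subrK.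
  by apply: le_trans (ler_normcD _ _) _; move: ih1; rewrite half; lra.
split=> //.
(* The linear part of the increment of [f] cancels against the Newton correction, leaving only the
   error that [fq] controls. *)
have e : newton n.+2 z - newton n.+1 z =
  - ((f z (newton n.+1 z) - f z (newton n z) -
      q z * (newton n.+1 z - newton n z)) / q z).
  rewrite /=; set a := newton n z; set c := f z (a - _).
  by field; exact: q0.
rewrite e normcN Normc.normcM Normc.normcV ler_pdivrMr//.
apply: le_trans (fq Ez _ _) _.
- by apply: le_trans b1 _; have := rge0 n.+1; lra.
- by apply: le_trans ih1 _; have := rge0 n; lra.
rewrite -mulrA mulrC ler_wpM2r ?normc_ge0// ler_pdivrMr//.
by rewrite mulrC -half.
Qed.

(** In the application [E] is the closed support of the amplitude, where the roots are wanted, and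
    [D] the set where the amplitude is nonzero, where their measurability is. The limit is taken in
    the real and imaginary parts separately. *)
Lemma parametric_root : exists L, cmeasurable D L /\
  forall z, E z -> f z (L z) = 0 /\ normc (L z - L0 z) <= rho.
Proof.
have cvRe z : E z -> exists2 l : R, Re (newton n z) @[n --> \oo] --> l &
    forall n, `|l - Re (newton n z)| <= rho / 2 ^+ n.
  move=> Ez; apply: geometric_cvg => n; rewrite -raddfB.
  by apply: le_trans (ler_Re_normc _) _; have [] := newton_bound n Ez.
have cvIm z : E z -> exists2 l : R, Im (newton n z) @[n --> \oo] --> l &
    forall n, `|l - Im (newton n z)| <= rho / 2 ^+ n.
  move=> Ez; apply: geometric_cvg => n; rewrite -raddfB.
  by apply: le_trans (ler_Im_normc _) _; have [] := newton_bound n Ez.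
pose L z := limn (fun n => Re (newton n z)) +i* limn (fun n => Im (newton n z)).
exists L; split.
  split.
    apply: (@measurable_fun_cvg _ _ _ D (fun n z => Re (newton n z))).
      by move=> n; case: (measurable_newton n).
    by move=> z /DE /cvRe[l /cvgP].
  apply: (@measurable_fun_cvg _ _ _ D (fun n z => Im (newton n z))).
    by move=> n; case: (measurable_newton n).
  by move=> z /DE /cvIm[l /cvgP].
move=> z Ez.
have nq : 0 < normc (q z) by rewrite normc_gt0 q0.
have Ln n : normc (L z - newton n z) <= 2 * rho / 2 ^+ n.
  have [l cl hl] := cvRe _ Ez; have [l' cl' hl'] := cvIm _ Ez.
  apply: le_trans (ler_normcReIm _) _; rewrite !raddfB/=.
  by rewrite (cvg_lim _ cl)// (cvg_lim _ cl')//; have := hl n; have := hl' n; lra.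
have LL0 : normc (L z - L0 z) <= rho.
  apply: (@le_geometric _ _ _ (2 * rho)) => n.
  have -> : L z - L0 z = (newton n z - L0 z) + (L z - newton n z).
    by ring.
  apply: le_trans (ler_normcD _ _) _; apply: lerD => //.
  have [h _] := newton_bound n Ez; apply: le_trans h _.
  rewrite gerBl divr_ge0 ?exprn_ge0//.
  have := le_trans (normc_ge0 _) (fL0 Ez).
  by rewrite pmulr_lge0 ?invr_gt0// pmulr_rge0.
split=> //.
apply: Normc.eq0_normc; apply/eqP; rewrite eq_le normc_ge0 andbT.
apply: (@le_geometric _ _ _ (normc (q z) * 4 * rho)) => n; rewrite add0r.
have rho0 : 0 <= rho.
  have := le_trans (normc_ge0 _) (fL0 Ez).
  by rewrite pmulr_lge0 ?invr_gt0// pmulr_rge0.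
have rge0 m : 0 <= rho / 2 ^+ m by rewrite divr_ge0// exprn_ge0.
have [h1 h2] := newton_bound n Ez.
have nb : normc (newton n z - L0 z) <= rho.
  by apply: le_trans h1 _; have := rge0 n; lra.
have H := fq Ez LL0 nb.
(* [fq] stands in for the continuity of [f]: both terms are bounded by distances between iterates
   and the limit. *)
have e : f z (L z) = (f z (L z) - f z (newton n z) - q z * (L z - newton n z))
   + q z * ((L z - newton n z) - (newton n.+1 z - newton n z)).
  by rewrite /=; field; exact: q0.
rewrite e; apply: le_trans (ler_normcD _ _) _; rewrite Normc.normcM.
have p2 : (2 : R) ^+ n != 0 by rewrite expf_neq0.
have h3 : rho / 2 ^+ n.+1 = rho / 2 ^+ n / 2 by rewrite exprS; field.
have -> : normc (q z) * 4 * rho / 2 ^+ n = normc (q z) * (2 * rho / 2 ^+ n / 2 + 3 * (rho / 2 ^+ n)).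
  by field.
rewrite [leRHS]mulrDr; apply: lerD.
  by apply: le_trans H _; rewrite -mulrA ler_wpM2l ?(ltW nq)// ler_wpM2r// ?invr_ge0.
rewrite ler_wpM2l ?(ltW nq)//; apply: le_trans (ler_normcB _ _) _.
have := Ln n; rewrite h3 in h2; have := rge0 n; lra.
Qed.

End parametric_roots.


(** * Simple roots of polynomials of degree at most six *)

Section polynomial_perturbation.
Context {R : realType}.
Local Notation T := (measurableTypeR R * measurableTypeR R)%type.

Definition peval (p : nat -> R[i]) (x : R[i]) := \sum_(j < 7) p j * x ^+ j.
Definition pderiv (p : nat -> R[i]) (x : R[i]) :=
  \sum_(j < 7) p j * (j%:R * x ^+ j.-1).

Lemma normc_sum (F : 'I_7 -> R[i]) (r : R) : (forall j, normc (F j) <= r) ->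
  normc (\sum_(j < 7) F j) <= 7 * r.
Proof.
move=> Fr.
have -> : 7 * r = \sum_(j < 7) r by rewrite sumr_const card_ord mulr_natl.
elim/big_ind2 : _ => [|x1 x2 y1 y2 h1 h2|j _]; rewrite ?Normc.normc0//.
by apply: le_trans (ler_normcD _ _) _; exact: lerD.
Qed.

Lemma normc_exp_lipschitz (M : R) (a b : R[i]) j : 1 <= M ->
  normc a <= M -> normc b <= M ->
  normc (a ^+ j - b ^+ j) <= j%:R * M ^+ j * normc (a - b).
Proof.
move=> M1 aM bM; have M0 : 0 <= M by lra.
elim: j => [|j ih]; first by rewrite !expr0 subrr Normc.normc0 !mul0r.
have -> : a ^+ j.+1 - b ^+ j.+1 = a * (a ^+ j - b ^+ j) + (a - b) * b ^+ j.
  by rewrite !exprS; ring.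
apply: le_trans (ler_normcD _ _) _; rewrite !Normc.normcM normcX.
have Mj : 0 <= M ^+ j by rewrite exprn_ge0.
have h1 : normc a * normc (a ^+ j - b ^+ j) <= M * (j%:R * M ^+ j * normc (a - b)).
  by rewrite ler_pM ?normc_ge0.
have h2 : normc (a - b) * normc b ^+ j <= normc (a - b) * (M * M ^+ j).
  rewrite ler_wpM2l ?normc_ge0// (@le_trans _ _ (M ^+ j))//.
    by apply: lerXn2r; rewrite ?nnegrE ?normc_ge0.
  by rewrite ler_peMl.
apply: le_trans (lerD h1 h2) _; rewrite exprS -natr1; lra.
Qed.

(** The linearization is taken at a third point [x], not at [a] or [b], because the Newton iteration
    keeps the derivative at the unperturbed root. *)
Lemma normc_exp_taylor (M r : R) (a b x : R[i]) j : 1 <= M ->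
  normc a <= M -> normc b <= M -> normc x <= M ->
  normc (a - x) <= r -> normc (b - x) <= r ->
  normc (a ^+ j - b ^+ j - j%:R * x ^+ j.-1 * (a - b)) <=
    j%:R ^+ 2 * M ^+ j * r * normc (a - b).
Proof.
move=> M1 aM bM xM ar br; have M0 : 0 <= M by lra.
have r0 : 0 <= r := le_trans (normc_ge0 _) ar.
elim: j => [|j ih].
  by rewrite !expr0 subrr !mul0r subr0 Normc.normc0 expr0n !mul0r.
have -> : a ^+ j.+1 - b ^+ j.+1 - j.+1%:R * x ^+ j.+1.-1 * (a - b) =
   a * (a ^+ j - b ^+ j - j%:R * x ^+ j.-1 * (a - b)) +
   (b ^+ j - x ^+ j) * (a - b) + j%:R * x ^+ j.-1 * (a - x) * (a - b).
  by case: j {ih} => [|j]; rewrite /= -?natr1 !exprS ?expr0; ring.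
set n := normc (a - b); have n0 : 0 <= n by rewrite normc_ge0.
have Mj : 0 <= M ^+ j by rewrite exprn_ge0.
have jR : normc (j%:R : R[i]) = j%:R.
  by rewrite (_ : j%:R = (j%:R)%:C) ?normc_real ?normr_nat// rmorph_nat.
have h1 : normc (a * (a ^+ j - b ^+ j - j%:R * x ^+ j.-1 * (a - b))) <=
    M * (j%:R ^+ 2 * M ^+ j * r * n).
  by rewrite Normc.normcM ler_pM ?normc_ge0.
have h2 : normc ((b ^+ j - x ^+ j) * (a - b)) <= j%:R * M ^+ j * r * n.
  rewrite Normc.normcM ler_pM ?normc_ge0//.
  apply: le_trans (normc_exp_lipschitz _ M1 bM xM) _.
  by rewrite ler_wpM2l// mulr_ge0.
have h3 : normc (j%:R * x ^+ j.-1 * (a - x) * (a - b)) <= j%:R * M ^+ j * r * n.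
  rewrite !Normc.normcM jR normcX.
  rewrite ler_pM ?mulr_ge0 ?exprn_ge0 ?normc_ge0//.
  rewrite ler_pM ?mulr_ge0 ?exprn_ge0 ?normc_ge0// ler_wpM2l//.
  apply: (@le_trans _ _ (M ^+ j.-1)); first by apply: lerXn2r; rewrite ?nnegrE ?normc_ge0.
  by rewrite ler_weXn2l// leq_pred.
apply: le_trans (ler_normcD _ _) _; apply: le_trans (lerD (ler_normcD _ _) h3) _.
apply: le_trans (lerD (lerD h1 h2) (lexx _)) _.
have Mj1 : M ^+ j <= M ^+ j.+1 by rewrite exprS ler_peMl.
have rn : 0 <= r * n by rewrite mulr_ge0.
have : j%:R * M ^+ j * r * n <= j%:R * M ^+ j.+1 * r * n.
  by rewrite -!(mulrA _ r) ler_wpM2r// ler_wpM2l.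
have : 0 <= M ^+ j.+1 * (r * n) by rewrite mulr_ge0// exprn_ge0.
rewrite -natr1 !exprS; lra.
Qed.

(** Supplies the two hypotheses of the contraction, with thresholds that depend only on the bound
    [K], the lower bound [c] of the derivative and [rho]. The radius [r] comes first, making the
    Taylor error small against [c]; the tolerance [d] on the coefficients is then small against [c]
    and against [c r]. *)
Lemma peval_perturbation (K c rho : R) : 1 <= K -> 0 < c -> 0 < rho ->
  exists2 d : R, 0 < d & exists2 r : R, 0 < r <= rho &
  forall (p q : nat -> R[i]) (x : R[i]),
    (forall j, normc (p j) <= K) -> (forall j, normc (q j - p j) <= d) ->
    normc x <= K -> peval p x = 0 -> c <= normc (pderiv p x) ->
    normc (peval q x) <= normc (pderiv p x) * r / 2 /\
    forall a b, normc (a - x) <= r -> normc (b - x) <= r ->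
      normc (peval q a - peval q b - pderiv p x * (a - b)) <=
      normc (pderiv p x) * normc (a - b) / 2.
Proof.
move=> K1 c0 rho0; set M := K + 1; set Q := M ^+ 6.
have M1 : 1 <= M by rewrite /M; lra.
have Q1 : 1 <= Q by rewrite /Q exprn_ege1.
have Q0 : 0 < Q by lra.
have K0 : 0 < K by lra.
have KQ : 0 < (4 * (7 * (6 * 6))) * K * Q.
  by do 2 (apply: mulr_gt0 => //); lra.
have Q4 : 0 < (4 * (7 * 6)) * Q by apply: mulr_gt0 => //; lra.
have Q2 : 0 < (2 * 7) * Q by apply: mulr_gt0 => //; lra.
(* The factor 7 counts coefficients, 6 bounds the exponents, and [Q] bounds the powers of points of
   the ball of radius [K + 1]. *)
pose r := Num.min (Num.min rho 1) (c / ((4 * (7 * (6 * 6))) * K * Q)).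
have r0 : 0 < r by rewrite /r !lt_min rho0 ltr01 divr_gt0.
have rr : r <= rho by rewrite /r !ge_min lexx.
have r1 : r <= 1 by rewrite /r !ge_min lexx orbT.
have rc : (7 * (6 * 6)) * K * Q * r <= c / 4.
  have : r <= c / ((4 * (7 * (6 * 6))) * K * Q) by rewrite /r ge_min lexx orbT.
  by rewrite ler_pdivlMr//; lra.
pose d := Num.min (c / ((4 * (7 * 6)) * Q)) (c * r / ((2 * 7) * Q)).
have d0 : 0 < d by rewrite /d lt_min; apply/andP; split; apply: divr_gt0 => //; exact: mulr_gt0.
have dc : (7 * 6) * Q * d <= c / 4.
  have : d <= c / ((4 * (7 * 6)) * Q) by rewrite /d ge_min lexx.
  by rewrite ler_pdivlMr//; lra.
have dr : 7 * Q * d <= c * r / 2.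
  have : d <= c * r / ((2 * 7) * Q) by rewrite /d ge_min lexx orbT.
  by rewrite ler_pdivlMr//; lra.
exists d => //; exists r; first by rewrite r0.
move=> p q x pK qp xK px cpx; split.
  have -> : peval q x = peval q x - peval p x by rewrite px subr0.
  rewrite /peval -sumrB.
  have -> : \sum_(j < 7) (q j * x ^+ j - p j * x ^+ j) =
    \sum_(j < 7) ((q j - p j) * x ^+ j) by apply: eq_bigr => j _; rewrite mulrBl.
  apply: le_trans (@normc_sum _ (d * Q) _) _.
    move=> j; rewrite Normc.normcM normcX ler_pM ?normc_ge0 ?exprn_ge0 ?normc_ge0//.
    apply: (@le_trans _ _ (M ^+ j)).
      by apply: lerXn2r; rewrite ?nnegrE ?normc_ge0//; rewrite /M; lra.
    by rewrite ler_weXn2l// -ltnS ltn_ord.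
  apply: (@le_trans _ _ (c * r / 2)); first lra.
  by rewrite ler_wpM2r// ler_wpM2r// ltW.
move=> a b ar br.
have ballM y : normc (y - x) <= r -> normc y <= M.
  move=> yr; rewrite -(subrK x y); apply: le_trans (ler_normcD _ _) _.
  rewrite /M; lra.
have aM := ballM _ ar; have bM := ballM _ br.
have xM : normc x <= M by rewrite /M; lra.
have -> : peval q a - peval q b - pderiv p x * (a - b) = \sum_(j < 7)
   ((q j - p j) * (a ^+ j - b ^+ j) +
    p j * (a ^+ j - b ^+ j - j%:R * x ^+ j.-1 * (a - b))).
  rewrite /peval /pderiv mulr_suml -!sumrB; apply: eq_bigr => j _; ring.
set n := normc (a - b); have n0 : 0 <= n by rewrite normc_ge0.
apply: le_trans (@normc_sum _ ((6 * Q * d + (6 * 6) * K * Q * r) * n) _) _; last first.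
  have h : 7 * ((6 * Q * d + (6 * 6) * K * Q * r)) <= normc (pderiv p x) / 2 by lra.
  by have := ler_wpM2r n0 h; lra.
move=> j.
have j6 : (j <= 6)%N by rewrite -ltnS ltn_ord.
have j6R : j%:R <= 6 :> R by rewrite ler_nat.
have j0R : 0 <= j%:R :> R by [].
have MQ : M ^+ j <= Q by rewrite ler_weXn2l.
have Mj0 : 0 <= M ^+ j by rewrite exprn_ge0//; lra.
apply: le_trans (ler_normcD _ _) _; rewrite [leRHS]mulrDl; apply: lerD.
  rewrite Normc.normcM.
  have h := normc_exp_lipschitz j M1 aM bM.
  have h' : normc (a ^+ j - b ^+ j) <= 6 * Q * n.
    apply: le_trans h _; rewrite ler_wpM2r// ler_pM//.
  apply: (@le_trans _ _ (d * (6 * Q * n))); last first.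
    by rewrite le_eqVlt; apply/orP; left; apply/eqP; ring.
  by rewrite ler_pM ?normc_ge0.
rewrite Normc.normcM.
have h := normc_exp_taylor j M1 aM bM xM ar br.
have h' : normc (a ^+ j - b ^+ j - j%:R * x ^+ j.-1 * (a - b)) <= (6 * 6) * Q * r * n.
  apply: le_trans h _; rewrite ler_wpM2r// ler_wpM2r ?(ltW r0)// ler_pM ?sqr_ge0//.
  by rewrite expr2; apply: ler_pM.
apply: (@le_trans _ _ (K * ((6 * 6) * Q * r * n))); last first.
  by rewrite le_eqVlt; apply/orP; left; apply/eqP; ring.
by rewrite ler_pM ?normc_ge0.
Qed.

End polynomial_perturbation.

(** * The rescaled dispersion polynomial *)

Section dispersion_polynomial.
Context {R : realType}.
Local Notation T := (measurableTypeR R * measurableTypeR R)%type.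

(** [A] carries [nu + kappa], [E] the product [nu kappa], [B] the coupling [2 k s c / w] and [C] the
    criticality. [G] and [h] carry the terms in [k ^ 2], which are small in every scaling used. *)
Definition dpoly (A E B C G h : R) (x : R[i]) : R[i] :=
  A%:C * (x ^+ 2 - h%:C) ^+ 2 - 'i%C * E%:C * (x ^+ 2 - h%:C) ^+ 3 +
  B%:C * x + 'i%C * C%:C * x ^+ 2 - 'i%C * G%:C.

(** Derivative of the limit polynomial, where [G = h = 0]: this is where the Newton iteration
    freezes its derivative. *)
Definition dpoly_deriv (A E B C : R) (x : R[i]) : R[i] :=
  4 * A%:C * x ^+ 3 - 6 * 'i%C * E%:C * x ^+ 5 + B%:C + 2 * 'i%C * C%:C * x.

Definition dcoef (A E B C G h : R) (j : nat) : R[i] :=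
  match j with
  | 0%N => A%:C * h%:C ^+ 2 + 'i%C * E%:C * h%:C ^+ 3 - 'i%C * G%:C
  | 1%N => B%:C
  | 2%N => 'i%C * C%:C - 2 * A%:C * h%:C - 3 * 'i%C * E%:C * h%:C ^+ 2
  | 4%N => A%:C + 3 * 'i%C * E%:C * h%:C
  | 6%N => - ('i%C * E%:C)
  | _ => 0
  end.

Lemma dpolyE A E B C G h x : dpoly A E B C G h x = peval (dcoef A E B C G h) x.
Proof.
rewrite /peval !big_ord_recr big_ord0 /= /dpoly; ring.
Qed.

Lemma dpoly_derivE A E B C x :
  dpoly_deriv A E B C x = pderiv (dcoef A E B C 0 0) x.
Proof.
rewrite /pderiv !big_ord_recr big_ord0 /= /dpoly_deriv; ring.
Qed.

Let nM (x y : R[i]) (a b : R) : normc x <= a -> normc y <= b ->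
  normc (x * y) <= a * b.
Proof. by move=> xa yb; rewrite Normc.normcM ler_pM ?normc_ge0. Qed.

Let nr (a K : R) : `|a| <= K -> normc a%:C <= K.
Proof. by rewrite normc_real. Qed.

Let ni (x : R[i]) (a : R) : normc x <= a -> normc ('i%C * x) <= a.
Proof. by rewrite Normc.normcM normc_i mul1r. Qed.

Let nn n : normc (n%:R : R[i]) <= n%:R.
Proof.
by rewrite (_ : n%:R = (n%:R)%:C) ?normc_real ?normr_nat// rmorph_nat.
Qed.

Let nB (x y : R[i]) (a b : R) : normc x <= a -> normc y <= b ->
  normc (x - y) <= a + b.
Proof. by move=> xa yb; apply: le_trans (ler_normcB _ _) _; exact: lerD. Qed.

Let nD (x y : R[i]) (a b : R) : normc x <= a -> normc y <= b ->
  normc (x + y) <= a + b.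
Proof. by move=> xa yb; apply: le_trans (ler_normcD _ _) _; exact: lerD. Qed.

Let dcoef_main A E B C j : dcoef A E B C 0 0 j =
  match j with
  | 1%N => B%:C | 2%N => 'i%C * C%:C | 4%N => A%:C
  | 6%N => - ('i%C * E%:C) | _ => 0
  end.
Proof.
by case: j => [|[|[|[|[|[|[|j]]]]]]] //; rewrite /dcoef rmorph0; ring.
Qed.

Lemma dcoef_main_le (K A E B C : R) j : 0 <= K -> `|A| <= K -> `|E| <= K ->
  `|B| <= K -> `|C| <= K -> normc (dcoef A E B C 0 0 j) <= K.
Proof.
move=> K0 AK EK BK CK.
rewrite dcoef_main.
case: j => [|[|[|[|[|[|[|j]]]]]]]; rewrite ?normcN ?Normc.normc0//.
- exact: nr.
- by apply: ni; exact: nr.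
- exact: nr.
- by apply: ni; exact: nr.
Qed.

(** [d <= 1] allows [h ^ 2] and [h ^ 3] to be estimated by [d], and keeps the perturbed [A'] and
    [E'] below [K + 1]. *)
Lemma dcoef_diff_le (K d A E B C A' E' B' C' G h : R) j :
  0 <= K -> 0 <= d <= 1 -> `|A| <= K -> `|E| <= K ->
  `|A' - A| <= d -> `|E' - E| <= d -> `|B' - B| <= d -> `|C' - C| <= d ->
  `|G| <= d -> `|h| <= d ->
  normc (dcoef A' E' B' C' G h j - dcoef A E B C 0 0 j) <= 6 * (K + 1) * d.
Proof.
move=> K0 /andP[d0 d1] AK EK hA hE hB hC hG hh.
have A'K : `|A'| <= K + 1.
  by rewrite -(subrK A A') (le_trans (ler_normD _ _))// addrC lerD// (le_trans hA).
have E'K : `|E'| <= K + 1.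
  by rewrite -(subrK E E') (le_trans (ler_normD _ _))// addrC lerD// (le_trans hE).
have h2 : normc (h%:C ^+ 2) <= d.
  rewrite normcX normc_real expr2 -[leRHS]mulr1 ler_pM//.
  exact: le_trans hh d1.
have h3 : normc (h%:C ^+ 3) <= d.
  rewrite exprS -[leRHS]mulr1 mulrC; apply: nM => //.
  by apply: nr; exact: le_trans hh d1.
have Kd : 0 <= K * d by rewrite mulr_ge0.
have Kd6 : 0 <= 6 * (K + 1) * d by lra.
rewrite dcoef_main.
case: j => [|[|[|[|[|[|[|j]]]]]]]; rewrite /dcoef ?subrr ?subr0 ?Normc.normc0//.
- apply: (@le_trans _ _ ((K + 1) * d + (K + 1) * d + d)); last lra.
  apply: nB; last by apply: ni; exact: nr.
  apply: nD; first by apply: nM => //; exact: nr.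
  by rewrite -mulrA; apply: ni; apply: nM => //; exact: nr.
- by apply: (@le_trans _ _ d); [rewrite -rmorphB; exact: nr|lra].
- have -> : 'i%C * C'%:C - 2 * A'%:C * h%:C - 3 * 'i%C * E'%:C * h%:C ^+ 2 -
    'i%C * C%:C = 'i%C * (C' - C)%:C - 2 * (A'%:C * h%:C) -
    3 * ('i%C * (E'%:C * h%:C ^+ 2)) by rewrite rmorphB/=; ring.
  apply: (@le_trans _ _ (d + 2 * ((K + 1) * d) + 3 * ((K + 1) * d))); last lra.
  apply: nB; last by apply: nM => //; apply: ni; apply: nM => //; exact: nr.
  apply: nB; first by apply: ni; exact: nr.
  by apply: nM => //; apply: nM; exact: nr.
- have -> : A'%:C + 3 * 'i%C * E'%:C * h%:C - A%:C =
    (A' - A)%:C + 3 * ('i%C * (E'%:C * h%:C)) by rewrite rmorphB/=; ring.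
  apply: (@le_trans _ _ (d + 3 * ((K + 1) * d))); last lra.
  apply: nD; first exact: nr.
  by apply: nM => //; apply: ni; apply: nM; exact: nr.
- rewrite -opprD normcN -mulrBr -rmorphB; apply: (@le_trans _ _ d); last lra.
  by apply: ni; exact: nr.
Qed.

(** The lower bound [c] on the derivative is the quantitative form of a simple root. *)
Definition main_part (K c : R) (A E B C : R) (x : R[i]) :=
  [/\ [/\ `|A| <= K, `|E| <= K, `|B| <= K & `|C| <= K], normc x <= K,
      dpoly A E B C 0 0 x = 0 & c <= normc (dpoly_deriv A E B C x)].

Definition small_part (d A E B C A' E' B' C' G h : R) :=
  [/\ `|A' - A| <= d, `|E' - E| <= d, `|B' - B| <= d, `|C' - C| <= d &
      `|G| <= d /\ `|h| <= d].

(** The order of the quantifiers is the point: [d] is fixed before the sets and the coefficients, so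
    that one threshold serves all small [e]. *)
Lemma dispersion_root (K c rho : R) : 1 <= K -> 0 < c -> 0 < rho ->
  exists2 d : R, 0 < d & forall (D S : set T) (A E B C A' E' B' C' G h : T -> R)
    (L0 : T -> R[i]), D `<=` S ->
    [/\ measurable_fun D A, measurable_fun D E, measurable_fun D B &
        measurable_fun D C] ->
    [/\ measurable_fun D A', measurable_fun D E', measurable_fun D B',
        measurable_fun D C' & measurable_fun D G /\ measurable_fun D h] ->
    cmeasurable D L0 ->
    (forall z, S z -> main_part K c (A z) (E z) (B z) (C z) (L0 z)) ->
    (forall z, S z -> small_part d (A z) (E z) (B z) (C z)
                        (A' z) (E' z) (B' z) (C' z) (G z) (h z)) ->
    exists2 L : T -> R[i], cmeasurable D L & forall z, S z ->
      dpoly (A' z) (E' z) (B' z) (C' z) (G z) (h z) (L z) = 0 /\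
      normc (L z - L0 z) <= rho.
Proof.
move=> K1 c0 rho0.
have [d0 d00 [r /andP[r0 rr] H]] := peval_perturbation K1 c0 rho0.
have K0 : 0 <= K by lra.
have K6 : 0 < 6 * (K + 1) by lra.
pose d := Num.min 1 (d0 / (6 * (K + 1))).
have dd0 : 0 < d by rewrite /d lt_min ltr01 divr_gt0.
have d1 : d <= 1 by rewrite /d ge_min lexx.
have dd : 6 * (K + 1) * d <= d0.
  by rewrite mulrC -ler_pdivlMr// /d ge_min lexx orbT.
exists d => // D S A E B C A' E' B' C' G h L0 DS mm mm' mL0 hm hs.
have mcoef (a e' b c' g h' : T -> R) j : measurable_fun D a ->
    measurable_fun D e' -> measurable_fun D b -> measurable_fun D c' ->
    measurable_fun D g -> measurable_fun D h' ->
    cmeasurable D (fun z => dcoef (a z) (e' z) (b z) (c' z) (g z) (h' z) j).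
  move=> ma me mb mc mg mh.
  have mr := @cmeasurable_real R D; have mcst := @cmeasurable_cst R D.
  have miE : cmeasurable D (fun z => 'i%C * (e' z)%:C).
    exact: cmeasurableM (mcst _) (mr _ me).
  have m3iE : cmeasurable D (fun z => 3 * 'i%C * (e' z)%:C).
    exact: cmeasurableM (mcst _) (mr _ me).
  have mhX n : cmeasurable D (fun z => (h' z)%:C ^+ n) by exact: cmeasurableX (mr _ mh).
  have mhC := mr _ mh.
  case: j => [|[|[|[|[|[|[|j]]]]]]] /=; try exact: mcst.
  - apply: cmeasurableB; last exact: cmeasurableM (mcst _) (mr _ mg).
    apply: cmeasurableD; last exact: cmeasurableM miE (mhX _).
    exact: cmeasurableM (mr _ ma) (mhX _).
  - exact: mr.
  - apply: cmeasurableB; last exact: cmeasurableM m3iE (mhX _).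
    apply: cmeasurableB; first exact: cmeasurableM (mcst _) (mr _ mc).
    exact: cmeasurableM (cmeasurableM (mcst _) (mr _ ma)) mhC.
  - exact: cmeasurableD (mr _ ma) (cmeasurableM m3iE mhC).
  - exact: cmeasurableN miE.
have mpe (q : T -> nat -> R[i]) L : (forall j, cmeasurable D (q ^~ j)) ->
    cmeasurable D L -> cmeasurable D (fun z => peval (q z) (L z)).
  move=> mq mL; apply: cmeasurable_sum => j.
  by apply: cmeasurableM; [exact: mq|exact: cmeasurableX].
have mpd (q : T -> nat -> R[i]) L : (forall j, cmeasurable D (q ^~ j)) ->
    cmeasurable D L -> cmeasurable D (fun z => pderiv (q z) (L z)).
  move=> mq mL; apply: cmeasurable_sum => j.
  by apply: cmeasurableM; [exact: mq|apply: cmeasurableM; [exact: cmeasurable_cst|exact: cmeasurableX]].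
have [mA mE mB mC] := mm; have [mA' mE' mB' mC' [mG mh]] := mm'.
pose p z := dcoef (A z) (E z) (B z) (C z) 0 0.
pose q z := dcoef (A' z) (E' z) (B' z) (C' z) (G z) (h z).
have Hz z : S z ->
    normc (peval (q z) (L0 z)) <= normc (pderiv (p z) (L0 z)) * r / 2 /\
    forall a b, normc (a - L0 z) <= r -> normc (b - L0 z) <= r ->
      normc (peval (q z) a - peval (q z) b - pderiv (p z) (L0 z) * (a - b)) <=
      normc (pderiv (p z) (L0 z)) * normc (a - b) / 2.
  move=> Sz; have [[? ? ? ?] xK px cp] := hm z Sz.
  have [? ? ? ? [? ?]] := hs z Sz.
  apply: H => //.
  - by move=> j; exact: dcoef_main_le.
  - move=> j; apply: le_trans dd.
    by apply: dcoef_diff_le => //; rewrite (ltW dd0).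
  - by rewrite -dpolyE.
  - by rewrite -dpoly_derivE.
have [L [mL HL]] := @parametric_root R D S (fun z => peval (q z)) L0
  (fun z => pderiv (p z) (L0 z)) r DS
  (fun L mL => mpe q L (fun j => mcoef _ _ _ _ _ _ j mA' mE' mB' mC' mG mh) mL)
  mL0 (mpd p L0 (fun j => mcoef _ _ _ _ _ _ j mA mE mB mC
     (measurable_cst _) (measurable_cst _)) mL0)
  (fun z Sz => ltac:(by have [_ _ _ cp] := hm z Sz; rewrite -normc_gt0
     -dpoly_derivE (lt_le_trans c0)))
  (fun z Sz => (Hz z Sz).1) (fun z a b Sz => (Hz z Sz).2 a b).
exists L => // z Sz; have [e1 e2] := HL z Sz; split; last exact: le_trans e2 rr.
by rewrite dpolyE.
Qed.

End dispersion_polynomial.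

(** * Principal roots in the right half-plane *)

Section principal_roots.
Context {R : realType}.
Local Notation T := (measurableTypeR R * measurableTypeR R)%type.

(* A logarithm only on the right half-plane [0 < Re w]. *)
Definition clog (w : R[i]) : R[i] := ln (normc w) +i* atan (Im w / Re w).

Lemma cexp_clog (w : R[i]) : 0 < Re w -> cexp (clog w) = w.
Proof.
move=> w0.
have n0 : 0 < normc w.
  by rewrite normc_gt0; apply: contraTneq w0 => ->; rewrite ltxx.
have c0 : cos (atan (Im w / Re w)) = Re w / normc w.
  rewrite cos_atan normc_sqrt.
  have -> : 1 + (Im w / Re w) ^+ 2 = (Re w ^+ 2 + Im w ^+ 2) / (Re w) ^+ 2.
    by field; rewrite gt_eqF.
  rewrite sqrtrM ?addr_ge0 ?sqr_ge0// sqrtrV ?sqr_ge0// sqrtr_sqr gtr0_norm//.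
  by rewrite invfM invrK mulrC.
have s0 : sin (atan (Im w / Re w)) = Im w / normc w.
  have cn0 : cos (atan (Im w / Re w)) != 0.
    by rewrite c0 mulf_neq0 ?invr_eq0 ?gt_eqF.
  have := atanK (Im w / Re w); rewrite /tan => /(canRL (mulfVK cn0)) ->.
  by rewrite c0; field; rewrite !gt_eqF.
rewrite /cexp/= lnK ?posrE// c0 s0.
by apply: complex_eqP => /=; rewrite mulrCA divff ?mulr1 ?gt_eqF.
Qed.

Definition croot (n : nat) (w : R[i]) : R[i] := cexp ((n%:R^-1)%:C * clog w).

Lemma crootX n w : (0 < n)%N -> 0 < Re w -> croot n w ^+ n = w.
Proof.
move=> n0 w0; rewrite /croot -cexpMn -mulrnAl -rmorphMn/= -[_ *+ n]mulr_natr.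
by rewrite mulVf ?pnatr_eq0 -?lt0n// rmorph1 mul1r cexp_clog.
Qed.

Lemma Re_croot_gt0 n w : (0 < n)%N -> 0 < Re (croot n w).
Proof.
move=> n0; rewrite /croot /cexp /clog/= mul0r mul0r addr0 subr0.
rewrite mulr_gt0 ?expR_gt0//; apply: cos_gt0_pihalf.
have n1 : 0 < (n%:R : R)^-1 <= 1.
  by rewrite invr_gt0 ltr0n n0 invf_le1 ?ltr0n// ler1n.
have := atan_gtNpi2 (Im w / Re w); have := atan_ltpi2 (Im w / Re w).
set t := atan _; set p := pi / 2 => tp pt.
have p0 : 0 < p by rewrite /p divr_gt0// pi_gt0.
have /andP[i0 i1] := n1.
by apply/andP; split; nra.
Qed.

(** The argument of [w] lies between [- pi / 2] and [pi / 2] and the root divides it by [n], so both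
    stay on the same side of the real axis. *)
Lemma Im_croot_sign n w : (0 < n)%N -> 0 < Re w -> 0 <= Im w * Im (croot n w).
Proof.
move=> n0 w0; rewrite /croot /cexp /clog/= !mul0r addr0 subr0.
set e := expR _; have e0 : 0 <= e by rewrite expR_ge0.
rewrite mulrCA mulr_ge0//.
have n1 : 0 < (n%:R : R)^-1 <= 1.
  by rewrite invr_gt0 ltr0n n0 invf_le1 ?ltr0n// ler1n.
have /andP[i0 i1] := n1.
have := atan_gtNpi2 (Im w / Re w); have := atan_ltpi2 (Im w / Re w).
have [y0|y0] := leP 0 (Im w).
  have t0 : 0 <= atan (Im w / Re w).
    by rewrite -(atan0 R) le_atan// divr_ge0// ltW.
  move=> tp pt; rewrite mulr_ge0// sin_ge0_pi//.
  move: tp pt t0; set t := atan _ => tp pt t0; have := pi_gt0 R => pi0.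
  by apply/andP; split; nra.
have t0 : 0 <= atan (- (Im w / Re w)).
  by rewrite -(atan0 R) le_atan// -mulNr divr_ge0 ?oppr_ge0// ltW.
move=> tp pt; rewrite -mulrNN; apply: mulr_ge0; first by rewrite oppr_ge0 ltW.
rewrite -sinN -mulrN -atanN sin_ge0_pi//.
rewrite atanN in t0 *.
move: tp pt t0; set t := atan _ => tp pt t0; have := pi_gt0 R => pi0.
by apply/andP; split; nra.
Qed.

Lemma Im_croot_eq0 n w : Im w = 0 -> Im (croot n w) = 0.
Proof.
move=> w0; rewrite /croot /clog w0 mul0r atan0 /cexp/=.
by rewrite !mul0r mulr0 addr0 sin0 mulr0.
Qed.

Lemma cmeasurable_croot n (D : set T) (w : T -> R[i]) : cmeasurable D w ->
  cmeasurable D (fun z => croot n (w z)).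
Proof.
move=> mw; have [m1 m2] := mw; apply: cmeasurable_cexp; apply: cmeasurableM.
  exact: cmeasurable_cst.
split => /=.
  apply: (@measurableT_comp _ _ _ _ _ _ (@ln R)); first exact: measurable_ln.
  exact: measurable_normc.
apply: (@measurableT_comp _ _ _ _ _ _ (@atan R)).
  by apply: continuous_measurable_fun => x; exact: continuous_atan.
by apply: measurable_funM => //; exact: measurable_funV.
Qed.

End principal_roots.

(** * Location and separation of the roots of the cubic *)

Section cubic.
Context {R : realType}.
Local Notation T := (measurableTypeR R * measurableTypeR R)%type.
Implicit Types z r : R.

(* Cardano's formula for [x ^ 3 + i z x + r]: with [x = - (a + b)],
   [3 a b = - i z] and [a ^ 3 + b ^ 3 = r]. *)
Definition cardano_sqrt z r : R[i] :=
  croot 2 ((r ^+ 2 / 4)%:C - 'i%C * (z ^+ 3 / 27)%:C).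
Definition cardano_a z r : R[i] := croot 3 ((r / 2)%:C + cardano_sqrt z r).
Definition cardano_b z r : R[i] := - ('i%C * (z / 3)%:C) / cardano_a z r.
Definition cardano_q z r : R[i] :=
  'i%C * (Num.sqrt 3 / 2)%:C * (cardano_a z r - cardano_b z r).
(** The roots other than [- (a + b)], namely [- (j a + j ^ 2 b)] for the two primitive cube roots of
    unity [j]. They turn out to be the decaying ones. *)
Definition cubic_root1 z r : R[i] :=
  (cardano_a z r + cardano_b z r) / 2 - cardano_q z r.
Definition cubic_root2 z r : R[i] :=
  (cardano_a z r + cardano_b z r) / 2 + cardano_q z r.

Let qE z r : cardano_q z r ^+ 2 = - (3 / 4 * (cardano_a z r - cardano_b z r) ^+ 2).
Proof.
rewrite /cardano_q !exprMn sqr_i -rmorphXn/= exprMn sqr_sqrtr//.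
rewrite rmorphM/= rmorph_nat exprVn fmorphV/= rmorphXn/= rmorph_nat.
by field.
Qed.

Section fixed.
Variables z r : R.
Hypothesis r0 : 0 < r.
Local Notation a := (cardano_a z r).
Local Notation b := (cardano_b z r).
Local Notation t := (cardano_sqrt z r).
Local Notation q := (cardano_q z r).

(** The imaginary coefficient contributes only to the imaginary part, as
    [(i z / 3) ^ 3 = - i z ^ 3 / 27]; hence principal roots are available for every real [z]. *)
Let radicand_gt0 : 0 < Re ((r ^+ 2 / 4)%:C - 'i%C * (z ^+ 3 / 27)%:C).
Proof.
rewrite raddfB/= mul0r mulr0 subrr subr0 divr_gt0// exprn_gt0//.
Qed.

Let t2 : t ^+ 2 = (r ^+ 2 / 4)%:C - 'i%C * (z ^+ 3 / 27)%:C.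
Proof. by rewrite crootX. Qed.

Let Re_t : 0 < Re t. Proof. exact: Re_croot_gt0. Qed.

Let A_gt0 : 0 < Re ((r / 2)%:C + t).
Proof. by rewrite raddfD/= addr_gt0// divr_gt0. Qed.

Let a3 : a ^+ 3 = (r / 2)%:C + t. Proof. by rewrite crootX. Qed.

Let Re_a : 0 < Re a. Proof. exact: Re_croot_gt0. Qed.

Let a0 : a != 0.
Proof. by apply: contraTneq Re_a => ->; rewrite ltxx. Qed.

Let ab : 3 * a * b = - ('i%C * z%:C).
Proof.
rewrite /cardano_b rmorphM/= fmorphV/= rmorph_nat; field.
by rewrite a0.
Qed.

Let b3 : b ^+ 3 = (r / 2)%:C - t.
Proof.
have e : (r / 2)%:C ^+ 2 - t ^+ 2 = a ^+ 3 * b ^+ 3.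
  rewrite t2 -exprMn.
  have -> : a * b = - ('i%C * (z / 3)%:C).
    by rewrite /cardano_b mulrC mulfVK.
  rewrite exprNn exprMn -rmorphXn/= -!rmorphXn/=.
  have -> : ('i%C : R[i]) ^+ 3 = - 'i%C by rewrite exprS sqr_i mulrN1.
  rewrite !exprMn !exprVn.
  have -> : (r ^+ 2 / 2 ^+ 2)%:C = (r ^+ 2 / 4)%:C :> R[i].
    by congr (_%:C); field.
  have -> : (z ^+ 3 / 3 ^+ 3)%:C = (z ^+ 3 / 27)%:C :> R[i].
    by congr (_%:C); field.
  ring.
apply: (mulfI (expf_neq0 3 a0)); rewrite -e a3; ring.
Qed.

Let a3b3 : a ^+ 3 + b ^+ 3 = r%:C.
Proof.
rewrite a3 b3 addrACA subrr addr0 -rmorphD/=; congr (_%:C); lra.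
Qed.

(** At [(a + b) / 2 - s] the cubic has the factor [s ^ 2 + 3 / 4 (a - b) ^ 2], so both square roots
    [s] of [q ^ 2] are treated at once. *)
Let cubic_at (s : R[i]) : s ^+ 2 = q ^+ 2 ->
  ((a + b) / 2 - s) ^+ 3 + 'i%C * z%:C * ((a + b) / 2 - s) + r%:C = 0.
Proof.
move=> s2; have -> : 'i%C * z%:C = - (3 * a * b) by rewrite ab opprK.
rewrite -a3b3.
have -> : ((a + b) / 2 - s) ^+ 3 + - (3 * a * b) * ((a + b) / 2 - s) +
  (a ^+ 3 + b ^+ 3) =
  (s ^+ 2 + 3 / 4 * (a - b) ^+ 2) * (3 * ((a + b) / 2) - s) by field.
by rewrite s2 qE addNr mul0r.
Qed.

Lemma cubic_root1P : cubic_root1 z r ^+ 3 + 'i%C * z%:C * cubic_root1 z r + r%:C = 0.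
Proof. exact: cubic_at. Qed.

Lemma cubic_root2P : cubic_root2 z r ^+ 3 + 'i%C * z%:C * cubic_root2 z r + r%:C = 0.
Proof.
have : (- q) ^+ 2 = q ^+ 2 by rewrite sqrrN.
by move=> /cubic_at; rewrite opprK.
Qed.

Let cubic_neg : (- (a + b)) ^+ 3 + 'i%C * z%:C * (- (a + b)) + r%:C = 0.
Proof.
have -> : 'i%C * z%:C = - (3 * a * b) by rewrite ab opprK.
rewrite -a3b3; ring.
Qed.

(** [Re a > 0] by the choice of root. As [b = - i z / (3 a)], the sign of [Re b] is that of
    [- z Im a]; and principal roots pass the sign of the imaginary part on from the radicand, where
    it is that of [- z ^ 3], to [t] and then to [a]. *)
Let Re_ab : 0 < Re (a + b).
Proof.
rewrite Re_addc ltr_pwDl//.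
have t_sign : z * Im t <= 0.
  have := Im_croot_sign (isT : (0 < 2)%N) radicand_gt0.
  rewrite -/(cardano_sqrt z r) Im_addc Im_oppc Im_mulc/= mul0r mul1r !add0r.
  have [z0|z0] := leP 0 z.
    have z3 : 0 <= z ^+ 3 by rewrite exprn_ge0.
    have [->|zn0] := eqVneq z 0; first by rewrite mul0r.
    have z3' : 0 < z ^+ 3 by rewrite exprn_gt0// lt0r zn0.
    by nra.
  have z3 : z ^+ 3 < 0 by rewrite exprS; have := exprn_even_gt0 z (isT : ~~ odd 2); rewrite (lt_eqF z0) /=; nra.
  by nra.
have a_sign : z * Im a <= 0.
  have := Im_croot_sign (isT : (0 < 3)%N) A_gt0.
  rewrite -/(cardano_a z r) Im_addc (_ : Im (r / 2)%:C = 0)// add0r.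
  have [it0|it0|it0] := ltgtP (Im t) 0; last first.
  - have h0 : Im ((r / 2)%:C + t) = 0 by rewrite Im_addc it0 addr0.
    have ia : Im a = 0 by exact: Im_croot_eq0 h0.
    by rewrite ia !mulr0.
  - have z0 : z <= 0 by rewrite leNgt; apply/negP => z0; nra.
    by nra.
  - have z0 : 0 <= z by rewrite leNgt; apply/negP => z0; nra.
    by nra.
have iu (u : R) (w : R[i]) : Re (- ('i%C * u%:C) * w) = u * Im w.
  by case: w => p1 p2 /=; ring.
rewrite /cardano_b iu Im_invc mulrN oppr_ge0.
rewrite mulrA pmulr_lle0; first by nra.
rewrite invr_gt0 ltr_pwDl ?sqr_ge0// exprn_gt0//.
Qed.

Let root_neq0 (x : R[i]) : x ^+ 3 + 'i%C * z%:C * x + r%:C = 0 -> x != 0.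
Proof.
move=> e; apply/eqP => x0; move: e.
rewrite x0 expr0n/= mulr0 !add0r => /(congr1 (@Re R))/= e.
by move: r0; rewrite e ltxx.
Qed.

(** This is the real part of [x ^ 2 = - i z - r / x], from which [z] disappears. *)
Let root_re (x : R[i]) : x ^+ 3 + 'i%C * z%:C * x + r%:C = 0 ->
  (Im x ^+ 2 - Re x ^+ 2) * normc x ^+ 2 = r * Re x.
Proof.
move=> e; have x0 := root_neq0 e.
have n0 : normc x ^+ 2 != 0 by rewrite expf_neq0// normc_eq0.
have e' : x ^+ 2 = - ('i%C * z%:C) - r%:C / x.
  apply: (mulfI x0); apply/eqP; rewrite -subr_eq0; apply/eqP.
  rewrite -[RHS]e; field; exact: x0.
have h : Re x * Re x - Im x * Im x = - (r * (Re x / normc x ^+ 2)).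
  rewrite -Re_mulc -expr2 e' Re_addc !Re_oppc !Re_mulc/= Re_invc -sqr_normc.
  by rewrite !mul0r mulr0 !subr0 oppr0 add0r.
have -> : Im x ^+ 2 - Re x ^+ 2 = r * (Re x / normc x ^+ 2) by rewrite !expr2; lra.
by rewrite mulrA mulfVK.
Qed.

(** In [root_re] the sign of [Re x] decides which of [|Re x|] and [|Im x|] is larger; a root on the
    imaginary axis would have to be 0. *)
Let root_sector (x : R[i]) : x ^+ 3 + 'i%C * z%:C * x + r%:C = 0 ->
  (0 < Re x -> `|Re x| < `|Im x|) /\ (Re x < 0 -> `|Im x| < `|Re x|) /\ Re x != 0.
Proof.
move=> e; have x0 := root_neq0 e; have h := root_re e.
have n0 : 0 < normc x ^+ 2 by rewrite exprn_gt0// normc_gt0.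
have sq (u v : R) : (`|u| < `|v|) = (u ^+ 2 < v ^+ 2).
  by rewrite -[u ^+ 2]real_normK ?num_real// -[v ^+ 2]real_normK ?num_real//
     ltr_sqr ?nnegrE.
rewrite !sq; split; [|split].
- move=> xp; rewrite -subr_gt0 -(pmulr_lgt0 _ n0) h mulr_gt0//.
- move=> xn; rewrite -subr_lt0 -(pmulr_llt0 _ n0) h pmulr_rlt0//.
- apply/eqP => xe; move: h; rewrite xe mulr0 expr0n/= subr0 => /eqP.
  rewrite mulf_eq0 (gt_eqF n0) orbF sqrf_eq0 => /eqP ye.
  by move/eqP: x0; apply; apply: complex_eqP.
Qed.

(** The three roots sum to 0. If [Re x < 0], then [x] and [- (a + b)] both lie in the left
    half-plane with [|Im| < |Re|]. The third root [y] is minus their sum, so [Re y > 0] and still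
    [|Im y| < |Re y|], which [root_sector] excludes. *)
Let Re_root (s : R[i]) : s ^+ 2 = q ^+ 2 -> 0 < Re ((a + b) / 2 - s).
Proof.
move=> s2; set x := _ - s.
have ex : x ^+ 3 + 'i%C * z%:C * x + r%:C = 0 by exact: cubic_at.
have ey : ((a + b) / 2 + s) ^+ 3 + 'i%C * z%:C * ((a + b) / 2 + s) + r%:C = 0.
  by have := @cubic_at (- s); rewrite opprK sqrrN; apply.
set y := _ + s in ey; have exy : y = (a + b) - x by rewrite /x /y; field.
have [_ [xneg xne]] := root_sector ex.
rewrite ltNge le_eqVlt negb_or xne/=; apply/negP => xn.
have {}xneg := xneg xn.
have [ypos [yneg yne]] := root_sector ey.
have [_ [nneg _]] := root_sector cubic_neg.
have {}nneg : `|Im (a + b)| < `|Re (a + b)|.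
  rewrite Re_oppc Im_oppc !normrN oppr_lt0 in nneg.
  exact: nneg Re_ab.
have yp : 0 < Re y.
  by rewrite exy Re_addc Re_oppc subr_gt0 (lt_trans xn Re_ab).
have := ypos yp.
have -> : Re y = Re (a + b) - Re x by rewrite exy Re_addc Re_oppc.
have -> : Im y = Im (a + b) - Im x by rewrite exy Im_addc Im_oppc.
have := ler_normB (Im (a + b)) (Im x).
have -> : `|Re (a + b) - Re x| = `|Re (a + b)| + `|Re x|.
  by rewrite (gtr0_norm Re_ab) (ltr0_norm xn) gtr0_norm// subr_gt0 (lt_trans xn Re_ab).
move=> h1 h2; have h3 := ltrD nneg xneg.
by have := lt_trans (lt_le_trans h2 h1) h3; rewrite ltxx.
Qed.

Lemma Re_cubic_root1_gt0 : 0 < Re (cubic_root1 z r).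
Proof. exact: Re_root. Qed.

Lemma Re_cubic_root2_gt0 : 0 < Re (cubic_root2 z r).
Proof. by have := @Re_root (- q); rewrite opprK sqrrN; apply. Qed.

Variables (Z r1 r2 : R).
Hypotheses (zZ : `|z| <= Z) (r1_gt0 : 0 < r1) (r1r : r1 <= r) (rr2 : r <= r2).
Let K := 1 + Z + r2.

Let Z0 : 0 <= Z. Proof. exact: le_trans zZ. Qed.

Let r2_gt0 : 0 < r2. Proof. exact: lt_le_trans r0 rr2. Qed.

Let K1 : 1 < K.
Proof. by rewrite /K -addrA ltrDl (lt_le_trans r2_gt0)// lerDr Z0. Qed.

Let K0 : 0 < K. Proof. exact: lt_trans K1. Qed.

Let root_le (x : R[i]) : x ^+ 3 + 'i%C * z%:C * x + r%:C = 0 -> normc x <= K.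
Proof.
move=> e; rewrite leNgt; apply/negP => Kx.
have e' : x ^+ 3 = - ('i%C * z%:C * x + r%:C) by apply/eqP; rewrite -subr_eq0 opprK addrA; apply/eqP.
have : normc x ^+ 3 <= Z * normc x + r2.
  rewrite -normcX e' normcN; apply: le_trans (ler_normcD _ _) _.
  rewrite !Normc.normcM normc_i mul1r !normc_real lerD//.
    by rewrite ler_wpM2r// normc_ge0.
  by rewrite gtr0_norm.
have n1 : 1 < normc x := lt_trans K1 Kx.
have k1 : K * normc x <= normc x ^+ 3.
  by rewrite exprS expr2 mulrC ler_pM2l ?(lt_trans _ n1)// (le_trans (ltW Kx))// ler_peMr ?(ltW n1)// ltW// (lt_trans _ n1).
rewrite /K in k1; have := Z0; have := r2_gt0; nra.
Qed.

Let mu := r1 / (K ^+ 2 + Z).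

Let root_ge (x : R[i]) : x ^+ 3 + 'i%C * z%:C * x + r%:C = 0 -> mu <= normc x.
Proof.
move=> e; have xK := root_le e.
rewrite ler_pdivrMr; last by rewrite ltr_pwDl// exprn_gt0.
have : r <= normc x * (normc x ^+ 2 + Z).
  have e' : r%:C = - (x * (x ^+ 2 + 'i%C * z%:C)).
    apply/eqP; rewrite -subr_eq0 opprK; apply/eqP; rewrite -[RHS]e; ring.
  rewrite -(gtr0_norm r0) -normc_real e' normcN Normc.normcM.
  rewrite ler_wpM2l ?normc_ge0//; apply: le_trans (ler_normcD _ _) _.
  by rewrite normcX Normc.normcM normc_i mul1r normc_real lerD2l.
move=> h; apply: le_trans r1r _; apply: le_trans h _.
rewrite ler_wpM2l ?normc_ge0// lerD2r.
by apply: lerXn2r; rewrite ?nnegrE ?normc_ge0// ltW.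
Qed.

(** If [Re x] were below both thresholds, [root_re] would put [Im x ^ 2 - Re x ^ 2] below
    [mu ^ 2 / 2], and [2 Re x ^ 2] would be below [mu ^ 2 / 2] as well; together they contradict
    [|x| >= mu]. *)
Let Re_root_ge (x : R[i]) : x ^+ 3 + 'i%C * z%:C * x + r%:C = 0 -> 0 < Re x ->
  Num.min (mu / 2) (mu ^+ 4 / (2 * r2)) <= Re x.
Proof.
move=> e x0; rewrite leNgt; apply/negP; rewrite lt_min => /andP[h1 h2].
have xm := root_ge e; have h := root_re e.
have mu0 : 0 < mu by rewrite divr_gt0// ltr_pwDl// exprn_gt0.
have r20 := r2_gt0.
rewrite ltr_pdivlMr ?mulr_gt0// in h2.
have mx : mu ^+ 2 <= normc x ^+ 2.
  by apply: lerXn2r; rewrite ?nnegrE ?normc_ge0// ltW.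
have nx : normc x ^+ 2 = 2 * Re x ^+ 2 + (Im x ^+ 2 - Re x ^+ 2).
  by rewrite sqr_normc; ring.
have m2 : 0 < mu ^+ 2 by rewrite exprn_gt0.
have d : (Im x ^+ 2 - Re x ^+ 2) * mu ^+ 2 <= r * Re x.
  rewrite -h ler_wpM2l// -(pmulr_lge0 _ (lt_le_trans m2 mx)) h.
  by rewrite mulr_ge0 ?ltW.
have x2 : 2 * Re x ^+ 2 < mu ^+ 2 / 2.
  have : Re x ^+ 2 < (mu / 2) ^+ 2 by rewrite ltr_sqr ?nnegrE ?ltW// divr_gt0.
  by rewrite expr_div_n -natrX /=; lra.
have rx : r * Re x <= r2 * Re x by rewrite ler_wpM2r// ltW.
have m4 : mu ^+ 4 = mu ^+ 2 * mu ^+ 2 by rewrite -exprD.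
have d1 : (Im x ^+ 2 - Re x ^+ 2) * mu ^+ 2 < mu ^+ 2 / 2 * mu ^+ 2.
  rewrite m4 in h2; lra.
rewrite ltr_pM2r// in d1.
have : normc x ^+ 2 < mu ^+ 2 by rewrite nx; lra.
by rewrite ltNge mx.
Qed.

(** The product of the differences of the three roots is [- 6 i sqrt 3 t], a square root of the
    discriminant, and [|t| >= r / 2] because [t ^ 2] has real part [r ^ 2 / 4]. *)
Let separation : r <= normc (cubic_root1 z r - cubic_root2 z r) *
  normc (cubic_root1 z r + (a + b)) * normc (cubic_root2 z r + (a + b)).
Proof.
have qi : q = 'i%C * (Num.sqrt 3 / 2)%:C * (a - b) by [].
have e : (cubic_root1 z r - cubic_root2 z r) *
  (cubic_root1 z r + (a + b)) * (cubic_root2 z r + (a + b)) =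
  - (2 * 6 * ('i%C * (Num.sqrt 3 / 2)%:C)) * t.
  have tE : t = (a ^+ 3 - b ^+ 3) / 2 by rewrite a3 b3; field.
  have e1 : (cubic_root1 z r + (a + b)) * (cubic_root2 z r + (a + b)) =
     3 * (a ^+ 2 + a * b + b ^+ 2).
    rewrite /cubic_root1 /cubic_root2.
    have -> : ((a + b) / 2 - q + (a + b)) * ((a + b) / 2 + q + (a + b)) =
      9 / 4 * (a + b) ^+ 2 - q ^+ 2 by field.
    by rewrite qE; field.
  rewrite -mulrA e1 tE /cubic_root1 /cubic_root2.
  have -> : (a + b) / 2 - q - ((a + b) / 2 + q) = - (2 * q) by ring.
  by rewrite qi; field.
rewrite -!Normc.normcM e mulNr normcN !Normc.normcM normc_i mul1r normc_real.
have n6 : normc (6 : R[i]) = 6.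
  by rewrite (_ : 6 = (6 : R)%:C) ?normc_real ?normr_nat// rmorph_nat.
have n2 : normc (2 : R[i]) = 2.
  by rewrite (_ : 2 = (2 : R)%:C) ?normc_real ?normr_nat// rmorph_nat.
have s3 : 1 <= Num.sqrt 3 :> R by rewrite -[leLHS]sqrtr1 ler_sqrt// ler1n.
have tr : r / 2 <= normc t.
  have : (r / 2) ^+ 2 <= normc t ^+ 2.
    rewrite -normcX t2.
    apply: le_trans (le_trans (ler_norm _) (ler_Re_normc _)).
    by rewrite Re_addc Re_oppc Re_mulc/= mul0r mulr0 subrr subr0; lra.
  by rewrite ler_sqr ?nnegrE ?normc_ge0// divr_ge0// ltW.
rewrite n6 n2 ger0_norm ?divr_ge0 ?sqrtr_ge0//.
have t0 : 0 <= normc t := normc_ge0 _.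
nra.
Qed.

Lemma cubic_roots_bounds :
  let m := Num.min (mu / 2) (mu ^+ 4 / (2 * r2)) in
  [/\ m <= Re (cubic_root1 z r), m <= Re (cubic_root2 z r),
      normc (cubic_root1 z r) <= K, normc (cubic_root2 z r) <= K &
  [/\ r1 / (4 * K ^+ 2) <= normc (cubic_root1 z r - cubic_root2 z r),
      r1 / (2 * K) <= normc (3 * cubic_root1 z r ^+ 2 + 'i%C * z%:C) &
      r1 / (2 * K) <= normc (3 * cubic_root2 z r ^+ 2 + 'i%C * z%:C)]].
Proof.
move=> m.
have k1 := root_le cubic_root1P; have k2 := root_le cubic_root2P.
have k0 : normc (a + b) <= K by have := root_le cubic_neg; rewrite normcN.
have d1 : normc (cubic_root1 z r + (a + b)) <= 2 * K.
  by apply: le_trans (ler_normcD _ _) _; lra.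
have d2 : normc (cubic_root2 z r + (a + b)) <= 2 * K.
  by apply: le_trans (ler_normcD _ _) _; lra.
have d0 : normc (cubic_root1 z r - cubic_root2 z r) <= 2 * K.
  by apply: le_trans (ler_normcB _ _) _; lra.
have ez : 'i%C * z%:C = - (3 * a * b) by rewrite ab opprK.
(* At a root the derivative of the cubic is the product of the differences with the other two roots,
   so [separation] bounds it from below. *)
have e1 : 3 * cubic_root1 z r ^+ 2 + 'i%C * z%:C =
  (cubic_root1 z r - cubic_root2 z r) * (cubic_root1 z r + (a + b)).
  rewrite ez; apply/eqP; rewrite -subr_eq0; apply/eqP.
  have -> : 3 * cubic_root1 z r ^+ 2 - 3 * a * b -
    (cubic_root1 z r - cubic_root2 z r) * (cubic_root1 z r + (a + b)) =
    q ^+ 2 + 3 / 4 * (a - b) ^+ 2.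
    by rewrite /cubic_root1 /cubic_root2; field.
  by rewrite qE addNr.
have e2 : 3 * cubic_root2 z r ^+ 2 + 'i%C * z%:C =
  - ((cubic_root1 z r - cubic_root2 z r) * (cubic_root2 z r + (a + b))).
  rewrite ez; apply/eqP; rewrite -subr_eq0; apply/eqP.
  have -> : 3 * cubic_root2 z r ^+ 2 - 3 * a * b -
    - ((cubic_root1 z r - cubic_root2 z r) * (cubic_root2 z r + (a + b))) =
    q ^+ 2 + 3 / 4 * (a - b) ^+ 2.
    by rewrite /cubic_root1 /cubic_root2; field.
  by rewrite qE addNr.
have n0 := normc_ge0 (cubic_root1 z r - cubic_root2 z r).
have n1 := normc_ge0 (cubic_root1 z r + (a + b)).
have n2 := normc_ge0 (cubic_root2 z r + (a + b)).
have sep := separation.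
split; [..|split].
- exact: Re_root_ge cubic_root1P Re_cubic_root1_gt0.
- exact: Re_root_ge cubic_root2P Re_cubic_root2_gt0.
- exact: k1.
- exact: k2.
- rewrite ler_pdivrMr ?mulr_gt0 ?exprn_gt0//.
  apply: (le_trans r1r); apply: (le_trans sep).
  rewrite -mulrA ler_wpM2l//; have -> : 4 * K ^+ 2 = (2 * K) * (2 * K) by ring.
  exact: ler_pM.
- rewrite e1 Normc.normcM ler_pdivrMr ?mulr_gt0//.
  apply: (le_trans r1r); apply: (le_trans sep).
  by rewrite ler_wpM2l// mulr_ge0.
- rewrite e2 normcN Normc.normcM ler_pdivrMr ?mulr_gt0//.
  apply: (le_trans r1r); apply: (le_trans sep).
  by rewrite mulrAC ler_wpM2l// mulr_ge0.
Qed.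

End fixed.

Lemma cmeasurable_cubic_roots (D : set T) (z r : T -> R) :
  measurable_fun D z -> measurable_fun D r ->
  cmeasurable D (fun x => cubic_root1 (z x) (r x)) /\
  cmeasurable D (fun x => cubic_root2 (z x) (r x)).
Proof.
move=> mz mr.
have mreal := @cmeasurable_real R D; have mcst := @cmeasurable_cst R D.
have ms : cmeasurable D (fun x => cardano_sqrt (z x) (r x)).
  apply: cmeasurable_croot; apply: cmeasurableB.
    by apply: mreal; apply: measurable_funM => //; exact: measurable_funX.
  apply: cmeasurableM; first exact: mcst.
  by apply: mreal; apply: measurable_funM => //; exact: measurable_funX.
have ma : cmeasurable D (fun x => cardano_a (z x) (r x)).
  apply: cmeasurable_croot; apply: cmeasurableD => //.
  by apply: mreal; exact: measurable_funM.
have mb : cmeasurable D (fun x => cardano_b (z x) (r x)).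
  apply: cmeasurableM; last exact: cmeasurableV.
  apply: cmeasurableN; apply: cmeasurableM; first exact: mcst.
  by apply: mreal; exact: measurable_funM.
have mq : cmeasurable D (fun x => cardano_q (z x) (r x)).
  by apply: cmeasurableM; [exact: mcst|exact: cmeasurableB].
have mab : cmeasurable D (fun x => (cardano_a (z x) (r x) + cardano_b (z x) (r x)) / 2).
  by apply: cmeasurableM; [exact: cmeasurableD|exact: mcst].
by split; [exact: cmeasurableB|exact: cmeasurableD].
Qed.

End cubic.

(** * The incident packet *)

Section incident_support.
Context {R : realType} (S : setting R).
Local Notation T := (measurableTypeR R * measurableTypeR R)%type.
Local Notation s := (sin (slope S)).
Local Notation c := (cos (slope S)).
Hypothesis hgamma : 0 < slope S < pi / 2.
Hypothesis hchi : C0_infty (chi S).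
Hypothesis hwave : admissible_wavenumber S.
Hypothesis hcrit : near_critical S.

Lemma sin_slope_gt0 : 0 < s.
Proof. exact: sin_gt0_pihalf. Qed.

Lemma cos_slope_gt0 : 0 < c.
Proof.
apply: cos_gt0_pihalf; have /andP[g0 ->] := hgamma.
by rewrite (lt_trans _ g0)// oppr_lt0 divr_gt0// pi_gt0.
Qed.

Lemma chi_continuous : continuous (chi S).
Proof. by apply: derivable_continuous => x; exact: (hchi.1 0%N x). Qed.

Lemma chi_support : exists2 K : R, 1 <= K & forall x, chi S x != 0 -> `|x| <= K.
Proof.
have [_ /compact_bounded[M [_ hM]]] := hchi.
exists (`|M| + 1); first by rewrite lerDr.
move=> x cx; apply: hM; first by rewrite ltr_pwDr// ler_norm.
exact: subset_closure.
Qed.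

Lemma chi_bounded : exists2 M : R, 1 <= M & forall x, `|chi S x| <= M.
Proof.
have [_ cK] := hchi.
have /compact_bounded[M [_ hM]] : compact (chi S @` closure [set x | chi S x != 0]).
  apply: continuous_compact => //.
  by apply: continuous_subspaceT; exact: chi_continuous.
exists (`|M| + 1); first by rewrite lerDr.
move=> x; have [->|cx] := eqVneq (chi S x) 0.
  by rewrite normr0 addr_ge0.
apply: hM; first by rewrite ltr_pwDr// ler_norm.
by exists x => //; exact: subset_closure.
Qed.

Lemma measurable_Ahat e : measurable_fun setT (fun z : T => Ahat S e z.1 z.2).
Proof.
have mchi : measurable_fun setT (chi S).
  by apply: continuous_measurable_fun; exact: chi_continuous.
have m1 (a : R) : measurable_fun setT (fun z : T => chi S (e ^- 2 * (z.1 + a))).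
  apply: (measurableT_comp mchi); apply: measurable_funM => //.
  by apply: measurable_funD => //; exact: measurable_fst.
have m2 (a : R) : measurable_fun setT (fun z : T => chi S (e ^- 2 * (z.2 + a))).
  apply: (measurableT_comp mchi); apply: measurable_funM => //.
  by apply: measurable_funD => //; exact: measurable_snd.
apply: measurable_funM => //.
by apply: measurable_funD; apply: measurable_funM.
Qed.

(** Integrals only see this set, while pointwise estimates are asked on its closure [supp_Ahat]. *)
Definition nzAhat e : set T := [set z | Ahat S e z.1 z.2 != 0].

Lemma measurable_nzAhat e : measurable (nzAhat e).
Proof.
have := measurable_Ahat e measurableT (measurableC (measurable_set1 (0 : R))).
rewrite setTI (_ : _ @^-1` _ = nzAhat e)//.
by apply/seteqP; split => z /=; move/eqP.
Qed.

Lemma nzAhat_supp e z : nzAhat e z -> supp_Ahat S e (z.1, z.2).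
Proof. by move=> h; apply: subset_closure; case: z h. Qed.

Lemma Ahat_neq0_near : exists2 K : R, 1 <= K & forall e k m, 0 < e ->
  Ahat S e k m != 0 ->
  (`|k + k0 S e| <= K * e ^+ 2 /\ `|m + m0 S e| <= K * e ^+ 2) \/
  (`|k - k0 S e| <= K * e ^+ 2 /\ `|m - m0 S e| <= K * e ^+ 2).
Proof.
have [K K1 hK] := chi_support; exists K => // e k m e0.
have e2 : 0 < e ^+ 2 by rewrite exprn_gt0.
have hx x : chi S (e ^- 2 * x) != 0 -> `|x| <= K * e ^+ 2.
  move=> /hK; rewrite normrM normfV (gtr0_norm e2) mulrC ler_pdivrMr//.
rewrite /Ahat mulf_eq0 negb_or => /andP[_].
have [h1|/negPn/eqP h1] := boolP (chi S (e ^- 2 * (k + k0 S e)) *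
  chi S (e ^- 2 * (m + m0 S e)) != 0).
  by move=> _; left; move: h1; rewrite mulf_eq0 negb_or => /andP[/hx ? /hx ?].
rewrite h1 add0r mulf_eq0 negb_or => /andP[/hx ? /hx ?].
by right.
Qed.

Let norm_near (x x0 d : R) : `|x + x0| <= d \/ `|x - x0| <= d ->
  `|x0| - d <= `|x| <= `|x0| + d.
Proof.
case=> h.
  have := lerB_normD x0 x; have := ler_normB (x + x0) x0; rewrite addrK.
  have := ler_normB (x + x0) x; rewrite addrAC subrr add0r.
  by move=> *; apply/andP; split; lra.
have := ler_normD (x - x0) x0; rewrite subrK.
have := ler_normB x (x - x0); rewrite opprB addrC subrK.
by move=> *; apply/andP; split; lra.
Qed.

Lemma supp_Ahat_bounds : exists2 K : R, 1 <= K & \forall e \near 0^'+,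
  forall k m, supp_Ahat S e (k, m) -> K^-1 <= `|k| <= K /\ K^-1 <= `|m| <= K.
Proof.
have [K1 K11 hK] := Ahat_neq0_near.
have [c0 [C0 [c00 hw]]] := hwave.
have C00 : 0 <= `|C0| by [].
pose K := 2 / c0 + `|C0| + 1.
have K1' : 1 <= K by rewrite /K lerDr addr_ge0// divr_ge0// ltW.
exists K => //; near=> e.
have e0 : 0 < e by near: e; exact: nbhs_right_gt.
have [/andP[k0c k0C] /andP[m0c m0C]] : c0 <= `|k0 S e| <= C0 /\ c0 <= `|m0 S e| <= C0.
  by near: e.
have eK : K1 * e ^+ 2 <= Num.min (c0 / 2) 1.
  have e1 : e <= 1 by near: e; exact: nbhs_right_le.
  have eb : e <= Num.min (c0 / 2) 1 / K1.
    near: e; apply: nbhs_right_le; rewrite divr_gt0 ?lt_min ?divr_gt0 ?ltr01//.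
    exact: lt_le_trans ltr01 K11.
  have K10 : 0 < K1 by exact: lt_le_trans ltr01 K11.
  rewrite ler_pdivlMr// in eb; apply: le_trans eb.
  by rewrite mulrC ler_wpM2r ?(ltW K10)// expr2 ler_piMr// ltW.
have Kinv : K^-1 <= c0 / 2.
  rewrite -[leRHS]invrK lef_pV2 ?posrE ?invr_gt0 ?divr_gt0//; last first.
    exact: lt_le_trans ltr01 K1'.
  by rewrite invf_div /K -addrA lerDl addr_ge0.
(* The support is a closure, so the bounds have to be closed conditions: they are shown where the
   amplitude is nonzero and then pass to the closure. *)
have closedF (f : R * R -> R) : continuous f ->
    closed [set z | K^-1 <= `|f z| <= K].
  move=> cf; rewrite (_ : [set z | _] = (fun z => `|f z|) @^-1` `[K^-1, K]); last first.
    by apply/seteqP; split => z /=; rewrite in_itv.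
  apply: closed_comp; last exact: itv_closed.
  move=> z _; apply: (@continuous_comp _ _ _ f (fun x : R => `|x|)); first exact: cf.
  exact: norm_continuous.
have sub : supp_Ahat S e `<=` [set z | K^-1 <= `|z.1| <= K] `&` [set z | K^-1 <= `|z.2| <= K].
  have cl : closed ([set z : R * R | K^-1 <= `|z.1| <= K] `&` [set z | K^-1 <= `|z.2| <= K]).
    by apply: closedI; apply: closedF => z; [exact: cvg_fst|exact: cvg_snd].
  rewrite ((closure_id _).1 cl); apply: closure_subset => -[k m] /= /(hK e _ _ e0).
  have aux (x x0 : R) : c0 <= `|x0| <= C0 ->
      `|x + x0| <= K1 * e ^+ 2 \/ `|x - x0| <= K1 * e ^+ 2 -> K^-1 <= `|x| <= K.
    move=> /andP[h1 h2] h3.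
    have /andP[h4 h5] := norm_near h3.
    have m1 : Num.min (c0 / 2) 1 <= c0 / 2 by rewrite ge_min lexx.
    have m2 : Num.min (c0 / 2) 1 <= 1 by rewrite ge_min lexx orbT.
    have c2 : 0 <= 2 / c0 by rewrite divr_ge0// ltW.
    have := ler_norm C0 => CC; rewrite /K in Kinv *.
    by clear -hgamma hchi hwave hcrit h1 h2 h4 h5 m1 m2 c2 CC eK Kinv; apply/andP; split; lra.
  case=> -[h1 h2]; split => /=.
  - by apply: (aux _ (k0 S e)); [rewrite k0c|left].
  - by apply: (aux _ (m0 S e)); [rewrite m0c|left].
  - by apply: (aux _ (k0 S e)); [rewrite k0c|right].
  - by apply: (aux _ (m0 S e)); [rewrite m0c|right].
by move=> k m /sub[].
Unshelve. all: by end_near. Qed.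

Lemma derive1_omega_plus k m : k != 0 -> derive1 (omega_plus S k) m =
  - (k * (s * k + m * c)) / ((k ^+ 2 + m ^+ 2) * Num.sqrt (k ^+ 2 + m ^+ 2)).
Proof.
move=> k0.
have d0 (x : R) : 0 < k ^+ 2 + x ^+ 2.
  by rewrite ltr_pwDl ?sqr_ge0// exprn_even_gt0.
have q0 (x : R) : 0 < Num.sqrt (k ^+ 2 + x ^+ 2) by rewrite sqrtr_gt0.
have dq : is_derive m 1 (fun x => Num.sqrt (k ^+ 2 + x ^+ 2))
    (m / Num.sqrt (k ^+ 2 + m ^+ 2)).
  have d1 : is_derive m 1 (fun x : R => k ^+ 2 + x ^+ 2) (2 * m).
    by apply: is_derive_eq; rewrite /GRing.scale/=; ring.
  have := @is_derive1_comp _ Num.sqrt (fun x : R => k ^+ 2 + x ^+ 2) m _ _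
    (is_derive1_sqrt (d0 m)) d1.
  move=> h; apply: (@is_derive_eq _ _ _ _ _ _ _ _ h).
  by field; rewrite gt_eqF.
rewrite derive1E; apply: derive_val; rewrite /omega_plus.
have dv : is_derive m 1 (fun x => (Num.sqrt (k ^+ 2 + x ^+ 2))^-1)
   (- (Num.sqrt (k ^+ 2 + m ^+ 2)) ^- 2 *: (m / Num.sqrt (k ^+ 2 + m ^+ 2))).
  apply: is_deriveV; rewrite gt_eqF//.
apply: is_derive_eq; rewrite /GRing.scale/=.
have sq : Num.sqrt (k ^+ 2 + m ^+ 2) ^+ 2 = k ^+ 2 + m ^+ 2.
  by rewrite sqr_sqrtr// ltW.
rewrite sq; move: (q0 m); set q := Num.sqrt _ => qp.
by field; rewrite !gt_eqF.
Qed.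

(** The sign condition [0 < k w] makes the coupling coefficient [2 k s c / w] of the dispersion
    polynomial positive, which the location of its roots requires. *)
Definition wavepoint (K e k m w zeta : R) :=
  [/\ K^-1 <= `|k| <= K, K^-1 <= `|m| <= K, K^-1 <= `|w| <= K,
      0 < k * w /\ w ^+ 2 = s ^+ 2 + zeta &
      e ^+ 2 / K <= `|zeta| <= K * e ^+ 2 /\
      w ^+ 2 * (k ^+ 2 + m ^+ 2) = (k * c - m * s) ^+ 2].

Lemma wavepoint_near : exists2 K : R, 1 <= K & \forall e \near 0^'+,
  forall k m, supp_Ahat S e (k, m) ->
    omega S k m = omega_plus S k m /\
    wavepoint K e k m (omega S k m) (criticality S k m).
Proof.
have s0 := sin_slope_gt0; have c0 := cos_slope_gt0.
have s1 : s <= 1 by exact: sin_le1.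
have [K1 K11 hb] := supp_Ahat_bounds.
have [c1 [C1 [c10 hc]]] := hcrit.
have K10 : 0 < K1 by lra.
pose K := K1 + c1^-1 + `|C1| + 2 / s + 2.
have ic1 : 0 <= c1^-1 by rewrite invr_ge0 ltW.
have is1 : 0 <= 2 / s by rewrite divr_ge0// ltW.
have C10 : 0 <= `|C1| by [].
have [Kk Kc KC Ks K2] : [/\ K1 <= K, c1^-1 <= K, `|C1| <= K, 2 / s <= K & 2 <= K].
  by rewrite /K; split; lra.
clearbody K.
have Kgt0 : 0 < K by lra.
exists K; first by lra.
(* [B e ^ 2] bounds [|zeta| (k ^ 2 + m ^ 2)]. The threshold [d] makes this at most half of the lower
   bound of [k ^ 2], and [|zeta|] at most [s ^ 2 / 2]. *)
pose B := (`|C1| + 1) * (2 * K1 ^+ 2).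
have B0 : 0 < B by rewrite mulr_gt0// ?mulr_gt0 ?exprn_gt0// ltr_pwDr.
pose d := Num.min (s ^+ 2 / 2 / (`|C1| + 1)) ((K1 ^+ 2)^-1 / (2 * B)).
have C1p : 0 < `|C1| + 1 by rewrite ltr_pwDr.
have d0 : 0 < d.
  rewrite lt_min; apply/andP; split; apply: divr_gt0 => //.
  - by rewrite divr_gt0// exprn_gt0.
  - by rewrite invr_gt0 exprn_gt0.
  - by rewrite mulr_gt0.
near=> e.
have e0 : 0 < e by near: e; exact: nbhs_right_gt.
have e1 : e <= 1 by near: e; exact: nbhs_right_le.
have hbe : forall k m, supp_Ahat S e (k, m) -> K1^-1 <= `|k| <= K1 /\ K1^-1 <= `|m| <= K1.
  by near: e.
have hce : forall k m, supp_Ahat S e (k, m) ->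
    c1 * e ^+ 2 <= `|criticality S k m| <= C1 * e ^+ 2.
  by near: e.
have ed : e <= d by near: e; exact: nbhs_right_le.
have e20 : 0 < e ^+ 2 by rewrite exprn_gt0.
have e2e : e ^+ 2 <= e by rewrite expr2 ler_piMr// ltW.
have ed1 : (`|C1| + 1) * e ^+ 2 <= s ^+ 2 / 2.
  rewrite mulrC -ler_pdivlMr; last by rewrite ltr_pwDr.
  by apply: (le_trans e2e); apply: (le_trans ed); rewrite ge_min lexx.
have ed2 : B * e ^+ 2 <= (K1 ^+ 2)^-1 / 2.
  have : e ^+ 2 <= (K1 ^+ 2)^-1 / (2 * B).
    by apply: (le_trans e2e); apply: (le_trans ed); rewrite ge_min lexx orbT.
  by rewrite ler_pdivlMr ?mulr_gt0// => h; clear -hgamma hchi hwave hcrit h; lra.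
move=> k m sp.
have [/andP[k1 k2] /andP[m1 m2]] := hbe k m sp.
have /andP[z1 z2] := hce k m sp.
have kk0 : 0 < `|k| by apply: lt_le_trans k1; rewrite invr_gt0.
have kn0 : k != 0 by rewrite -normr_gt0.
have d2 : 0 < k ^+ 2 + m ^+ 2.
  by rewrite ltr_pwDl ?sqr_ge0// exprn_even_gt0.
have q0 : 0 < Num.sqrt (k ^+ 2 + m ^+ 2) by rewrite sqrtr_gt0.
have w2 : omega S k m ^+ 2 * (k ^+ 2 + m ^+ 2) = (k * c - m * s) ^+ 2.
  have -> : omega S k m ^+ 2 = omega_plus S k m ^+ 2.
    by rewrite /omega; case: ifP => _ //; rewrite /omega_minus sqrrN.
  rewrite /omega_plus exprMn exprVn sqr_sqrtr ?(ltW d2)// mulfVK//.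
  by rewrite gt_eqF.
set zeta := criticality S k m in z1 z2 *.
have wz : omega S k m ^+ 2 = s ^+ 2 + zeta by rewrite /zeta /criticality addrC subrK.
(* [eta] is [k cos (2 gamma) - m sin (2 gamma)], which vanishes exactly at criticality since
   [zeta (k ^ 2 + m ^ 2) = k eta]. Being small, [k eta] cannot overturn the sign of [k ^ 2] in the
   two identities for [p1] and [p2]; these decide the branch of the frequency and the sign of
   [k w]. *)
pose eta := k * (c ^+ 2 - s ^+ 2) - 2 * (m * (s * c)).
have keta : zeta * (k ^+ 2 + m ^+ 2) = k * eta.
  have -> : zeta = omega S k m ^+ 2 - s ^+ 2 by rewrite wz addrAC subrr add0r.
  by rewrite mulrBl w2 /eta; ring.
have C1e : C1 * e ^+ 2 <= (`|C1| + 1) * e ^+ 2.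
  by rewrite ler_wpM2r ?(ltW e20)// (le_trans (ler_norm _))// lerDl.
have zl : `|zeta| <= s ^+ 2 / 2 := le_trans z2 (le_trans C1e ed1).
have sq (x : R) : `|x| <= K1 -> x ^+ 2 <= K1 ^+ 2.
  move=> xK; rewrite -real_normK ?num_real//; apply: lerXn2r; rewrite ?nnegrE//.
  exact: ltW.
have ketal : `|k * eta| <= (K1 ^+ 2)^-1 / 2.
  rewrite -keta normrM (gtr0_norm d2); apply: le_trans ed2.
  have -> : B * e ^+ 2 = (`|C1| + 1) * e ^+ 2 * (2 * K1 ^+ 2) by rewrite /B; ring.
  apply: ler_pM => //; [exact: ltW|exact: le_trans z2 C1e|].
  by have := sq _ k2; have := sq _ m2; clear -hgamma hchi hwave hcrit; lra.
have ksq : (K1 ^+ 2)^-1 <= k ^+ 2.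
  rewrite -[k ^+ 2]real_normK ?num_real// -exprVn.
  have K1i : 0 <= K1^-1 by rewrite invr_ge0 ltW.
  by apply: lerXn2r; rewrite ?nnegrE.
have K2i : 0 < (K1 ^+ 2)^-1 by rewrite invr_gt0 exprn_gt0.
have cs : c ^+ 2 + s ^+ 2 = 1 by rewrite cos2Dsin2.
have p1 : 0 < k * (s * k + m * c).
  have e' : 2 * s * (k * (s * k + m * c)) = k ^+ 2 - k * eta.
    rewrite /eta; have -> : k ^+ 2 = k ^+ 2 * (c ^+ 2 + s ^+ 2) by rewrite cs mulr1.
    ring.
  have : 0 < 2 * s * (k * (s * k + m * c)).
    by rewrite e'; move: ketal; rewrite ler_norml => /andP[]; clear -hgamma hchi hwave hcrit ksq K2i; lra.
  by rewrite pmulr_rgt0// mulr_gt0.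
have p2 : 0 < k * (k * c - m * s).
  have e' : 2 * c * (k * (k * c - m * s)) = k ^+ 2 + k * eta.
    rewrite /eta; have -> : k ^+ 2 = k ^+ 2 * (c ^+ 2 + s ^+ 2) by rewrite cs mulr1.
    ring.
  have : 0 < 2 * c * (k * (k * c - m * s)).
    by rewrite e'; move: ketal; rewrite ler_norml => /andP[]; clear -hgamma hchi hwave hcrit ksq K2i; lra.
  by rewrite pmulr_rgt0// mulr_gt0.
have wE : omega S k m = omega_plus S k m.
  rewrite /omega derive1_omega_plus// mulNr oppr_lt0 divr_gt0//.
  by rewrite mulr_gt0.
have wl : (s / 2) ^+ 2 <= `|omega S k m| ^+ 2 <= (2 : R) ^+ 2.
  rewrite real_normK ?num_real// wz.
  have ss : s ^+ 2 <= 1 by rewrite expr_le1// ltW.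
  move: zl; rewrite ler_norml => /andP[zl1 zl2].
  by rewrite expr_div_n; clear -hgamma hchi hwave hcrit zl1 zl2 ss; have := sqr_ge0 s; move=> ?; apply/andP; split; lra.
have [wl1 wl2] : s / 2 <= `|omega S k m| /\ `|omega S k m| <= 2.
  have s20 : 0 <= s / 2 by rewrite divr_ge0// ltW.
  by move: wl => /andP[]; rewrite !ler_sqr ?nnegrE// => ? ?; split.
have KK (x y : R) : 0 < x -> x^-1 <= K -> x <= y -> K^-1 <= y.
  by move=> x0 xK xy; apply: le_trans xy; rewrite -[leRHS]invrK lef_pV2 ?posrE ?invr_gt0.
split=> //; split.
- apply/andP; split; last exact: le_trans k2 Kk.
  by apply: KK k1; rewrite ?invr_gt0// invrK.
- apply/andP; split; last exact: le_trans m2 Kk.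
  by apply: KK m1; rewrite ?invr_gt0// invrK.
- apply/andP; split; last exact: le_trans wl2 K2.
  by apply: KK wl1; rewrite ?divr_gt0// invf_div.
- split=> //; rewrite wE /omega_plus mulrA divr_gt0//.
- split=> //; apply/andP; split.
    apply: le_trans z1; rewrite mulrC ler_wpM2r ?(ltW e20)//.
    exact: (KK c1).
  apply: le_trans z2 _; by rewrite ler_wpM2r ?(ltW e20)// (le_trans (ler_norm _)).
Unshelve. all: by end_near. Qed.

(** Two squares of side [2 K e ^ 2], one for each sign of the central wavenumber, hence the constant
    [8 K ^ 2]. *)
Lemma leb2_nzAhat : exists2 K : R, 0 < K & \forall e \near 0^'+,
  exists2 b : R, 0 < b & nzAhat e `<=` `[- b, b]%classic `*` `[- b, b]%classic /\
  fine (leb2 (nzAhat e)) <= K * e ^+ 4.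
Proof.
have [K K1 hK] := Ahat_neq0_near.
have [K2 K21 hb] := supp_Ahat_bounds.
exists (8 * K ^+ 2); first by rewrite mulr_gt0// exprn_gt0// (lt_le_trans ltr01).
near=> e.
have e0 : 0 < e by near: e; exact: nbhs_right_gt.
have hbe : forall k m, supp_Ahat S e (k, m) -> K2^-1 <= `|k| <= K2 /\ K2^-1 <= `|m| <= K2.
  by near: e.
have K20 : 0 < K2 by exact: lt_le_trans ltr01 K21.
exists K2 => //; split.
  move=> [k m] /nzAhat_supp/hbe[/andP[_ ?] /andP[_ ?]]; split.
    by rewrite /= in_itv/= -ler_norml.
  by rewrite /= in_itv/= -ler_norml.
pose r := K * e ^+ 2.
have r0 : 0 < r by rewrite mulr_gt0 ?exprn_gt0// (lt_le_trans ltr01).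
pose box (a b : R) : set T := `[a - r, a + r]%classic `*` `[b - r, b + r]%classic.
have mbox a b : measurable (box a b) by exact: measurableX.
have lbox a b : leb2 (box a b) = (4 * r ^+ 2)%:E.
  have h (x : R) : x - r <= x + r by rewrite lerD2l (@le_trans _ _ 0) ?oppr_le0 ?ltW.
  by rewrite leb2_box//; congr (_%:E); ring.
have sub : nzAhat e `<=` box (- k0 S e) (- m0 S e) `|` box (k0 S e) (m0 S e).
  move=> [k m] /= /(hK e _ _ e0)[[h1 h2]|[h1 h2]]; [left|right].
    by split; rewrite /= in_itv/= -ler_distl opprK.
  by split; rewrite /= in_itv/= -ler_distl.
have le8 : (leb2 (nzAhat e) <= (8 * K ^+ 2 * e ^+ 4)%:E)%E.
  apply: (@le_trans _ _ (leb2 (box (- k0 S e) (- m0 S e) `|` box (k0 S e) (m0 S e)))).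
    apply: le_measure; rewrite ?inE//; first exact: measurable_nzAhat.
    exact: measurableU.
  set A := box (- k0 S e) _; set B := box (k0 S e) _.
  have h : (leb2 (A `|` B) <= leb2 A + leb2 B)%E by exact: (measureU2 _ (mbox _ _) (mbox _ _)).
  apply: (le_trans h); rewrite !lbox -EFinD lee_fin.
  by rewrite /r exprMn -exprM; lra.
have fin : leb2 (nzAhat e) \is a fin_num.
  by rewrite ge0_fin_numE ?measure_ge0// (le_lt_trans le8)// ltry.
by rewrite -lee_fin fineK.
Unshelve. all: by end_near. Qed.

End incident_support.

(** * Boundary layer modes and their amplitudes *)

Section boundary_layer_modes.
Context {R : realType} (S : setting R).
Local Notation s := (sin (slope S)).
Local Notation c := (cos (slope S)).

Definition dispersion_relation (e k w : R) (lam : R[i]) :=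
  let d := lam ^+ 2 - (k ^+ 2)%:C in
  ('i%C * w%:C + (nu S e)%:C * d) * ('i%C * w%:C + (kappa S e)%:C * d) * d +
  (s%:C * lam + 'i%C * k%:C * c%:C) ^+ 2 = 0.

(** The pressure amplitude forced by the first momentum equation. *)
Definition bl_p (e k m : R) (lam : R[i]) : R[i] :=
  ((nu S e)%:C * (lam ^+ 2 - (k ^+ 2)%:C) + 'i%C * (omega S k m)%:C +
   bl_b S e k m lam * s%:C) / ('i%C * k%:C).

Variables (e k m : R) (lam : R[i]).
Hypothesis s_gt0 : 0 < s.
Hypothesis k_neq0 : k != 0.
Hypothesis Re_lam : 0 < Re lam.
Hypothesis disp : dispersion_relation e k (omega S k m) lam.
Local Notation w := (omega S k m).

Lemma mode_lam_neq0 : lam != 0.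
Proof. by apply: contraTneq Re_lam => ->; rewrite ltxx. Qed.

Lemma mode_numerator_neq0 : s%:C * lam + 'i%C * k%:C * c%:C != 0.
Proof.
apply/eqP => /(congr1 (@Re R)); rewrite Re_addc !Re_mulc/=.
by apply/eqP; rewrite gt_eqF//; move: (mulr_gt0 s_gt0 Re_lam); lra.
Qed.

(** If the denominator vanished, the dispersion relation would force [s lam + i k c = 0], whose real
    part [s Re lam] is positive. *)
Lemma mode_denominator_neq0 :
  'i%C * w%:C - (kappa S e)%:C * ((k ^+ 2)%:C - lam ^+ 2) != 0.
Proof.
apply/eqP => h; have := disp; rewrite /dispersion_relation/=.
have -> : 'i%C * w%:C + (kappa S e)%:C * (lam ^+ 2 - (k ^+ 2)%:C) = 0.
  by rewrite -[RHS]h; ring.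
rewrite mulr0 mul0r add0r => /eqP.
by rewrite expf_eq0/= (negbTE mode_numerator_neq0).
Qed.

Local Notation A := (- ('i%C * w%:C)).
Local Notation B := ('i%C * k%:C).
Local Notation C := (- lam).

Let ik_neq0 : 'i%C * k%:C != 0 :> R[i].
Proof.
rewrite -normc_eq0 Normc.normcM normc_i mul1r normc_real normr_eq0.
exact: k_neq0.
Qed.

Let BC : B ^+ 2 + C ^+ 2 = lam ^+ 2 - (k ^+ 2)%:C.
Proof. by rewrite exprMn sqr_i sqrrN rmorphXn/=; ring. Qed.

Lemma mode_eq_u : A - bl_b S e k m lam * s%:C + bl_p e k m lam * B =
  (nu S e)%:C * (B ^+ 2 + C ^+ 2).
Proof.
rewrite BC /bl_p mulfVK//; ring.
Qed.

Lemma bl_bE : bl_b S e k m lam *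
  ('i%C * w%:C - (kappa S e)%:C * ((k ^+ 2)%:C - lam ^+ 2)) =
  s%:C + 'i%C * k%:C * lam^-1 * c%:C.
Proof. by rewrite /bl_b mulfVK// mode_denominator_neq0. Qed.

Lemma mode_eq_b : bl_b S e k m lam * A + s%:C + bl_w k lam * c%:C =
  (kappa S e)%:C * (bl_b S e k m lam * (B ^+ 2 + C ^+ 2)).
Proof.
have -> : bl_w k lam * c%:C = 'i%C * k%:C * lam^-1 * c%:C by [].
apply/eqP; rewrite -subr_eq0 BC; apply/eqP; rewrite -[RHS](subrr (bl_b S e k m lam *
  ('i%C * w%:C - (kappa S e)%:C * ((k ^+ 2)%:C - lam ^+ 2)))) {1}bl_bE; ring.
Qed.

(** The equation that encodes the dispersion relation: multiplied by [i k lam (i w + kappa d)], the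
    difference of its sides becomes minus the left-hand side of that relation. *)
Lemma mode_eq_w : bl_w k lam * A - bl_b S e k m lam * c%:C +
  bl_p e k m lam * C = (nu S e)%:C * (bl_w k lam * (B ^+ 2 + C ^+ 2)).
Proof.
have h := mode_denominator_neq0; have l0 := mode_lam_neq0; have ik := ik_neq0.
apply/eqP; rewrite -subr_eq0 BC; apply/eqP.
set d := _ - _ in h; set D := lam ^+ 2 - (k ^+ 2)%:C.
set W := bl_w k lam; set b := bl_b S e k m lam; set p := bl_p e k m lam.
set n := s%:C * lam + 'i%C * k%:C * c%:C.
have wl : W * lam = B by rewrite /W /bl_w mulfVK.
have pik : p * B = (nu S e)%:C * D + 'i%C * w%:C + b * s%:C by rewrite mulfVK.
have bdl : b * d * lam = n.
  by rewrite /b /d bl_bE /n mulrDl -!mulrA [lam^-1 * _]mulrC -!mulrA mulfV// mulr1.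
have B2 : B * B = - (k ^+ 2)%:C by rewrite mulrACA sqri mulN1r -expr2 rmorphXn.
apply: (mulfI (mulf_neq0 (mulf_neq0 ik l0) h)); rewrite mulr0.
have dE : d = 'i%C * w%:C + (kappa S e)%:C * D by rewrite /d /D; ring.
rewrite -[RHS]oppr0 -[in RHS]disp -/D -dE -/n.
have -> : B * lam * d * (W * A - b * c%:C + p * C - (nu S e)%:C * (W * D)) =
  d * ((W * lam) * B * A - (nu S e)%:C * (W * lam) * B * D) -
  (b * d * lam) * (B * c%:C) - d * (p * B) * lam ^+ 2 by ring.
rewrite wl pik bdl.
have -> : d * (B * B * A - (nu S e)%:C * B * B * D) =
  d * (B * B) * (A - (nu S e)%:C * D) by ring.
have e2 : d * b * s%:C * lam ^+ 2 = n * s%:C * lam by rewrite -bdl; ring.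
have -> : d * ((nu S e)%:C * D + 'i%C * w%:C + b * s%:C) * lam ^+ 2 =
  d * ((nu S e)%:C * D + 'i%C * w%:C) * lam ^+ 2 + d * b * s%:C * lam ^+ 2 by ring.
rewrite e2 B2 {2}/D {3}/n; have -> : lam ^+ 2 = D + (k ^+ 2)%:C by rewrite /D subrK.
by rewrite /n; ring.
Qed.

Lemma mode_eq_div : B + bl_w k lam * C = 0.
Proof. by have l0 := mode_lam_neq0; rewrite /bl_w; field. Qed.

Let mode (G : R[i]) : field R := fun t x y => G * bl_phase S k m lam t x y.

Let mode_t G t x y : mode G t x y =
  G * cexp (A * t%:C + ('i%C * k%:C * x%:C - lam * y%:C)).
Proof.
by congr (_ * cexp _); rewrite rmorphD/= !rmorphM/= rmorphN/=; ring.
Qed.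

Let mode_x G t x y : mode G t x y =
  G * cexp (B * x%:C + (A * t%:C - lam * y%:C)).
Proof. by rewrite mode_t; congr (_ * cexp _); ring. Qed.

Let mode_y G t x y : mode G t x y =
  G * cexp (C * y%:C + (A * t%:C + B * x%:C)).
Proof. by rewrite mode_t; congr (_ * cexp _); ring. Qed.

Let mode_dt G t x y : cderivable (fun r => mode G r x y) t /\
  dt (mode G) t x y = mode (G * A) t x y.
Proof.
rewrite /dt (funext (fun r => mode_t G r x y)) mode_t.
by split; [exact: cderivable_cexp|exact: cderive_cexp].
Qed.

Let mode_dx G t x y : cderivable (fun r => mode G t r y) x /\
  dx (mode G) t x y = mode (G * B) t x y.
Proof.
rewrite /dx (funext (fun r => mode_x G t r y)) mode_x.
by split; [exact: cderivable_cexp|exact: cderive_cexp].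
Qed.

Let mode_dy G t x y : cderivable (fun r => mode G t x r) y /\
  dy (mode G) t x y = mode (G * C) t x y.
Proof.
rewrite /dy (funext (fun r => mode_y G t x r)) mode_y.
by split; [exact: cderivable_cexp|exact: cderive_cexp].
Qed.

Let mode_dxE G : dx (mode G) = mode (G * B).
Proof. by do 3 apply/funext => ?; rewrite (mode_dx _ _ _ _).2. Qed.

Let mode_dyE G : dy (mode G) = mode (G * C).
Proof. by do 3 apply/funext => ?; rewrite (mode_dy _ _ _ _).2. Qed.

Let mode_regular G : regular (mode G).
Proof.
split => t x y _.
- exact: (mode_dt G t x y).1.
- exact: (mode_dx G t x y).1.
- exact: (mode_dy G t x y).1.
- by rewrite mode_dxE; exact: (mode_dx _ t x y).1.
- by rewrite mode_dyE; exact: (mode_dy _ t x y).1.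
Qed.

Let laplacian_mode G t x y :
  laplacian (mode G) t x y = mode (G * (B ^+ 2 + C ^+ 2)) t x y.
Proof.
rewrite /laplacian mode_dxE mode_dyE (mode_dx _ _ _ _).2 (mode_dy _ _ _ _).2.
by rewrite /mode; ring.
Qed.

Lemma dispersion_bl_root : bl_root S e k m lam.
Proof.
split=> //; exists (bl_p e k m lam).
have e1 : bl_mode S e k m lam =
    Wave (mode 1) (mode (bl_w k lam)) (mode (bl_b S e k m lam)).
  by congr Wave; do 3 apply/funext => ?; rewrite /mode mul1r.
rewrite e1 /system /system_rhs /=; split.
  by split; exact: mode_regular.
split.
  by split => t x y _; [exact: (mode_dx _ t x y).1|exact: (mode_dy _ t x y).1].
move=> t x y _.
rewrite -!/(mode (bl_p e k m lam)).
rewrite !(mode_dt _ _ _ _).2 !(mode_dx _ _ _ _).2 !(mode_dy _ _ _ _).2.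
rewrite !laplacian_mode /mode !addr0; split.
- set ph := bl_phase _ _ _ _ _ _ _.
  transitivity ((A - bl_b S e k m lam * s%:C + bl_p e k m lam * B) * ph); first ring.
  by rewrite mode_eq_u; ring.
- set ph := bl_phase _ _ _ _ _ _ _.
  transitivity ((bl_w k lam * A - bl_b S e k m lam * c%:C +
    bl_p e k m lam * C) * ph); first ring.
  by rewrite mode_eq_w; ring.
- set ph := bl_phase _ _ _ _ _ _ _.
  transitivity ((bl_b S e k m lam * A + s%:C + bl_w k lam * c%:C) * ph); first ring.
  by rewrite mode_eq_b; ring.
- by rewrite mul1r -mulrDl mode_eq_div mul0r.
Qed.

End boundary_layer_modes.

Section scaled_dispersion.
Context {R : realType} (S : setting R).
Local Notation s := (sin (slope S)).
Local Notation c := (cos (slope S)).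

(* [lam = tau * L] turns the dispersion relation, divided by [i w N], into
   a [dpoly] in [L]. *)
Lemma dpoly_dispersion (e k w zeta tau N : R) (L : R[i]) :
  w != 0 -> N != 0 -> tau != 0 -> w ^+ 2 = s ^+ 2 + zeta ->
  dpoly ((nu S e + kappa S e) * tau ^+ 4 / N)
    (nu S e * kappa S e * tau ^+ 6 / (w * N)) (2 * (k / w) * s * c * tau / N)
    (zeta * tau ^+ 2 / (w * N)) (k ^+ 2 * (w ^+ 2 - c ^+ 2) / (w * N))
    (k ^+ 2 / tau ^+ 2) L = 0 ->
  dispersion_relation S e k w (tau%:C * L).
Proof.
move=> w0 N0 tau0 wz h; rewrite /dispersion_relation /=.
have zE : zeta = w ^+ 2 - s ^+ 2 by rewrite wz; ring.
have i2 : ('i%C : R[i]) ^+ 2 = -1 by exact: sqr_i.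
have w0' : w%:C != 0 :> R[i] by rewrite -(rmorph0 (real_complex R)) (inj_eq (@complexI _)).
have N0' : N%:C != 0 :> R[i] by rewrite -(rmorph0 (real_complex R)) (inj_eq (@complexI _)).
have t0' : tau%:C != 0 :> R[i] by rewrite -(rmorph0 (real_complex R)) (inj_eq (@complexI _)).
have -> : ('i%C * w%:C + (nu S e)%:C * ((tau%:C * L) ^+ 2 - (k ^+ 2)%:C)) *
   ('i%C * w%:C + (kappa S e)%:C * ((tau%:C * L) ^+ 2 - (k ^+ 2)%:C)) *
   ((tau%:C * L) ^+ 2 - (k ^+ 2)%:C) +
   (s%:C * (tau%:C * L) + 'i%C * k%:C * c%:C) ^+ 2 =
  'i%C * w%:C * N%:C * dpoly ((nu S e + kappa S e) * tau ^+ 4 / N)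
    (nu S e * kappa S e * tau ^+ 6 / (w * N)) (2 * (k / w) * s * c * tau / N)
    (zeta * tau ^+ 2 / (w * N)) (k ^+ 2 * (w ^+ 2 - c ^+ 2) / (w * N))
    (k ^+ 2 / tau ^+ 2) L; last by rewrite h mulr0.
have push := (rmorphM, rmorphB, rmorphD, rmorphXn, fmorphV, rmorph_nat).
have eA : ((nu S e + kappa S e) * tau ^+ 4 / N)%:C =
    ((nu S e)%:C + (kappa S e)%:C) * tau%:C ^+ 4 / N%:C :> R[i] by rewrite !push.
have eE : (nu S e * kappa S e * tau ^+ 6 / (w * N))%:C =
    (nu S e)%:C * (kappa S e)%:C * tau%:C ^+ 6 / (w%:C * N%:C) :> R[i] by rewrite !push.
have eB : (2 * (k / w) * s * c * tau / N)%:C =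
    2 * (k%:C / w%:C) * s%:C * c%:C * tau%:C / N%:C :> R[i] by rewrite !push.
have eC : (zeta * tau ^+ 2 / (w * N))%:C =
    (w%:C ^+ 2 - s%:C ^+ 2) * tau%:C ^+ 2 / (w%:C * N%:C) :> R[i] by rewrite zE !push.
have eG : (k ^+ 2 * (w ^+ 2 - c ^+ 2) / (w * N))%:C =
    k%:C ^+ 2 * (w%:C ^+ 2 - c%:C ^+ 2) / (w%:C * N%:C) :> R[i] by rewrite !push.
have eh : (k ^+ 2 / tau ^+ 2)%:C = k%:C ^+ 2 / tau%:C ^+ 2 :> R[i] by rewrite !push.
rewrite /dpoly eA eE eB eC eG eh rmorphXn/=.
set I := 'i%C in i2 *.
apply/eqP; rewrite -subr_eq0; apply/eqP.
pose x := (tau%:C * L) ^+ 2 - k%:C ^+ 2.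
(* [field] treats ['i] as an indeterminate, so the difference of the two sides is exhibited as a
   multiple of ['i ^ 2 + 1]. *)
transitivity ((I ^+ 2 + 1) * (s%:C ^+ 2 * (tau%:C * L) ^+ 2 +
   (nu S e)%:C * (kappa S e)%:C * x ^+ 3)); last by rewrite i2 addNr mul0r.
by rewrite /x; field; rewrite w0' N0' t0'.
Qed.

End scaled_dispersion.

(** * Amplitudes by Cramer's rule *)

Section amplitudes.
Context {R : realType}.
Implicit Types (l m d q b u x : R[i]).

Lemma normcM_le x u (r t : R) : normc x <= r -> normc u <= t ->
  normc (x * u) <= r * t.
Proof. by move=> xa yb; rewrite Normc.normcM ler_pM ?normc_ge0. Qed.

Lemma normcD_le x u (r t : R) : normc x <= r -> normc u <= t ->
  normc (x + u) <= r + t.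
Proof. by move=> xa yb; apply: le_trans (ler_normcD _ _) _; exact: lerD. Qed.

Lemma normcB_le x u (r t : R) : normc x <= r -> normc u <= t ->
  normc (x - u) <= r + t.
Proof. by move=> xa yb; apply: le_trans (ler_normcB _ _) _; exact: lerD. Qed.

Lemma normcV_le x (r : R) : 0 < r -> r <= normc x -> normc x^-1 <= r^-1.
Proof.
move=> r0 rx; rewrite Normc.normcV lef_pV2 ?posrE//.
exact: lt_le_trans rx.
Qed.

(** Rows [(1, 1, 1)], [(l1, l2, l3)] and [(m1, m2, m3)]: the conditions on [u], on [w] and on the
    normal derivative of [b]. In [cnum] the first column is replaced by [(-1, d, q)]. *)
Definition cdet l1 l2 l3 m1 m2 m3 : R[i] :=
  m1 * (l3 - l2) + m2 * (l1 - l3) + m3 * (l2 - l1).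

Definition cnum l2 l3 m2 m3 d q : R[i] :=
  l3 * m2 - l2 * m3 + d * (m2 - m3) + q * (l3 - l2).

Lemma cramer3 l1 l2 l3 m1 m2 m3 d q :
  let D := cdet l1 l2 l3 m1 m2 m3 in
  let a1 := cnum l2 l3 m2 m3 d q / D in
  let a2 := cnum l3 l1 m3 m1 d q / D in
  let a3 := cnum l1 l2 m1 m2 d q / D in
  D != 0 ->
  [/\ a1 + a2 + a3 = -1, a1 * l1 + a2 * l2 + a3 * l3 = d &
      a1 * m1 + a2 * m2 + a3 * m3 = q].
Proof.
move=> D a1 a2 a3 D0; split.
- by rewrite /a1 /a2 /a3 -!mulrDl; apply: (canLR (mulfK D0)); rewrite /cnum /D /cdet; ring.
- rewrite /a1 /a2 /a3 !(mulrAC _ D^-1) -!mulrDl; apply: (canLR (mulfK D0)).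
  by rewrite /cnum /D /cdet; ring.
- rewrite /a1 /a2 /a3 !(mulrAC _ D^-1) -!mulrDl; apply: (canLR (mulfK D0)).
  by rewrite /cnum /D /cdet; ring.
Qed.

Let ratio_le (n D : R[i]) (N E C : R) : 0 < E -> normc n <= N -> E <= normc D ->
  N <= C * E -> normc (n / D) <= C.
Proof.
move=> E0 nN ED NC; rewrite Normc.normcM Normc.normcV.
rewrite ler_pdivrMr ?(lt_le_trans E0)//; apply: (le_trans nN); apply: (le_trans NC).
rewrite ler_wpM2l//.
have := le_trans (normc_ge0 n) (le_trans nN NC).
by rewrite pmulr_lge0.
Qed.

(** Slow wavenumbers are [L2 / eta] and [L3 / eta]; [u] and [xi] describe the fast mode. To leading
    order the determinant is [b (L2 - L3) / (L2 L3) * (xi - (L2 + L3))]. The last factor cannot be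
    small: [xi] lies in a sector of the left half-plane and [L2], [L3] in the right one, so the real
    parts add up to a multiple of [1 + |xi|]. *)
Lemma two_scale_amplitudes (K c : R) : 1 <= K -> 0 < c ->
  exists2 del : R, 0 < del & exists2 C : R, 0 < C &
  forall (eta : R) b L2 L3 u b2 b3 xi d q, 0 < eta <= 1 ->
    K^-1 <= normc b -> c <= Re L2 -> c <= Re L3 ->
    normc L2 <= K -> normc L3 <= K -> c <= normc (L2 - L3) ->
    normc u <= del -> normc (b2 - 1) <= del -> normc (b3 - 1) <= del ->
    normc xi <= - 2 * Re xi -> normc d <= K -> normc q <= K ->
    let e := eta%:C in
    let D := cdet (e * u) (e / L2) (e / L3)
               (b * xi / e) (b * L2 * b2 / e) (b * L3 * b3 / e) in
    let N1 := cnum (e / L2) (e / L3) (b * L2 * b2 / e) (b * L3 * b3 / e) d q in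
    let N2 := cnum (e / L3) (e * u) (b * L3 * b3 / e) (b * xi / e) d q in
    let N3 := cnum (e * u) (e / L2) (b * xi / e) (b * L2 * b2 / e) d q in
    [/\ D != 0, normc (N1 / D) <= C / (eta * (1 + normc xi)),
        normc (N2 / D) <= C / eta & normc (N3 / D) <= C / eta].
Proof.
move=> K1 c0.
have K0 : 0 < K by lra.
(* [2 c] is the lower bound of [Re (L2 + L3)], and [1 / 2] comes from [- Re xi >= |xi| / 2]. *)
pose c' := Num.min (2 * c) (1 / 2).
have c'0 : 0 < c' by rewrite lt_min; apply/andP; split; lra.
have c'1 : c' <= 2 * c by rewrite ge_min lexx.
have c'2 : c' <= 1 / 2 by rewrite ge_min lexx orbT.
pose kap := c / K ^+ 2 * c'.
have K20 : 0 < K ^+ 2 by rewrite exprn_gt0.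
have kap0 : 0 < kap by rewrite mulr_gt0// divr_gt0.
have ic0 : 0 < c^-1 by rewrite invr_gt0.
have Q0 : 0 < 4 * K + 2 * (K * c^-1) by have := mulr_gt0 K0 ic0; lra.
pose del := Num.min 1 (kap / 2 / (4 * K + 2 * (K * c^-1))).
have del0 : 0 < del by rewrite lt_min ltr01 divr_gt0// divr_gt0.
have del1 : del <= 1 by rewrite ge_min lexx.
have delk : del * (4 * K + 2 * (K * c^-1)) <= kap / 2.
  by rewrite -ler_pdivlMr// ge_min lexx orbT.
(* the numerators are O(M (1 + |xi|) / eta), the determinant is at least
   (kap / 2) (1 + |xi|), up to the common factor b *)
pose M := 4 * (K * c^-1) + 4 * K ^+ 2 + 2 * (K * (K * c^-1)) + 2 * K + K * K +
  c^-1 + K * (K + K * c^-1).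
have M0 : 0 < M.
  have := mulr_gt0 K0 ic0; have := mulr_gt0 K0 (mulr_gt0 K0 ic0).
  have := mulr_gt0 K0 K0 => p1 p2 p3.
  by rewrite /M mulrDr; lra.
exists del => //; exists (2 * M / kap); first by rewrite divr_gt0// mulr_gt0.
move=> eta b L2 L3 u b2 b3 xi d q /andP[eta0 eta1] hb hL2 hL3 L2K L3K L23 hu
  hb2 hb3 hxi hd hq e D N1 N2 N3.
have b0 : 0 < normc b by apply: lt_le_trans hb; rewrite invr_gt0.
have bn0 : b != 0 by rewrite -normc_gt0.
have e0 : e != 0 by rewrite -normc_gt0 normc_real gtr0_norm.
have L2c : c <= normc L2.
  by apply: le_trans (ler_Re_normc _); apply: le_trans hL2 (ler_norm _).
have L3c : c <= normc L3.
  by apply: le_trans (ler_Re_normc _); apply: le_trans hL3 (ler_norm _).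
have L20 : L2 != 0 by rewrite -normc_gt0 (lt_le_trans c0).
have L30 : L3 != 0 by rewrite -normc_gt0 (lt_le_trans c0).
have iL2 : normc L2^-1 <= c^-1 by exact: normcV_le.
have iL3 : normc L3^-1 <= c^-1 by exact: normcV_le.
have x0 : 0 <= normc xi := normc_ge0 _.
have u1 : normc u <= 1 := le_trans hu del1.
have b2' : normc b2 <= 2.
  by have := normcD_le hb2 (_ : normc 1 <= 1); rewrite subrK Normc.normc1 => /(_ (lexx _)); clear -ratio_le del1; lra.
have b3' : normc b3 <= 2.
  by have := normcD_le hb3 (_ : normc 1 <= 1); rewrite subrK Normc.normc1 => /(_ (lexx _)); clear -ratio_le del1; lra.
have DE : D = b * ((L2 - L3) / (L2 * L3) * (xi - (L2 + L3)) +
   (u * (L2 * b2 - L3 * b3) - (b2 - 1) * (L2 / L3) + (b3 - 1) * (L3 / L2))).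
  by rewrite /D /cdet; field; rewrite e0 L20 L30.
have err : normc (u * (L2 * b2 - L3 * b3) - (b2 - 1) * (L2 / L3) +
    (b3 - 1) * (L3 / L2)) <= kap / 2.
  apply: le_trans delk.
  have -> : del * (4 * K + 2 * (K * c^-1)) =
    del * (K * 2 + K * 2) + del * (K * c^-1) + del * (K * c^-1) by ring.
  apply: normcD_le; last by do 2 apply: normcM_le => //.
  apply: normcB_le; last by do 2 apply: normcM_le => //.
  by apply: normcM_le => //; apply: normcB_le; exact: normcM_le.
have gap : c' * (1 + normc xi) <= normc (xi - (L2 + L3)).
  apply: le_trans (ler_Re_normc _); rewrite Re_addc Re_oppc Re_addc.
  rewrite -normrN; apply: le_trans (ler_norm _).
  have : c' * normc xi <= 1 / 2 * normc xi by rewrite ler_wpM2r.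
  by clear -ratio_le hL2 hL3 hxi c'1 c'2 x0; lra.
have main : kap * (1 + normc xi) <= normc ((L2 - L3) / (L2 * L3) * (xi - (L2 + L3))).
  rewrite /kap -mulrA Normc.normcM; apply: ler_pM => //.
  - by rewrite divr_ge0 ?ltW.
  - by rewrite mulr_ge0 ?ltW// ltr_pwDl.
  rewrite Normc.normcM Normc.normcV; apply: ler_pM => //.
  - exact: ltW.
  - by rewrite invr_ge0 ltW.
  rewrite lef_pV2 ?posrE//; last by rewrite normc_gt0 mulf_neq0.
  by rewrite expr2; apply: normcM_le.
have Dge : normc b * (kap / 2 * (1 + normc xi)) <= normc D.
  rewrite DE Normc.normcM ler_wpM2l ?(ltW b0)//.
  apply: le_trans (lerB_normcD _ _).
  have : 0 <= kap * normc xi by rewrite mulr_ge0// ltW.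
  by clear -ratio_le main err kap0; lra.
have E0 : 0 < normc b * (kap / 2 * (1 + normc xi)).
  by rewrite mulr_gt0// mulr_gt0 ?divr_gt0// ltr_pwDl.
have Dn0 : D != 0 by rewrite -normc_gt0 (lt_le_trans E0).
have ne : normc e = eta by rewrite normc_real gtr0_norm.
have ie : normc e^-1 <= eta^-1 by rewrite Normc.normcV ne.
have ie1 : 1 <= eta^-1 by rewrite invf_ge1.
have Kb : K <= K * K * normc b.
  have := ler_wpM2l (ltW K0) hb; rewrite mulfV ?gt_eqF// => h.
  by have := ler_wpM2l (ltW K0) h; rewrite mulr1 mulrA.
have hM (x : R) : x <= M * (1 + normc xi) -> 
    normc b * (eta^-1 * x) <= 2 * M / kap / eta * (normc b * (kap / 2 * (1 + normc xi))).
  move=> xM; have -> : 2 * M / kap / eta * (normc b * (kap / 2 * (1 + normc xi))) =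
    normc b * (eta^-1 * (M * (1 + normc xi))) by field; rewrite !gt_eqF.
  by rewrite ler_wpM2l ?(ltW b0)// ler_wpM2l// ltW// invr_gt0.
have hbi : normc b^-1 <= K.
  by rewrite -[leRHS]invrK; apply: normcV_le => //; rewrite invr_gt0.
have en1 : normc e <= 1 by rewrite ne.
have pKc : 0 < K * c^-1 by rewrite mulr_gt0.
have pKKc : 0 < K * (K * c^-1) by rewrite mulr_gt0.
have pKK : 0 < K * K by rewrite mulr_gt0.
have eta_ge0 : 0 <= eta^-1 by rewrite invr_ge0 ltW.
have hN23 L b' : L != 0 -> normc L <= K -> normc L^-1 <= c^-1 -> normc b' <= 2 ->
    normc (cnum (e / L) (e * u) (b * L * b' / e) (b * xi / e) d q) <=
    normc b * (eta^-1 * (M * (1 + normc xi))).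
  move=> L0 LK Lc b'2.
  have -> : cnum (e / L) (e * u) (b * L * b' / e) (b * xi / e) d q =
    b * (e^-1 * (e * (u * (L * b') - xi / L) + d * (L * b' - xi) +
                 b^-1 * (q * (e * (e * (u - L^-1)))))).
    by rewrite /cnum; field; rewrite e0 L0 bn0.
  rewrite Normc.normcM ler_wpM2l ?(ltW b0)//; apply: normcM_le => //.
  apply: (@le_trans _ _ (1 * (1 * (K * 2) + normc xi * c^-1) + K * (K * 2 + normc xi) +
    K * (K * (1 * (1 * (1 + c^-1)))))).
    apply: normcD_le; last first.
      by do 4 (apply: normcM_le => //); exact: normcB_le.
    apply: normcD_le.
      apply: normcM_le => //; apply: normcB_le.
        by do 2 (apply: normcM_le => //).
      by apply: normcM_le.
    by apply: normcM_le => //; apply: normcB_le => //; exact: normcM_le.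
  have -> : 1 * (1 * (K * 2) + normc xi * c^-1) + K * (K * 2 + normc xi) +
    K * (K * (1 * (1 * (1 + c^-1)))) =
    (2 * K + 3 * (K * K) + K * (K * c^-1)) + (c^-1 + K) * normc xi by ring.
  rewrite mulrDr mulr1; apply: lerD.
    by rewrite /M mulrDr expr2; clear -ratio_le pKc pKKc pKK K0 ic0; lra.
  by rewrite ler_wpM2r// /M mulrDr expr2; clear -ratio_le pKc pKKc pKK K0 ic0; lra.
split=> //.
- have hN : normc N1 <= normc b * (eta^-1 * M).
    have -> : N1 = b * (e^-1 * (e * (L2 * b2 / L3 - L3 * b3 / L2) +
       d * (L2 * b2 - L3 * b3) + b^-1 * (q * (e * (e * (L3^-1 - L2^-1)))))).
      by rewrite /N1 /cnum; field; rewrite e0 L20 L30 bn0.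
    rewrite Normc.normcM ler_wpM2l ?(ltW b0)//; apply: normcM_le => //.
    apply: (@le_trans _ _ (1 * (K * 2 * c^-1 + K * 2 * c^-1) + K * (K * 2 + K * 2) +
      K * (K * (1 * (1 * (c^-1 + c^-1)))))).
      apply: normcD_le; last first.
        by do 4 (apply: normcM_le => //); exact: normcB_le.
      apply: normcD_le.
        apply: normcM_le => //; apply: normcB_le; apply: normcM_le => //;
          exact: normcM_le.
      by apply: normcM_le => //; apply: normcB_le; exact: normcM_le.
    by rewrite /M mulrDr expr2; clear -ratio_le pKc pKKc pKK K0 ic0; lra.
  apply: (ratio_le E0 hN Dge).
  have -> : 2 * M / kap / (eta * (1 + normc xi)) * (normc b * (kap / 2 * (1 + normc xi))) =
    normc b * (eta^-1 * M).
    by field; rewrite !gt_eqF// ltr_pwDl.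
  exact: lexx.
- have hN := hN23 L3 b3 L30 L3K iL3 b3'.
  by apply: (ratio_le E0 hN Dge); exact: hM.
- have hN := hN23 L2 b2 L20 L2K iL2 b2'.
  have e3 : N3 = - cnum (e / L2) (e * u) (b * L2 * b2 / e) (b * xi / e) d q.
    by rewrite /N3 /cnum; ring.
  rewrite -normcN -e3 in hN.
  by apply: (ratio_le E0 hN Dge); exact: hM.
Qed.

(** With [|v1|], [|v2|], [|v3|] well separated the determinant is dominated by the single term
    [b n b3 v3 / v1], so no cancellation has to be excluded. In the application [n] is [nu / kappa]
    and the minus sign in [m3] is that of the fast buoyancy coefficient. *)
Lemma three_scale_amplitudes (K : R) : 1 <= K ->
  exists2 del : R, 0 < del <= 1 & exists2 C : R, 0 < C &
  forall (n : R) b v1 v2 v3 b1 b2 b3 d q,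
    K^-1 <= normc b -> K^-1 <= n <= K -> 1 <= normc v1 ->
    normc v1 <= del * normc v2 -> normc v2 <= del * normc v3 ->
    normc (b1 - 1) <= 2^-1 -> normc (b2 - 1) <= 2^-1 -> normc (b3 - 1) <= 2^-1 ->
    normc d <= K -> normc q <= K ->
    let m1 := b * v1 * b1 in let m2 := b * v2 * b2 in
    let m3 := - (b * n%:C * v3 * b3) in
    let D := cdet v1^-1 v2^-1 v3^-1 m1 m2 m3 in
    let N1 := cnum v2^-1 v3^-1 m2 m3 d q in
    let N2 := cnum v3^-1 v1^-1 m3 m1 d q in
    let N3 := cnum v1^-1 v2^-1 m1 m2 d q in
    [/\ D != 0, normc (N1 / D) <= C * normc v1, normc (N2 / D) <= C * normc v1 &
        normc (N3 / D) <= C * (normc v1 * normc v2 / normc v3)].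
Proof.
move=> K1; have K0 : 0 < K by lra.
have K80 : 0 < 4 * K * (2 * K + 8) by rewrite mulr_gt0//; lra.
pose del := Num.min 1 (4 * K * (2 * K + 8))^-1.
have del0 : 0 < del by rewrite lt_min ltr01 invr_gt0.
have del1 : del <= 1 by rewrite ge_min lexx.
have delK : del * (2 * K + 8) <= (4 * K)^-1.
  have : del <= (4 * K * (2 * K + 8))^-1 by rewrite ge_min lexx orbT.
  rewrite invfM -ler_pdivrMr ?invr_gt0; last lra.
  by rewrite invrK.
exists del; first by rewrite del0.
pose M := 2 * K + 2 + K * (2 * K + 2) + K * (K * 2).
have M0 : 0 < M by have := mulr_gt0 K0 K0; rewrite /M mulrDr; lra.
exists (4 * K * M); first by rewrite !mulr_gt0.
have KK2 (x : R) : 1 <= x -> K * (K * (1 + 1)) <= K * (K * 2) * x.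
  by move=> x1; rewrite -[1 + 1]/(2 : R) ler_peMr// !mulr_ge0// ltW.
move=> n b v1 v2 v3 b1 b2 b3 d q hb /andP[n1 n2] v11 v12 v23 hb1 hb2 hb3 hd hq
  m1 m2 m3 D N1 N2 N3.
have b0 : 0 < normc b by apply: lt_le_trans hb; rewrite invr_gt0.
have bn0 : b != 0 by rewrite -normc_gt0.
have v20' : 0 <= normc v2 := normc_ge0 _.
have v30' : 0 <= normc v3 := normc_ge0 _.
have v12' : normc v1 <= normc v2 by apply: (le_trans v12); rewrite ler_piMl.
have v23' : normc v2 <= normc v3 by apply: (le_trans v23); rewrite ler_piMl.
have v10 : 0 < normc v1 := lt_le_trans ltr01 v11.
have v20 : 0 < normc v2 := lt_le_trans v10 v12'.
have v30 : 0 < normc v3 := lt_le_trans v20 v23'.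
have v21 : 1 <= normc v2 := le_trans v11 v12'.
have v31 : 1 <= normc v3 := le_trans v21 v23'.
have v1n : v1 != 0 by rewrite -normc_gt0.
have v2n : v2 != 0 by rewrite -normc_gt0.
have v3n : v3 != 0 by rewrite -normc_gt0.
have i1 : normc v1^-1 <= 1 by rewrite Normc.normcV invf_le1.
have i2 : normc v2^-1 <= 1 by rewrite Normc.normcV invf_le1.
have i3 : normc v3^-1 <= 1 by rewrite Normc.normcV invf_le1.
have two (x : R[i]) : normc (x - 1) <= 2^-1 -> 2^-1 <= normc x <= 2.
  move=> h; have := normcD_le h (_ : normc 1 <= 1).
  rewrite subrK Normc.normc1 => /(_ (lexx _)) h2.
  have := lerB_normcB 1 (1 - x).
  have -> : 1 - (1 - x) = x by ring.
  rewrite Normc.normc1 normcBC => h3.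
  by clear -ratio_le h h2 h3; apply/andP; split; lra.
have /andP[b1l b1u] := two _ hb1; have /andP[b2l b2u] := two _ hb2.
have /andP[b3l b3u] := two _ hb3.
have n0 : 0 < n by apply: lt_le_trans n1; rewrite invr_gt0.
have nn : normc n%:C = n by rewrite normc_real gtr0_norm.
have hbi : normc b^-1 <= K.
  by rewrite -[leRHS]invrK; apply: normcV_le => //; rewrite invr_gt0.
(* Every error term is a bounded multiple of [del r], while the leading term is at least
   [r / (2 K)]. *)
set r := normc v3 / normc v1.
have r1 : 1 <= r by rewrite ler_pdivlMr// mul1r; exact: le_trans v12' v23'.
have DE : D = b * (n%:C * b3 * (v3 / v1) +
   (v1 * b1 * (v3^-1 - v2^-1) + v2 * b2 * (v1^-1 - v3^-1) - n%:C * b3 * (v3 / v2))).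
  by rewrite /D /cdet /m1 /m2 /m3; field; rewrite v1n v2n v3n.
have s13 : normc (v1 / v3) <= del * r.
  rewrite Normc.normcM Normc.normcV ler_pdivrMr//.
  apply: le_trans (le_trans v12 _) _; first exact: (ler_wpM2l (ltW del0) v23').
  by rewrite -mulrA ler_wpM2l ?(ltW del0)// ler_peMl.
have s12 : normc (v1 / v2) <= del * r.
  rewrite Normc.normcM Normc.normcV ler_pdivrMr//.
  apply: (le_trans v12); rewrite -mulrA ler_wpM2l ?(ltW del0)// ler_peMl//.
have s21 : normc (v2 / v1) <= del * r.
  by rewrite Normc.normcM Normc.normcV /r mulrA ler_pM2r ?invr_gt0.
have s23 : normc (v2 / v3) <= del * r.
  rewrite Normc.normcM Normc.normcV ler_pdivrMr//.
  apply: (le_trans v23); rewrite -mulrA ler_wpM2l ?(ltW del0)// ler_peMl//.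
have s32 : normc (v3 / v2) <= del * r.
  rewrite Normc.normcM Normc.normcV /r mulrCA ler_wpM2l//.
  rewrite ler_pdivlMr// mulrC ler_pdivrMr//.
have err : normc (v1 * b1 * (v3^-1 - v2^-1) + v2 * b2 * (v1^-1 - v3^-1) -
    n%:C * b3 * (v3 / v2)) <= (4 * K)^-1 * r.
  apply: (@le_trans _ _ (del * (2 * K + 8) * r)); last first.
    by rewrite ler_wpM2r// (le_trans ler01).
  have -> : v1 * b1 * (v3^-1 - v2^-1) + v2 * b2 * (v1^-1 - v3^-1) -
    n%:C * b3 * (v3 / v2) = b1 * (v1 / v3 - v1 / v2) + b2 * (v2 / v1 - v2 / v3)
      - n%:C * b3 * (v3 / v2) by ring.
  have -> : del * (2 * K + 8) * r = 2 * (del * r + del * r) +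
    2 * (del * r + del * r) + K * 2 * (del * r) by ring.
  apply: normcB_le; last by do 2 apply: normcM_le => //; rewrite ?nn.
  by apply: normcD_le; apply: normcM_le => //; exact: normcB_le.
have main : (2 * K)^-1 * r <= normc (n%:C * b3 * (v3 / v1)).
  rewrite !Normc.normcM Normc.normcV nn -/r ler_wpM2r ?(le_trans ler01 r1)//.
  by rewrite invfM mulrC ler_pM// invr_ge0// ltW.
have K4 : (2 * K)^-1 = (4 * K)^-1 + (4 * K)^-1 by field; rewrite gt_eqF.
have Dge : normc b * ((4 * K)^-1 * r) <= normc D.
  rewrite DE Normc.normcM ler_wpM2l ?(ltW b0)//.
  by apply: le_trans (lerB_normcD _ _); move: main; rewrite K4 mulrDl; clear -ratio_le err; lra.
have r0 : 0 < r := lt_le_trans ltr01 r1.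
have E0 : 0 < normc b * ((4 * K)^-1 * r).
  by rewrite mulr_gt0// mulr_gt0// invr_gt0 mulr_gt0.
have vK := ltW K0.
have pKK : 0 < K * K by rewrite mulr_gt0.
have hN1 : normc N1 <= normc b * (M * normc v3).
  have -> : N1 = b * (v2 * b2 * v3^-1 + n%:C * b3 * (v3 * v2^-1) +
      d * (v2 * b2 + n%:C * b3 * v3) + b^-1 * (q * (v3^-1 - v2^-1))).
    by rewrite /N1 /cnum /m2 /m3; field; rewrite v2n v3n bn0.
  rewrite Normc.normcM ler_wpM2l ?(ltW b0)//.
  apply: (@le_trans _ _ (normc v3 * 2 * 1 + K * 2 * (normc v3 * 1) +
    K * (normc v3 * 2 + K * 2 * normc v3) + K * (K * (1 + 1)))).
    apply: normcD_le; last by do 2 apply: normcM_le => //; exact: normcB_le.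
    apply: normcD_le.
      by apply: normcD_le; do 2 apply: normcM_le => //; rewrite ?nn.
    apply: normcM_le => //; apply: normcD_le; first exact: normcM_le.
    by do 2 apply: normcM_le => //; rewrite nn.
  by have := KK2 _ v31; rewrite /M; clear -ratio_le; lra.
have hN2 : normc N2 <= normc b * (M * normc v3).
  have -> : N2 = b * (- (n%:C * b3 * (v3 * v1^-1)) - v1 * b1 * v3^-1 -
      d * (n%:C * b3 * v3 + v1 * b1) + b^-1 * (q * (v1^-1 - v3^-1))).
    by rewrite /N2 /cnum /m1 /m3; field; rewrite v1n v3n bn0.
  rewrite Normc.normcM ler_wpM2l ?(ltW b0)//.
  have v13 := le_trans v12' v23'.
  apply: (@le_trans _ _ (K * 2 * (normc v3 * 1) + normc v3 * 2 * 1 +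
    K * (K * 2 * normc v3 + normc v3 * 2) + K * (K * (1 + 1)))).
    apply: normcD_le; last by do 2 apply: normcM_le => //; exact: normcB_le.
    apply: normcB_le.
      apply: normcB_le; first by rewrite normcN; do 2 apply: normcM_le => //; rewrite ?nn.
      by do 2 apply: normcM_le => //.
    apply: normcM_le => //; apply: normcD_le; last exact: normcM_le.
    by do 2 apply: normcM_le => //; rewrite nn.
  by have := KK2 _ v31; rewrite /M; clear -ratio_le; lra.
have hN3 : normc N3 <= normc b * (M * normc v2).
  have -> : N3 = b * (v1 * b1 * v2^-1 - v2 * b2 * v1^-1 +
      d * (v1 * b1 - v2 * b2) + b^-1 * (q * (v2^-1 - v1^-1))).
    by rewrite /N3 /cnum /m1 /m2; field; rewrite v1n v2n bn0.
  rewrite Normc.normcM ler_wpM2l ?(ltW b0)//.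
  apply: (@le_trans _ _ (normc v2 * 2 * 1 + normc v2 * 2 * 1 +
    K * (normc v2 * 2 + normc v2 * 2) + K * (K * (1 + 1)))).
    apply: normcD_le; last by do 2 apply: normcM_le => //; exact: normcB_le.
    apply: normcD_le; first by apply: normcB_le; do 2 apply: normcM_le => //.
    by apply: normcM_le => //; apply: normcB_le; exact: normcM_le.
  have := KK2 _ v21.
  have : 0 <= (K - 1) * normc v2 by rewrite mulr_ge0// subr_ge0.
  have : 0 <= (K * K - K) * normc v2 by rewrite mulr_ge0// subr_ge0 ler_peMl.
  by rewrite /M; clear -ratio_le; lra.
split.
- by rewrite -normc_gt0 (lt_le_trans E0).
- apply: (ratio_le E0 hN1 Dge); rewrite /r le_eqVlt; apply/orP; left; apply/eqP.
  by field; rewrite !gt_eqF.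
- apply: (ratio_le E0 hN2 Dge); rewrite /r le_eqVlt; apply/orP; left; apply/eqP.
  by field; rewrite !gt_eqF.
- apply: (ratio_le E0 hN3 Dge); rewrite /r le_eqVlt; apply/orP; left; apply/eqP.
  by field; rewrite !gt_eqF.
Qed.

End amplitudes.

(** * Packets as solutions of the system *)

Section incident_symbols.
Context {R : realType} (S : setting R).
Local Notation T := (measurableTypeR R * measurableTypeR R)%type.
Local Notation s := (sin (slope S)).
Local Notation c := (cos (slope S)).
Variables (e K : R).
Hypothesis hchi : C0_infty (chi S).
Hypothesis K1 : 1 <= K.
Hypothesis wave_points : forall k m, supp_Ahat S e (k, m) ->
  omega S k m = omega_plus S k m /\
  wavepoint S K e k m (omega S k m) (criticality S k m).
Local Notation D := (nzAhat S e).

Definition sym_t (z : T) : R[i] := - ('i%C * (omega S z.1 z.2)%:C).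
Definition sym_x (z : T) : R[i] := 'i%C * z.1%:C.
Definition sym_y (z : T) : R[i] := 'i%C * z.2%:C.

Lemma cbounded_real (f : T -> R) (M : R) : measurable_fun D f ->
  (forall z, D z -> `|f z| <= M) -> cbounded D (fun z => (f z)%:C).
Proof.
by move=> mf fM; split; [exact: cmeasurable_real|exists M => z Dz; rewrite normc_real fM].
Qed.

Lemma Ahat_le (M : R) : 0 <= M -> (forall x, `|chi S x| <= M) -> forall k m,
  `|Ahat S e k m| <= e ^- 2 * (2 * M ^+ 2).
Proof.
move=> M0 hM k m; rewrite /Ahat normrM ger0_norm ?invr_ge0 ?sqr_ge0//.
apply: ler_wpM2l; first by rewrite invr_ge0 sqr_ge0.
apply: le_trans (ler_normD _ _) _; rewrite !normrM.
have -> : 2 * M ^+ 2 = M * M + M * M by ring.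
by apply: lerD; apply: ler_pM.
Qed.

Lemma csymbol_Ahat : csymbol D (fun z => (Ahat S e z.1 z.2)%:C).
Proof.
have [M M1 hM] := chi_bounded hchi.
split; last by move=> z /negP; rewrite negbK => /eqP ->.
apply: (@cbounded_real _ (e ^- 2 * (2 * M ^+ 2))).
  by apply: measurable_funTS; exact: measurable_Ahat.
by move=> z _; apply: Ahat_le => //; lra.
Qed.

Let K0 : 0 < K. Proof. by move: K1; lra. Qed.

Lemma wavepoint_neq0 k m : supp_Ahat S e (k, m) ->
  [/\ k != 0, m != 0 & omega S k m != 0].
Proof.
have h (x : R) : K^-1 <= `|x| -> x != 0.
  move=> hx; rewrite -normr_gt0 (lt_le_trans _ hx)// invr_gt0.
  exact: K0.
by move=> /wave_points[_ [/andP[/h-> _] /andP[/h-> _] /andP[/h-> _] _ _]].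
Qed.

Lemma cbounded_k : cbounded D (fun z => z.1%:C).
Proof.
apply: (@cbounded_real _ K) => [|z /nzAhat_supp/wave_points[_ [/andP[]//]]].
by apply: measurable_funTS; exact: measurable_fst.
Qed.

Lemma cbounded_m : cbounded D (fun z => z.2%:C).
Proof.
apply: (@cbounded_real _ K) => [|z /nzAhat_supp/wave_points[_ [_ /andP[]//]]].
by apply: measurable_funTS; exact: measurable_snd.
Qed.

Lemma cmeasurable_km : cmeasurable setT (fun z : T => z.1 +i* z.2).
Proof. by split; [exact: measurable_fst|exact: measurable_snd]. Qed.

Lemma measurable_omega : measurable_fun D (fun z => omega S z.1 z.2).
Proof.
have mp : measurable_fun D (fun z : T => omega_plus S z.1 z.2).
  apply: measurable_funTS; apply: measurable_funM.
    by apply: measurable_funB; apply: measurable_funM.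
  apply: measurable_funV.
  apply: (eq_measurable_fun (fun z : T => normc (z.1 +i* z.2))).
    by move=> z _; rewrite normc_sqrt.
  exact: measurable_normc cmeasurable_km.
by apply: eq_measurable_fun mp => z /[!inE] /nzAhat_supp/wave_points[->].
Qed.

Lemma cbounded_omega : cbounded D (fun z => (omega S z.1 z.2)%:C).
Proof.
apply: (cbounded_real measurable_omega (M := K)).
by move=> z /nzAhat_supp/wave_points[_ [_ _ /andP[]//]].
Qed.

Lemma cboundedV (f : T -> R) : measurable_fun D f ->
  (forall z, D z -> K^-1 <= `|f z|) -> cbounded D (fun z => ((f z)^-1)%:C).
Proof.
move=> mf fK; apply: (@cbounded_real _ K); first exact: measurable_funV.
move=> z /fK h; rewrite normfV -(invrK K) lef_pV2 ?posrE ?invr_gt0//.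
by apply: lt_le_trans h; rewrite invr_gt0.
Qed.

Lemma cbounded_mV : cbounded D (fun z => (z.2^-1)%:C).
Proof.
apply: (@cboundedV (fun z => z.2)) => [|z /nzAhat_supp/wave_points[_ [_ /andP[]//]]].
by apply: measurable_funTS; exact: measurable_snd.
Qed.

Lemma cbounded_kV : cbounded D (fun z => (z.1^-1)%:C).
Proof.
apply: (@cboundedV (fun z => z.1)) => [|z /nzAhat_supp/wave_points[_ [/andP[]//]]].
by apply: measurable_funTS; exact: measurable_fst.
Qed.

Lemma cbounded_omegaV : cbounded D (fun z => ((omega S z.1 z.2)^-1)%:C).
Proof.
apply: (cboundedV measurable_omega).
by move=> z /nzAhat_supp/wave_points[_ [_ _ /andP[]//]].
Qed.

Lemma cbounded_sym_t : cbounded D sym_t.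
Proof. by apply/cboundedN/cboundedM; [exact: cbounded_cst|exact: cbounded_omega]. Qed.

Lemma cbounded_sym_x : cbounded D sym_x.
Proof. by apply: cboundedM; [exact: cbounded_cst|exact: cbounded_k]. Qed.

Lemma cbounded_sym_y : cbounded D sym_y.
Proof. by apply: cboundedM; [exact: cbounded_cst|exact: cbounded_m]. Qed.

Lemma eq_cbounded (f g : T -> R[i]) : f =1 g -> cbounded D f -> cbounded D g.
Proof. by move=> /funext ->. Qed.

Definition inc_w (z : T) : R[i] := (- (z.1 / z.2))%:C.

Definition inc_p (z : T) : R[i] :=
  ((omega S z.1 z.2 + s * (z.1 * c - z.2 * s) / (z.2 * omega S z.1 z.2)) / z.1)%:C.

Lemma cbounded_inc_w : cbounded D inc_w.
Proof.
apply: (@eq_cbounded (fun z => - (z.1%:C * (z.2^-1)%:C))).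
  by move=> z; rewrite /inc_w !rmorphN/= rmorphM.
by apply/cboundedN/cboundedM; [exact: cbounded_k|exact: cbounded_mV].
Qed.

Lemma inc_bE k m : inc_b S k m =
  'i%C * (k%:C * c%:C - m%:C * s%:C) * ((m^-1)%:C * ((omega S k m)^-1)%:C).
Proof.
by rewrite /inc_b rmorphB/= !rmorphM/= !fmorphV/= invfM.
Qed.

Let cst_bounded (a : R[i]) : cbounded D (fun=> a).
Proof. exact: cbounded_cst. Qed.

Lemma cbounded_inc_b : cbounded D (fun z => inc_b S z.1 z.2).
Proof.
apply: (eq_cbounded (fun z => esym (inc_bE z.1 z.2))).
have mV := cbounded_mV; have wV := cbounded_omegaV.
apply: cboundedM; last exact: cboundedM.
apply: cboundedM => //; apply: cboundedD; last apply: cboundedN.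
  by apply: cboundedM => //; exact: cbounded_k.
by apply: cboundedM => //; exact: cbounded_m.
Qed.

Lemma inc_pE z : inc_p z = ((omega S z.1 z.2)%:C + s%:C *
  (z.1%:C * c%:C - z.2%:C * s%:C) * ((z.2^-1)%:C * ((omega S z.1 z.2)^-1)%:C)) *
  (z.1^-1)%:C.
Proof.
by rewrite /inc_p invfM !rmorphM/= rmorphD/= !rmorphM/= rmorphB/= !rmorphM/= !mulrA.
Qed.

Lemma cbounded_inc_p : cbounded D inc_p.
Proof.
apply: (eq_cbounded (fun z => esym (inc_pE z))).
have mV := cbounded_mV; have wV := cbounded_omegaV.
apply: cboundedM; last exact: cbounded_kV.
apply: cboundedD; first exact: cbounded_omega.
apply: cboundedM; last exact: cboundedM.
apply: cboundedM => //; apply: cboundedD; last apply: cboundedN.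
  by apply: cboundedM => //; exact: cbounded_k.
by apply: cboundedM => //; exact: cbounded_m.
Qed.

Local Notation Ah := (fun z : T => (Ahat S e z.1 z.2)%:C).
Local Notation pk := (packet sym_t sym_x sym_y).

Lemma W_incE : W_inc S e =
  Wave (pk (fun z => Ah z * 1)) (pk (fun z => Ah z * inc_w z))
       (pk (fun z => Ah z * inc_b S z.1 z.2)).
Proof.
have h k m t x y : inc_phase S k m t x y =
    cexp (sym_t (k, m) * t%:C + sym_x (k, m) * x%:C + sym_y (k, m) * y%:C).
  rewrite /inc_phase; congr cexp.
  by rewrite /sym_t /sym_x /sym_y/= !rmorphD/= !rmorphM/= rmorphN/=; ring.
congr Wave; do 3 apply/funext => ?; congr cintegral2; apply/funext => -[k m];
  by rewrite /packet_integrand h.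
Qed.

Lemma inviscid_u k m : supp_Ahat S e (k, m) ->
  sym_t (k, m) - inc_b S k m * s%:C + inc_p (k, m) * sym_x (k, m) = 0.
Proof.
move=> /wavepoint_neq0[k0 m0 w0]; rewrite inc_bE inc_pE /sym_t /sym_x/=.
rewrite !fmorphV/=.
have kC : k%:C != 0 :> R[i] by rewrite fmorph_eq0.
have mC : m%:C != 0 :> R[i] by rewrite fmorph_eq0.
have wC : (omega S k m)%:C != 0 :> R[i] by rewrite fmorph_eq0.
by field; rewrite kC mC wC.
Qed.

(** The one equation that needs the inviscid dispersion relation
    [w ^ 2 (k ^ 2 + m ^ 2) = (k c - m s) ^ 2]. *)
Lemma inviscid_w k m : supp_Ahat S e (k, m) ->
  inc_w (k, m) * sym_t (k, m) - inc_b S k m * c%:C + inc_p (k, m) * sym_y (k, m) = 0.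
Proof.
move=> km; have [k0 m0 w0] := wavepoint_neq0 km.
have [_ [_ _ _ _ [_ /(congr1 (real_complex R))]]] := wave_points km.
rewrite rmorphM rmorphD !rmorphXn rmorphB !rmorphM/= => dr.
rewrite inc_bE inc_pE /inc_w /sym_t /sym_y/= rmorphN/= rmorphM/= !fmorphV/=.
have kC : k%:C != 0 :> R[i] by rewrite fmorph_eq0.
have mC : m%:C != 0 :> R[i] by rewrite fmorph_eq0.
have wC : (omega S k m)%:C != 0 :> R[i] by rewrite fmorph_eq0.
set w := (omega S k m)%:C in dr wC *.
transitivity ('i%C * (w ^+ 2 * (k%:C ^+ 2 + m%:C ^+ 2) -
   (k%:C * c%:C - m%:C * s%:C) ^+ 2) / (k%:C * m%:C * w)); last first.
  by rewrite dr subrr mulr0 mul0r.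
by field; rewrite kC mC wC.
Qed.

Lemma inviscid_b k m : supp_Ahat S e (k, m) ->
  inc_b S k m * sym_t (k, m) + s%:C + inc_w (k, m) * c%:C = 0.
Proof.
move=> km; have [k0 m0 w0] := wavepoint_neq0 km.
rewrite inc_bE /inc_w /sym_t/= rmorphN/= rmorphM/= !fmorphV/=.
have mC : m%:C != 0 :> R[i] by rewrite fmorph_eq0.
have wC : (omega S k m)%:C != 0 :> R[i] by rewrite fmorph_eq0.
have i2 : ('i%C : R[i]) * 'i%C = -1 by rewrite sqri.
set w := (omega S k m)%:C in wC *.
transitivity (('i%C * 'i%C + 1) * (- (k%:C * c%:C - m%:C * s%:C)) / m%:C); last first.
  by rewrite i2 addNr !mul0r.
by field; rewrite mC wC.
Qed.

Lemma inviscid_div k m : supp_Ahat S e (k, m) ->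
  sym_x (k, m) + inc_w (k, m) * sym_y (k, m) = 0.
Proof.
move=> /wavepoint_neq0[k0 m0 w0].
rewrite /inc_w /sym_x /sym_y/= rmorphN/= rmorphM/= fmorphV/=.
have mC : m%:C != 0 :> R[i] by rewrite fmorph_eq0.
by field.
Qed.

(** Symbol of [- a] times the Laplacian of a component: what a solution of the inviscid system
    leaves over in the viscous one. *)
Definition remainder (a : R) (G : T -> R[i]) (z : T) : R[i] :=
  Ah z * G z * (- a%:C * (sym_x z ^+ 2 + sym_y z ^+ 2)).

Definition W_rem : wave R :=
  Wave (pk (remainder (nu S e) (fun=> 1))) (pk (remainder (nu S e) inc_w))
       (pk (remainder (kappa S e) (fun z => inc_b S z.1 z.2))).

Lemma csymbol_remainder a G : cbounded D G -> csymbol D (remainder a G).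
Proof.
move=> bG; apply: csymbolM; first by apply: csymbolM => //; exact: csymbol_Ahat.
have bx := cbounded_sym_x; have b_y := cbounded_sym_y.
apply: cboundedM => //; apply: cboundedD.
  apply: (@eq_cbounded (fun z => sym_x z * sym_x z)) => [z|]; last exact: cboundedM.
  by rewrite expr2.
apply: (@eq_cbounded (fun z => sym_y z * sym_y z)) => [z|]; last exact: cboundedM.
by rewrite expr2.
Qed.

Hypothesis D_fin : (leb2 D < +oo)%E.

Lemma Ahat_supp_eq0 (z : T) (G : R[i]) : (supp_Ahat S e (z.1, z.2) -> G = 0) ->
  Ah z * G = 0.
Proof.
move=> h; have [/= ->|nz] := eqVneq (Ahat S e z.1 z.2) 0; first by rewrite mul0r.
by rewrite h ?mulr0//; apply: nzAhat_supp.
Qed.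

Lemma incident_system : smooth_system (slope S) (nu S e) (kappa S e)
  (W_inc S e) (pk (fun z => Ah z * inc_p z)) W_rem.
Proof.
have sA := csymbol_Ahat; have b1 := cst_bounded 1.
have bw := cbounded_inc_w; have bb := cbounded_inc_b.
rewrite W_incE.
apply: (packet_system (measurable_nzAhat hchi e) D_fin cbounded_sym_t
  cbounded_sym_x cbounded_sym_y).
- exact: csymbolM.
- exact: csymbolM.
- exact: csymbolM.
- by apply: csymbolM => //; exact: cbounded_inc_p.
- exact: csymbol_remainder.
- exact: csymbol_remainder.
- exact: csymbol_remainder.
- move=> z; transitivity (Ah z * (sym_t z - inc_b S z.1 z.2 * s%:C + inc_p z * sym_x z)).
    ring.
  rewrite Ahat_supp_eq0; first by rewrite /remainder; ring.
  by move=> /inviscid_u; case: z.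
- move=> z; transitivity (Ah z * (inc_w z * sym_t z - inc_b S z.1 z.2 * c%:C +
    inc_p z * sym_y z)); first ring.
  rewrite Ahat_supp_eq0; first by rewrite /remainder; ring.
  by move=> /inviscid_w; case: z.
- move=> z; transitivity (Ah z * (inc_b S z.1 z.2 * sym_t z + s%:C + inc_w z * c%:C)).
    ring.
  rewrite Ahat_supp_eq0; first by rewrite /remainder; ring.
  by move=> /inviscid_b; case: z.
- move=> z; transitivity (Ah z * (sym_x z + inc_w z * sym_y z)); first ring.
  by rewrite Ahat_supp_eq0// => /inviscid_div; case: z.
Qed.

(** The factor in time has modulus 1 and is absorbed into the amplitude; this is why the L2 bounds
    are uniform in [t]. *)
Lemma packet_fourier G t x y : pk G t x y =
  fourier (fun z => G z * cexp (sym_t z * t%:C)) (x, y).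
Proof.
congr cintegral2; apply/funext => -[k m]; rewrite /packet_integrand -mulrA -cexpD.
by congr (_ * cexp _); rewrite /sym_x /sym_y/= rmorphD/= !rmorphM/=; ring.
Qed.

Lemma normc_phase_t z (t : R) : normc (cexp (sym_t z * t%:C)) = 1.
Proof. by rewrite normc_cexp /sym_t !(Re_mulc, Im_mulc, Re_oppc, Im_oppc)/= -expR0; congr expR; ring. Qed.

Variables (b M L : R).
Hypothesis b_gt0 : 0 < b.
Hypothesis Db : D `<=` `[- b, b]%classic `*` `[- b, b]%classic.
Hypothesis chiM : 0 <= M /\ forall x, `|chi S x| <= M.
Hypothesis e_gt0 : 0 < e.
Hypothesis DL : 0 <= L /\ fine (leb2 D) <= L * e ^+ 4.

(** The Plancherel bound is quadratic; [|X| <= (1 + |X|) ^ 2] spares a square root in the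
    constant. *)
Let C0 : R := (4 * M ^+ 2 * K ^+ 2) * (1 + `|4 * plancherel_cst * L|).

Lemma remainder_L2 (a : R) (G : T -> R[i]) (g t : R) : 0 <= a -> 0 <= g ->
  cbounded D G -> (forall z, D z -> normc (G z) <= g) ->
  cmeasurable setT (fun z : T => pk (remainder a G) t z.1 z.2) /\
  (\int[leb2]_z (normc (pk (remainder a G) t z.1 z.2) ^+ 2)%:E <=
   ((C0 * g * a) ^+ 2)%:E)%E.
Proof.
move=> a0 g0 bG Gg; have [M0 hM] := chiM; have [L0 hL] := DL.
have mD := measurable_nzAhat hchi e.
pose H z := remainder a G z * cexp (sym_t z * t%:C).
have sH : csymbol D H.
  apply: csymbolM; first exact: csymbol_remainder.
  by apply: cbounded_expM; exact: cbounded_sym_t.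
pose N := e ^- 2 * (4 * M ^+ 2 * K ^+ 2) * g * a.
have N0 : 0 <= N.
  by rewrite /N !mulr_ge0// ?invr_ge0 ?sqr_ge0// ?exprn_ge0 // ltW.
have HN z : D z -> normc (H z) <= N.
  move=> Dz; rewrite /H /remainder !Normc.normcM normc_phase_t mulr1 normcN !normc_real.
  rewrite (ger0_norm a0).
  have -> : N = e ^- 2 * (2 * M ^+ 2) * g * (a * (2 * K ^+ 2)) by rewrite /N; ring.
  apply: ler_pM; rewrite ?mulr_ge0 ?normc_ge0//.
    by apply: ler_pM; rewrite ?normc_ge0 ?Gg//; exact: Ahat_le.
  apply: ler_wpM2l => //; rewrite /sym_x /sym_y.
  have [_ [/andP[_ hk] /andP[_ hm] _ _ _]] := wave_points (nzAhat_supp Dz).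
  apply: le_trans (ler_normcD _ _) _; rewrite !normcX !Normc.normcM normc_i !mul1r !normc_real.
  have -> : 2 * K ^+ 2 = K ^+ 2 + K ^+ 2 by ring.
  by apply: lerD; apply: lerXn2r; rewrite ?nnegrE// ltW.
have e1 : (fun z : T => pk (remainder a G) t z.1 z.2) = fourier H.
  by apply/funext => -[x y]; rewrite packet_fourier.
split; first by rewrite e1; exact: (measurable_fourier mD b_gt0 Db sH N0 HN).
have -> : (fun z : T => (normc (pk (remainder a G) t z.1 z.2) ^+ 2)%:E) =
  (fun z : T => (normc (fourier H z) ^+ 2)%:E) by rewrite -e1.
apply: le_trans (plancherel_le mD b_gt0 Db sH N0 HN) _; rewrite lee_fin.
set X := 4 * plancherel_cst * L.
have pc : 4 * plancherel_cst * fine (leb2 D) <= `|X| * e ^+ 4.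
  have f0 : 0 <= fine (leb2 D) by rewrite fine_ge0.
  apply: le_trans (ler_norm _) _; rewrite normrM (ger0_norm f0).
  apply: le_trans (ler_wpM2l (normr_ge0 _) hL) _.
  by rewrite /X [`|_ * L|]normrM (ger0_norm L0) mulrA.
have -> : 4 * plancherel_cst * (N ^+ 2 * fine (leb2 D)) =
  N ^+ 2 * (4 * plancherel_cst * fine (leb2 D)) by ring.
apply: le_trans (ler_wpM2l (sqr_ge0 _) pc) _.
pose Y := 4 * M ^+ 2 * K ^+ 2 * g * a.
have -> : N ^+ 2 * (`|X| * e ^+ 4) = Y ^+ 2 * `|X|.
  by rewrite /N /Y; field; exact: lt0r_neq0.
have -> : (C0 * g * a) ^+ 2 = Y ^+ 2 * (1 + `|X|) ^+ 2 by rewrite /C0 -/X /Y; ring.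
by apply: ler_wpM2l; rewrite ?sqr_ge0//; have := normr_ge0 X; nra.
Qed.

End incident_symbols.

Section incident_remainder.
Context {R : realType} (S : setting R).
Local Notation T := (measurableTypeR R * measurableTypeR R)%type.
Hypothesis hgamma : 0 < slope S < pi / 2.
Hypothesis hchi : C0_infty (chi S).
Hypothesis hwave : admissible_wavenumber S.
Hypothesis hcrit : near_critical S.
Hypothesis nu_ge0 : \forall e \near 0^'+, 0 <= nu S e.
Hypothesis kappa_ge0 : \forall e \near 0^'+, 0 <= kappa S e.

Lemma inc_symbols_le (K e k m : R) : 1 <= K ->
  wavepoint S K e k m (omega S k m) (criticality S k m) ->
  normc (inc_w (k, m)) <= 2 * K ^+ 3 /\ normc (inc_b S k m) <= 2 * K ^+ 3.
Proof.
move=> K1 [/andP[_ kK] /andP[mK' mK] /andP[wK' wK] _ _].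
have K0 : 0 < K by lra.
have inv_le (x : R) : K^-1 <= `|x| -> `|x|^-1 <= K.
  move=> hx; rewrite -(invrK K) lef_pV2 ?posrE ?invr_gt0//.
  by apply: lt_le_trans hx; rewrite invr_gt0.
have mV := inv_le _ mK'; have wV := inv_le _ wK'.
have KK : K * K <= K ^+ 3 by rewrite exprS -expr2 ler_peMl ?sqr_ge0.
split.
  rewrite /inc_w normc_real /= normrN normrM normfV.
  apply: (@le_trans _ _ (K * K)); first by apply: ler_pM => //; rewrite invr_ge0.
  by apply: le_trans KK _; have := exprn_ge0 3 (ltW K0); lra.
rewrite /inc_b Normc.normcM Normc.normcV Normc.normcM normc_i mul1r !normc_real.
rewrite normrM invfM.
have -> : 2 * K ^+ 3 = 2 * K * (K * K) by ring.
apply: ler_pM; rewrite ?mulr_ge0 ?invr_ge0//.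
  apply: le_trans (ler_normB _ _) _; rewrite !normrM.
  have -> : 2 * K = K * 1 + K * 1 by ring.
  apply: lerD; apply: ler_pM => //.
    by rewrite ler_norml cos_geN1 cos_le1.
  by rewrite ler_norml sin_geN1 sin_le1.
by apply: ler_pM => //; rewrite invr_ge0.
Qed.

Let uniform_bound : exists2 C : R, 0 <= C & \forall e \near 0^'+, forall t,
  let r := W_rem S e in
  let small F a := cmeasurable setT (fun z : T => F t z.1 z.2) /\
    (\int[leb2]_z (normc (F t z.1 z.2) ^+ 2)%:E <= ((C * a) ^+ 2)%:E)%E in
  [/\ small (u_ r) (nu S e), small (w_ r) (nu S e) & small (b_ r) (kappa S e)].
Proof.
have [K K1 hK] := wavepoint_near hgamma hchi hwave hcrit.
have [L L0 hL] := leb2_nzAhat hchi hwave.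
have [M M1 hM] := chi_bounded hchi.
have K0 : 0 < K by lra.
pose C0 := (4 * M ^+ 2 * K ^+ 2) * (1 + `|4 * plancherel_cst * L|).
have C00 : 0 <= C0.
  rewrite /C0 mulr_ge0 ?addr_ge0// mulr_ge0 ?sqr_ge0//.
  by rewrite mulr_ge0 ?sqr_ge0.
have K3 : 0 <= 2 * K ^+ 3 by rewrite mulr_ge0// exprn_ge0// ltW.
have K31 : 1 <= 2 * K ^+ 3.
  by have := exprn_ege1 3 K1; lra.
exists (C0 * (2 * K ^+ 3)); first exact: mulr_ge0.
near=> e => t /=.
have wp : forall k m, supp_Ahat S e (k, m) -> omega S k m = omega_plus S k m /\
    wavepoint S K e k m (omega S k m) (criticality S k m) by near: e.
have [b b0 [Db DL]] : exists2 b : R, 0 < b &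
    nzAhat S e `<=` `[- b, b]%classic `*` `[- b, b]%classic /\
    fine (leb2 (nzAhat S e)) <= L * e ^+ 4 by near: e.
have e0 : 0 < e by near: e; exact: nbhs_right_gt.
have n0 : 0 <= nu S e by near: e.
have ka0 : 0 <= kappa S e by near: e.
have M0 : 0 <= M by lra.
have rem a G : 0 <= a -> cbounded (nzAhat S e) G ->
    (forall z, nzAhat S e z -> normc (G z) <= 2 * K ^+ 3) ->
    cmeasurable setT (fun z : T => packet (sym_t S) sym_x sym_y (remainder S e a G) t z.1 z.2) /\
    (\int[leb2]_z (normc (packet (sym_t S) sym_x sym_y (remainder S e a G) t z.1 z.2) ^+ 2)%:E
       <= ((C0 * (2 * K ^+ 3) * a) ^+ 2)%:E)%E.
  move=> a0 bG Gg.
  exact: (remainder_L2 hchi K1 wp b0 Db (conj M0 hM) e0 (conj (ltW L0) DL) t a0 K3 bG Gg).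
split; apply: rem => //.
- exact: cbounded_cst.
- by move=> z _; rewrite -(rmorph1 (real_complex R)) normc_real normr1.
- exact: (cbounded_inc_w K1 wp).
- by move=> -[k m] /nzAhat_supp/wp[_ /(inc_symbols_le K1)[]].
- exact: (cbounded_inc_b K1 wp).
- by move=> -[k m] /nzAhat_supp/wp[_ /(inc_symbols_le K1)[]].
Unshelve. all: by end_near. Qed.

Let comp_L2_bigO (f : wave R -> field R) (g : R -> R) (C : R) : 0 <= C ->
  (\forall e \near 0^'+, 0 <= g e) ->
  (\forall e \near 0^'+, forall t,
    cmeasurable setT (fun z : T => f (W_rem S e) t z.1 z.2) /\
    (\int[leb2]_z (normc (f (W_rem S e) t z.1 z.2) ^+ 2)%:E <=
      ((C * g e) ^+ 2)%:E)%E) ->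
  L2_bigO (fun e => f (W_rem S e)) g.
Proof.
move=> C0 g0 h; exists C; near=> e => t.
have ge0 : 0 <= g e by near: e.
have [mf fle] : cmeasurable setT (fun z : T => f (W_rem S e) t z.1 z.2) /\
    (\int[leb2]_z (normc (f (W_rem S e) t z.1 z.2) ^+ 2)%:E <=
      ((C * g e) ^+ 2)%:E)%E by move: t; near: e.
split.
- exact: measurable_funTS mf.1.
- exact: measurable_funTS mf.2.
- apply: L2norm_le fle; first exact: measurable_normc.
  exact: mulr_ge0.
Unshelve. all: by end_near. Qed.

Lemma remainder_bigO :
  [/\ L2_bigO (fun e => u_ (W_rem S e)) (nu S),
      L2_bigO (fun e => w_ (W_rem S e)) (nu S),
      L2_bigO (fun e => b_ (W_rem S e)) (kappa S) &
      wave_L2_bigO (W_rem S) (fun e => nu S e + kappa S e)].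
Proof.
have [C C0 h] := uniform_bound; split.
- apply: (comp_L2_bigO C0 nu_ge0); near=> e => t.
  by have [] := near h e _ t.
- apply: (comp_L2_bigO C0 nu_ge0); near=> e => t.
  by have [] := near h e _ t.
- apply: (comp_L2_bigO C0 kappa_ge0); near=> e => t.
  by have [] := near h e _ t.
exists (2 * C); apply: filterS3 nu_ge0 kappa_ge0 h => e n0 k0 h t.
have [] := h t.
set u := fun z : T => u_ (W_rem S e) t z.1 z.2.
set w := fun z : T => w_ (W_rem S e) t z.1 z.2.
set b := fun z : T => b_ (W_rem S e) t z.1 z.2.
move=> [mu hu] [mw hw] [mb hb].
have mu2 : measurable_fun setT (fun z => normc (u z) ^+ 2).
  exact: (measurable_funX 2 (measurable_normc mu)).
have mw2 : measurable_fun setT (fun z => normc (w z) ^+ 2).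
  exact: (measurable_funX 2 (measurable_normc mw)).
have mb2 : measurable_fun setT (fun z => normc (b z) ^+ 2).
  exact: (measurable_funX 2 (measurable_normc mb)).
have q0 z : 0 <= normc (u z) ^+ 2 + normc (w z) ^+ 2 + normc (b z) ^+ 2.
  by rewrite !addr_ge0 ?sqr_ge0.
apply: (@L2norm_le _ (fun z => Num.sqrt (normc (u z) ^+ 2 + normc (w z) ^+ 2 + normc (b z) ^+ 2))).
- apply: (eq_measurable_fun (fun z : T => (normc (u z) ^+ 2 + normc (w z) ^+ 2 +
     normc (b z) ^+ 2) `^ (2^-1))).
    by move=> z _; rewrite powR12_sqrt// q0.
  apply: (@measurableT_comp _ _ _ _ _ _ (@powR R ^~ (2^-1))).
    exact: measurable_powR.
  exact: (measurable_funD (measurable_funD mu2 mw2) mb2).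
- by rewrite mulr_ge0 ?addr_ge0 ?mulr_ge0.
have -> : (\int[leb2]_z (Num.sqrt (normc (u z) ^+ 2 + normc (w z) ^+ 2 +
    normc (b z) ^+ 2) ^+ 2)%:E = \int[leb2]_z (normc (u z) ^+ 2)%:E +
    \int[leb2]_z (normc (w z) ^+ 2)%:E + \int[leb2]_z (normc (b z) ^+ 2)%:E)%E.
  have p0 (F : T -> R[i]) : forall z : T, setT z -> (0 <= (normc (F z) ^+ 2)%:E)%E.
    by move=> z _; rewrite lee_fin sqr_ge0.
  have m2 (F : T -> R[i]) : measurable_fun setT (fun z => normc (F z) ^+ 2) ->
      measurable_fun setT (fun z : T => (normc (F z) ^+ 2)%:E).
    by move=> mF; exact/measurable_EFinP.
  rewrite -(ge0_integralD leb2 measurableT (p0 u) (m2 u mu2) (p0 w) (m2 w mw2)).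
  have p1 : forall z : T, setT z ->
      (0 <= (normc (u z) ^+ 2)%:E + (normc (w z) ^+ 2)%:E)%E.
    by move=> z _; rewrite -EFinD lee_fin addr_ge0 ?sqr_ge0.
  have m1 := emeasurable_funD (m2 u mu2) (m2 w mw2).
  rewrite -(ge0_integralD leb2 measurableT p1 m1 (p0 b) (m2 b mb2)).
  by apply: eq_integral => z _; rewrite -!EFinD sqr_sqrtr.
apply: le_trans (leeD (leeD hu hw) hb) _.
rewrite -!EFinD lee_fin.
set n := nu S e in n0 *; set k := kappa S e in k0 *.
have -> : (2 * C * (n + k)) ^+ 2 = (C * n) ^+ 2 + (C * n) ^+ 2 + (C * k) ^+ 2 +
  C ^+ 2 * (2 * n * n + 3 * k * k + 8 * n * k) by ring.
by rewrite lerDl !(addr_ge0, mulr_ge0, sqr_ge0).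
Unshelve. all: by end_near. Qed.

Lemma wave_L2_bigO_le (W : R -> wave R) (g h : R -> R) (C : R) :
  (\forall e \near 0^'+, 0 <= g e <= C * h e) ->
  wave_L2_bigO W g -> wave_L2_bigO W h.
Proof.
move=> gh [C1 hC1]; exists (`|C1| * C); apply: filterS2 gh hC1 => e /andP[g0 gC] hC t.
apply: le_trans (hC t) _.
rewrite lee_fin -mulrA; apply: (@le_trans _ _ (`|C1| * g e)).
  by apply: ler_wpM2r => //; exact: ler_norm.
exact: ler_wpM2l.
Qed.

End incident_remainder.

(** * Boundary layer packets *)

Section layer_packets.
Context {R : realType} (S : setting R).
Local Notation T := (measurableTypeR R * measurableTypeR R)%type.
Local Notation s := (sin (slope S)).
Local Notation c := (cos (slope S)).
Implicit Types (lam a : R -> R -> R -> R[i]).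

(** The bound [M] may depend on [e]: it serves integrability at a fixed [e], while the estimates
    uniform in [e] are kept apart. *)
Definition layer e lam :=
  cmeasurable (nzAhat S e) (fun z : T => lam e z.1 z.2) /\
  exists2 M : R, 0 < M & forall k m, supp_Ahat S e (k, m) ->
    [/\ M^-1 <= Re (lam e k m), normc (lam e k m) <= M &
        dispersion_relation S e k (omega S k m) (lam e k m)].

(** The dispersion relation trades the denominator [i w + kappa d], for which no lower bound is at
    hand, for [lam (s lam + i k c)], which is bounded below through [Re lam]. This form also serves
    the fast mode when [kappa < nu]. *)
Lemma bl_b_conj e k m (l : R[i]) : 0 < s -> 0 < Re l ->
  dispersion_relation S e k (omega S k m) l ->
  bl_b S e k m l = - ('i%C * (omega S k m)%:C + (nu S e)%:C * (l ^+ 2 - (k ^+ 2)%:C)) *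
    (l ^+ 2 - (k ^+ 2)%:C) * (l^-1 * (s%:C * l + 'i%C * k%:C * c%:C)^-1).
Proof.
move=> s0 Rl disp.
have l0 := mode_lam_neq0 Rl; have n0 := mode_numerator_neq0 k s0 Rl.
have d0 := mode_denominator_neq0 s0 Rl disp.
rewrite /bl_b; apply: (canLR (mulfK d0)).
move: disp; rewrite /dispersion_relation/=.
set d := l ^+ 2 - _; set n := _ + 'i%C * k%:C * c%:C in n0 *.
have -> : 'i%C * (omega S k m)%:C - (kappa S e)%:C * ((k ^+ 2)%:C - l ^+ 2) =
  'i%C * (omega S k m)%:C + (kappa S e)%:C * d by rewrite /d; ring.
set X := _ + (nu S e)%:C * d; set Y := _ + (kappa S e)%:C * d => disp.
have -> : s%:C + 'i%C * k%:C * l^-1 * c%:C = n / l by rewrite /n; field.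
have nE : n ^+ 2 = - (X * Y * d) by apply/eqP; rewrite -addr_eq0 addrC disp.
apply: (mulfI l0); apply: (mulfI n0).
transitivity (n ^+ 2); first by field.
by rewrite nE; field; rewrite n0 l0.
Qed.

Variables (e K : R).
Hypothesis hgamma : 0 < slope S < pi / 2.
Hypothesis hchi : C0_infty (chi S).
Hypothesis K1 : 1 <= K.
Hypothesis wave_points : forall k m, supp_Ahat S e (k, m) ->
  omega S k m = omega_plus S k m /\
  wavepoint S K e k m (omega S k m) (criticality S k m).
Local Notation D := (nzAhat S e).
Local Notation Ah := (fun z : T => (Ahat S e z.1 z.2)%:C).
Hypothesis D_fin : (leb2 D < +oo)%E.

Lemma eq_cbounded_in (f g : T -> R[i]) : (forall z, D z -> f z = g z) ->
  cbounded D f -> cbounded D g.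
Proof.
move=> fg [mf [M fM]]; split; first exact: eq_cmeasurable mf.
by exists M => z Dz; rewrite -fg// fM.
Qed.

Lemma cbounded_inv (f : T -> R[i]) (r : R) : 0 < r -> cmeasurable D f ->
  (forall z, D z -> r <= normc (f z)) -> cbounded D (fun z => (f z)^-1).
Proof.
move=> r0 mf fr; split; first exact: cmeasurableV.
exists r^-1 => z Dz; rewrite Normc.normcV lef_pV2 ?posrE ?fr//.
exact: lt_le_trans (fr z Dz).
Qed.

Variables (lam a : R -> R -> R -> R[i]).
Hypothesis hlam : layer e lam.
Hypothesis ba : cbounded D (fun z : T => a e z.1 z.2).
Local Notation l := (fun z : T => lam e z.1 z.2).

Let cst_bounded (x : R[i]) : cbounded D (fun=> x).
Proof. exact: cbounded_cst. Qed.

Lemma layer_Re k m : supp_Ahat S e (k, m) -> 0 < Re (lam e k m).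
Proof.
have [_ [M M0 h]] := hlam; move=> /h[hM _ _]; apply: lt_le_trans hM.
by rewrite invr_gt0.
Qed.

Lemma layer_dispersion k m : supp_Ahat S e (k, m) ->
  dispersion_relation S e k (omega S k m) (lam e k m).
Proof. by have [_ [M M0 h]] := hlam; move=> /h[]. Qed.

Lemma layer_bl_root k m : supp_Ahat S e (k, m) -> bl_root S e k m (lam e k m).
Proof.
move=> km; have [k0 _ _] := wavepoint_neq0 K1 wave_points km.
exact: (dispersion_bl_root (sin_slope_gt0 hgamma) k0 (layer_Re km) (layer_dispersion km)).
Qed.

Lemma cbounded_lam : cbounded D l.
Proof.
have [ml [M M0 h]] := hlam; split => //; exists M => z /nzAhat_supp.
by move=> /h[].
Qed.

Lemma cbounded_lamV : cbounded D (fun z => (l z)^-1).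
Proof.
have [ml [M M0 h]] := hlam; apply: (@cbounded_inv _ M^-1) => //.
  by rewrite invr_gt0.
move=> z /nzAhat_supp/h[hM _ _]; apply: le_trans hM _.
by apply: le_trans (ler_norm _) _; exact: ler_Re_normc.
Qed.

Lemma cbounded_bl_w : cbounded D (fun z => bl_w z.1 (l z)).
Proof.
apply: cboundedM; last exact: cbounded_lamV.
by apply: cboundedM => //; exact: cbounded_k wave_points.
Qed.

Lemma cbounded_bl_b : cbounded D (fun z => bl_b S e z.1 z.2 (l z)).
Proof.
have s0 := sin_slope_gt0 hgamma.
apply: (@eq_cbounded_in (fun z => - ('i%C * (omega S z.1 z.2)%:C +
    (nu S e)%:C * (l z * l z - z.1%:C * z.1%:C)) *
    (l z * l z - z.1%:C * z.1%:C) *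
    ((l z)^-1 * (s%:C * l z + 'i%C * z.1%:C * c%:C)^-1))).
  move=> z /nzAhat_supp km; rewrite (bl_b_conj s0 (layer_Re km) (layer_dispersion km)).
  by rewrite rmorphXn/= !expr2.
have bl := cbounded_lam; have blV := cbounded_lamV.
have bk := cbounded_k wave_points.
have bd : cbounded D (fun z => l z * l z - z.1%:C * z.1%:C).
  by apply: cboundedD; [exact: cboundedM|apply/cboundedN/cboundedM].
apply: cboundedM.
  apply: cboundedM => //; apply/cboundedN/cboundedD; last exact: cboundedM.
  by apply: cboundedM => //; exact: cbounded_omega wave_points.
apply: cboundedM => //.
have [_ [M M0 h]] := hlam; apply: (@cbounded_inv _ (s / M)).
- exact: divr_gt0.
- have [] : cbounded D (fun z => s%:C * l z + 'i%C * z.1%:C * c%:C) => //.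
  by apply: cboundedD; repeat apply: cboundedM.
move=> z /nzAhat_supp/h[hM _ _]; apply: (@le_trans _ _ (s * Re (l z))).
  by apply: ler_wpM2l => //; exact: ltW.
apply: le_trans (ler_Re_normc _); apply: le_trans (ler_norm _).
by rewrite Re_addc !Re_mulc/=; lra.
Qed.

Lemma cbounded_bl_p : cbounded D (fun z => bl_p S e z.1 z.2 (l z)).
Proof.
have bl := cbounded_lam; have bk := cbounded_k wave_points.
apply: (@eq_cbounded_in (fun z => ((nu S e)%:C * (l z * l z - z.1%:C * z.1%:C) +
  'i%C * (omega S z.1 z.2)%:C + bl_b S e z.1 z.2 (l z) * s%:C) *
  ('i%C^-1 * (z.1^-1)%:C))).
  by move=> z _; rewrite /bl_p invfM fmorphV rmorphXn/= !expr2.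
apply: cboundedM; last by apply: cboundedM => //; exact: (cbounded_kV K1 wave_points).
apply: cboundedD; last by apply: cboundedM => //; exact: cbounded_bl_b.
apply: cboundedD; last by apply: cboundedM => //; exact: cbounded_omega wave_points.
by apply: cboundedM => //; apply: cboundedD; [exact: cboundedM|apply/cboundedN/cboundedM].
Qed.

Local Notation pk := (packet (sym_t S) sym_x (fun z => - l z)).

Let bl_phaseE k m t x y : bl_phase S k m (lam e k m) t x y =
  cexp (sym_t S (k, m) * t%:C + sym_x (k, m) * x%:C + - lam e k m * y%:C).
Proof.
rewrite /bl_phase; congr cexp.
by rewrite /sym_t /sym_x/= !rmorphD/= !rmorphM/= rmorphN/=; ring.
Qed.

Definition layer_symbol (G : T -> R[i]) (z : T) := Ah z * a e z.1 z.2 * G z.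

Let bl_integrandE (F : wave R -> field R) G t x y :
  (forall k m, F (bl_mode S e k m (lam e k m)) t x y =
     G (k, m) * bl_phase S k m (lam e k m) t x y) ->
  bl_integrand S lam a F e t x y =
  packet_integrand (sym_t S) sym_x (fun z => - l z) (layer_symbol G) t x y.
Proof.
move=> h; apply/funext => -[k m].
by rewrite /bl_integrand/= h bl_phaseE /packet_integrand /layer_symbol !mulrA.
Qed.

Let integrand_u t x y : bl_integrand S lam a (@u_ R) e t x y =
  packet_integrand (sym_t S) sym_x (fun z => - l z) (layer_symbol (fun=> 1)) t x y.
Proof. by apply: bl_integrandE => k m; rewrite mul1r. Qed.

Let integrand_w t x y : bl_integrand S lam a (@w_ R) e t x y =
  packet_integrand (sym_t S) sym_x (fun z => - l z)
    (layer_symbol (fun z => bl_w z.1 (l z))) t x y.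
Proof. exact: bl_integrandE. Qed.

Let integrand_b t x y : bl_integrand S lam a (@b_ R) e t x y =
  packet_integrand (sym_t S) sym_x (fun z => - l z)
    (layer_symbol (fun z => bl_b S e z.1 z.2 (l z))) t x y.
Proof. exact: bl_integrandE. Qed.

Lemma bl_packetE : bl_packet S lam a e =
  Wave (pk (layer_symbol (fun=> 1))) (pk (layer_symbol (fun z => bl_w z.1 (l z))))
       (pk (layer_symbol (fun z => bl_b S e z.1 z.2 (l z)))).
Proof.
congr Wave; do 3 apply/funext => ?; congr cintegral2.
- exact: integrand_u.
- exact: integrand_w.
- exact: integrand_b.
Qed.

Lemma csymbol_layer G : cbounded D G -> csymbol D (layer_symbol G).
Proof.
by move=> bG; apply: csymbolM => //; apply: csymbolM => //; exact: csymbol_Ahat.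
Qed.

Let mD := measurable_nzAhat hchi e.
Let bt := cbounded_sym_t wave_points.
Let bx := cbounded_sym_x wave_points.

Lemma cbounded_lamN : cbounded D (fun z => - l z).
Proof. exact/cboundedN/cbounded_lam. Qed.

Lemma layer_integrable t x y :
  [/\ cintegrable2 (bl_integrand S lam a (@u_ R) e t x y),
      cintegrable2 (bl_integrand S lam a (@w_ R) e t x y) &
      cintegrable2 (bl_integrand S lam a (@b_ R) e t x y)].
Proof.
rewrite integrand_u integrand_w integrand_b.
split; apply: (packet_integrable mD D_fin bt bx cbounded_lamN); apply: csymbol_layer.
- exact: cst_bounded.
- exact: cbounded_bl_w.
- exact: cbounded_bl_b.
Qed.

Lemma packet0 (A B C : T -> R[i]) : packet A B C (fun=> 0) = fun _ _ _ => 0.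
Proof.
do 3 apply/funext => ?; rewrite /packet /packet_integrand.
under eq_fun do rewrite mul0r.
by apply: complex_eqP; rewrite /= Rintegral_cst// mul0r.
Qed.

Lemma layer_system : smooth_system (slope S) (nu S e) (kappa S e)
  (bl_packet S lam a e) (pk (layer_symbol (fun z => bl_p S e z.1 z.2 (l z)))) (wave0 : wave R).
Proof.
have s0 := sin_slope_gt0 hgamma.
rewrite bl_packetE.
have -> : (wave0 : wave R) = Wave (pk (fun=> 0)) (pk (fun=> 0)) (pk (fun=> 0)).
  by rewrite !packet0.
have sz : csymbol D (fun=> 0 : R[i]) by split => //; exact: cst_bounded.
(* The identities between symbols are known on the support only; elsewhere the factor [Ahat]
   vanishes. *)
have red (z : T) (X Y : R[i]) : (supp_Ahat S e (z.1, z.2) -> X = Y) ->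
    Ah z * a e z.1 z.2 * X = Ah z * a e z.1 z.2 * Y + 0.
  move=> h; rewrite addr0 -!mulrA; apply/eqP; rewrite -subr_eq0 -mulrBr; apply/eqP.
  by apply: Ahat_supp_eq0 => /h ->; rewrite subrr.
have k0 z : supp_Ahat S e (z.1, z.2) -> z.1 != 0.
  by move=> /(wavepoint_neq0 K1 wave_points)[].
apply: (packet_system mD D_fin bt bx cbounded_lamN) => //.
- exact/csymbol_layer/cst_bounded.
- exact/csymbol_layer/cbounded_bl_w.
- exact/csymbol_layer/cbounded_bl_b.
- exact/csymbol_layer/cbounded_bl_p.
- move=> z; have h := red z _ _ (fun km => mode_eq_u S e z.2 (l z) (k0 z km)).
  transitivity (Ah z * a e z.1 z.2 * (sym_t S z - bl_b S e z.1 z.2 (l z) * s%:C +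
    bl_p S e z.1 z.2 (l z) * sym_x z)); first by rewrite /layer_symbol; ring.
  by rewrite /sym_t /sym_x h /layer_symbol; ring.
- move=> z; have h := red z _ _ (fun km => mode_eq_w s0 (k0 z km) (layer_Re km)
    (layer_dispersion km)).
  transitivity (Ah z * a e z.1 z.2 * (bl_w z.1 (l z) * sym_t S z -
    bl_b S e z.1 z.2 (l z) * c%:C +
    bl_p S e z.1 z.2 (l z) * - l z)); first by rewrite /layer_symbol; ring.
  by rewrite /sym_t /sym_x h /layer_symbol; ring.
- move=> z; have h := red z _ _ (fun km => mode_eq_b s0 (layer_Re km)
    (layer_dispersion km)).
  transitivity (Ah z * a e z.1 z.2 * (bl_b S e z.1 z.2 (l z) * sym_t S z + s%:C +
    bl_w z.1 (l z) * c%:C)); first by rewrite /layer_symbol; ring.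
  by rewrite /sym_t /sym_x h /layer_symbol; ring.
- move=> z; have h := red z _ _ (fun km => mode_eq_div z.1 (layer_Re km)).
  transitivity (Ah z * a e z.1 z.2 * (sym_x z + bl_w z.1 (l z) * - l z)).
    by rewrite /layer_symbol; ring.
  by rewrite /sym_x h mulr0 addr0.
Qed.

End layer_packets.

(** * Matching three layers to the traces of the incident packet *)

Section three_layers.
Context {R : realType} (S : setting R).
Local Notation T := (measurableTypeR R * measurableTypeR R)%type.
Local Notation s := (sin (slope S)).
Local Notation c := (cos (slope S)).
Implicit Types (lam : R -> R -> R -> R[i]).

Definition layer_det lam1 lam2 lam3 (e k m : R) : R[i] :=
  cdet (lam1 e k m)^-1 (lam2 e k m)^-1 (lam3 e k m)^-1
    (lam1 e k m * bl_b S e k m (lam1 e k m))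
    (lam2 e k m * bl_b S e k m (lam2 e k m))
    (lam3 e k m * bl_b S e k m (lam3 e k m)).

(* Cramer's rule for the three boundary conditions: the right-hand sides are
   the traces of the incident wave of unit amplitude. *)
Definition amplitude lam1 lam2 lam3 (e k m : R) : R[i] :=
  cnum (lam2 e k m)^-1 (lam3 e k m)^-1
    (lam2 e k m * bl_b S e k m (lam2 e k m))
    (lam3 e k m * bl_b S e k m (lam3 e k m))
    (- ('i%C * (m^-1)%:C)) (- ((k * c - m * s) / omega S k m)%:C) /
  layer_det lam1 lam2 lam3 e k m.

(** Cyclic symmetry, thanks to which the three amplitudes are one definition with rotated
    arguments. *)
Lemma layer_det_rot lam1 lam2 lam3 e k m :
  layer_det lam2 lam3 lam1 e k m = layer_det lam1 lam2 lam3 e k m.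
Proof. by rewrite /layer_det /cdet; ring. Qed.

Lemma amplitudeP lam1 lam2 lam3 e k m :
  let a1 := amplitude lam1 lam2 lam3 e k m in
  let a2 := amplitude lam2 lam3 lam1 e k m in
  let a3 := amplitude lam3 lam1 lam2 e k m in
  layer_det lam1 lam2 lam3 e k m != 0 ->
  [/\ a1 + a2 + a3 = -1,
      a1 * (lam1 e k m)^-1 + a2 * (lam2 e k m)^-1 + a3 * (lam3 e k m)^-1 =
        - ('i%C * (m^-1)%:C) &
      a1 * (lam1 e k m * bl_b S e k m (lam1 e k m)) +
      a2 * (lam2 e k m * bl_b S e k m (lam2 e k m)) +
      a3 * (lam3 e k m * bl_b S e k m (lam3 e k m)) =
        - ((k * c - m * s) / omega S k m)%:C].
Proof.
move=> a1 a2 a3 D0; rewrite /a1 /a2 /a3 /amplitude.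
have -> : layer_det lam3 lam1 lam2 e k m = layer_det lam1 lam2 lam3 e k m.
  by rewrite -(layer_det_rot lam3 lam1 lam2).
rewrite (layer_det_rot lam1 lam2); exact: cramer3.
Qed.

Section fixed_e.
Variables (e K : R).
Hypothesis hgamma : 0 < slope S < pi / 2.
Hypothesis hchi : C0_infty (chi S).
Hypothesis K1 : 1 <= K.
Hypothesis wave_points : forall k m, supp_Ahat S e (k, m) ->
  omega S k m = omega_plus S k m /\
  wavepoint S K e k m (omega S k m) (criticality S k m).
Local Notation D := (nzAhat S e).
Local Notation Ah := (fun z : T => (Ahat S e z.1 z.2)%:C).
Hypothesis D_fin : (leb2 D < +oo)%E.

Lemma cmeasurable_amplitude lam1 lam2 lam3 :
  layer S e lam1 -> layer S e lam2 -> layer S e lam3 ->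
  cmeasurable D (fun z : T => amplitude lam1 lam2 lam3 e z.1 z.2).
Proof.
move=> h1 h2 h3.
have i1 := (cbounded_lamV h1).1; have i2 := (cbounded_lamV h2).1.
have i3 := (cbounded_lamV h3).1.
have mb lam : layer S e lam -> cmeasurable D
    (fun z : T => lam e z.1 z.2 * bl_b S e z.1 z.2 (lam e z.1 z.2)).
  move=> h; apply: cmeasurableM; first exact: h.1.
  exact: (cbounded_bl_b hgamma wave_points h).1.
have b1 := mb _ h1; have b2 := mb _ h2; have b3 := mb _ h3.
apply: cmeasurableM; last first.
  apply: cmeasurableV; rewrite /layer_det /cdet.
  by apply: cmeasurableD; [apply: cmeasurableD|]; apply: cmeasurableM => //;
    exact: cmeasurableB.
rewrite /cnum; apply: cmeasurableD.
  apply: cmeasurableD; first by apply: cmeasurableB; exact: cmeasurableM.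
  apply: cmeasurableM; last exact: cmeasurableB.
  apply: cmeasurableN; apply: cmeasurableM; first exact: cmeasurable_cst.
  exact: (cbounded_mV K1 wave_points).1.
apply: cmeasurableM; last exact: cmeasurableB.
apply: cmeasurableN; apply: cmeasurable_real; apply: measurable_funM; last first.
  apply: measurable_funV; exact: measurable_omega wave_points.
by apply: measurable_funTS; apply: measurable_funB; apply: measurable_funM.
Qed.

Let mD := measurable_nzAhat hchi e.
Let bt := cbounded_sym_t wave_points.
Let bx := cbounded_sym_x wave_points.
Let b_y := cbounded_sym_y wave_points.

(** At the boundary the vertical exponent disappears, so the traces of packets with different [lam]
    can be added under one integral. *)
Lemma packet_y0 (C C' G : T -> R[i]) t x :
  packet (sym_t S) sym_x C G t x 0 = packet (sym_t S) sym_x C' G t x 0.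
Proof.
by congr cintegral2; apply/funext => z; rewrite /packet_integrand !mulr0.
Qed.

Lemma packet_trace (C1 C2 C3 G0 G1 G2 G3 : T -> R[i]) t x :
  csymbol D G0 -> csymbol D G1 -> csymbol D G2 -> csymbol D G3 ->
  (forall z, G1 z + G2 z + G3 z + G0 z = 0) ->
  packet (sym_t S) sym_x C1 G1 t x 0 + packet (sym_t S) sym_x C2 G2 t x 0 +
  packet (sym_t S) sym_x C3 G3 t x 0 =
  - packet (sym_t S) sym_x sym_y G0 t x 0.
Proof.
move=> s0 s1 s2 s3 h; apply/eqP; rewrite -addr_eq0.
rewrite !(packet_y0 _ sym_y) -!(packetD mD D_fin bt bx b_y)//.
- by rewrite (funext h) packet0.
- by apply: csymbolD => //; exact: csymbolD.
- exact: csymbolD.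
Qed.

Variables lam1 lam2 lam3 : R -> R -> R -> R[i].
Hypothesis h1 : layer S e lam1.
Hypothesis h2 : layer S e lam2.
Hypothesis h3 : layer S e lam3.
Local Notation a1 := (amplitude lam1 lam2 lam3).
Local Notation a2 := (amplitude lam2 lam3 lam1).
Local Notation a3 := (amplitude lam3 lam1 lam2).
Hypothesis ha : exists M : R, forall k m, supp_Ahat S e (k, m) ->
  layer_det lam1 lam2 lam3 e k m != 0 /\
  [/\ normc (a1 e k m) <= M, normc (a2 e k m) <= M & normc (a3 e k m) <= M].

Let ba1 : cbounded D (fun z : T => a1 e z.1 z.2).
Proof.
split; first exact: cmeasurable_amplitude.
by have [M h] := ha; exists M => z /nzAhat_supp/h[_ []].
Qed.

Let ba2 : cbounded D (fun z : T => a2 e z.1 z.2).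
Proof.
split; first exact: cmeasurable_amplitude.
by have [M h] := ha; exists M => z /nzAhat_supp/h[_ []].
Qed.

Let ba3 : cbounded D (fun z : T => a3 e z.1 z.2).
Proof.
split; first exact: cmeasurable_amplitude.
by have [M h] := ha; exists M => z /nzAhat_supp/h[_ []].
Qed.

Definition layers : wave R :=
  addw (addw (bl_packet S lam1 a1 e) (bl_packet S lam2 a2 e)) (bl_packet S lam3 a3 e).

Definition layer_pressure lam (a : R -> R -> R -> R[i]) : field R :=
  packet (sym_t S) sym_x (fun z => - lam e z.1 z.2)
    (layer_symbol S e a (fun z => bl_p S e z.1 z.2 (lam e z.1 z.2))).

Definition layers_pressure : field R := fun t x y =>
  layer_pressure lam1 a1 t x y + layer_pressure lam2 a2 t x y +
  layer_pressure lam3 a3 t x y.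

Lemma addw00 : addw (addw wave0 wave0) wave0 = (wave0 : wave R).
Proof. by congr Wave; do 3 apply/funext => ?; rewrite /= !addr0. Qed.

Lemma layers_smooth_system : smooth_system (slope S) (nu S e) (kappa S e)
  layers layers_pressure wave0.
Proof.
rewrite -addw00.
have hs := layer_system hgamma hchi K1 wave_points D_fin.
exact: (smooth_systemD (smooth_systemD (hs _ _ h1 ba1) (hs _ _ h2 ba2)) (hs _ _ h3 ba3)).
Qed.

Let cst_bounded (x : R[i]) : cbounded D (fun=> x).
Proof. exact: cbounded_cst. Qed.

Lemma layers_traces t x :
  [/\ u_ layers t x 0 = - u_ (W_inc S e) t x 0,
      w_ layers t x 0 = - w_ (W_inc S e) t x 0 &
      dy (b_ layers) t x 0 = - dy (b_ (W_inc S e)) t x 0].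
Proof.
have sA := csymbol_Ahat e hchi.
have bw := cbounded_inc_w K1 wave_points; have bb := cbounded_inc_b K1 wave_points.
have bb1 := cbounded_bl_b hgamma wave_points h1.
have bb2 := cbounded_bl_b hgamma wave_points h2.
have bb3 := cbounded_bl_b hgamma wave_points h3.
have sL := csymbol_layer hchi.
have red (z : T) (x1 x2 x3 x0 : R[i]) :
    (supp_Ahat S e (z.1, z.2) -> layer_det lam1 lam2 lam3 e z.1 z.2 != 0 ->
     z.2 != 0 -> omega S z.1 z.2 != 0 ->
     a1 e z.1 z.2 * x1 + a2 e z.1 z.2 * x2 + a3 e z.1 z.2 * x3 + x0 = 0) ->
    Ah z * a1 e z.1 z.2 * x1 + Ah z * a2 e z.1 z.2 * x2 +
    Ah z * a3 e z.1 z.2 * x3 + Ah z * x0 = 0.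
  move=> h; rewrite -!(mulrA (Ah z)) -!mulrDr; apply: Ahat_supp_eq0 => km.
  have [M hM] := ha; have [D0 _] := hM _ _ km.
  have [_ m0 w0] := wavepoint_neq0 K1 wave_points km.
  exact: h.
rewrite W_incE /layers !bl_packetE; split.
- apply: packet_trace.
  + exact: csymbolM.
  + exact: (sL _ _ ba1).
  + exact: (sL _ _ ba2).
  + exact: (sL _ _ ba3).
  move=> z; apply: red => km D0 m0 w0; rewrite !mulr1.
  by have [-> _ _] := amplitudeP D0; rewrite addNr.
- apply: packet_trace.
  + exact: csymbolM.
  + by apply: (sL _ _ ba1); exact: (cbounded_bl_w wave_points h1).
  + by apply: (sL _ _ ba2); exact: (cbounded_bl_w wave_points h2).
  + by apply: (sL _ _ ba3); exact: (cbounded_bl_w wave_points h3).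
  move=> z; apply: red => km D0 m0 w0; have [_ hd _] := amplitudeP D0.
  rewrite /bl_w /inc_w rmorphN/= rmorphM/=.
  transitivity ('i%C * z.1%:C * (a1 e z.1 z.2 * (lam1 e z.1 z.2)^-1 +
    a2 e z.1 z.2 * (lam2 e z.1 z.2)^-1 + a3 e z.1 z.2 * (lam3 e z.1 z.2)^-1) -
    z.1%:C * (z.2^-1)%:C); first by ring.
  rewrite hd; transitivity (- ('i%C * 'i%C + 1) * (z.1%:C * (z.2^-1)%:C)); first by ring.
  by rewrite sqri addNr oppr0 mul0r.
set b0 := b_ (Wave _ _ (packet _ _ sym_y _)).
have nb1 := cbounded_lamN h1; have nb2 := cbounded_lamN h2; have nb3 := cbounded_lamN h3.
have s1 := sL _ _ ba1 _ bb1; have s2 := sL _ _ ba2 _ bb2; have s3 := sL _ _ ba3 _ bb3.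
have p1 := packet_smooth mD D_fin bt bx nb1 s1.
have p2 := packet_smooth mD D_fin bt bx nb2 s2.
have p3 := packet_smooth mD D_fin bt bx nb3 s3.
have [p12 [_ _ e12 _]] := smoothD p1 p2.
have [_ [_ _ e123 _]] := smoothD p12 p3.
apply: (etrans (congr1 (fun F : field R => F t x 0) e123)).
rewrite e12 (packet_dyE mD D_fin bt bx nb1 s1) (packet_dyE mD D_fin bt bx nb2 s2).
rewrite (packet_dyE mD D_fin bt bx nb3 s3) /b0/=.
rewrite (packet_dyE mD D_fin bt bx b_y); last exact: csymbolM.
apply: packet_trace; [|exact: csymbolM|exact: csymbolM|exact: csymbolM|].
  by apply: csymbolM => //; exact: csymbolM.
move=> z; apply: (etrans _ (red z
  (bl_b S e z.1 z.2 (lam1 e z.1 z.2) * - lam1 e z.1 z.2)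
  (bl_b S e z.1 z.2 (lam2 e z.1 z.2) * - lam2 e z.1 z.2)
  (bl_b S e z.1 z.2 (lam3 e z.1 z.2) * - lam3 e z.1 z.2)
  (inc_b S z.1 z.2 * sym_y z) _)); first by rewrite /layer_symbol !mulrA.
move=> km D0 m0 w0; have [_ _ hd] := amplitudeP D0.
set B1 := bl_b _ _ _ _ _ in hd *; set B2 := bl_b _ _ _ _ (lam2 _ _ _) in hd *.
set B3 := bl_b _ _ _ _ (lam3 _ _ _) in hd *.
transitivity (inc_b S z.1 z.2 * sym_y z -
  (a1 e z.1 z.2 * (lam1 e z.1 z.2 * B1) + a2 e z.1 z.2 * (lam2 e z.1 z.2 * B2) +
   a3 e z.1 z.2 * (lam3 e z.1 z.2 * B3))); first by ring.
rewrite hd inc_bE /sym_y opprK rmorphM/= rmorphB/= !rmorphM/= !fmorphV/=.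
have mC : z.2%:C != 0 :> R[i] by rewrite fmorph_eq0.
have wC : (omega S z.1 z.2)%:C != 0 :> R[i] by rewrite fmorph_eq0.
set w := (omega _ _ _)%:C in wC *.
transitivity (('i%C * 'i%C + 1) * (z.1%:C * c%:C - z.2%:C * s%:C) / w); last first.
  by rewrite sqri addNr !mul0r.
by field; rewrite mC wC.
Qed.

Lemma layers_integrable t x y :
  [/\ [/\ cintegrable2 (bl_integrand S lam1 a1 (@u_ R) e t x y),
      cintegrable2 (bl_integrand S lam1 a1 (@w_ R) e t x y) &
      cintegrable2 (bl_integrand S lam1 a1 (@b_ R) e t x y)],
      [/\ cintegrable2 (bl_integrand S lam2 a2 (@u_ R) e t x y),
      cintegrable2 (bl_integrand S lam2 a2 (@w_ R) e t x y) &
      cintegrable2 (bl_integrand S lam2 a2 (@b_ R) e t x y)] &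
      [/\ cintegrable2 (bl_integrand S lam3 a3 (@u_ R) e t x y),
      cintegrable2 (bl_integrand S lam3 a3 (@w_ R) e t x y) &
      cintegrable2 (bl_integrand S lam3 a3 (@b_ R) e t x y)]].
Proof.
split.
- exact: (layer_integrable hgamma hchi wave_points D_fin h1 ba1).
- exact: (layer_integrable hgamma hchi wave_points D_fin h2 ba2).
- exact: (layer_integrable hgamma hchi wave_points D_fin h3 ba3).
Qed.

Lemma addw0 (W : wave R) : addw W wave0 = W.
Proof.
by case: W => u w b; congr Wave; do 3 apply/funext => ?; rewrite /= addr0.
Qed.

Definition incident_pressure : field R :=
  packet (sym_t S) sym_x sym_y (fun z => Ah z * inc_p S z).

Lemma approximate_smooth_system : smooth_system (slope S) (nu S e) (kappa S e)
  (addw (W_inc S e) layers)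
  (fun t x y => incident_pressure t x y + layers_pressure t x y) (W_rem S e).
Proof.
rewrite -[W_rem S e]addw0.
exact: (smooth_systemD (incident_system hchi K1 wave_points D_fin) layers_smooth_system).
Qed.

Lemma approximate_boundary_conditions :
  boundary_conditions (addw (W_inc S e) layers).
Proof.
move=> t x; have [hu hw hb] := layers_traces t x.
have [[_ _ [_ _ d3 _ _]] _] := approximate_smooth_system.
have [[_ _ sb0] _] := incident_system hchi K1 wave_points D_fin.
have [[_ _ sb1] _] := layers_smooth_system.
have [_ [_ _ ey _]] := smoothD sb0 sb1.
split.
- exact: (etrans (congr1 (+%R _) hu) (subrr _)).
- exact: (etrans (congr1 (+%R _) hw) (subrr _)).
- exact: d3.
apply: (etrans (congr1 (fun F : field R => F t x 0) ey)).
exact: (etrans (congr1 (+%R _) hb) (subrr _)).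
Qed.

End fixed_e.
End three_layers.

Section layers_solution.
Context {R : realType} (S : setting R).
Hypothesis hgamma : 0 < slope S < pi / 2.
Hypothesis hchi : C0_infty (chi S).
Hypothesis hwave : admissible_wavenumber S.
Hypothesis hcrit : near_critical S.
Hypothesis nu_ge0 : \forall e \near 0^'+, 0 <= nu S e.
Hypothesis kappa_ge0 : \forall e \near 0^'+, 0 <= kappa S e.
Variables lam1 lam2 lam3 : R -> R -> R -> R[i].
Local Notation a1 := (amplitude S lam1 lam2 lam3).
Local Notation a2 := (amplitude S lam2 lam3 lam1).
Local Notation a3 := (amplitude S lam3 lam1 lam2).
Hypothesis hlayers : \forall e \near 0^'+,
  [/\ layer S e lam1, layer S e lam2 & layer S e lam3].
Hypothesis hdet : \forall e \near 0^'+,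
  exists M : R, forall k m, supp_Ahat S e (k, m) ->
  layer_det S lam1 lam2 lam3 e k m != 0 /\
  [/\ normc (a1 e k m) <= M, normc (a2 e k m) <= M & normc (a3 e k m) <= M].

(** Gathers what holds for all small [e], so that facts proved at a fixed [e] pass to the filter. *)
Lemma layers_near (P : R -> Prop) :
  (forall e K, 1 <= K -> (forall k m, supp_Ahat S e (k, m) ->
     omega S k m = omega_plus S k m /\
     wavepoint S K e k m (omega S k m) (criticality S k m)) ->
   (leb2 (nzAhat S e) < +oo)%E ->
   layer S e lam1 -> layer S e lam2 -> layer S e lam3 ->
   (exists M : R, forall k m, supp_Ahat S e (k, m) ->
    layer_det S lam1 lam2 lam3 e k m != 0 /\
    [/\ normc (a1 e k m) <= M, normc (a2 e k m) <= M & normc (a3 e k m) <= M]) ->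
   P e) -> \forall e \near 0^'+, P e.
Proof.
move=> h.
have [K K1 hK] := wavepoint_near hgamma hchi hwave hcrit.
have [L L0 hL] := leb2_nzAhat hchi hwave.
near=> e.
have [b b0 [Db _]] : exists2 b : R, 0 < b &
    nzAhat S e `<=` `[- b, b]%classic `*` `[- b, b]%classic /\
    fine (leb2 (nzAhat S e)) <= L * e ^+ 4 by near: e.
have [l1 l2 l3] : [/\ layer S e lam1, layer S e lam2 & layer S e lam3] by near: e.
apply: (h e K) => //; [by near: e| |by near: e].
exact: (leb2_bounded_lty (measurable_nzAhat hchi e) b0 Db).
Unshelve. all: by end_near. Qed.

Lemma layers_wellformed :
  [/\ bl_wellformed S lam1 a1, bl_wellformed S lam2 a2 & bl_wellformed S lam3 a3].
Proof.
split; apply: layers_near => e K K1 wp fD l1 l2 l3 ha.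
- split=> [k m|t x y _]; first exact: (layer_bl_root hgamma K1 wp l1).
  by have [] := layers_integrable hgamma hchi K1 wp fD l1 l2 l3 ha t x y.
- split=> [k m|t x y _]; first exact: (layer_bl_root hgamma K1 wp l2).
  by have [] := layers_integrable hgamma hchi K1 wp fD l1 l2 l3 ha t x y.
- split=> [k m|t x y _]; first exact: (layer_bl_root hgamma K1 wp l3).
  by have [] := layers_integrable hgamma hchi K1 wp fD l1 l2 l3 ha t x y.
Qed.

(** The conclusion of the theorem without the form of the layers and the size of the remainder; the
    latter is fixed to [W_rem], which does not depend on the layers. *)
Definition consistent_layers (WBL : R -> wave R) :=
  (exists pBL : R -> field R, \forall e \near 0^'+,
     system (slope S) (nu S e) (kappa S e) (WBL e) (pBL e) /\
     forall t x : R,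
       [/\ u_ (WBL e) t x 0 = - u_ (W_inc S e) t x 0,
           w_ (WBL e) t x 0 = - w_ (W_inc S e) t x 0 &
           dy (b_ (WBL e)) t x 0 = - dy (b_ (W_inc S e)) t x 0]) /\
  exists papp : R -> field R, \forall e \near 0^'+,
    system_rhs (slope S) (nu S e) (kappa S e)
      (addw (W_inc S e) (WBL e)) (papp e) (W_rem S e) /\
    boundary_conditions (addw (W_inc S e) (WBL e)).

Lemma layers_consistent :
  consistent_layers (fun e => layers S e lam1 lam2 lam3).
Proof.
split.
  exists (fun e => layers_pressure S e lam1 lam2 lam3).
  apply: layers_near => e K K1 wp fD l1 l2 l3 ha; split.
    exact: (smooth_systemP (layers_smooth_system hgamma hchi K1 wp fD l1 l2 l3 ha)).
  exact: (layers_traces hgamma hchi K1 wp fD l1 l2 l3 ha).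
exists (fun e t x y =>
  incident_pressure S e t x y + layers_pressure S e lam1 lam2 lam3 t x y).
apply: layers_near => e K K1 wp fD l1 l2 l3 ha; split.
  exact: (smooth_systemP (approximate_smooth_system hgamma hchi K1 wp fD l1 l2 l3 ha)).
exact: (approximate_boundary_conditions hgamma hchi K1 wp fD l1 l2 l3 ha).
Qed.

End layers_solution.

(** * Roots of the dispersion relation *)

Section imaginary_square_root.
Context {R : realType}.
Local Notation T := (measurableTypeR R * measurableTypeR R)%type.

(* The root of [L ^+ 2 = - 'i * z] with positive real part. *)
Definition isqrt (z : R) : R[i] :=
  Num.sqrt (`|z| / 2) +i* (- (z / (2 * Num.sqrt (`|z| / 2)))).

Lemma isqrtP z : z != 0 -> [/\ 0 < Re (isqrt z), Re (isqrt z) ^+ 2 = `|z| / 2,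
  isqrt z ^+ 2 = - ('i%C * z%:C) & normc (isqrt z) ^+ 2 = `|z|].
Proof.
move=> z0; have a0 : 0 < `|z| / 2 by rewrite divr_gt0// normr_gt0.
have r0 : 0 < Num.sqrt (`|z| / 2) by rewrite sqrtr_gt0.
have r2 : Num.sqrt (`|z| / 2) ^+ 2 = `|z| / 2 by rewrite sqr_sqrtr// ltW.
have e2 : isqrt z ^+ 2 = - ('i%C * z%:C).
  apply: complex_eqP; rewrite expr2 ?Re_oppc ?Im_oppc ?Re_mulc ?Im_mulc/=.
    set r := Num.sqrt _ in r0 r2 *.
    have zr : z ^+ 2 = 4 * r ^+ 2 * r ^+ 2.
      by rewrite r2 -real_normK ?num_real//; field.
    have -> : r * r - - (z / (2 * r)) * - (z / (2 * r)) =
      (4 * r ^+ 2 * r ^+ 2 - z ^+ 2) / (4 * r ^+ 2) by field; exact: lt0r_neq0.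
    by rewrite zr subrr mul0r; ring.
  set r := Num.sqrt _ in r0 r2 *.
  by field; exact: lt0r_neq0.
split => //; rewrite -normcX e2 normcN Normc.normcM normc_i mul1r normc_real//.
Qed.

Lemma isqrt_bounds (K z : R) : 1 <= K -> K^-1 <= `|z| <= K ->
  [/\ (2 * K)^-1 <= Re (isqrt z), normc (isqrt z) <= K &
      (4 * K ^+ 2)^-1 <= normc (isqrt z ^+ 3)].
Proof.
move=> K1 /andP[zK zK']; have K0 : 0 < K by lra.
have iK : K^-1 <= 1 by rewrite invf_le1.
have iK0 : 0 < K^-1 by rewrite invr_gt0.
have z0 : z != 0 by rewrite -normr_gt0; lra.
have [r0 r2 e2 n2] := isqrtP z0.
have h1 : (2 * K)^-1 <= Re (isqrt z).
  rewrite -(@ler_pXn2r _ 2) ?nnegrE ?(ltW r0)// ?invr_ge0; last by lra.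
  rewrite r2 invfM exprMn; apply: (@le_trans _ _ (K^-1 / 2)); last by lra.
  rewrite mulrC; have : (2^-1 : R) ^+ 2 = 2^-1 / 2 by rewrite expr2.
  by move=> ->; nra.
have nr := le_trans (ler_norm _) (ler_Re_normc (isqrt z)).
split => //.
  rewrite -(@ler_pXn2r _ 2) ?nnegrE ?normc_ge0 ?(ltW K0)// n2.
  by apply: le_trans zK' _; rewrite expr2 ler_peMr// ltW.
rewrite normcX (exprSr _ 2) n2 (_ : (4 * K ^+ 2)^-1 = K^-1 / 2 * (2 * K)^-1); last first.
  by field; exact: lt0r_neq0.
apply: ler_pM; rewrite ?invr_ge0 ?divr_ge0 ?mulr_ge0//; lra.
Qed.

Lemma cmeasurable_isqrt (D : set T) (f : T -> R) : measurable_fun D f ->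
  cmeasurable D (fun z => isqrt (f z)).
Proof.
move=> mf.
have ms : measurable_fun D (fun z => Num.sqrt (`|f z| / 2)).
  apply: (eq_measurable_fun (fun z => (`|f z| / 2) `^ (2^-1))).
    by move=> z _; rewrite powR12_sqrt// divr_ge0.
  apply: (@measurableT_comp _ _ _ _ _ _ (@powR R ^~ (2^-1))).
    exact: measurable_powR.
  by apply: measurable_funM => //; exact: measurableT_comp mf.
split => //=; apply: measurableT_comp => //; apply: measurable_funM => //.
by apply: measurable_funV; exact: measurable_funM.
Qed.

End imaginary_square_root.

(** * Buoyancy coefficients relative to their slow limit *)

Section buoyancy_coefficients.
Context {R : realType} (S : setting R).
Local Notation s := (sin (slope S)).
Local Notation c := (cos (slope S)).

Lemma normc_ratio1 (x y : R[i]) (d : R) : d <= 2^-1 -> normc x <= d -> normc y <= d ->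
  1 + y != 0 /\ normc ((1 + x) / (1 + y) - 1) <= 4 * d.
Proof.
move=> d2 xd yd.
have y1 : 2^-1 <= normc (1 + y).
  have := lerB_normcD 1 y; rewrite (_ : normc (1 : R[i]) = 1); first by lra.
  by rewrite -(rmorph1 (real_complex R)) normc_real normr1.
have y0 : 1 + y != 0 by rewrite -normc_eq0; apply: lt0r_neq0; lra.
split => //.
have -> : (1 + x) / (1 + y) - 1 = (x - y) / (1 + y) by field.
rewrite Normc.normcM Normc.normcV ler_pdivrMr; last by lra.
by apply: le_trans (ler_normcB _ _) _; have := normc_ge0 x; nra.
Qed.

Definition buoyancy0 (w : R) : R[i] := s%:C / ('i%C * w%:C).

Variables (e k m K : R).
Local Notation w := (omega S k m).
Hypotheses (K1 : 1 <= K) (s_gt0 : 0 < s) (sK : K^-1 <= s).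
Hypotheses (kK : `|k| <= K) (wK : K^-1 <= `|w|).

Let K0 : 0 < K. Proof. by move: K1; lra. Qed.

Let w0 : w != 0.
Proof. by rewrite -normr_gt0; apply: lt_le_trans wK; rewrite invr_gt0; exact: K0. Qed.

Let iw0 : 'i%C * w%:C != 0 :> R[i].
Proof. by rewrite -normc_eq0 Normc.normcM normc_i mul1r normc_real normr_eq0 w0. Qed.

Let sC0 : s%:C != 0 :> R[i].
Proof. by rewrite fmorph_eq0 lt0r_neq0 ?s_gt0. Qed.

Let inv_le (a : R[i]) (x : R) : K^-1 <= `|x| -> normc (a / x%:C) <= K * normc a.
Proof.
move=> hx; rewrite Normc.normcM Normc.normcV normc_real mulrC.
apply: ler_wpM2r; rewrite ?normc_ge0// -(invrK K) lef_pV2 ?posrE ?invr_gt0 ?K0//.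
by apply: lt_le_trans hx; rewrite invr_gt0 K0.
Qed.

Let inv_iw (a : R[i]) : normc (a / ('i%C * w%:C)) <= K * normc a.
Proof.
have -> : a / ('i%C * w%:C) = (a / 'i%C) / w%:C by rewrite invfM mulrA.
apply: le_trans (inv_le _ wK) _.
by rewrite Normc.normcM Normc.normcV normc_i invr1 mulr1.
Qed.

Lemma buoyancy0_bounds : s <= K -> `|w| <= K ->
  buoyancy0 w != 0 /\ (K ^+ 2)^-1 <= normc (buoyancy0 w).
Proof.
move=> sK' wK'; split; first by rewrite /buoyancy0 mulf_neq0// invr_neq0.
rewrite /buoyancy0 Normc.normcM Normc.normcV Normc.normcM normc_i mul1r !normc_real.
rewrite (gtr0_norm s_gt0) expr2 invfM; apply: ler_pM; rewrite ?invr_ge0 ?(ltW K0)//.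
rewrite lef_pV2 ?posrE ?K0//.
by rewrite normr_gt0 w0.
Qed.

Let num_small (lam : R[i]) (d : R) : lam != 0 -> K ^+ 2 <= d * normc lam ->
  normc ('i%C * k%:C * c%:C / (s%:C * lam)) <= d.
Proof.
move=> l0 hd.
have n0 : 0 < normc lam by rewrite normc_gt0.
have -> : 'i%C * k%:C * c%:C / (s%:C * lam) = ('i%C * k%:C * c%:C / s%:C) / lam.
  by rewrite invfM mulrA.
rewrite Normc.normcM Normc.normcV ler_pdivrMr//; apply: le_trans hd.
have sa : K^-1 <= `|s| by rewrite (gtr0_norm s_gt0) sK.
apply: le_trans (inv_le _ sa) _; rewrite expr2; apply: ler_wpM2l; first exact: (ltW K0).
rewrite !Normc.normcM normc_i mul1r !normc_real -[leRHS]mulr1.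
by apply: ler_pM => //; rewrite ler_norml cos_geN1 cos_le1.
Qed.

(** Two relative errors: [x] compares [i k c] with [s lam] and is small because [lam] is large, [y]
    compares [kappa (lam ^ 2 - k ^ 2)] with [i w] and is small as long as [kappa |lam| ^ 2] is. *)
Lemma slow_buoyancy (lam : R[i]) (d : R) : lam != 0 -> 0 <= kappa S e -> d <= 2^-1 ->
  K ^+ 2 <= d * normc lam ->
  K * (kappa S e * (normc lam ^+ 2 + K ^+ 2)) <= d ->
  normc (bl_b S e k m lam / buoyancy0 w - 1) <= 4 * d.
Proof.
move=> l0 ka0 d2 hd hk.
have xd := num_small l0 hd; set x := _ / _ in xd.
pose y := (kappa S e)%:C * (lam ^+ 2 - (k ^+ 2)%:C) / ('i%C * w%:C).
have yd : normc y <= d.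
  apply: le_trans (inv_iw _) _; apply: le_trans hk; apply: ler_wpM2l; first exact: (ltW K0).
  rewrite Normc.normcM normc_real (ger0_norm ka0); apply: ler_wpM2l => //.
  apply: le_trans (ler_normcB _ _) _; rewrite normcX normc_real normrX.
  by apply: lerD => //; apply: lerXn2r; rewrite ?nnegrE// (ltW K0).
have [y1 h] := normc_ratio1 d2 xd yd.
suff -> : bl_b S e k m lam / buoyancy0 w = (1 + x) / (1 + y) by [].
have -> : bl_b S e k m lam = (s%:C * (1 + x)) / ('i%C * w%:C * (1 + y)).
  rewrite /bl_b /x /y; congr (_ / _); first by field; rewrite sC0 l0.
  by rewrite [RHS]mulrDr mulr1 [X in _ = _ + X]mulrCA mulfV// mulr1; ring.
have i0 : ('i%C : R[i]) != 0 by rewrite -normc_eq0 normc_i oner_eq0.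
have wC0 : w%:C != 0 :> R[i] by rewrite fmorph_eq0.
by rewrite /buoyancy0; field; rewrite i0 wC0 sC0 y1.
Qed.

(* Since [tau ^+ 2 = nu^-1 + kappa^-1] and [L ^+ 2 ~ - 'i * w], the factor
   [i w + kappa d] of the dispersion relation is close to
   [- (kappa / nu) * i w], and symmetrically. *)
Let factor_small (n n' tau : R) (L : R[i]) (d : R) : 0 < n -> 0 < n' -> n' <= n ->
  tau ^+ 2 = (n + n') / (n * n') ->
  2 * K * normc (L ^+ 2 + 'i%C * w%:C) + n' * K ^+ 3 <= d ->
  exists2 y : R[i], normc y <= d &
    'i%C * w%:C + n%:C * ((tau%:C * L) ^+ 2 - (k ^+ 2)%:C) =
    - ('i%C * w%:C) * (n / n')%:C * (1 + y).
Proof.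
move=> n0 n'0 nn' tau2 hd.
pose y := - ((1 + n' / n)%:C * (L ^+ 2 + 'i%C * w%:C) / ('i%C * w%:C)) +
  (n' * k ^+ 2)%:C / ('i%C * w%:C).
exists y.
  apply: le_trans hd; apply: le_trans (ler_normcD _ _) _; rewrite normcN.
  apply: lerD; apply: le_trans (inv_iw _) _.
    rewrite Normc.normcM normc_real mulrA; apply: ler_wpM2r; first exact: normc_ge0.
    have q0 : 0 <= n' / n by rewrite divr_ge0 ?ltW.
    have q1 : n' / n <= 1 by rewrite ler_pdivrMr ?mul1r.
    by rewrite ger0_norm; [have := K0; nra|lra].
  rewrite normc_real normrM normrX (gtr0_norm n'0) mulrCA; apply: ler_wpM2l; first exact: ltW.
  rewrite (exprS K 2); apply: ler_wpM2l; first exact: (ltW K0).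
  by apply: lerXn2r; rewrite ?nnegrE// (ltW K0).
have n0C : n%:C != 0 :> R[i] by rewrite fmorph_eq0 lt0r_neq0.
have n'0C : n'%:C != 0 :> R[i] by rewrite fmorph_eq0 lt0r_neq0.
have wC0 : w%:C != 0 :> R[i] by rewrite fmorph_eq0.
have i0 : ('i%C : R[i]) != 0 by rewrite -normc_eq0 normc_i oner_eq0.
have tC : tau%:C ^+ 2 = (n%:C + n'%:C) / (n%:C * n'%:C) :> R[i].
  by rewrite -rmorphXn tau2 rmorphM/= rmorphD/= fmorphV/= rmorphM.
rewrite exprMn tC /y !(rmorphM, rmorphD, rmorphXn, fmorphV, rmorph1)/=.
by field; rewrite n0C n'0C i0 wC0.
Qed.

Lemma normc_ratio2 (x y z v : R[i]) (d : R) : d <= 2^-1 -> normc x <= d ->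
  normc y <= d -> normc z <= d -> normc v <= d ->
  normc ((1 + z) * (1 + y) * (1 - v) / (1 + x) - 1) <= 20 * d.
Proof.
move=> d2 xd yd zd vd.
have d0 : 0 <= d by apply: le_trans xd; exact: normc_ge0.
pose u := z + y + z * y - v * ((1 + z) * (1 + y)).
have n1 : normc (1 : R[i]) = 1.
  by rewrite -(rmorph1 (real_complex R)) normc_real normr1.
have h1 (a : R[i]) : normc a <= d -> normc (1 + a) <= 3 / 2.
  by move=> ad; apply: le_trans (ler_normcD _ _) _; rewrite n1; lra.
have ud : normc u <= 5 * d.
  apply: le_trans (ler_normcB _ _) _.
  have b1 : normc (v * ((1 + z) * (1 + y))) <= d * (3 / 2 * (3 / 2)).
    by rewrite !Normc.normcM; apply: ler_pM; rewrite ?mulr_ge0 ?normc_ge0//;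
       apply: ler_pM; rewrite ?normc_ge0 ?h1.
  have b2 : normc (z * y) <= d * 2^-1.
    by rewrite Normc.normcM; apply: ler_pM; rewrite ?normc_ge0//; lra.
  have b3 : normc (z + y + z * y) <= normc z + normc y + normc (z * y).
    by apply: le_trans (ler_normcD _ _) _; rewrite lerD2r ler_normcD.
  by lra.
have x1 : 2^-1 <= normc (1 + x) by have := lerB_normcD 1 x; rewrite n1; lra.
have x0 : 1 + x != 0 by rewrite -normc_eq0; apply: lt0r_neq0; lra.
have -> : (1 + z) * (1 + y) * (1 - v) / (1 + x) - 1 = (u - x) / (1 + x).
  by rewrite /u; field.
rewrite Normc.normcM Normc.normcV ler_pdivrMr; last by lra.
by apply: le_trans (ler_normcB _ _) _; nra.
Qed.

(** The coefficient can be written with the factor of [kappa], by definition, or with that of [nu],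
    by [bl_b_conj]. The factor of the larger diffusivity is used, since [factor_small] loses
    [1 + n' / n], which is controlled only for [n' <= n]. *)
Lemma fast_buoyancy (tau d zeta : R) (L : R[i]) : 0 < nu S e -> 0 < kappa S e ->
  0 < tau -> tau ^+ 2 = (nu S e + kappa S e) / (nu S e * kappa S e) ->
  0 < Re L -> dispersion_relation S e k w (tau%:C * L) ->
  w ^+ 2 = s ^+ 2 + zeta -> d <= 2^-1 ->
  2 * K * normc (L ^+ 2 + 'i%C * w%:C) + (nu S e + kappa S e) * K ^+ 3 <= d ->
  K ^+ 2 <= d * normc (tau%:C * L) -> K ^+ 2 <= d * normc (tau%:C * L) ^+ 2 ->
  K ^+ 2 * `|zeta| <= d ->
  normc (bl_b S e k m (tau%:C * L) / (- (nu S e / kappa S e)%:C * buoyancy0 w) - 1)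
    <= 20 * d.
Proof.
move=> n0 ka0 tau0 tau2 RL disp wz d2 hd hl hl2 hz.
have Rl : 0 < Re (tau%:C * L) by rewrite Re_mulc/= mul0r subr0 mulr_gt0.
have l0 := mode_lam_neq0 Rl; set lam := tau%:C * L in hl hl2 Rl l0 disp *.
have xd := num_small l0 hl; set x := _ / _ in xd.
have d0 : 0 <= d by apply: le_trans xd; exact: normc_ge0.
have n0C : (nu S e)%:C != 0 :> R[i] by rewrite fmorph_eq0 lt0r_neq0.
have ka0C : (kappa S e)%:C != 0 :> R[i] by rewrite fmorph_eq0 lt0r_neq0.
have wC0 : w%:C != 0 :> R[i] by rewrite fmorph_eq0.
have i0 : ('i%C : R[i]) != 0 by rewrite -normc_eq0 normc_i oner_eq0.
have K30 : 0 <= K ^+ 3 by rewrite exprn_ge0// (ltW K0).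
have z0 : normc (0 : R[i]) <= d by rewrite Normc.normc0.
have [nk|kn] := leP (nu S e) (kappa S e).
  have [||y yd hy] := @factor_small (kappa S e) (nu S e) tau L d ka0 n0 nk.
  - by rewrite tau2 addrC [kappa S e * _]mulrC.
  - by apply: le_trans hd; rewrite lerD2l; apply: ler_wpM2r => //; rewrite lerDl ltW.
  have [y1 _] := normc_ratio1 d2 xd yd.
  have := normc_ratio1 d2 xd yd => -[_ h].
  suff -> : bl_b S e k m lam / (- (nu S e / kappa S e)%:C * buoyancy0 w) =
      (1 + x) / (1 + y) by apply: le_trans h _; lra.
  have -> : bl_b S e k m lam = (s%:C * (1 + x)) /
      (- ('i%C * w%:C) * (kappa S e / nu S e)%:C * (1 + y)).
    rewrite -hy /bl_b /x; congr (_ / _); first by field; rewrite sC0 l0.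
    by rewrite -/lam; ring.
  rewrite /buoyancy0 !(rmorphM, fmorphV)/=.
  by field; rewrite i0 wC0 sC0 y1 n0C ka0C.
have [||y yd hy] := @factor_small (nu S e) (kappa S e) tau L d n0 ka0 (ltW kn).
- exact: tau2.
- by apply: le_trans hd; rewrite lerD2l; apply: ler_wpM2r => //; rewrite lerDr ltW.
pose v := (k ^+ 2)%:C / lam ^+ 2.
have vd : normc v <= d.
  rewrite /v Normc.normcM Normc.normcV normcX normc_real normrX ler_pdivrMr; last first.
    by rewrite exprn_gt0// normc_gt0.
  by apply: le_trans hl2; apply: lerXn2r; rewrite ?nnegrE// (ltW K0).
pose z : R[i] := (zeta / s ^+ 2)%:C.
have zd : normc z <= d.
  apply: le_trans hz; rewrite /z normc_real normrM normfV normrX (gtr0_norm s_gt0) mulrC.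
  apply: ler_wpM2r => //; rewrite -exprVn; apply: lerXn2r; rewrite ?nnegrE ?(ltW K0)//.
    by rewrite invr_ge0 ltW.
  by rewrite -(invrK K) lef_pV2 ?posrE ?invr_gt0 ?K0.
have [x1 _] := normc_ratio1 d2 z0 xd.
have h := normc_ratio2 d2 xd yd zd vd.
suff -> : bl_b S e k m lam / (- (nu S e / kappa S e)%:C * buoyancy0 w) =
    (1 + z) * (1 + y) * (1 - v) / (1 + x) by [].
rewrite (bl_b_conj s_gt0 Rl disp) hy.
have -> : s%:C * lam + 'i%C * k%:C * c%:C = s%:C * lam * (1 + x).
  by rewrite /x; field; rewrite sC0 l0.
have -> : lam ^+ 2 - (k ^+ 2)%:C = lam ^+ 2 * (1 - v).
  by rewrite /v; field.
(* In this form the quotient carries [w ^ 2 / s ^ 2], which near-criticality keeps close to 1. *)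
have -> : 1 + z = (w%:C / s%:C) ^+ 2.
  rewrite /z -fmorphV -rmorphM -rmorphXn exprMn wz exprVn mulrDl mulfV ?expf_neq0 ?lt0r_neq0//.
  by rewrite rmorphD rmorph1.
have i2 : ('i%C : R[i]) * 'i%C = -1 by rewrite sqri.
rewrite /buoyancy0 !(rmorphM, fmorphV)/=.
apply/eqP; rewrite -subr_eq0; apply/eqP.
transitivity (- ('i%C * 'i%C + 1) * ((w%:C / s%:C) ^+ 2 * (1 + y) * (1 - v) / (1 + x)) : R[i]);
  last by rewrite i2 addNr oppr0 mul0r.
by field; rewrite i0 wC0 sC0 x1 n0C ka0C l0.
Qed.

End buoyancy_coefficients.

(** * Families of roots over the support *)

Section root_families.
Context {R : realType} (S : setting R).
Local Notation T := (measurableTypeR R * measurableTypeR R)%type.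
Local Notation s := (sin (slope S)).
Local Notation c := (cos (slope S)).
Local Notation p e := (nu S e + kappa S e).
Local Notation om z := (omega S z.1 z.2).
Local Notation ze z := (criticality S z.1 z.2).

Definition wave_points (K e : R) := forall k m, supp_Ahat S e (k, m) ->
  omega S k m = omega_plus S k m /\
  wavepoint S K e k m (omega S k m) (criticality S k m).

(** [tau] and the normalization [N] are left free, so that each family picks its own scale. The
    polynomial equation itself is kept in the conclusion for the slowest root of Case 5, whose real
    part is extracted from it. *)
Lemma scaled_dpoly_root (K Km c0 rho : R) : 1 <= K -> 1 <= Km -> 0 < c0 -> 0 < rho ->
  exists2 d : R, 0 < d & forall (e tau N : R) (A E B C : T -> R) (L0 : T -> R[i]),
    wave_points K e -> 0 < tau -> 0 < N ->
    [/\ measurable_fun (nzAhat S e) A, measurable_fun (nzAhat S e) E,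
        measurable_fun (nzAhat S e) B & measurable_fun (nzAhat S e) C] ->
    cmeasurable (nzAhat S e) L0 ->
    (forall z : T, supp_Ahat S e (z.1, z.2) ->
       main_part Km c0 (A z) (E z) (B z) (C z) (L0 z)) ->
    (forall z : T, supp_Ahat S e (z.1, z.2) ->
       wavepoint S K e z.1 z.2 (om z) (ze z) ->
       small_part d (A z) (E z) (B z) (C z)
         (p e * tau ^+ 4 / N) (nu S e * kappa S e * tau ^+ 6 / (om z * N))
         (2 * (z.1 / om z) * s * c * tau / N) (ze z * tau ^+ 2 / (om z * N))
         (z.1 ^+ 2 * (om z ^+ 2 - c ^+ 2) / (om z * N)) (z.1 ^+ 2 / tau ^+ 2)) ->
    exists2 L : T -> R[i], cmeasurable (nzAhat S e) L &
      forall z : T, supp_Ahat S e (z.1, z.2) ->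
      [/\ dispersion_relation S e z.1 (om z) (tau%:C * L z),
          normc (L z - L0 z) <= rho &
          dpoly (p e * tau ^+ 4 / N) (nu S e * kappa S e * tau ^+ 6 / (om z * N))
            (2 * (z.1 / om z) * s * c * tau / N) (ze z * tau ^+ 2 / (om z * N))
            (z.1 ^+ 2 * (om z ^+ 2 - c ^+ 2) / (om z * N)) (z.1 ^+ 2 / tau ^+ 2)
            (L z) = 0].
Proof.
move=> K1 Km1 c00 rho0.
have [d d0 h] := dispersion_root Km1 c00 rho0; exists d => //.
move=> e tau N A E B C L0 wp tau0 N0 mM mL0 main small.
pose D' : set T := [set z | supp_Ahat S e (z.1, z.2)].
have DS : nzAhat S e `<=` D' by move=> z; exact: nzAhat_supp.
have mw : measurable_fun (nzAhat S e) (fun z : T => om z) := measurable_omega wp.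
have mk : measurable_fun (nzAhat S e) (fun z : T => z.1).
  by apply: measurable_funTS; exact: measurable_fst.
have mV : measurable_fun (nzAhat S e) (fun z : T => (om z * N)^-1).
  by apply: measurable_funV; apply: measurable_funM => //; exact: measurable_cst.
have mcst (x : R) : measurable_fun (nzAhat S e) (fun=> x) by exact: measurable_cst.
have mP : [/\ measurable_fun (nzAhat S e) (fun z : T => p e * tau ^+ 4 / N),
    measurable_fun (nzAhat S e) (fun z : T => nu S e * kappa S e * tau ^+ 6 / (om z * N)),
    measurable_fun (nzAhat S e) (fun z : T => 2 * (z.1 / om z) * s * c * tau / N),
    measurable_fun (nzAhat S e) (fun z : T => ze z * tau ^+ 2 / (om z * N)) &
    measurable_fun (nzAhat S e) (fun z : T =>
      z.1 ^+ 2 * (om z ^+ 2 - c ^+ 2) / (om z * N)) /\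
    measurable_fun (nzAhat S e) (fun z : T => z.1 ^+ 2 / tau ^+ 2)].
  split => //.
  - exact: measurable_funM.
  - do 4 (apply: measurable_funM; last exact: mcst).
    apply: measurable_funM; first exact: mcst.
    by apply: measurable_funM => //; exact: measurable_funV.
  - apply: measurable_funM => //; apply: measurable_funM; last exact: mcst.
    by apply: measurable_funB; [exact: measurable_funX|exact: mcst].
  - split.
      apply: measurable_funM => //; apply: measurable_funM.
        exact: measurable_funX.
      by apply: measurable_funB; [exact: measurable_funX|exact: mcst].
    by apply: measurable_funM; [exact: measurable_funX|exact: mcst].
have sm z : D' z -> small_part d (A z) (E z) (B z) (C z)
         (p e * tau ^+ 4 / N) (nu S e * kappa S e * tau ^+ 6 / (om z * N))
         (2 * (z.1 / om z) * s * c * tau / N) (ze z * tau ^+ 2 / (om z * N))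
         (z.1 ^+ 2 * (om z ^+ 2 - c ^+ 2) / (om z * N)) (z.1 ^+ 2 / tau ^+ 2).
  by move=> Dz; apply: small => //; have [] := wp _ _ Dz.
have [L mL hL] := h _ _ _ _ _ _ _ _ _ _ _ _ _ DS mM mP mL0 main sm.
exists L => // z Dz; have [h1 h2] := hL z Dz; split => //.
have [_ [_ _ /andP[wK _] [_ wz] _]] := wp _ _ Dz.
apply: dpoly_dispersion h1 => //; try exact: lt0r_neq0.
rewrite -normr_gt0; apply: lt_le_trans wK; rewrite invr_gt0; lra.
Qed.

Lemma scaled_root (K Km c0 rho : R) : 1 <= K -> 1 <= Km -> 0 < c0 -> 0 < rho ->
  exists2 d : R, 0 < d & forall (e tau N : R) (A E B C : T -> R) (L0 : T -> R[i]),
    wave_points K e -> 0 < tau -> 0 < N ->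
    [/\ measurable_fun (nzAhat S e) A, measurable_fun (nzAhat S e) E,
        measurable_fun (nzAhat S e) B & measurable_fun (nzAhat S e) C] ->
    cmeasurable (nzAhat S e) L0 ->
    (forall z : T, supp_Ahat S e (z.1, z.2) ->
       main_part Km c0 (A z) (E z) (B z) (C z) (L0 z)) ->
    (forall z : T, supp_Ahat S e (z.1, z.2) ->
       wavepoint S K e z.1 z.2 (om z) (ze z) ->
       small_part d (A z) (E z) (B z) (C z)
         (p e * tau ^+ 4 / N) (nu S e * kappa S e * tau ^+ 6 / (om z * N))
         (2 * (z.1 / om z) * s * c * tau / N) (ze z * tau ^+ 2 / (om z * N))
         (z.1 ^+ 2 * (om z ^+ 2 - c ^+ 2) / (om z * N)) (z.1 ^+ 2 / tau ^+ 2)) ->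
    exists2 L : T -> R[i], cmeasurable (nzAhat S e) L &
      forall z : T, supp_Ahat S e (z.1, z.2) ->
      dispersion_relation S e z.1 (om z) (tau%:C * L z) /\
      normc (L z - L0 z) <= rho.
Proof.
move=> K1 Km1 c00 rho0; have [d d0 h] := scaled_dpoly_root K1 Km1 c00 rho0.
exists d => // e tau N A E B C L0 wp tau0 N0 mM mL0 main small.
have [L mL hL] := h e tau N A E B C L0 wp tau0 N0 mM mL0 main small.
by exists L => // z /hL[].
Qed.

Lemma wavepoint_bounds (K e k m w zeta : R) : 1 <= K ->
  wavepoint S K e k m w zeta ->
  [/\ 0 < k / w, K ^- 2 <= k / w <= K ^+ 2, `|w^-1| <= K &
      `|k ^+ 2 * (w ^+ 2 - c ^+ 2)| <= 2 * K ^+ 4].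
Proof.
move=> K1 [/andP[kK kK'] _ /andP[wK wK'] [kw _] _]; have K0 : 0 < K by lra.
have iK : 0 < K^-1 by rewrite invr_gt0.
have w0 : w != 0 by rewrite -normr_gt0; lra.
have q0 : 0 < k / w.
  have -> : k / w = k * w / w ^+ 2 by field.
  by rewrite divr_gt0// exprn_even_gt0.
have wV : `|w^-1| <= K.
  by rewrite normfV -(invrK K) lef_pV2 ?posrE//; lra.
have wV' : K^-1 <= `|w^-1| by rewrite normfV lef_pV2 ?posrE//; lra.
have K2 : 1 <= K ^+ 2 by rewrite exprn_ege1.
split => //.
  rewrite -(gtr0_norm q0) normrM -exprVn !expr2.
  by apply/andP; split; apply: ler_pM => //; exact: ltW.
rewrite normrM normrX.
have -> : 2 * K ^+ 4 = K ^+ 2 * (2 * K ^+ 2) by ring.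
apply: ler_pM; rewrite ?exprn_ge0//.
  by apply: lerXn2r; rewrite ?nnegrE// ltW.
apply: le_trans (ler_normB _ _) _; rewrite !normrX.
have h1 : `|w| ^+ 2 <= K ^+ 2 by apply: lerXn2r; rewrite ?nnegrE// ltW.
have h2 : `|c| ^+ 2 <= 1.
  by rewrite -(expr1n _ 2); apply: lerXn2r; rewrite ?nnegrE// ler_norml cos_geN1 cos_le1.
by lra.
Qed.

End root_families.

Section fast_and_intermediate_roots.
Context {R : realType} (S : setting R).
Local Notation T := (measurableTypeR R * measurableTypeR R)%type.
Local Notation s := (sin (slope S)).
Local Notation c := (cos (slope S)).
Local Notation p e := (nu S e + kappa S e).
Local Notation om z := (omega S z.1 z.2).
Local Notation ze z := (criticality S z.1 z.2).
Hypothesis hgamma : 0 < slope S < pi / 2.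

Let s0 := sin_slope_gt0 hgamma.
Let c0 := cos_slope_gt0 hgamma.

Let sc1 : 0 <= s * c <= 1.
Proof.
have h1 : s <= 1 by exact: sin_le1.
have h2 : c <= 1 by exact: cos_le1.
by have := s0; have := c0; nra.
Qed.

Let powers (K : R) : 1 <= K ->
  [/\ 1 <= K ^+ 2, K ^+ 2 <= K ^+ 5, K ^+ 2 <= 2 * K ^+ 5, K <= 2 * K ^+ 5 & 0 < K ^+ 5].
Proof.
move=> K1; have K50 : 0 < K ^+ 5 by rewrite exprn_gt0// (lt_le_trans ltr01).
have K25 : K ^+ 2 <= K ^+ 5 by rewrite ler_weXn2l.
have K5 : K <= K ^+ 5 by rewrite -{1}(expr1 K) ler_weXn2l.
by split => //; rewrite ?exprn_ege1//; lra.
Qed.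

Let mul_le_sqr (x y : R) : 0 < x -> 0 < y -> x * y <= (x + y) ^+ 2.
Proof. by move=> x0 y0; have := mulr_gt0 x0 y0; nra. Qed.

Lemma measurable_criticality (K e : R) : wave_points S K e ->
  measurable_fun (nzAhat S e) (fun z : T => ze z).
Proof.
move=> wp; apply: measurable_funB; last exact: measurable_cst.
by apply: measurable_funX; exact: measurable_omega wp.
Qed.

(** The limit polynomial is [L ^ 4 (1 - i L ^ 2 / w)], whose nonzero roots satisfy
    [L ^ 2 = - i w]. *)
Lemma quartic_sextic_main (K w : R) : 1 <= K -> K^-1 <= `|w| <= K ->
  main_part K (4 * K ^+ 2)^-1 1 w^-1 0 0 (isqrt w).
Proof.
move=> K1 wK; have K0 : 0 < K by lra.
have [h1 h2 h3] := isqrt_bounds K1 wK.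
have /andP[wK1 wK2] := wK.
have w0 : w != 0 by rewrite -normr_gt0; apply: lt_le_trans wK1; rewrite invr_gt0.
have [_ _ e2 _] := isqrtP w0.
have wC : w%:C != 0 :> R[i] by rewrite fmorph_eq0.
have i0 : ('i%C : R[i]) != 0 by rewrite -normc_eq0 normc_i oner_eq0.
have wE : w%:C = 'i%C * isqrt w ^+ 2.
  by rewrite e2 mulrN mulrA sqri mulN1r opprK.
have wiE : (w^-1)%:C = ('i%C * isqrt w ^+ 2)^-1 :> R[i] by rewrite fmorphV/= wE.
have l0 : isqrt w != 0.
  by apply: contraNneq wC => h; rewrite wE h expr0n mulr0.
split => //.
- split; rewrite ?normr0 ?normr1 ?(ltW K0)//.
  by rewrite normfV -(invrK K) lef_pV2 ?posrE ?invr_gt0//; apply: lt_le_trans wK1; rewrite invr_gt0.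
- rewrite /dpoly fmorphV/= wE !rmorph0 !rmorph1 !subr0 !mulr0 !mul0r !addr0 mul1r.
  by rewrite subr0; field; rewrite i0 l0.
- rewrite /dpoly_deriv wiE.
  have -> : 4 * 1%:C * isqrt w ^+ 3 - 6 * 'i%C * ('i%C * isqrt w ^+ 2)^-1 * isqrt w ^+ 5 +
    0%:C + 2 * 'i%C * 0%:C * isqrt w = - (2 * isqrt w ^+ 3).
    by rewrite !rmorph0 !rmorph1; field; rewrite i0 l0.
  rewrite normcN Normc.normcM (_ : normc (2 : R[i]) = 2); last first.
    by rewrite -(rmorph_nat (real_complex R)) normc_real normr_nat.
  by have := normc_ge0 (isqrt w ^+ 3); lra.
Qed.

(** The limit polynomial is [L ^ 2 (L ^ 2 + i w)]; it is used with the rescaled criticality in place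
    of [w]. *)
Lemma quartic_quadratic_main (K w : R) : 1 <= K -> K^-1 <= `|w| <= K ->
  main_part K (4 * K ^+ 2)^-1 1 0 0 w (isqrt w).
Proof.
move=> K1 wK; have K0 : 0 < K by lra.
have [h1 h2 h3] := isqrt_bounds K1 wK.
have /andP[wK1 wK2] := wK.
have w0 : w != 0 by rewrite -normr_gt0; apply: lt_le_trans wK1; rewrite invr_gt0.
have [_ _ e2 _] := isqrtP w0.
have wE : 'i%C * w%:C = - isqrt w ^+ 2 by rewrite e2 opprK.
split => //.
- by split; rewrite ?normr0 ?normr1 ?(ltW K0).
- by rewrite /dpoly wE !rmorph0 !rmorph1; ring.
- rewrite /dpoly_deriv -[2 * 'i%C * w%:C]mulrA wE.
  have -> : 4 * 1%:C * isqrt w ^+ 3 - 6 * 'i%C * 0%:C * isqrt w ^+ 5 +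
    0%:C + 2 * - isqrt w ^+ 2 * isqrt w = 2 * isqrt w ^+ 3.
    by rewrite !rmorph0 !rmorph1; ring.
  rewrite Normc.normcM (_ : normc (2 : R[i]) = 2); last first.
    by rewrite -(rmorph_nat (real_complex R)) normc_real normr_nat.
  by have := normc_ge0 (isqrt w ^+ 3); lra.
Qed.

Let bound_mul (x y X Y : R) : `|x| <= X -> `|y| <= Y -> `|x * y| <= X * Y.
Proof. by move=> hx hy; rewrite normrM ler_pM. Qed.

(** This [tau] balances the quartic and sextic terms exactly: with [N = (nu + kappa) tau ^ 4] their
    coefficients are [1] and [1 / w]. The coupling and the terms in [k ^ 2] gain a negative power of
    [tau], the criticality is of order [e ^ 2]. *)
Lemma fast_root (K rho : R) : 1 <= K -> 0 < rho ->
  exists2 d : R, 0 < d & forall e tau : R, wave_points S K e ->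
    0 < nu S e -> 0 < kappa S e -> 0 < tau ->
    tau ^+ 2 = p e / (nu S e * kappa S e) -> e ^+ 2 <= d -> 1 <= d * tau ->
    exists2 L : T -> R[i], cmeasurable (nzAhat S e) L &
      forall z : T, supp_Ahat S e (z.1, z.2) ->
      dispersion_relation S e z.1 (om z) (tau%:C * L z) /\
      normc (L z - isqrt (om z)) <= rho.
Proof.
move=> K1 rho0; have K0 : 0 < K by lra.
have [K2 K25 K25' K5' K50] := powers K1.
have c00 : 0 < (4 * K ^+ 2)^-1 by rewrite invr_gt0 mulr_gt0// exprn_gt0.
have [d d0 h] := scaled_root S K1 K1 c00 rho0.
pose d' := Num.min 1 (d / (2 * K ^+ 5)).
have d'0 : 0 < d' by rewrite lt_min ltr01/= divr_gt0// mulr_gt0.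
have d'1 : d' <= 1 by rewrite ge_min lexx.
have d'd : 2 * K ^+ 5 * d' <= d.
  by rewrite mulrC -ler_pdivlMr ?mulr_gt0// ge_min lexx orbT.
exists d' => // e tau wp n0 ka0 tau0 tau2 ed td.
have p0 : 0 < p e by rewrite addr_gt0.
have v0 : 0 < tau^-1 by rewrite invr_gt0.
have vd : tau^-1 <= d' by rewrite -[leLHS]mul1r ler_pdivrMr.
(* [q <= 1] expresses [nu kappa <= (nu + kappa) ^ 2]. *)
pose q := (p e * tau ^+ 2)^-1.
have q0 : 0 <= q by rewrite invr_ge0 mulr_ge0 ?sqr_ge0// ltW.
have q1 : q <= 1.
  rewrite /q invf_le1; last by rewrite mulr_gt0// exprn_gt0.
  rewrite tau2 mulrA ler_pdivlMr ?mul1r ?mulr_gt0//.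
  by rewrite -expr2; exact: mul_le_sqr.
have t0 : tau != 0 by exact: lt0r_neq0.
have pn0 : p e != 0 by exact: lt0r_neq0.
have mw := measurable_omega wp.
apply: (h e tau (p e * tau ^+ 4) (fun=> 1) (fun z => (om z)^-1) (fun=> 0) (fun=> 0)) => //.
- by rewrite mulr_gt0// exprn_gt0.
- by split => //; exact: measurable_funV.
- exact: cmeasurable_isqrt.
- move=> z Dz; have [_ [_ _ wK _ _]] := wp _ _ Dz.
  exact: quartic_sextic_main.
move=> z Dz wpz; have [k_w /andP[_ kw2] wV G4] := wavepoint_bounds K1 wpz.
have [/andP[_ kK] _ /andP[wK _] _ [/andP[_ zK] _]] := wpz.
have w0 : om z != 0 by rewrite -normr_gt0; apply: lt_le_trans wK; rewrite invr_gt0.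
have v2 : tau^-1 ^+ 2 <= d'.
  apply: (le_trans _ vd); rewrite expr2; apply: ler_piMl (ltW v0) _.
  exact: (le_trans vd d'1).
have v20 : 0 <= tau^-1 ^+ 2 by exact: sqr_ge0.
split.
- by rewrite mulfV ?subrr ?normr0 ?(ltW d0)// mulf_neq0// expf_neq0.
- have nk : nu S e * kappa S e != 0 by rewrite mulf_neq0// lt0r_neq0.
  have -> : nu S e * kappa S e * tau ^+ 6 / (om z * (p e * tau ^+ 4)) =
    nu S e * kappa S e * tau ^+ 2 / (om z * p e).
    by field; rewrite w0 t0 pn0.
  rewrite tau2 (_ : _ / _ = (om z)^-1) ?subrr ?normr0 ?(ltW d0)//.
  by field; rewrite w0 pn0 (lt0r_neq0 n0) (lt0r_neq0 ka0).
- have -> : 2 * (z.1 / om z) * s * c * tau / (p e * tau ^+ 4) - 0 =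
    2 * (z.1 / om z) * (s * c) * (q * tau^-1).
    by rewrite /q; field; rewrite w0 t0 pn0.
  have b1 : `|2 * (z.1 / om z)| <= 2 * K ^+ 2.
    by rewrite normrM normr_nat (gtr0_norm k_w) ler_pM2l.
  have b2 : `|s * c| <= 1 by rewrite ger0_norm; case/andP: sc1.
  have b3 : `|q * tau^-1| <= 1 * d'.
    by apply: bound_mul; rewrite ger0_norm// ltW.
  apply: le_trans (bound_mul (bound_mul b1 b2) b3) _.
  by apply: le_trans d'd; rewrite mulr1 mul1r ler_pM2r// ler_pM2l.
- have -> : ze z * tau ^+ 2 / (om z * (p e * tau ^+ 4)) - 0 = ze z * (om z)^-1 * q.
    by rewrite /q; field; rewrite w0 t0 pn0.
  have b1 : `|q| <= 1 by rewrite ger0_norm.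
  apply: le_trans (bound_mul (bound_mul zK wV) b1) _; rewrite mulr1 mulrAC -expr2.
  by apply: le_trans d'd; apply: ler_pM => //; rewrite ?sqr_ge0.
- have -> : z.1 ^+ 2 * (om z ^+ 2 - c ^+ 2) / (om z * (p e * tau ^+ 4)) =
    z.1 ^+ 2 * (om z ^+ 2 - c ^+ 2) * (om z)^-1 * (q * tau^-1 ^+ 2).
    by rewrite /q; field; rewrite w0 t0 pn0.
  have b3 : `|q * tau^-1 ^+ 2| <= 1 * d' by apply: bound_mul; rewrite ger0_norm.
  split.
    apply: le_trans (bound_mul (bound_mul G4 wV) b3) _; apply: le_trans d'd.
    by rewrite mul1r (_ : 2 * K ^+ 4 * K = 2 * K ^+ 5)//; ring.
  rewrite -exprVn; have b1 : `|z.1 ^+ 2| <= K ^+ 2.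
    by rewrite normrX; apply: lerXn2r; rewrite ?nnegrE// ltW.
  have b2 : `|tau^-1 ^+ 2| <= d' by rewrite ger0_norm.
  apply: le_trans (bound_mul b1 b2) _; apply: le_trans d'd.
  by rewrite ler_pM2r.
Qed.

Lemma criticality_ratio (K e k m w zeta : R) : 1 <= K -> 0 < e ->
  wavepoint S K e k m w zeta -> K ^- 2 <= `|zeta / (w * e ^+ 2)| <= K ^+ 2.
Proof.
move=> K1 e0 [_ _ /andP[wK wK'] _ [/andP[zK zK'] _]]; have K0 : 0 < K by lra.
have e20 : 0 < e ^+ 2 by rewrite exprn_gt0.
have w0 : 0 < `|w| by apply: lt_le_trans wK; rewrite invr_gt0.
rewrite normrM normfV normrM (gtr0_norm e20); apply/andP; split.
  rewrite ler_pdivlMr ?mulr_gt0//; apply: le_trans zK.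
  have -> : e ^+ 2 / K = K ^- 2 * (K * e ^+ 2) by field; exact: lt0r_neq0.
  by rewrite ler_pM2l ?invr_gt0 ?exprn_gt0// ler_pM2r.
rewrite ler_pdivrMr ?mulr_gt0//; apply: le_trans zK' _.
have -> : K * e ^+ 2 = K ^+ 2 * (K^-1 * e ^+ 2) by field; exact: lt0r_neq0.
by rewrite ler_pM2l ?exprn_gt0// ler_pM2r.
Qed.

(** Here [(nu + kappa) lam ^ 4] balances the criticality term [zeta lam ^ 2], since
    [(nu + kappa) tau ^ 2] and [zeta] are both of size [e ^ 2]; the coupling is smaller by the
    factor [1 / (e ^ 2 tau)]. *)
Lemma intermediate_root (K rho : R) : 1 <= K -> 0 < rho ->
  exists2 d : R, 0 < d & forall e tau : R, wave_points S K e -> 0 < e ->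
    0 < nu S e -> 0 < kappa S e -> 0 < tau ->
    p e * tau ^+ 2 = e ^+ 2 -> e ^+ 2 <= d -> 1 <= d * (e ^+ 2 * tau) ->
    exists2 L : T -> R[i], cmeasurable (nzAhat S e) L &
      forall z : T, supp_Ahat S e (z.1, z.2) ->
      dispersion_relation S e z.1 (om z) (tau%:C * L z) /\
      normc (L z - isqrt (ze z / (om z * e ^+ 2))) <= rho.
Proof.
move=> K1 rho0; have K0 : 0 < K by lra.
have [K2 K25 K25' K5' K50] := powers K1.
have c00 : 0 < (4 * (K ^+ 2) ^+ 2)^-1 by rewrite invr_gt0 mulr_gt0// !exprn_gt0.
have [d d0 h] := scaled_root S K1 K2 c00 rho0.
pose d' := Num.min 1 (d / (2 * K ^+ 5)).
have d'0 : 0 < d' by rewrite lt_min ltr01/= divr_gt0// mulr_gt0.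
have d'1 : d' <= 1 by rewrite ge_min lexx.
have d'd : 2 * K ^+ 5 * d' <= d.
  by rewrite mulrC -ler_pdivlMr ?mulr_gt0// ge_min lexx orbT.
exists d' => // e tau wp e0 n0 ka0 tau0 ptau ed td.
have p0 : 0 < p e by rewrite addr_gt0.
have e20 : 0 < e ^+ 2 by rewrite exprn_gt0.
pose v := (e ^+ 2 * tau)^-1.
have v0 : 0 < v by rewrite invr_gt0 mulr_gt0.
have vd : v <= d' by rewrite -[leLHS]mul1r ler_pdivrMr// mulr_gt0.
have t0 : tau != 0 by exact: lt0r_neq0.
have pn0 : p e != 0 by exact: lt0r_neq0.
have en0 : e != 0 by exact: lt0r_neq0.
have N_E : p e * tau ^+ 4 = e ^+ 2 * tau ^+ 2 by rewrite -ptau; ring.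
have mw := measurable_omega wp; have mz := measurable_criticality wp.
apply: (h e tau (p e * tau ^+ 4) (fun=> 1) (fun=> 0) (fun=> 0)
  (fun z => ze z / (om z * e ^+ 2))) => //.
- by rewrite mulr_gt0// exprn_gt0.
- split => //; apply: measurable_funM => //; apply: measurable_funV.
  by apply: measurable_funM => //; exact: measurable_cst.
- apply: cmeasurable_isqrt; apply: measurable_funM => //; apply: measurable_funV.
  by apply: measurable_funM => //; exact: measurable_cst.
- move=> z Dz; have [_ wpz] := wp _ _ Dz.
  exact: (quartic_quadratic_main K2 (criticality_ratio K1 e0 wpz)).
move=> z Dz wpz; have [k_w /andP[_ kw2] wV G4] := wavepoint_bounds K1 wpz.
have [/andP[_ kK] _ /andP[wK _] _ [/andP[_ zK] _]] := wpz.
have w0 : om z != 0 by rewrite -normr_gt0; apply: lt_le_trans wK; rewrite invr_gt0.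
have v2 : e ^+ 2 * v ^+ 2 <= d'.
  apply: (@le_trans _ _ (1 * (1 * d'))); last by rewrite !mul1r.
  apply: ler_pM; rewrite ?sqr_ge0//; first exact: le_trans ed d'1.
  by rewrite expr2; apply: ler_pM => //; [exact: ltW|exact: ltW|exact: le_trans vd d'1].
have v4 : e ^+ 4 * v ^+ 2 <= d'.
  rewrite (_ : e ^+ 4 = e ^+ 2 * e ^+ 2); last by ring.
  rewrite -mulrA -[leRHS]mul1r; apply: ler_pM => //; rewrite ?sqr_ge0//.
    by rewrite mulr_ge0 ?sqr_ge0.
  exact: le_trans ed d'1.
split.
- by rewrite mulfV ?subrr ?normr0 ?(ltW d0)// mulf_neq0// expf_neq0.
- pose q := nu S e * kappa S e / p e ^+ 2.
  have q0 : 0 <= q by rewrite divr_ge0 ?sqr_ge0// mulr_ge0// ltW.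
  have q1 : q <= 1.
    rewrite ler_pdivrMr ?exprn_gt0// mul1r.
    exact: mul_le_sqr.
  have -> : nu S e * kappa S e * tau ^+ 6 / (om z * (p e * tau ^+ 4)) - 0 =
    q * (p e * tau ^+ 2) * (om z)^-1 by rewrite /q; field; rewrite w0 t0 pn0.
  rewrite ptau; have b1 : `|q * e ^+ 2| <= 1 * d'.
    by apply: bound_mul; rewrite ger0_norm// ltW.
  apply: le_trans (bound_mul b1 wV) _; apply: le_trans d'd.
  by rewrite mul1r mulrC ler_pM2r.
- have -> : 2 * (z.1 / om z) * s * c * tau / (p e * tau ^+ 4) - 0 =
    2 * (z.1 / om z) * (s * c) * v.
    by rewrite N_E /v; field; rewrite w0 t0 en0.
  have b1 : `|2 * (z.1 / om z)| <= 2 * K ^+ 2.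
    by rewrite normrM normr_nat (gtr0_norm k_w) ler_pM2l.
  have b2 : `|s * c| <= 1 by rewrite ger0_norm; case/andP: sc1.
  have b3 : `|v| <= d' by rewrite gtr0_norm.
  apply: le_trans (bound_mul (bound_mul b1 b2) b3) _.
  by apply: le_trans d'd; rewrite mulr1 ler_pM2r// ler_pM2l.
- rewrite N_E (_ : _ - _ = 0) ?normr0 ?(ltW d0)//.
  by field; rewrite w0 t0 en0.
- have -> : z.1 ^+ 2 * (om z ^+ 2 - c ^+ 2) / (om z * (p e * tau ^+ 4)) =
    z.1 ^+ 2 * (om z ^+ 2 - c ^+ 2) * (om z)^-1 * (e ^+ 2 * v ^+ 2).
    by rewrite N_E /v; field; rewrite w0 t0 en0.
  have b3 : `|e ^+ 2 * v ^+ 2| <= d' by rewrite ger0_norm// mulr_ge0 ?sqr_ge0.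
  split.
    apply: le_trans (bound_mul (bound_mul G4 wV) b3) _; apply: le_trans d'd.
    by rewrite (_ : 2 * K ^+ 4 * K = 2 * K ^+ 5)//; ring.
  have -> : z.1 ^+ 2 / tau ^+ 2 = z.1 ^+ 2 * (e ^+ 4 * v ^+ 2).
    by rewrite /v; field; rewrite t0 en0.
  have b1 : `|z.1 ^+ 2| <= K ^+ 2.
    by rewrite normrX; apply: lerXn2r; rewrite ?nnegrE// ltW.
  have b2 : `|e ^+ 4 * v ^+ 2| <= d' by rewrite ger0_norm// mulr_ge0 ?exprn_ge0// ltW.
  apply: le_trans (bound_mul b1 b2) _; apply: le_trans d'd.
  by rewrite ler_pM2r.
Qed.

End fast_and_intermediate_roots.

(** * The slowest root when the criticality dominates *)

Section slow_roots.
Context {R : realType}.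

Let bound_mul (x y X Y : R) : `|x| <= X -> `|y| <= Y -> `|x * y| <= X * Y.
Proof. by move=> hx hy; rewrite normrM ler_pM. Qed.

(** What remains is [L (B + i C L)]. Its nonzero root is purely imaginary, so the sign of its real
    part is left for the perturbation to decide. *)
Lemma quadratic_main (K B C b : R) : 1 <= K -> 0 < b <= B -> B <= K ->
  K^-1 <= `|C| <= K -> main_part (K ^+ 2) b 0 0 B C ('i%C * (B / C)%:C).
Proof.
move=> K1 /andP[b0 bB] BK /andP[CK CK']; have K0 : 0 < K by lra.
have C0 : C != 0 by rewrite -normr_gt0; apply: lt_le_trans CK; rewrite invr_gt0.
have CC : C%:C != 0 :> R[i] by rewrite fmorph_eq0.
have B0 : 0 < B by lra.
have KK : K <= K ^+ 2 by rewrite expr2 ler_peMl// ltW.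
have i2 : ('i%C : R[i]) ^+ 2 = -1 by exact: sqr_i.
split.
- by split; rewrite ?normr0 ?sqr_ge0// ?(gtr0_norm B0); apply: le_trans KK.
- rewrite Normc.normcM normc_i mul1r normc_real expr2; apply: bound_mul.
    by rewrite gtr0_norm.
  by rewrite normfV -(invrK K) lef_pV2 ?posrE ?invr_gt0// normr_gt0.
- rewrite /dpoly rmorphM/= fmorphV/= !rmorph0.
  transitivity ('i%C * (B%:C ^+ 2 / C%:C) * (1 + 'i%C ^+ 2) : R[i]); first by field.
  by rewrite i2 subrr mulr0.
- rewrite (_ : dpoly_deriv _ _ _ _ _ = - B%:C) ?normcN ?normc_real ?gtr0_norm//.
  rewrite /dpoly_deriv rmorphM/= fmorphV/= !rmorph0.
  transitivity (B%:C * (1 + 2 * 'i%C ^+ 2) : R[i]); first by field.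
  by rewrite i2; ring.
Qed.

Lemma Re_dpoly (A E B C G h X Y : R) :
  let u := X ^+ 2 - Y ^+ 2 - h in let v := 2 * X * Y in
  Re (dpoly A E B C G h (X +i* Y)) =
  A * (u ^+ 2 - v ^+ 2) + E * v * (3 * u ^+ 2 - v ^+ 2) + B * X - 2 * C * X * Y.
Proof.
move=> u v.
have x2 : (X +i* Y) ^+ 2 = (X ^+ 2 - Y ^+ 2) +i* (2 * X * Y).
  by apply: complex_eqP; rewrite expr2 ?Re_mulc ?Im_mulc/=; ring.
have d1 : (X +i* Y) ^+ 2 - h%:C = u +i* v.
  by rewrite x2; apply: complex_eqP; rewrite ?Re_addc ?Im_addc ?Re_oppc ?Im_oppc/=; rewrite ?oppr0 ?addr0.
have d2 : (u +i* v) ^+ 2 = (u ^+ 2 - v ^+ 2) +i* (2 * u * v).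
  by apply: complex_eqP; rewrite expr2 ?Re_mulc ?Im_mulc/=; ring.
have d3 : (u +i* v) ^+ 3 = (u ^+ 3 - 3 * u * v ^+ 2) +i* (v * (3 * u ^+ 2 - v ^+ 2)).
  by rewrite exprS d2; apply: complex_eqP; rewrite ?Re_mulc ?Im_mulc/=; ring.
rewrite /dpoly d1 d2 d3 x2 !(Re_addc, Re_oppc, Re_mulc, Im_mulc)/=.
by ring.
Qed.

(** [X] is the real part sought, [P] the real part of [(L ^ 2 - h) ^ 2]; [Z] measures the deviation
    of [Im L] from [B / C] and [F] the sextic term. Both are small against [B], so [X] is comparable
    to [A P / B]. *)
Let quotient_bounds (A b B K F Z P X w M : R) : 1 <= K -> 0 < A -> 0 < b -> b <= B ->
  B <= K -> `|F| <= b / 8 -> `|Z| <= b / 64 -> w ^+ 2 <= P -> P <= M ^+ 2 ->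
  X * (B + 2 * Z - 2 * F) = A * P ->
  w ^+ 2 / (2 * K) * A <= X <= 2 * M ^+ 2 / b * A.
Proof.
move=> K1 A0 b0 bB BK; rewrite !ler_norml => /andP[F1 F2] /andP[Z1 Z2] P_lo P_hi.
set Q := _ - _ => XQ.
have Q_lo : b / 2 <= Q by rewrite /Q; lra.
have Q_hi : Q <= 2 * K by rewrite /Q; lra.
have Q0 : 0 < Q by lra.
have -> : X = A * P / Q by rewrite -XQ mulfK// lt0r_neq0.
apply/andP; split.
  rewrite ler_pdivlMr// mulrAC [leRHS]mulrC; apply: ler_wpM2r; first exact: ltW.
  apply: le_trans P_lo; rewrite -mulrA ler_piMr ?sqr_ge0//.
  by rewrite mulrC ler_pdivrMr ?mul1r//; lra.
rewrite ler_pdivrMr//.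
have -> : 2 * M ^+ 2 / b * A * Q = A * (M ^+ 2 * (2 * Q / b)) by ring.
apply: ler_wpM2l; first exact: ltW.
apply: le_trans P_hi _; rewrite ler_peMr ?sqr_ge0// ler_pdivlMr//; lra.
Qed.

Let sqr_le (x X : R) : `|x| <= X -> x ^+ 2 <= X ^+ 2.
Proof.
move=> h; rewrite -[x ^+ 2]real_normK ?num_real//; apply: lerXn2r; rewrite ?nnegrE//.
exact: le_trans h.
Qed.

Let sqr_diff (u v w M : R) : 0 <= w -> 2 * w <= - u -> `|u| <= M -> `|v| <= w ->
  [/\ u ^+ 2 <= M ^+ 2, w ^+ 2 <= u ^+ 2 - v ^+ 2 & u ^+ 2 - v ^+ 2 <= M ^+ 2].
Proof.
move=> w0 hu uM /sqr_le vw; have u2 := sqr_le uM; have v2 := sqr_ge0 v; split => //.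
  have : (2 * w) * (2 * w) <= (- u) * (- u) by apply: ler_pM => //; lra.
  by have := sqr_ge0 w; nra.
by lra.
Qed.

Let scale_bounds (K b d : R) : 1 <= K -> 0 < b -> b <= K -> 0 <= d ->
  8 * 8 * K ^+ 4 * d <= b ^+ 2 ->
  [/\ 8 * 8 * K ^+ 2 * d <= b ^+ 2, d <= 1 & 8 * 8 * (K * d) <= b].
Proof.
move=> K1 b0 bK d0 dK; have K2 : 1 <= K ^+ 2 by rewrite exprn_ege1.
have b2 : b ^+ 2 <= K ^+ 2 by apply: lerXn2r; rewrite ?nnegrE//; lra.
have K4 : K ^+ 4 = K ^+ 2 * K ^+ 2 by ring.
have K3 : K <= K ^+ 3 by rewrite -{1}(expr1 K) ler_weXn2l.
have h2 : 8 * 8 * K ^+ 2 * d <= b ^+ 2.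
  apply: le_trans dK; rewrite K4; apply: ler_wpM2r => //.
  by rewrite ler_pM2l ?mulr_gt0// ler_peMl// (le_trans ler01).
have h3 : K * (8 * 8 * K ^+ 3 * d) <= K * b.
  rewrite (_ : K * (8 * 8 * K ^+ 3 * d) = 8 * 8 * K ^+ 4 * d); last by ring.
  by apply: (le_trans dK); rewrite expr2 ler_pM2r.
have K0 : 0 < K by lra.
rewrite ler_pM2l// in h3; split => //; last by clear -h3 K3 d0; nra.
have : K ^+ 2 * d <= K ^+ 2 * 1 by clear -h2 b2 K2 d0; nra.
by rewrite ler_pM2l// (lt_le_trans ltr01).
Qed.

(** [L] is within [d] of [i y], so [L ^ 2 - h] is close to [- y ^ 2]: its real part [u] is negative
    and bounded away from 0 while its imaginary part [v] is small, which keeps [u ^ 2 - v ^ 2]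
    positive. *)
Let uv_bounds (K b d X Y y h : R) : 1 <= K -> 0 < b -> b <= K -> 0 <= d ->
  8 * 8 * K ^+ 4 * d <= b ^+ 2 ->
  8 * 8 * K ^+ 2 * d <= b ^+ 2 -> d <= 1 -> 8 * 8 * (K * d) <= b ->
  `|X| <= d -> `|Y - y| <= d -> `|h| <= d -> `|y| <= K ^+ 2 -> b <= K * `|y| ->
  let u := X ^+ 2 - Y ^+ 2 - h in let v := 2 * X * Y in
  let w := b ^+ 2 / (16 * K ^+ 2) in let M := 6 * K ^+ 4 in
  [/\ 0 <= w, w <= M & [/\ `|Y| <= M, 2 * w <= - u, `|u| <= M & `|v| <= w]].
Proof.
move=> K1 b0 bK d0 dK td d1 Kd Xd Yd hd yK yb u v w M.
have K2 : 1 <= K ^+ 2 by rewrite exprn_ege1.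
have b2 : b ^+ 2 <= K ^+ 2 by apply: lerXn2r; rewrite ?nnegrE//; lra.
have MK : M = 6 * (K ^+ 2 * K ^+ 2) by rewrite /M; ring.
have dK' : 8 * 8 * (K ^+ 2 * K ^+ 2) * d <= b ^+ 2.
  by apply: le_trans dK; rewrite -exprD.
have Kt : K * K = K ^+ 2 by rewrite expr2.
set t := K ^+ 2 in dK' td K2 yK b2 MK Kt w *.
have t0 : 0 < t by exact: lt_le_trans ltr01 K2.
have w0 : 0 <= w by rewrite divr_ge0 ?sqr_ge0// mulr_ge0// ltW.
have wE : 16 * (w * t) = b ^+ 2 by rewrite /w; field; exact: lt0r_neq0.
have tt : t <= t * t by rewrite ler_peMl// ltW.
have wM : w <= M.
  have : t * w <= t * 1 by clear -wE b2 w0 t0; nra.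
  by rewrite ler_pM2l// => h1; rewrite MK; clear -h1 K2 tt; lra.
have aY : `|Y| <= 2 * t.
  have -> : Y = y + (Y - y) by ring.
  by apply: le_trans (ler_normD _ _) _; clear -yK Yd d1 K2; lra.
have KY : b / 2 <= K * `|Y|.
  have h1 : `|y| <= `|Y| + d.
    have -> : y = Y - (Y - y) by ring.
    by apply: le_trans (ler_normB _ _) _; rewrite lerD2l.
  have h2 : K * `|y| <= K * (`|Y| + d) by apply: ler_wpM2l => //; exact: le_trans ler01 K1.
  by clear -h2 yb Kd b0; lra.
have X2 : X ^+ 2 <= d.
  apply: (le_trans (sqr_le Xd)); rewrite expr2 ler_piMl//.
have Y2 : b ^+ 2 / 4 <= t * Y ^+ 2.
  have b20 : 0 <= b / 2 by rewrite divr_ge0// ltW.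
  have : (b / 2) * (b / 2) <= (K * `|Y|) * (K * `|Y|) by apply: ler_pM.
  rewrite [X in _ <= X]mulrACA Kt -[`|Y| * _]expr2 real_normK ?num_real//.
  by rewrite (_ : b / 2 * (b / 2) = b ^+ 2 / 4)//; field.
have Y2u : Y ^+ 2 <= 4 * (t * t) by apply: (le_trans (sqr_le aY)); rewrite (_ : (2 * t) ^+ 2 = 4 * (t * t))//; ring.
move: hd; rewrite ler_norml => /andP[hd1 hd2].
have td' : 8 * 8 * (t * d) <= b ^+ 2 by rewrite mulrA.
split => //; split.
- by apply: (le_trans aY); rewrite MK; clear -tt t0; lra.
- have : t * (2 * w) <= t * (- u).
    have h1 : t * X ^+ 2 <= t * d by rewrite ler_pM2l.
    have h2 : t * - h <= t * d by rewrite ler_pM2l// lerNl.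
    rewrite /u; clear -h1 h2 Y2 td' wE b0; have := sqr_ge0 b; lra.
  by rewrite ler_pM2l.
- rewrite ler_norml MK /u; have := sqr_ge0 X; have := sqr_ge0 Y.
  by clear -X2 Y2u hd1 hd2 d1 tt K2; lra.
- have : t * `|v| <= t * w.
    rewrite /v !normrM normr_nat.
    have h1 : `|X| * `|Y| <= d * (2 * t) by apply: ler_pM.
    have h2 : t * (`|X| * `|Y|) <= t * (d * (2 * t)) by rewrite ler_pM2l.
    by clear -h2 dK' wE; lra.
  by rewrite ler_pM2l.
Qed.

(* To leading order this root is purely imaginary; the size of its real part
   is read off the real part of the dispersion relation. *)
Lemma Re_slow_root (K A E B C G h b d : R) (L : R[i]) : 1 <= K -> 0 < A ->
  0 < b <= B -> B <= K -> K^-1 <= `|C| <= K ->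
  dpoly A E B C G h L = 0 -> 8 * 8 * K ^+ 4 * d <= b ^+ 2 ->
  normc (L - 'i%C * (B / C)%:C) <= d -> `|h| <= d ->
  32 * (`|E| * (6 * K ^+ 4) ^+ 3) <= b ->
  ((b ^+ 2 / (16 * K ^+ 2)) ^+ 2 / (2 * K)) * A <= Re L <=
  (2 * (6 * K ^+ 4) ^+ 2 / b) * A.
Proof.
move=> K1 A0 /andP[b0 bB] BK /andP[CK CK'] hL dK Ld hd hE.
have K0 : 0 < K by lra.
have C0 : C != 0 by rewrite -normr_gt0; apply: lt_le_trans CK; rewrite invr_gt0.
set y := B / C in Ld.
case: L hL Ld => X Y hL Ld.
have Xd : `|X| <= d.
  apply: le_trans Ld; have := ler_Re_normc ((X +i* Y) - 'i%C * y%:C).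
  by rewrite Re_addc Re_oppc Re_mulc/=; rewrite mul0r mulr0 subrr subr0.
have Yd : `|Y - y| <= d.
  apply: le_trans Ld; have := ler_Im_normc ((X +i* Y) - 'i%C * y%:C).
  by rewrite Im_addc Im_oppc Im_mulc/=; rewrite mul0r mul1r add0r.
have d0 : 0 <= d by apply: le_trans Xd.
have := congr1 (@Re R) hL; rewrite Re_dpoly/=.
set u := X ^+ 2 - Y ^+ 2 - h; set v := 2 * X * Y => hRe.
have Cy : C * y = B by rewrite /y; field.
have yK : `|y| <= K ^+ 2.
  rewrite /y expr2; apply: bound_mul; first by rewrite gtr0_norm//; lra.
  by rewrite normfV -(invrK K) lef_pV2 ?posrE ?invr_gt0// normr_gt0.
have yb : b <= K * `|y|.
  apply: (le_trans bB); have -> : B = `|C| * `|y|.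
    by rewrite -normrM Cy gtr0_norm//; lra.
  by rewrite ler_wpM2r.
have bK : b <= K := le_trans bB BK.
have [td d1 Kd] := scale_bounds K1 b0 bK d0 dK.
have [w0 w1 [YM u_lo u_hi v_hi]] :=
  uv_bounds K1 b0 bK d0 dK td d1 Kd Xd Yd hd yK yb.
rewrite -/u -/v in u_lo u_hi v_hi.
set w := b ^+ 2 / (16 * K ^+ 2) in w0 w1 u_lo v_hi *.
set M := 6 * K ^+ 4 in hE YM u_hi *.
have vM : `|v| <= M := le_trans v_hi w1.
have [u2M P_lo P_hi] := sqr_diff w0 u_lo u_hi v_hi.
have v2M := sqr_le vM.
pose F := E * Y * (3 * u ^+ 2 - v ^+ 2).
have FM : `|F| <= b / 8.
  have h3 : `|3 * u ^+ 2 - v ^+ 2| <= 4 * M ^+ 2.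
    clear -u2M v2M; rewrite ler_norml; have := sqr_ge0 v; have := sqr_ge0 u; lra.
  apply: (le_trans (bound_mul (bound_mul (lexx `|E|) YM) h3)).
  rewrite (_ : `|E| * M * _ = 4 * (`|E| * M ^+ 3)); last by ring.
  by move: hE; lra.
pose Z := C * (Y - y).
have ZK : `|Z| <= b / 64.
  apply: (le_trans (bound_mul CK' Yd)).
  by rewrite ler_pdivlMr// (_ : K * d * 64 = 8 * 8 * (K * d))//; ring.
apply: (quotient_bounds K1 A0 b0 bB BK FM ZK P_lo P_hi).
have -> : X * (B + 2 * Z - 2 * F) = X * (B + 2 * (C * Y) - 2 * (C * y) - 2 * F).
  by rewrite /Z; ring.
by rewrite Cy /F; clear -hRe; move: hRe; rewrite /v; lra.
Qed.

End slow_roots.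

Section slow_root_families.
Context {R : realType} (S : setting R).
Local Notation T := (measurableTypeR R * measurableTypeR R)%type.
Local Notation s := (sin (slope S)).
Local Notation c := (cos (slope S)).
Local Notation p e := (nu S e + kappa S e).
Local Notation om z := (omega S z.1 z.2).
Local Notation ze z := (criticality S z.1 z.2).
Hypothesis hgamma : 0 < slope S < pi / 2.

Let bound_mul (x y X Y : R) : `|x| <= X -> `|y| <= Y -> `|x * y| <= X * Y.
Proof. by move=> hx hy; rewrite normrM ler_pM. Qed.

Lemma coupling_bounds : exists2 b : R, 0 < b <= 2 & forall K k w : R, 1 <= K ->
  K ^- 2 <= k / w <= K ^+ 2 -> b * K ^- 2 <= 2 * (k / w) * s * c <= 2 * K ^+ 2.
Proof.
have s0 := sin_slope_gt0 hgamma; have c0 := cos_slope_gt0 hgamma.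
have h1 : s <= 1 by exact: sin_le1.
have h2 : c <= 1 by exact: cos_le1.
have sc0 := mulr_gt0 s0 c0.
have sc1 : s * c <= 1 by nra.
exists (2 * (s * c)); first by apply/andP; split; lra.
clear -sc0 sc1 => K k w K1 /andP[h1 h2].
have K2 : 0 < K ^- 2 by rewrite invr_gt0 exprn_gt0//; lra.
have -> : 2 * (k / w) * s * c = 2 * (s * c) * (k / w) by ring.
by apply/andP; split; nra.
Qed.

Let powers (K : R) : 1 <= K -> [/\ 1 <= K ^+ 2, K <= K ^+ 5, K ^+ 2 <= K ^+ 5 & 0 < K ^+ 5].
Proof.
move=> K1; split; rewrite ?exprn_ege1 ?exprn_gt0 ?(lt_le_trans ltr01)//.
- by rewrite -{1}(expr1 K) ler_weXn2l.
- by rewrite ler_weXn2l.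
Qed.

Let choose_small (a1 a2 a3 x1 x2 x3 : R) : 0 < a1 -> 0 < a2 -> 0 < a3 ->
  0 < x1 -> 0 < x2 -> 0 < x3 ->
  exists2 d : R, 0 < d <= 1 & [/\ x1 * d <= a1, x2 * d <= a2 & x3 * d <= a3].
Proof.
move=> a10 a20 a30 x10 x20 x30.
exists (Num.min 1 (Num.min (a1 / x1) (Num.min (a2 / x2) (a3 / x3)))).
  by rewrite !lt_min ltr01 !divr_gt0//= ge_min lexx.
by split; rewrite mulrC -ler_pdivlMr// !ge_min lexx ?orbT.
Qed.

(** With [tau = N = e ^ (-2)] the coupling and the criticality are of order one, and
    [A = (nu + kappa) / e ^ 6] is the small parameter; it also gives the order of the real part of
    [L]. *)
Lemma subcritical_root (K : R) : 1 <= K ->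
  exists2 d : R, 0 < d & exists2 c1 : R, 0 < c1 & exists2 C1 : R, 0 < C1 &
  forall e : R, wave_points S K e -> 0 < e -> 0 < nu S e -> 0 < kappa S e ->
    p e / e ^+ 6 <= d -> e ^+ 2 <= d ->
    exists2 L : T -> R[i], cmeasurable (nzAhat S e) L &
      forall z : T, supp_Ahat S e (z.1, z.2) ->
      [/\ dispersion_relation S e z.1 (om z) ((e ^- 2)%:C * L z),
          c1 * (p e / e ^+ 6) <= Re (L z) <= C1 * (p e / e ^+ 6) &
          c1 <= normc (L z) <= C1].
Proof.
move=> K1; have K0 : 0 < K by lra.
have [K2 K5 K25 K50] := powers K1.
have [b0 /andP[b00 b02] hB] := coupling_bounds.
pose b := b0 * K ^- 2; pose Kq := 2 * K ^+ 2.
have bgt : 0 < b by rewrite mulr_gt0// invr_gt0 exprn_gt0.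
have Kq1 : 1 <= Kq by rewrite /Kq; lra.
have Kq0 : 0 < Kq by lra.
have Kq21 : 1 <= Kq ^+ 2 by rewrite exprn_ege1.
have K20 : 0 < K ^+ 2 by lra.
have bKq : b <= Kq.
  have : K ^- 2 <= 1 by rewrite invf_le1.
  have : 0 < K ^- 2 by rewrite invr_gt0.
  by rewrite /b /Kq; nra.
(* The distance to [i B / C] tolerated by [Re_slow_root]. *)
pose dd := b ^+ 2 / (8 * 8 * Kq ^+ 4).
have dd0 : 0 < dd by rewrite divr_gt0 ?exprn_gt0// !mulr_gt0// exprn_gt0.
have ddE : 8 * 8 * Kq ^+ 4 * dd <= b ^+ 2.
  by rewrite /dd mulrC divfK// lt0r_neq0// !mulr_gt0// exprn_gt0.
have [dsc dsc0 h] := scaled_dpoly_root S K1 Kq21 bgt dd0.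
pose M3 := (6 * Kq ^+ 4) ^+ 3.
have M30 : 0 < M3 by rewrite exprn_gt0// mulr_gt0// exprn_gt0.
have x20 : 0 < 2 * K ^+ 5 by rewrite mulr_gt0.
have x30 : 0 < 32 * (K * M3) by rewrite !mulr_gt0.
have [d /andP[d0 d1] [ds dd' db]] := choose_small dsc0 dd0 bgt x20 x20 x30.
pose C1 := Kq ^+ 2 + 1 + 2 * (6 * Kq ^+ 4) ^+ 2 / b.
pose c1 := Num.min (b / (2 * Kq)) ((b ^+ 2 / (16 * Kq ^+ 2)) ^+ 2 / (2 * Kq)).
have c10 : 0 < c1.
  rewrite lt_min; apply/andP; split; first by rewrite divr_gt0// mulr_gt0.
  have q0 : 0 < b ^+ 2 / (16 * Kq ^+ 2).
    by apply: divr_gt0; [exact: exprn_gt0|apply: mulr_gt0 => //; exact: exprn_gt0].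
  by apply: divr_gt0; [exact: exprn_gt0|exact: mulr_gt0].
have C1q : 0 <= 2 * (6 * Kq ^+ 4) ^+ 2 / b.
  by apply: divr_ge0; [apply: mulr_ge0 => //; exact: sqr_ge0|exact: ltW].
have C10 : 0 < C1 by rewrite /C1 ltr_wpDr// ltr_wpDl ?sqr_ge0 ?ltr01.
exists d => //; exists c1 => //; exists C1 => // e wp e0 n0 ka0 pd ed.
have p0 : 0 < p e by rewrite addr_gt0.
have e20 : 0 < e ^+ 2 by rewrite exprn_gt0.
have en0 : e != 0 by exact: lt0r_neq0.
have mw := measurable_omega wp; have mz := measurable_criticality wp.
have mk : measurable_fun (nzAhat S e) (fun z : T => z.1).
  by apply: measurable_funTS; exact: measurable_fst.
have mcst (x : R) : measurable_fun (nzAhat S e) (fun=> x) by exact: measurable_cst.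
pose B := fun z : T => 2 * (z.1 / om z) * s * c.
pose C := fun z : T => ze z / (om z * e ^+ 2).
have mB : measurable_fun (nzAhat S e) B.
  do 2 (apply: measurable_funM; last exact: mcst).
  apply: measurable_funM; first exact: mcst.
  by apply: measurable_funM => //; exact: measurable_funV.
have mC : measurable_fun (nzAhat S e) C.
  apply: measurable_funM => //; apply: measurable_funV.
  by apply: measurable_funM => //; exact: mcst.
have Bb z : supp_Ahat S e (z.1, z.2) -> b <= B z <= Kq.
  move=> Dz; have [_ wpz] := wp _ _ Dz; have [_ kw _ _] := wavepoint_bounds K1 wpz.
  exact: hB.
have Cb z : supp_Ahat S e (z.1, z.2) -> Kq^-1 <= `|C z| <= Kq.
  move=> Dz; have [_ wpz] := wp _ _ Dz.
  have /andP[h1 h2] := criticality_ratio K1 e0 wpz; apply/andP; split.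
    by apply: le_trans h1; rewrite lef_pV2 ?posrE// /Kq; clear -hgamma K20; lra.
  by apply: (le_trans h2); rewrite /Kq; clear -hgamma K20; lra.
have main z : supp_Ahat S e (z.1, z.2) ->
    main_part (Kq ^+ 2) b 0 0 (B z) (C z) ('i%C * (B z / C z)%:C).
  move=> Dz; have /andP[h1 h2] := Bb z Dz.
  by apply: quadratic_main => //; [rewrite bgt h1|exact: Cb].
(* Because [nu kappa <= (nu + kappa) ^ 2], the sextic coefficient is at most
   [((nu + kappa) / e ^ 6) ^ 2 e ^ 2], up to the factor [1 / w]. *)
have pE : (nu S e * kappa S e) * (e ^- 2) ^+ 6 / e ^- 2 =
  nu S e * kappa S e / p e ^+ 2 * (p e / e ^+ 6) ^+ 2 * e ^+ 2.
  by field; rewrite en0 lt0r_neq0.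
have a0 : 0 <= p e / e ^+ 6 by rewrite divr_ge0 ?exprn_ge0 ?ltW.
have E0 : 0 <= (nu S e * kappa S e) * (e ^- 2) ^+ 6 / e ^- 2.
  by rewrite divr_ge0 ?mulr_ge0 ?exprn_ge0 ?invr_ge0 ?exprn_ge0// ltW.
have Ed : (nu S e * kappa S e) * (e ^- 2) ^+ 6 / e ^- 2 <= d.
  rewrite pE; have q1 : nu S e * kappa S e / p e ^+ 2 <= 1.
    rewrite ler_pdivrMr ?exprn_gt0// mul1r; clear -n0 ka0.
    by have := mulr_gt0 n0 ka0; nra.
  have q0 : 0 <= nu S e * kappa S e / p e ^+ 2.
    by rewrite divr_ge0 ?sqr_ge0// mulr_ge0// ltW.
  have a1 : p e / e ^+ 6 <= 1 := le_trans pd d1.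
  have a2 : (p e / e ^+ 6) ^+ 2 <= 1 by rewrite expr2 -[leRHS]mul1r; apply: ler_pM.
  have qa : nu S e * kappa S e / p e ^+ 2 * (p e / e ^+ 6) ^+ 2 <= 1.
    by rewrite -[leRHS]mul1r; apply: ler_pM => //; exact: sqr_ge0.
  rewrite -[leRHS]mul1r; apply: ler_pM => //; last exact: sqr_ge0.
  by apply: mulr_ge0 => //; exact: sqr_ge0.
have dE z : om z != 0 -> nu S e * kappa S e * (e ^- 2) ^+ 6 / (om z * e ^- 2) =
    (nu S e * kappa S e) * (e ^- 2) ^+ 6 / e ^- 2 * (om z)^-1.
  by move=> w0; field; rewrite en0 w0.
have t0 : 0 < e ^- 2 by rewrite invr_gt0.
have Es z : supp_Ahat S e (z.1, z.2) ->
    `|nu S e * kappa S e * (e ^- 2) ^+ 6 / (om z * e ^- 2)| <= K * d.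
  move=> Dz; have [_ wpz] := wp _ _ Dz; have [_ _ wV _] := wavepoint_bounds K1 wpz.
  have [_ _ w0] := wavepoint_neq0 K1 wp Dz.
  rewrite dE// mulrC; apply: bound_mul => //; rewrite ger0_norm//.
have hs z : supp_Ahat S e (z.1, z.2) -> `|z.1 ^+ 2 / (e ^- 2) ^+ 2| <= 2 * K ^+ 5 * d.
  move=> Dz; have [_ [/andP[_ kK] _ _ _ _]] := wp _ _ Dz.
  have -> : z.1 ^+ 2 / (e ^- 2) ^+ 2 = z.1 ^+ 2 * (e ^+ 2 * e ^+ 2).
    by field; rewrite en0.
  apply: bound_mul.
    rewrite normrX; apply: (@le_trans _ _ (K ^+ 2)).
      by apply: lerXn2r; rewrite ?nnegrE// ltW.
    by clear -hgamma K25 K50; lra.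
  rewrite normrM !(gtr0_norm e20) -[leRHS]mul1r; apply: ler_pM => //; try exact: ltW.
  exact: (le_trans ed d1).
have Kd : K * d <= 2 * K ^+ 5 * d by rewrite ler_pM2r//; clear -hgamma K5 K50; lra.
have mL0 : cmeasurable (nzAhat S e) (fun z => 'i%C * (B z / C z)%:C).
  apply: cmeasurableM; first exact: cmeasurable_cst.
  apply: cmeasurable_real; apply: measurable_funM => //; exact: measurable_funV.
have [||L mL hL] := h e (e ^- 2) (e ^- 2) (fun=> 0) (fun=> 0) B C _ wp t0 t0 _ mL0 main.
- by split.
- move=> z Dz wpz; have [_ _ wV G4] := wavepoint_bounds K1 wpz.
  have [_ _ w0] := wavepoint_neq0 K1 wp Dz.
  have aE : p e * (e ^- 2) ^+ 4 / e ^- 2 = p e / e ^+ 6 by field.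
  have d5 : d <= 2 * K ^+ 5 * d by rewrite ler_peMl// ?ltW//; clear -hgamma K1 K5; lra.
  split.
  + rewrite subr0 aE ger0_norm//; apply: (le_trans pd); exact: le_trans ds.
  + by rewrite subr0; apply: (le_trans (Es z Dz)); exact: le_trans ds.
  + rewrite /B mulfK ?lt0r_neq0// subrr normr0; exact: ltW.
  + rewrite (_ : _ - _ = 0) ?normr0 ?(ltW dsc0)// /C; field; by rewrite en0 w0.
  + split; last exact: le_trans (hs z Dz) ds.
    have -> : z.1 ^+ 2 * (om z ^+ 2 - c ^+ 2) / (om z * e ^- 2) =
      z.1 ^+ 2 * (om z ^+ 2 - c ^+ 2) * (om z)^-1 * e ^+ 2 by field; rewrite en0 w0.
    have b3 : `|e ^+ 2| <= d by rewrite gtr0_norm.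
    apply: (le_trans (bound_mul (bound_mul G4 wV) b3)); apply: le_trans ds.
    by rewrite (_ : 2 * K ^+ 4 * K = 2 * K ^+ 5)//; ring.
exists L => // z Dz; have [disp Ld hdp] := hL z Dz.
have [_ wpz] := wp _ _ Dz; have [_ _ w0] := wavepoint_neq0 K1 wp Dz.
have /andP[Bz1 Bz2] := Bb z Dz; have /andP[Cz1 Cz2] := Cb z Dz.
have aE : p e * (e ^- 2) ^+ 4 / e ^- 2 = p e / e ^+ 6 by field.
have BE : 2 * (z.1 / om z) * s * c * e ^- 2 / e ^- 2 = B z by rewrite mulfK ?lt0r_neq0.
have CE : ze z * (e ^- 2) ^+ 2 / (om z * e ^- 2) = C z.
  by rewrite /C; field; rewrite en0 w0.
rewrite aE BE CE in hdp.
have agt : 0 < p e / e ^+ 6 by rewrite divr_gt0 ?exprn_gt0.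
have bB : 0 < b <= B z by rewrite bgt.
have hE : 32 * (`|nu S e * kappa S e * (e ^- 2) ^+ 6 / (om z * e ^- 2)| *
    (6 * Kq ^+ 4) ^+ 3) <= b.
  apply: le_trans db; rewrite -/M3.
  rewrite (_ : 32 * (K * M3) * d = 32 * (K * d * M3)); last by ring.
  by rewrite ler_pM2l// ler_pM2r// Es.
have hh : `|z.1 ^+ 2 / (e ^- 2) ^+ 2| <= dd := le_trans (hs z Dz) dd'.
have /andP[R1 R2] := Re_slow_root Kq1 agt bB Bz2 (Cb z Dz) hdp ddE Ld hh hE.
split => //.
  apply/andP; split.
    by apply: le_trans R1; rewrite ler_pM2r// ge_min lexx orbT.
  by apply: (le_trans R2); rewrite ler_pM2r// /C1; have := sqr_ge0 Kq; clear -hgamma; lra.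
have n0' : normc ('i%C * (B z / C z)%:C) = B z / `|C z|.
  rewrite Normc.normcM normc_i mul1r normc_real normrM normfV gtr0_norm//.
  exact: lt_le_trans Bz1.
have C0 : 0 < `|C z| by apply: lt_le_trans Cz1; rewrite invr_gt0.
have q1 : b / Kq <= B z / `|C z|.
  by apply: ler_pM => //; rewrite ?invr_ge0 ?(ltW bgt) ?(ltW Kq0)// lef_pV2 ?posrE.
have q2 : B z / `|C z| <= Kq ^+ 2.
  have [_ + _ _] := main z Dz; by rewrite n0'.
have dds : dd <= b / (2 * Kq).
  rewrite /dd ler_pdivrMr ?mulr_gt0 ?exprn_gt0//.
  rewrite (_ : b / (2 * Kq) * _ = b * (32 * Kq ^+ 3)); last by field; exact: lt0r_neq0.
  rewrite expr2 ler_pM2l//; apply: (le_trans bKq).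
  rewrite -[leLHS]mul1r; apply: ler_pM; rewrite ?(ltW Kq0)//; first by rewrite ler1n.
  by rewrite -{1}(expr1 Kq) ler_weXn2l.
have dd1 : dd <= 1.
  apply: (le_trans dds); rewrite ler_pdivrMr ?mulr_gt0// mul1r.
  by clear -hgamma bKq Kq0; lra.
have LE : L z = 'i%C * (B z / C z)%:C + (L z - 'i%C * (B z / C z)%:C) by ring.
apply/andP; split.
  have h3 := lerB_normcD ('i%C * (B z / C z)%:C) (L z - 'i%C * (B z / C z)%:C).
  rewrite -LE n0' in h3; apply: le_trans h3.
  apply: (@le_trans _ _ (b / (2 * Kq))); first by rewrite ge_min lexx.
  have -> : b / (2 * Kq) = b / Kq - b / (2 * Kq) by field; exact: lt0r_neq0.
  by apply: lerB => //; exact: le_trans Ld dds.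
rewrite LE; apply: le_trans (ler_normcD _ _) _; rewrite n0'.
by rewrite /C1; clear -hgamma q2 Ld dd1 C1q; lra.
Qed.

End slow_root_families.

(** * The two slow roots given by the cubic *)

Section critical_roots.
Context {R : realType} (S : setting R).
Local Notation T := (measurableTypeR R * measurableTypeR R)%type.
Local Notation s := (sin (slope S)).
Local Notation c := (cos (slope S)).
Local Notation p e := (nu S e + kappa S e).
Local Notation om z := (omega S z.1 z.2).
Local Notation ze z := (criticality S z.1 z.2).
Hypothesis hgamma : 0 < slope S < pi / 2.

Let bound_mul (x y X Y : R) : `|x| <= X -> `|y| <= Y -> `|x * y| <= X * Y.
Proof. by move=> hx hy; rewrite normrM ler_pM. Qed.

(** Dividing [a L ^ 4 + i C L ^ 2 + B L] by [a L] leaves the cubic with [z = C / a] and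
    [r = B / a > 0]. Only an upper bound on [|C|] is asked, which includes the scales where the
    criticality is negligible. *)
Lemma quartic_cubic_main (K b : R) : 1 <= K -> 0 < b ->
  exists2 m : R, 0 < m & forall a B C : R, K^-1 <= a <= K -> b <= B <= K -> `|C| <= K ->
  let x1 := cubic_root1 (C / a) (B / a) in let x2 := cubic_root2 (C / a) (B / a) in
  [/\ m <= Re x1, m <= Re x2, m <= normc (x1 - x2) &
      main_part (1 + K ^+ 2 + K ^+ 2) m a 0 B C x1 /\
      main_part (1 + K ^+ 2 + K ^+ 2) m a 0 B C x2].
Proof.
move=> K1 b0; have K0 : 0 < K by lra.
pose r1 := b / K; pose Z := K ^+ 2.
pose Km := 1 + Z + Z; pose mu := r1 / (Km ^+ 2 + Z).
have r10 : 0 < r1 by rewrite divr_gt0.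
have Z0 : 0 < Z by rewrite exprn_gt0.
have Km0 : 0 < Km by rewrite /Km; lra.
have mu0 : 0 < mu by rewrite divr_gt0// addr_gt0// exprn_gt0.
pose m0 := Num.min (mu / 2) (mu ^+ 4 / (2 * Z)).
have m00 : 0 < m0.
  by rewrite lt_min divr_gt0//= divr_gt0 ?exprn_gt0// mulr_gt0.
pose m1 := r1 / (4 * Km ^+ 2); pose m2 := K^-1 * m0 * (r1 / (2 * Km)).
have m10 : 0 < m1 by rewrite divr_gt0// mulr_gt0// exprn_gt0.
have m20 : 0 < m2 by rewrite !mulr_gt0 ?invr_gt0// mulr_gt0.
pose m := Num.min m0 (Num.min m1 m2).
have hm0 : m <= m0 by rewrite ge_min lexx.
have hm1 : m <= m1 by rewrite !ge_min lexx !orbT.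
have hm2 : m <= m2 by rewrite !ge_min lexx !orbT.
exists m; first by rewrite lt_min m00/= lt_min m10.
move=> a B C /andP[aK aK'] /andP[bB BK] CK x1 x2.
have a0 : 0 < a by apply: lt_le_trans aK; rewrite invr_gt0.
have B0 : 0 < B by lra.
have aV : a^-1 <= K by rewrite -(invrK K) lef_pV2 ?posrE ?invr_gt0.
have aV0 : 0 < a^-1 by rewrite invr_gt0.
have r0 : 0 < B / a by rewrite divr_gt0.
have zZ : `|C / a| <= Z.
  by rewrite /Z expr2; apply: bound_mul => //; rewrite gtr0_norm.
have rr1 : r1 <= B / a.
  by apply: ler_pM => //; rewrite ?invr_ge0 ?(ltW b0) ?(ltW K0)// lef_pV2 ?posrE.
have rr2 : B / a <= Z by rewrite /Z expr2; apply: ler_pM => //; exact: ltW.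
have [h1 h2 h3 h4 [h5 h6 h7]] := cubic_roots_bounds r0 zZ r10 rr1 rr2.
have c1 := cubic_root1P (C / a) r0; have c2 := cubic_root2P (C / a) r0.
rewrite -/x1 -/x2 -/Km -/mu -/m0 in h1 h2 h3 h4 h5 h6 h7 c1 c2.
have an0 : a%:C != 0 :> R[i] by rewrite fmorph_eq0 lt0r_neq0.
have KZ : K <= Z by rewrite /Z expr2 ler_peMl// ltW.
have ZKm : Z <= Km by rewrite /Km lerDr addr_ge0// /Z sqr_ge0.
have mainx x : x ^+ 3 + 'i%C * (C / a)%:C * x + (B / a)%:C = 0 -> m0 <= Re x ->
    normc x <= Km -> r1 / (2 * Km) <= normc (3 * x ^+ 2 + 'i%C * (C / a)%:C) ->
    main_part Km m a 0 B C x.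
  move=> hx Rx nx dx.
  have Cx : C%:C = a%:C * (C / a)%:C :> R[i].
    by rewrite -rmorphM/= mulrC divfK// lt0r_neq0.
  have Bx : B%:C = a%:C * (B / a)%:C :> R[i].
    by rewrite -rmorphM/= mulrC divfK// lt0r_neq0.
  split => //.
  - split; rewrite ?normr0 ?(ltW Km0)//.
    + by rewrite gtr0_norm//; apply: (le_trans aK'); exact: le_trans KZ _.
    + by rewrite gtr0_norm//; apply: (le_trans BK); exact: le_trans KZ _.
    + by apply: (le_trans CK); exact: le_trans KZ _.
  - transitivity (a%:C * x * (x ^+ 3 + 'i%C * (C / a)%:C * x + (B / a)%:C)); last first.
      by rewrite hx mulr0.
    by rewrite /dpoly Cx Bx !rmorph0; ring.
  - have -> : dpoly_deriv a 0 B C x = a%:C * x * (3 * x ^+ 2 + 'i%C * (C / a)%:C).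
      apply/eqP; rewrite -subr_eq0; apply/eqP.
      transitivity (a%:C * (x ^+ 3 + 'i%C * (C / a)%:C * x + (B / a)%:C)); last first.
        by rewrite hx mulr0.
      by rewrite /dpoly_deriv Cx Bx !rmorph0; ring.
    apply: (le_trans hm2); rewrite /m2 !Normc.normcM normc_real (gtr0_norm a0).
    apply: ler_pM => //.
    + by rewrite mulr_ge0 ?invr_ge0 ?(ltW m00) ?(ltW K0).
    + by apply: divr_ge0; [exact: ltW|apply: mulr_ge0 => //; exact: ltW].
    apply: ler_pM => //; rewrite ?invr_ge0 ?(ltW K0) ?(ltW m00)//.
    by apply: (le_trans Rx); apply: (le_trans (ler_norm _)); exact: ler_Re_normc.
split.
- exact: le_trans hm0 h1.
- exact: le_trans hm0 h2.
- exact: le_trans hm1 h5.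
- by split; apply: mainx.
Qed.

Let powers (K : R) : 1 <= K -> [/\ 1 <= K ^+ 2, K <= K ^+ 2, K ^+ 2 <= K ^+ 5 & 0 < K ^+ 5].
Proof.
move=> K1; split; rewrite ?exprn_ege1 ?exprn_gt0 ?(lt_le_trans ltr01)//.
- by rewrite -{1}(expr1 K) ler_weXn2l.
- by rewrite ler_weXn2l.
Qed.

(** The scale [eta] balances viscosity and coupling, [(nu + kappa) / eta ^ 3] being of order one.
    The assumption [e ^ 2 <= eta] keeps the criticality bounded, and the smallness of
    [nu kappa / eta ^ 5] removes the sextic term. *)
Lemma critical_roots (K : R) : 1 <= K ->
  exists2 d : R, 0 < d & exists2 c1 : R, 0 < c1 & exists2 C1 : R, 0 < C1 &
  forall e eta : R, wave_points S K e -> 0 < nu S e -> 0 < kappa S e ->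
    0 < eta <= d -> e ^+ 2 <= eta -> K^-1 <= p e / eta ^+ 3 <= K ->
    nu S e * kappa S e / eta ^+ 5 <= d ->
    exists L2 L3 : T -> R[i], [/\ cmeasurable (nzAhat S e) L2,
      cmeasurable (nzAhat S e) L3 &
      forall z : T, supp_Ahat S e (z.1, z.2) ->
      [/\ dispersion_relation S e z.1 (om z) ((eta^-1)%:C * L2 z),
          dispersion_relation S e z.1 (om z) ((eta^-1)%:C * L3 z),
          c1 <= Re (L2 z) /\ c1 <= Re (L3 z),
          normc (L2 z) <= C1 /\ normc (L3 z) <= C1 &
          c1 <= normc (L2 z - L3 z)]].
Proof.
move=> K1; have K0 : 0 < K by lra.
have [K2 KK2 K25 K50] := powers K1.
have [b0 /andP[b00 b02] hB] := coupling_bounds hgamma.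
pose b := b0 * K ^- 2; pose Kq := 2 * K ^+ 2.
have bgt : 0 < b by rewrite mulr_gt0// invr_gt0 exprn_gt0.
have Kq1 : 1 <= Kq by rewrite /Kq; lra.
have KqS : K ^+ 2 <= Kq by rewrite /Kq ler_peMl ?sqr_ge0 ?ler1n.
have Kq0 : 0 < Kq by lra.
have [m m0 hm] := quartic_cubic_main Kq1 bgt.
pose Km := 1 + Kq ^+ 2 + Kq ^+ 2.
have Km1 : 1 <= Km by rewrite /Km -addrA lerDl addr_ge0 ?sqr_ge0.
(* A displacement of [m / 4] leaves at least half of the real parts and of the separation of the two
   roots. *)
have r0 : 0 < m / 4 by rewrite divr_gt0.
have [dsc dsc0 h] := scaled_root S K1 Km1 m0 r0.
pose d := Num.min 1 (dsc / (2 * K ^+ 5)).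
have d0 : 0 < d by rewrite lt_min ltr01/= divr_gt0// mulr_gt0.
have d1 : d <= 1 by rewrite ge_min lexx.
have dd : 2 * K ^+ 5 * d <= dsc.
  by rewrite mulrC -ler_pdivlMr ?mulr_gt0// ge_min lexx orbT.
exists d => //; exists (m / 2); first exact: divr_gt0.
exists (Km + m); first by rewrite addr_gt0// (lt_le_trans ltr01).
move=> e eta wp n0 ka0 /andP[eta0 etad] eeta /andP[aK aK'] Ed.
have p0 : 0 < p e by rewrite addr_gt0.
have t0 : 0 < eta^-1 by rewrite invr_gt0.
have en0 : eta != 0 by exact: lt0r_neq0.
have mw := measurable_omega wp; have mz := measurable_criticality wp.
have mk : measurable_fun (nzAhat S e) (fun z : T => z.1).
  by apply: measurable_funTS; exact: measurable_fst.
have mcst (x : R) : measurable_fun (nzAhat S e) (fun=> x) by exact: measurable_cst.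
pose a := p e / eta ^+ 3.
pose B := fun z : T => 2 * (z.1 / om z) * s * c.
pose C := fun z : T => ze z / (om z * eta).
have mB : measurable_fun (nzAhat S e) B.
  do 2 (apply: measurable_funM; last exact: mcst).
  apply: measurable_funM; first exact: mcst.
  by apply: measurable_funM => //; exact: measurable_funV.
have mC : measurable_fun (nzAhat S e) C.
  apply: measurable_funM => //; apply: measurable_funV.
  by apply: measurable_funM => //; exact: mcst.
have KKq : K <= Kq := le_trans KK2 KqS.
have aq : Kq^-1 <= a <= Kq.
  apply/andP; split; last exact: le_trans aK' KKq.
  by apply: le_trans aK; rewrite lef_pV2 ?posrE.
have Bb z : supp_Ahat S e (z.1, z.2) -> b <= B z <= Kq.
  move=> Dz; have [_ wpz] := wp _ _ Dz; have [_ kw _ _] := wavepoint_bounds K1 wpz.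
  exact: hB.
have Cb z : supp_Ahat S e (z.1, z.2) -> `|C z| <= Kq.
  move=> Dz; have [_ wpz] := wp _ _ Dz; have [_ _ wV _] := wavepoint_bounds K1 wpz.
  have [_ _ _ _ [/andP[_ zK] _]] := wpz.
  have [_ _ w0] := wavepoint_neq0 K1 wp Dz.
  have -> : C z = ze z / eta * (om z)^-1 by rewrite /C; field; rewrite w0 en0.
  apply: (@le_trans _ _ (K * K)); last by rewrite -expr2.
  apply: bound_mul => //; rewrite normrM normfV (gtr0_norm eta0) ler_pdivrMr//.
  by apply: (le_trans zK); rewrite ler_pM2l.
have mains z : supp_Ahat S e (z.1, z.2) -> _ := fun Dz => hm a _ _ aq (Bb z Dz) (Cb z Dz).
have mZ : measurable_fun (nzAhat S e) (fun z => C z / a).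
  by apply: measurable_funM => //; exact: mcst.
have mR : measurable_fun (nzAhat S e) (fun z => B z / a).
  by apply: measurable_funM => //; exact: mcst.
have [mx1 mx2] := cmeasurable_cubic_roots mZ mR.
have mM : [/\ measurable_fun (nzAhat S e) (fun=> a : R),
    measurable_fun (nzAhat S e) (fun=> 0 : R), measurable_fun (nzAhat S e) B &
    measurable_fun (nzAhat S e) C] by split.
have small z : supp_Ahat S e (z.1, z.2) -> wavepoint S K e z.1 z.2 (om z) (ze z) ->
    small_part dsc a 0 (B z) (C z)
      (p e * eta^-1 ^+ 4 / eta^-1) (nu S e * kappa S e * eta^-1 ^+ 6 / (om z / eta))
      (2 * (z.1 / om z) * s * c / eta / eta^-1) (ze z * eta^-1 ^+ 2 / (om z / eta))
      (z.1 ^+ 2 * (om z ^+ 2 - c ^+ 2) / (om z / eta)) (z.1 ^+ 2 / eta^-1 ^+ 2).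
  move=> Dz wpz; have [_ _ wV G4] := wavepoint_bounds K1 wpz.
  have [/andP[_ kK] _ _ _ _] := wpz.
  have [_ _ w0] := wavepoint_neq0 K1 wp Dz.
  have Kd : K * d <= 2 * K ^+ 5 * d by rewrite ler_pM2r//; clear -hgamma KK2 K25 K50; lra.
  split.
  - by rewrite (_ : _ - _ = 0) ?normr0 ?(ltW dsc0)// /a; field.
  - rewrite subr0 (_ : _ / _ = (om z)^-1 * (nu S e * kappa S e / eta ^+ 5)); last first.
      by field; rewrite w0 en0.
    apply: le_trans dd; apply: le_trans Kd; apply: bound_mul => //.
    by rewrite ger0_norm// divr_ge0 ?mulr_ge0 ?exprn_ge0 ?ltW.
  - by rewrite mulfK ?invr_neq0// subrr normr0 ltW.
  - by rewrite (_ : _ - _ = 0) ?normr0 ?(ltW dsc0)// /C; field; rewrite w0 en0.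
  - split.
      rewrite (_ : _ / _ = z.1 ^+ 2 * (om z ^+ 2 - c ^+ 2) * (om z)^-1 * eta); last first.
        by field; rewrite w0 en0.
      have b3 : `|eta| <= d by rewrite gtr0_norm.
      apply: (le_trans (bound_mul (bound_mul G4 wV) b3)); apply: le_trans dd.
      by rewrite (_ : 2 * K ^+ 4 * K = 2 * K ^+ 5)//; ring.
    rewrite (_ : _ / _ = z.1 ^+ 2 * (eta * eta)); last by field.
    have b1 : `|z.1 ^+ 2| <= K ^+ 2.
      by rewrite normrX; apply: lerXn2r; rewrite ?nnegrE// ltW.
    have b2 : `|eta * eta| <= 1 * d.
      apply: bound_mul; rewrite gtr0_norm//; exact: le_trans etad d1.
    apply: (le_trans (bound_mul b1 b2)); apply: le_trans dd; rewrite mul1r ler_pM2r//.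
    by clear -hgamma K25 K50; lra.
have main1 z : supp_Ahat S e (z.1, z.2) ->
    main_part Km m a 0 (B z) (C z) (cubic_root1 (C z / a) (B z / a)).
  by move=> /mains[_ _ _ []].
have main2 z : supp_Ahat S e (z.1, z.2) ->
    main_part Km m a 0 (B z) (C z) (cubic_root2 (C z / a) (B z / a)).
  by move=> /mains[_ _ _ []].
have [L2 mL2 hL2] := h e eta^-1 eta^-1 _ _ _ _ _ wp t0 t0 mM mx1 main1 small.
have [L3 mL3 hL3] := h e eta^-1 eta^-1 _ _ _ _ _ wp t0 t0 mM mx2 main2 small.
exists L2, L3; split => // z Dz.
have [d2 n2] := hL2 z Dz; have [d3 n3] := hL3 z Dz.
have [q1 q2 q3 _] := mains z Dz.
have [_ k1 _ _] := main1 z Dz; have [_ k2 _ _] := main2 z Dz.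
set x1 := cubic_root1 _ _ in n2 q1 q3 k1; set x2 := cubic_root2 _ _ in n3 q2 q3 k2.
have near (L x : R[i]) : normc (L - x) <= m / 4 ->
    Re x - m / 4 <= Re L /\ normc L <= normc x + m / 4.
  move=> Lx; have := le_trans (ler_Re_normc _) Lx; rewrite Re_addc Re_oppc ler_norml.
  move=> /andP[u1 _]; split; first by clear -hgamma u1; lra.
  have -> : L = x + (L - x) by ring.
  by apply: (le_trans (ler_normcD _ _)); rewrite lerD2l.
have [u1 u2] := near _ _ n2; have [u3 u4] := near _ _ n3.
split => //.
- by clear -hgamma u1 u3 q1 q2 m0; split; lra.
- by clear -hgamma u2 u4 k1 k2 m0; split; lra.
have -> : L2 z - L3 z = (x1 - x2) + ((L2 z - x1) - (L3 z - x2)) by ring.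
apply: le_trans (lerB_normcD _ _).
have := ler_normcB (L2 z - x1) (L3 z - x2).
by clear -hgamma q3 n2 n3 m0; lra.
Qed.

End critical_roots.

(** * The fast root together with its buoyancy coefficient *)

Section fast_mode.
Context {R : realType} (S : setting R).
Local Notation T := (measurableTypeR R * measurableTypeR R)%type.
Local Notation s := (sin (slope S)).
Local Notation c := (cos (slope S)).
Local Notation p e := (nu S e + kappa S e).
Local Notation om z := (omega S z.1 z.2).
Local Notation ze z := (criticality S z.1 z.2).
Hypothesis hgamma : 0 < slope S < pi / 2.

Lemma wavepoint_le (K K' e k m w zeta : R) : 0 < K <= K' ->
  wavepoint S K e k m w zeta -> wavepoint S K' e k m w zeta.
Proof.
move=> /andP[K0 KK].
have K'0 : 0 < K' by exact: lt_le_trans KK.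
have iK : K'^-1 <= K^-1 by rewrite lef_pV2 ?posrE.
have h (x : R) : K^-1 <= `|x| <= K -> K'^-1 <= `|x| <= K'.
  by move=> /andP[h1 h2]; rewrite (le_trans iK h1) (le_trans h2 KK).
move=> [/h h1 /h h2 /h h3 h4 [/andP[h5 h6] h7]]; split => //; split => //.
apply/andP; split.
  by apply: le_trans h5; rewrite ler_wpM2l ?sqr_ge0.
by apply: (le_trans h6); rewrite ler_wpM2r ?sqr_ge0.
Qed.

(* [L0] stands for [isqrt w], whose argument is [+- pi / 4]. *)
Let sector_perturbation (K r : R) (L L0 q : R[i]) : 1 <= K -> 0 < r ->
  24 * (K * r) <= 1 -> (2 * K)^-1 <= Re L0 -> normc L0 <= K ->
  normc L0 ^+ 2 = 2 * Re L0 ^+ 2 ->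
  normc (L - L0) <= r -> 2 * K * normc (q - 1) <= r ->
  [/\ (4 * K)^-1 <= Re L, normc L <= 2 * K, (4 * K)^-1 <= Re (L * q) &
      normc (L * q) <= 2 * Re (L * q)].
Proof.
move=> K1 r0 Kr R0 N0 NR Lr qr; have K0 : 0 < K by lra.
have rR : 12 * r <= Re L0.
  apply: le_trans R0; rewrite -[_^-1]mul1r ler_pdivlMr ?mulr_gt0//; lra.
have near1 (x : R[i]) (t : R) : normc (x - L0) <= t ->
    Re L0 - t <= Re x /\ normc x <= normc L0 + t.
  move=> xt; have := le_trans (ler_Re_normc _) xt; rewrite Re_addc Re_oppc ler_norml.
  move=> /andP[u1 _]; split; first by clear -hgamma u1; lra.
  have -> : x = L0 + (x - L0) by ring.
  by apply: (le_trans (ler_normcD _ _)); rewrite lerD2l.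
have [L1 L2] := near1 _ _ Lr.
have r1 : r <= 1 by nra.
have L3 : normc L <= 2 * K by lra.
have h4 : (4 * K)^-1 = (2 * K)^-1 / 2 by field; exact: lt0r_neq0.
have Lq : normc (L * q - L0) <= 2 * r.
  have -> : L * q - L0 = (L - L0) + L * (q - 1) by ring.
  apply: (le_trans (ler_normcD _ _)); rewrite Normc.normcM.
  have : normc L * normc (q - 1) <= 2 * K * normc (q - 1).
    by apply: ler_wpM2r => //; exact: normc_ge0.
  by lra.
have [Q1 Q2] := near1 _ _ Lq.
have N1 : normc L0 <= 3 / 2 * Re L0.
  rewrite -(@ler_pXn2r _ 2) ?nnegrE ?normc_ge0//; last by lra.
  by rewrite NR; have := sqr_ge0 (Re L0); nra.
by split => //; lra.
Qed.

(** The last two bounds place [L q] in a sector around the positive real axis: this is the sign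
    information that keeps the determinant away from 0 when the fast mode is not negligible. *)
Lemma fast_mode (K d0 : R) : 1 <= K -> K^-1 <= s -> 0 < d0 ->
  exists2 d : R, 0 < d & forall e tau : R, wave_points S K e ->
    0 < nu S e -> 0 < kappa S e -> 0 < tau ->
    tau ^+ 2 = p e / (nu S e * kappa S e) ->
    e ^+ 2 <= d -> p e <= d -> 1 <= d * tau ->
    exists2 L : T -> R[i], cmeasurable (nzAhat S e) L &
      forall z : T, supp_Ahat S e (z.1, z.2) ->
      let q := bl_b S e z.1 z.2 (tau%:C * L z) /
        (- (nu S e / kappa S e)%:C * buoyancy0 S (om z)) in
      [/\ dispersion_relation S e z.1 (om z) (tau%:C * L z),
          (4 * K)^-1 <= Re (L z) /\ normc (L z) <= 2 * K,
          normc (q - 1) <= d0, (4 * K)^-1 <= Re (L z * q) &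
          normc (L z * q) <= 2 * Re (L z * q)].
Proof.
move=> K1 sK d00; have K0 : 0 < K by lra.
have s0 := sin_slope_gt0 hgamma.
pose r := (24 * K)^-1.
have r0 : 0 < r by rewrite invr_gt0 mulr_gt0.
have Kr : 24 * (K * r) <= 1 by rewrite mulrA mulfV// lt0r_neq0// mulr_gt0.
pose d1 := Num.min 2^-1 (Num.min (d0 / 20) (r / (2 * K) / 20)).
have d10 : 0 < d1.
  by rewrite !lt_min invr_gt0 ltr0n !divr_gt0// mulr_gt0.
have d1h : d1 <= 2^-1 by rewrite ge_min lexx.
have d1d : 20 * d1 <= d0.
  by rewrite mulrC -ler_pdivlMr// /d1 !ge_min lexx !orbT.
have d1r : 2 * K * (20 * d1) <= r.
  have : d1 <= r / (2 * K) / 20 by rewrite !ge_min lexx !orbT.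
  by rewrite ler_pdivlMr// ler_pdivlMr ?mulr_gt0// mulrC [d1 * _]mulrC.
pose rho := Num.min r (d1 / 2 / (2 * K * (2 * K + 1))).
have X0 : 0 < 2 * K * (2 * K + 1) by rewrite !mulr_gt0// addr_gt0// mulr_gt0.
have rho0 : 0 < rho by rewrite lt_min r0 !divr_gt0.
have rhor : rho <= r by rewrite ge_min lexx.
have rhod : 2 * K * ((2 * K + 1) * rho) <= d1 / 2.
  rewrite mulrA mulrC -ler_pdivlMr//; by rewrite ge_min lexx orbT.
have [df df0 h] := fast_root hgamma K1 rho0.
have K30 : 0 < K ^+ 3 by rewrite exprn_gt0.
have Y0 : 0 < 4 * K ^+ 3 by rewrite mulr_gt0.
pose d := Num.min df (d1 / (4 * K ^+ 3)).
have dgt : 0 < d by rewrite lt_min df0 divr_gt0.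
have ddf : d <= df by rewrite ge_min lexx.
have d4 : 4 * K ^+ 3 * d <= d1 by rewrite mulrC -ler_pdivlMr// ge_min lexx orbT.
exists d => // e tau wp n0 ka0 tau0 tau2 ed pd td.
have td' : 1 <= df * tau by apply: (le_trans td); rewrite ler_pM2r.
have [L mL hL] := h e tau wp n0 ka0 tau0 tau2 (le_trans ed ddf) td'.
exists L => // z Dz q; have [disp Ld] := hL z Dz.
have [_ wpz] := wp _ _ Dz; have [_ _ w0] := wavepoint_neq0 K1 wp Dz.
have [/andP[_ kK] _ wK [_ wz] [/andP[_ zK] _]] := wpz.
have /andP[wK1 _] := wK.
have [R0 N0 _] := isqrt_bounds K1 wK.
have [_ RE sqE NE] := isqrtP w0.
have NR : normc (isqrt (om z)) ^+ 2 = 2 * Re (isqrt (om z)) ^+ 2.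
  by rewrite NE RE; field.
have Ld' : normc (L z - isqrt (om z)) <= r := le_trans Ld rhor.
have q1 : 2 * K * normc (1 - 1 : R[i]) <= r by rewrite subrr Normc.normc0 mulr0 ltW.
have [RL NL _ _] := sector_perturbation K1 r0 Kr R0 N0 NR Ld' q1.
have RL0 : 0 < Re (L z) by apply: lt_le_trans RL; rewrite invr_gt0 mulr_gt0.
have sq : normc (L z ^+ 2 + 'i%C * (om z)%:C) <= (2 * K + 1) * rho.
  have -> : L z ^+ 2 + 'i%C * (om z)%:C =
    (L z + isqrt (om z)) * (L z - isqrt (om z)).
    rewrite (_ : 'i%C * (om z)%:C = - isqrt (om z) ^+ 2); last by rewrite sqE opprK.
    by ring.
  rewrite Normc.normcM; apply: ler_pM => //; rewrite ?normc_ge0//.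
  apply: (le_trans (ler_normcD _ _)).
  have hr : r <= 1 by clear -hgamma Kr K1 r0; nra.
  have : normc (L z) <= normc (isqrt (om z)) + r.
    have -> : L z = isqrt (om z) + (L z - isqrt (om z)) by ring.
    by apply: (le_trans (ler_normcD _ _)); rewrite lerD2l.
  by clear -hgamma N0 hr; lra.
have nl : (4 * K)^-1 * tau <= normc (tau%:C * L z).
  rewrite Normc.normcM normc_real (gtr0_norm tau0) mulrC ler_pM2l//.
  by apply: (le_trans RL); apply: (le_trans (ler_norm _)); exact: ler_Re_normc.
have hl : K ^+ 2 <= d1 * normc (tau%:C * L z).
  apply: le_trans (ler_wpM2l (ltW d10) nl).
  have : K ^+ 2 <= K ^+ 2 * (d * tau) by rewrite ler_peMr// exprn_ge0// ltW.
  move=> /le_trans; apply.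
  have -> : d1 * ((4 * K)^-1 * tau) = d1 / (4 * K) * tau by rewrite mulrA.
  rewrite mulrA ler_pM2r// ler_pdivlMr ?mulr_gt0//.
  by apply: le_trans d4; rewrite (_ : K ^+ 2 * d * (4 * K) = 4 * K ^+ 3 * d)//; ring.
have n1 : 1 <= normc (tau%:C * L z).
  have k2 : 1 <= K ^+ 2 by rewrite exprn_ege1.
  have := normc_ge0 (tau%:C * L z); clear -hgamma hl k2 d1h d10; nra.
have hl2 : K ^+ 2 <= d1 * normc (tau%:C * L z) ^+ 2.
  apply: (le_trans hl); rewrite ler_pM2l// expr2 ler_peMl//; exact: normc_ge0.
have hd : 2 * K * normc (L z ^+ 2 + 'i%C * (om z)%:C) + p e * K ^+ 3 <= d1.
  have : 2 * K * normc (L z ^+ 2 + 'i%C * (om z)%:C) <= d1 / 2.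
    by apply: le_trans rhod; rewrite ler_pM2l ?mulr_gt0.
  have : p e * K ^+ 3 <= d * K ^+ 3 by rewrite ler_pM2r.
  by clear -hgamma d4 d10; lra.
have hz : K ^+ 2 * `|ze z| <= d1.
  have : K ^+ 2 * `|ze z| <= K ^+ 2 * (K * d).
    rewrite ler_pM2l ?exprn_gt0//; apply: (le_trans zK); by rewrite ler_pM2l.
  have -> : K ^+ 2 * (K * d) = K ^+ 3 * d by ring.
  by clear -hgamma d4 dgt K30; nra.
have qs := fast_buoyancy K1 s0 sK kK wK1 n0 ka0 tau0 tau2 RL0 disp wz d1h hd hl hl2 hz.
have q2 : 2 * K * normc (q - 1) <= r.
  by apply: le_trans d1r; rewrite ler_pM2l// mulr_gt0.
have [_ _ RLq NLq] := sector_perturbation K1 r0 Kr R0 N0 NR Ld' q2.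
split => //.
exact: le_trans qs d1d.
Qed.

End fast_mode.

(** * Layers in the five regimes *)

Section two_scale_layers.
Context {R : realType} (S : setting R).
Local Notation T := (measurableTypeR R * measurableTypeR R)%type.
Local Notation s := (sin (slope S)).
Local Notation c := (cos (slope S)).
Local Notation p e := (nu S e + kappa S e).
Local Notation om z := (omega S z.1 z.2).
Local Notation ze z := (criticality S z.1 z.2).
Hypothesis hgamma : 0 < slope S < pi / 2.

Let Re_realM (a : R) (x : R[i]) : Re (a%:C * x) = a * Re x.
Proof. by rewrite Re_mulc/= mul0r subr0. Qed.

(** The first argument is a dummy: layers are built at one fixed [e] and assembled into a function
    of [e] by [select_layers]. *)
Definition lift (L : T -> R[i]) (a : R) : R -> R -> R -> R[i] :=
  fun _ k m => a%:C * L (k, m).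

Lemma layer_lift (e a c1 C1 : R) (L : T -> R[i]) : 0 < a -> 0 < c1 ->
  cmeasurable (nzAhat S e) L ->
  (forall z : T, supp_Ahat S e (z.1, z.2) ->
    [/\ dispersion_relation S e z.1 (om z) (a%:C * L z),
        c1 <= Re (L z) & normc (L z) <= C1]) ->
  layer S e (lift L a).
Proof.
move=> a0 c10 mL h; split.
  apply: (@eq_cmeasurable _ _ (fun z => a%:C * L z)); first by case.
  by apply: cmeasurableM => //; exact: cmeasurable_cst.
have ac0 : 0 < a * c1 by exact: mulr_gt0.
have M0 : 0 < (a * c1)^-1 + a * `|C1|.
  by apply: ltr_wpDr; [apply: mulr_ge0 => //; exact: ltW|rewrite invr_gt0].
exists ((a * c1)^-1 + a * `|C1|) => //.
move=> k m /(h (k, m))[disp Rl Nl]; split => //.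
- rewrite /lift Re_mulc/= mul0r subr0; apply: (@le_trans _ _ (a * c1)).
    rewrite -[leRHS]invrK lef_pV2 ?posrE ?invr_gt0//.
    by rewrite lerDl; apply: mulr_ge0 => //; exact: ltW.
  by rewrite ler_pM2l.
- rewrite /lift Normc.normcM normc_real (gtr0_norm a0).
  apply: (@le_trans _ _ (a * `|C1|)); last by rewrite lerDr invr_ge0 ltW.
  by rewrite ler_pM2l//; apply: (le_trans Nl); exact: ler_norm.
Qed.

Lemma incident_traces_le (K e k m : R) : 1 <= K ->
  wavepoint S K e k m (omega S k m) (criticality S k m) ->
  normc (- ('i%C * (m^-1)%:C) : R[i]) <= 2 * K ^+ 2 /\
  normc (- ((k * c - m * s) / omega S k m)%:C) <= 2 * K ^+ 2.
Proof.
move=> K1 [/andP[_ kK] /andP[mK' mK] /andP[wK' wK] _ _]; have K0 : 0 < K by lra.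
have inv_le (x : R) : K^-1 <= `|x| -> `|x^-1| <= K.
  move=> hx; rewrite normfV -(invrK K) lef_pV2 ?posrE ?invr_gt0//.
  by apply: lt_le_trans hx; rewrite invr_gt0.
rewrite !normcN Normc.normcM normc_i mul1r !normc_real; split.
  by apply: (le_trans (inv_le _ mK')); clear -hgamma K1; nra.
rewrite normrM (_ : 2 * K ^+ 2 = (K * 1 + K * 1) * K); last by ring.
apply: ler_pM => //; last exact: inv_le.
apply: (le_trans (ler_normB _ _)); rewrite !normrM.
apply: lerD; apply: ler_pM => //.
  by rewrite ler_norml cos_geN1 cos_le1.
by rewrite ler_norml sin_geN1 sin_le1.
Qed.

(** [eta tau nu / kappa] is the order of [xi], the normal derivative of the buoyancy of the fast
    mode relative to that of the slow ones. When it is large it forces the fast amplitude down,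
    whence the denominator in the first bound. *)
Lemma two_scale_layers (K : R) : 1 <= K -> K^-1 <= s ->
  exists2 d : R, 0 < d & exists2 c1 : R, 0 < c1 & exists2 C1 : R, 0 < C1 &
  forall e eta tau : R, wave_points S K e -> 0 < nu S e -> 0 < kappa S e ->
    0 < eta <= d -> e ^+ 2 <= eta -> K^-1 <= p e / eta ^+ 3 <= K ->
    nu S e * kappa S e / eta ^+ 5 <= d ->
    0 < tau -> tau ^+ 2 = p e / (nu S e * kappa S e) -> 1 <= d * (eta * tau) ->
  exists lam1 lam2 lam3 : R -> R -> R -> R[i],
    [/\ layer S e lam1, layer S e lam2, layer S e lam3 &
    forall k m, supp_Ahat S e (k, m) ->
    [/\ c1 * tau <= normc (lam1 e k m) <= C1 * tau,
        c1 / eta <= normc (lam2 e k m) <= C1 / eta,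
        c1 / eta <= normc (lam3 e k m) <= C1 / eta,
        lam2 e k m != lam3 e k m &
        layer_det S lam1 lam2 lam3 e k m != 0 /\
        [/\ normc (amplitude S lam1 lam2 lam3 e k m) <=
              C1 / (eta * (1 + eta * tau * (nu S e / kappa S e))),
            normc (amplitude S lam2 lam3 lam1 e k m) <= C1 / eta &
            normc (amplitude S lam3 lam1 lam2 e k m) <= C1 / eta]]].
Proof.
move=> K1 sK; have K0 : 0 < K by lra.
have s0 := sin_slope_gt0 hgamma.
have [dc dc0 [cs cs0 [Cs Cs0 hslow]]] := critical_roots hgamma K1.
pose K2 := Cs + 2 * K ^+ 2.
have KK : 1 <= K ^+ 2 by rewrite exprn_ege1.
have K21 : 1 <= K2 by rewrite /K2; lra.
have K2K : K ^+ 2 <= K2 by rewrite /K2; lra.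
have [del del0 [C2 C20 hamp]] := two_scale_amplitudes K21 cs0.
have one0 : (0 : R) < 1 by exact: ltr01.
have [df df0 hfast] := fast_mode hgamma K1 sK one0.
pose d1 := Num.min 2^-1 (del / 4).
have d10 : 0 < d1 by rewrite lt_min invr_gt0 ltr0n divr_gt0.
have d1h : d1 <= 2^-1 by rewrite ge_min lexx.
have d14 : 4 * d1 <= del by rewrite mulrC -ler_pdivlMr// ge_min lexx orbT.
clearbody d1.
(* [X] collects the factors that a small [d] has to beat, and [m] below is the smallest of the
   thresholds. *)
pose X := 4 * K + K ^+ 2 / cs + K ^+ 2 * (Cs ^+ 2 + K ^+ 2) + K + 1.
have q0 : 0 < K ^+ 2 / cs by rewrite divr_gt0// exprn_gt0.
have q1 : 0 < K ^+ 2 * (Cs ^+ 2 + K ^+ 2).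
  by rewrite mulr_gt0 ?exprn_gt0// addr_gt0 ?exprn_gt0.
have X1 : 1 <= X by rewrite /X; lra.
have X0 : 0 < X by lra.
pose m := Num.min (Num.min dc df) (Num.min del d1).
have m0 : 0 < m by rewrite !lt_min dc0 df0 del0.
pose d := Num.min 1 (m / X).
have d0 : 0 < d by rewrite lt_min ltr01 divr_gt0.
have d1' : d <= 1 by rewrite ge_min lexx.
have Xd : X * d <= m by rewrite mulrC -ler_pdivlMr// ge_min lexx orbT.
have dm : d <= m by apply: le_trans Xd; rewrite ler_peMl// ltW.
have mdc : m <= dc by rewrite !ge_min lexx.
have mdf : m <= df by rewrite !ge_min lexx !orbT.
have mdel : m <= del by rewrite !ge_min lexx !orbT.
have md1 : m <= d1 by rewrite /m !ge_min lexx !orbT.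
pose C1 := Cs + 2 * K + C2 * (4 * K).
have C2K : 0 < C2 * (4 * K) by rewrite !mulr_gt0.
have C10 : 0 < C1 by rewrite /C1 !addr_gt0// mulr_gt0.
pose c1 := Num.min cs (4 * K)^-1.
have c10 : 0 < c1 by rewrite lt_min cs0 invr_gt0 mulr_gt0.
have X_K : 4 * K <= X by clear -hgamma q0 q1 K0; rewrite /X; lra.
have X_cs : K ^+ 2 / cs <= X by clear -hgamma q0 q1 K0; rewrite /X; lra.
have X_C : K ^+ 2 * (Cs ^+ 2 + K ^+ 2) <= X by clear -hgamma q0 q1 K0; rewrite /X; lra.
have X_K' : K <= X by clear -hgamma q0 q1 K0; rewrite /X; lra.
have C1s : Cs <= C1 by clear -hgamma C2K K0; rewrite /C1; lra.
have C1K : 2 * K <= C1 by clear -hgamma C2K Cs0; rewrite /C1; lra.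
have C1C : C2 * (4 * K) <= C1 by clear -hgamma Cs0 K0; rewrite /C1; lra.
have C12 : C2 <= C1.
  by apply: le_trans C1C; rewrite ler_peMr ?(ltW C20)//; clear -hgamma K1; lra.
clearbody X m d C1.
exists d => //; exists c1 => //; exists C1 => //.
move=> e eta tau wp n0 ka0 /andP[eta0 etad] eeta aK Ed tau0 tau2 td.
have eta1 : eta <= 1 := le_trans etad d1'.
have e0' : eta != 0 by exact: lt0r_neq0.
have etam : eta <= m := le_trans etad dm.
have p0 : 0 < p e by rewrite addr_gt0.
have [L2 [L3 [mL2 mL3 hL]]] := hslow e eta wp n0 ka0
  (introT andP (conj eta0 (le_trans etam mdc))) eeta aK (le_trans Ed (le_trans dm mdc)).
have peta : p e <= K * eta ^+ 3.
  by have /andP[_] := aK; rewrite ler_pdivrMr// exprn_gt0.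
have eta32 : eta ^+ 3 <= eta.
  rewrite -[leRHS]expr1; apply: ler_wiXn2l => //; exact: ltW.
have pdf : p e <= df.
  apply: (le_trans peta); apply: le_trans mdf; apply: le_trans Xd.
  apply: ler_pM => //; rewrite ?exprn_ge0 ?(ltW K0) ?(ltW eta0)//.
  exact: le_trans eta32 etad.
have tdf : 1 <= df * tau.
  apply: (le_trans td); rewrite mulrA ler_pM2r//.
  apply: le_trans (le_trans dm mdf); rewrite -[leRHS]mulr1 ler_pM2l//.
have [L1 mL1 hL1] := hfast e tau wp n0 ka0 tau0 tau2
  (le_trans eeta (le_trans etam mdf)) pdf tdf.
have ti0 : 0 < eta^-1 by rewrite invr_gt0.
have l1 : layer S e (lift L1 tau).
  apply: (@layer_lift _ _ (4 * K)^-1 (2 * K)) => //.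
    by rewrite invr_gt0 mulr_gt0.
  by move=> z /hL1[? [? ?] _ _ _]; split.
have l2 : layer S e (lift L2 eta^-1).
  by apply: (@layer_lift _ _ cs Cs) => // z /hL[? _ [? _] [? _] _]; split.
have l3 : layer S e (lift L3 eta^-1).
  by apply: (@layer_lift _ _ cs Cs) => // z /hL[_ ? [_ ?] [_ ?] _]; split.
exists (lift L1 tau), (lift L2 eta^-1), (lift L3 eta^-1); split => // k m' km.
have [disp1 [R1 N1] _ Rq Nq] := hL1 (k, m') km.
have [_ _ [R2 R3] [N2 N3] D23] := hL (k, m') km.
have [_ wpz] := wp _ _ km; have [_ _ w0] := wavepoint_neq0 K1 wp km.
have [/andP[_ kK] _ /andP[wK wK'] [_ wz] _] := wpz.
set q := bl_b _ _ _ _ _ / _ in Rq Nq.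
move: R1 N1 Rq Nq R2 R3 N2 N3 D23 disp1; rewrite {}/q /=.
set x1 := L1 (k, m'); set x2 := L2 (k, m'); set x3 := L3 (k, m').
set w := omega S k m'; set b := buoyancy0 S w; set g := nu S e / kappa S e.
set lam1 := tau%:C * x1; set q := bl_b _ _ _ _ _ / _ => R1 N1 Rq Nq R2 R3 N2 N3 D23 disp1.
have g0 : 0 < g by rewrite divr_gt0.
clearbody g.
have sle : s <= K by apply: le_trans K1; exact: sin_le1.
have [b0 bK] := buoyancy0_bounds K1 s0 sK wK sle wK'.
rewrite -/w -/b in b0 bK.
have Re_norm (x : R[i]) (r : R) : r <= Re x -> r <= normc x.
  by move=> h; apply: (le_trans h); apply: (le_trans (ler_norm _)); exact: ler_Re_normc.
have cs_n2 := Re_norm _ _ R2; have cs_n3 := Re_norm _ _ R3.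
have n1 := Re_norm _ _ R1.
have i4K : 0 < (4 * K)^-1 by rewrite invr_gt0 mulr_gt0.
have neq0 (x : R[i]) (r : R) : 0 < r -> r <= normc x -> x != 0.
  by move=> r0 h; rewrite -normc_gt0; exact: lt_le_trans h.
have x10 := neq0 _ _ i4K n1; have x20 := neq0 _ _ cs0 cs_n2.
have x30 := neq0 _ _ cs0 cs_n3.
have tC0 : tau%:C != 0 :> R[i] by rewrite fmorph_eq0 lt0r_neq0.
have eC0 : eta%:C != 0 :> R[i] by rewrite fmorph_eq0.
have gC0 : g%:C != 0 :> R[i] by rewrite fmorph_eq0 lt0r_neq0.
have slow (x : R[i]) : cs <= normc x -> normc x <= Cs ->
    normc (bl_b S e k m' ((eta^-1)%:C * x) / b - 1) <= del.
  move=> nx Nx; have xn0 := neq0 _ _ cs0 nx.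
  have NE : normc ((eta^-1)%:C * x) = normc x / eta.
    by rewrite Normc.normcM normc_real gtr0_norm// mulrC.
  apply: le_trans d14; apply: (slow_buoyancy K1 s0 sK kK wK) => //.
  - by rewrite mulf_neq0// fmorph_eq0 invr_neq0.
  - exact: ltW.
  - rewrite NE mulrA ler_pdivlMr//.
    apply: (@le_trans _ _ (d1 * cs)); last by rewrite ler_pM2l.
    rewrite -ler_pdivrMr// mulrAC; apply: le_trans md1; apply: le_trans Xd.
    by apply: ler_pM => //; exact: ltW.
  - rewrite NE; apply: le_trans md1; apply: le_trans Xd.
    apply: (@le_trans _ _ (K ^+ 2 * (Cs ^+ 2 + K ^+ 2) * eta)); last first.
      by apply: ler_pM => //; exact: ltW.
    have kp : kappa S e <= K * eta ^+ 3 by apply: le_trans peta; rewrite lerDr ltW.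
    rewrite (_ : K ^+ 2 * (Cs ^+ 2 + K ^+ 2) * eta =
      K * (K * eta ^+ 3 * ((Cs ^+ 2 + K ^+ 2) / eta ^+ 2))); last by field.
    rewrite ler_pM2l//; apply: ler_pM => //; first exact: ltW.
      by rewrite addr_ge0 ?sqr_ge0.
    rewrite ler_pdivlMr ?exprn_gt0// mulrDl expr_div_n divfK ?expf_neq0//.
    apply: lerD; first by apply: lerXn2r; rewrite ?nnegrE ?normc_ge0 ?(ltW Cs0).
    rewrite ler_piMr ?sqr_ge0// expr_le1//; exact: ltW.
have b2 := slow _ cs_n2 N2; have b3 := slow _ cs_n3 N3.
set q2 := bl_b _ _ _ _ _ / b in b2; set q3 := bl_b _ _ _ _ _ / b in b3.
pose u := (eta%:C * lam1)^-1.
have nlam1 : normc lam1 = tau * normc x1.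
  by rewrite Normc.normcM normc_real gtr0_norm.
have nu_del : normc u <= del.
  rewrite /u Normc.normcV Normc.normcM normc_real (gtr0_norm eta0) nlam1.
  apply: le_trans mdel; apply: le_trans Xd.
  have y0 : 0 < eta * tau by rewrite mulr_gt0.
  rewrite mulrA; apply: (@le_trans _ _ (eta * tau * (4 * K)^-1)^-1).
    rewrite lef_pV2 ?posrE ?mulr_gt0//; last exact: lt_le_trans n1.
    by rewrite ler_pM2l.
  rewrite invfM invrK mulrC; apply: ler_pM => //; rewrite ?invr_ge0 ?(ltW y0)//.
    by rewrite mulr_ge0// ltW.
  by rewrite -[leLHS]mul1r ler_pdivrMr.
(* Relative to a slow layer, the wavenumber is multiplied by [eta tau] and the buoyancy coefficient
   by [- nu / kappa]. The minus sign and the sector containing [L q] put [xi] in the left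
   half-plane, as [two_scale_amplitudes] requires. *)
pose xi := - (eta * tau * g)%:C * (x1 * q).
have G0 : 0 < eta * tau * g by apply: mulr_gt0 => //; exact: mulr_gt0.
have xiN : normc xi = eta * tau * g * normc (x1 * q).
  by rewrite Normc.normcM normcN normc_real gtr0_norm.
have xiR : Re xi = - (eta * tau * g) * Re (x1 * q).
  by rewrite /xi -rmorphN Re_realM.
have xi2 : normc xi <= - 2 * Re xi.
  rewrite xiN xiR (_ : - 2 * _ = eta * tau * g * (2 * Re (x1 * q))); last by ring.
  by rewrite ler_pM2l.
have [tr1 tr2] := incident_traces_le K1 wpz.
have K22 : 2 * K ^+ 2 <= K2 by clear -hgamma Cs0; rewrite /K2; lra.
have bK2 : K2^-1 <= normc b.
  by apply: le_trans bK; rewrite lef_pV2 ?posrE ?exprn_gt0//; clear -hgamma K21; lra.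
have CsK2 : Cs <= K2 by clear -hgamma KK; rewrite /K2; lra.
have [Dn0 A1 A2 A3] := hamp eta b x2 x3 u q2 q3 xi _ _ (introT andP (conj eta0 eta1)) bK2 R2 R3
  (le_trans N2 CsK2) (le_trans N3 CsK2) D23 nu_del b2 b3 xi2
  (le_trans tr1 K22) (le_trans tr2 K22).
have E1 : (lift L1 tau e k m')^-1 = eta%:C * u.
  by rewrite /u /lift -/x1 -/lam1; field; rewrite eC0 mulf_neq0.
have inv_eta : (eta^-1)%:C = eta%:C^-1 :> R[i] by rewrite fmorphV.
have E2 : (lift L2 eta^-1 e k m')^-1 = eta%:C / x2.
  by rewrite /lift inv_eta invfM invrK.
have E3 : (lift L3 eta^-1 e k m')^-1 = eta%:C / x3.
  by rewrite /lift inv_eta invfM invrK.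
have B1 : lift L1 tau e k m' * bl_b S e k m' (lift L1 tau e k m') = b * xi / eta%:C.
  rewrite /xi /q /lift -/x1 -/lam1 !rmorphM/=.
  by rewrite {1 3}/lam1; field; rewrite gC0 b0 eC0.
have B2 : lift L2 eta^-1 e k m' * bl_b S e k m' (lift L2 eta^-1 e k m') =
    b * x2 * q2 / eta%:C.
  by rewrite /q2 /lift -/x2 inv_eta; field; rewrite b0 eC0.
have B3 : lift L3 eta^-1 e k m' * bl_b S e k m' (lift L3 eta^-1 e k m') =
    b * x3 * q3 / eta%:C.
  by rewrite /q3 /lift -/x3 inv_eta; field; rewrite b0 eC0.
rewrite -E1 -E2 -E3 -B1 -B2 -B3 in Dn0 A1 A2 A3.
split.
- rewrite /lift -/lam1 nlam1 ![_ * tau]mulrC !ler_pM2l//; apply/andP; split.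
    by apply: le_trans n1; rewrite ge_min lexx orbT.
  exact: le_trans N1 C1K.
- rewrite /lift Normc.normcM normc_real gtr0_norm// -/x2 ![_ / eta]mulrC !ler_pM2l//.
  apply/andP; split; last exact: le_trans N2 C1s.
  by apply: le_trans cs_n2; rewrite ge_min lexx.
- rewrite /lift Normc.normcM normc_real gtr0_norm// -/x3 ![_ / eta]mulrC !ler_pM2l//.
  apply/andP; split; last exact: le_trans N3 C1s.
  by apply: le_trans cs_n3; rewrite ge_min lexx.
- apply: contraTneq D23 => h; rewrite -ltNge (_ : x2 - x3 = 0) ?Normc.normc0//.
  have : (eta^-1)%:C * x2 = (eta^-1)%:C * x3 :> R[i] := h.
  by move/mulfI => ->; rewrite ?subrr// fmorph_eq0 invr_neq0.
split; first exact: Dn0.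
split.
- apply: (le_trans A1).
  have nq := Re_norm _ _ Rq.
  have y1 : 0 < eta * (1 + eta * tau * g) by rewrite mulr_gt0// addr_gt0.
  have h4 : (4 * K)^-1 <= 1.
    by rewrite invf_le1 ?mulr_gt0//; clear -hgamma K1; lra.
  have h5 : eta * (1 + eta * tau * g) * (4 * K)^-1 <= eta * (1 + normc xi).
    rewrite -mulrA ler_pM2l// mulrDl mul1r; apply: lerD => //.
    by rewrite xiN ler_pM2l.
  apply: (@le_trans _ _ (C2 / (eta * (1 + eta * tau * g) * (4 * K)^-1))).
    have y2 : 0 < eta * (1 + normc xi).
      by apply: mulr_gt0 => //; apply: ltr_pwDl => //; exact: normc_ge0.
    have y3 := mulr_gt0 y1 i4K.
    by rewrite ler_pM2l// lef_pV2 ?posrE.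
  rewrite invfM invrK mulrA mulrAC ler_pM2r ?invr_gt0//.
- rewrite /amplitude layer_det_rot; apply: (le_trans A2).
  by rewrite ler_pM2r.
- rewrite /amplitude -layer_det_rot; apply: (le_trans A3).
  by rewrite ler_pM2r.
Qed.

End two_scale_layers.

(** * Three separated scales *)

Section three_scale_layers.
Context {R : realType} (S : setting R).
Local Notation T := (measurableTypeR R * measurableTypeR R)%type.
Local Notation s := (sin (slope S)).
Local Notation c := (cos (slope S)).
Local Notation p e := (nu S e + kappa S e).
Local Notation om z := (omega S z.1 z.2).
Local Notation ze z := (criticality S z.1 z.2).
Hypothesis hgamma : 0 < slope S < pi / 2.

Let Re_norm (x : R[i]) (r : R) : r <= Re x -> r <= normc x.
Proof.
by move=> h; apply: (le_trans h); apply: (le_trans (ler_norm _)); exact: ler_Re_normc.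
Qed.

Let le1_sqr (x y d : R) : 0 < x -> 0 < y -> 0 < d -> d <= y ^+ 2 -> 1 <= d * x ^+ 2 ->
  1 <= y * x.
Proof.
move=> x0 y0 d0 dy h; rewrite -(@ler_pXn2r _ 2) ?nnegrE ?mulr_ge0 ?(ltW x0) ?(ltW y0)//.
by rewrite expr1n exprMn; apply: (le_trans h); rewrite ler_pM2r// exprn_gt0.
Qed.

Lemma intermediate_layer (K : R) : 1 <= K ->
  exists2 d : R, 0 < d & forall e tau : R, wave_points S K e -> 0 < e ->
    0 < nu S e -> 0 < kappa S e -> 0 < tau ->
    p e * tau ^+ 2 = e ^+ 2 -> e ^+ 2 <= d -> 1 <= d * (e ^+ 2 * tau) ->
    exists2 L : T -> R[i], cmeasurable (nzAhat S e) L &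
      forall z : T, supp_Ahat S e (z.1, z.2) ->
      [/\ dispersion_relation S e z.1 (om z) (tau%:C * L z),
          (4 * K ^+ 2)^-1 <= Re (L z) & normc (L z) <= 2 * K ^+ 2].
Proof.
move=> K1; have K0 : 0 < K by lra.
have K2 : 1 <= K ^+ 2 by rewrite exprn_ege1.
have K20 : 0 < K ^+ 2 by lra.
have r0 : 0 < (4 * K ^+ 2)^-1 by rewrite invr_gt0 mulr_gt0.
have r1 : (4 * K ^+ 2)^-1 <= 1 by rewrite invf_le1 ?mulr_gt0//; lra.
have rE : (2 * K ^+ 2)^-1 = 2 * (4 * K ^+ 2)^-1 by field; exact: lt0r_neq0.
have [d d0 h] := intermediate_root hgamma K1 r0; exists d => //.
move=> e tau wp e0 n0 ka0 tau0 pt ed td.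
have [L mL hL] := h e tau wp e0 n0 ka0 tau0 pt ed td; exists L => // z Dz.
have [disp Ld] := hL z Dz; have [_ wpz] := wp _ _ Dz.
have [R0 N0 _] := isqrt_bounds K2 (criticality_ratio K1 e0 wpz).
set x := isqrt _ in Ld R0 N0; split => //.
  have := le_trans (ler_Re_normc _) Ld; rewrite Re_addc Re_oppc ler_norml.
  by rewrite rE in R0; clear -hgamma R0 => /andP[u1 _]; lra.
have -> : L z = x + (L z - x) by ring.
apply: (le_trans (ler_normcD _ _)); clear -hgamma N0 Ld r1 K2; lra.
Qed.

Let choose (X m : R) : 1 <= X -> 0 < m -> exists2 d : R, 0 < d <= 1 &
  forall x y, 0 <= x <= X -> y <= d -> 0 <= y -> x * y <= m.
Proof.
move=> X1 m0; have X0 : 0 < X by lra.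
have d0 : 0 < Num.min 1 (m / X) by rewrite lt_min ltr01 divr_gt0.
exists (Num.min 1 (m / X)); first by rewrite d0 ge_min lexx.
move=> x y /andP[x0 xX] yd y0; apply: (@le_trans _ _ (X * Num.min 1 (m / X))).
  exact: ler_pM.
by rewrite mulrC -ler_pdivlMr// ge_min lexx orbT.
Qed.

(** The scales are [e ^ (-2)], [tau2] and [tau3]. Smallness of [(nu + kappa) / e ^ 6] separates the
    first two, and [tau2 <= e tau3] the last two; the ratio [nu / kappa] becomes the [n] of
    [three_scale_amplitudes]. *)
Lemma three_scale_layers (K : R) : 1 <= K -> K^-1 <= s ->
  exists2 d : R, 0 < d & exists2 c1 : R, 0 < c1 & exists2 C1 : R, 0 < C1 &
  forall e tau2 tau3 : R, wave_points S K e -> 0 < e ->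
    0 < nu S e -> 0 < kappa S e -> K^-1 <= nu S e / kappa S e <= K ->
    p e / e ^+ 6 <= d -> e <= d ->
    0 < tau2 -> p e * tau2 ^+ 2 = e ^+ 2 ->
    0 < tau3 -> tau3 ^+ 2 = p e / (nu S e * kappa S e) ->
  exists lam1 lam2 lam3 : R -> R -> R -> R[i],
    [/\ layer S e lam1, layer S e lam2, layer S e lam3 &
    forall k m, supp_Ahat S e (k, m) ->
    [/\ normc (lam1 e k m) <= C1 / e ^+ 2,
        c1 * (p e / e ^+ 8) <= Re (lam1 e k m) <= C1 * (p e / e ^+ 8),
        c1 * tau2 <= normc (lam2 e k m) <= C1 * tau2,
        c1 * tau3 <= normc (lam3 e k m) <= C1 * tau3 &
        layer_det S lam1 lam2 lam3 e k m != 0 /\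
        [/\ normc (amplitude S lam1 lam2 lam3 e k m) <= C1 / e ^+ 2,
            normc (amplitude S lam2 lam3 lam1 e k m) <= C1 / e ^+ 2 &
            normc (amplitude S lam3 lam1 lam2 e k m) <= C1 / e]]].
Proof.
move=> K1 sK; have K0 : 0 < K by lra.
have s0 := sin_slope_gt0 hgamma.
have KK : 1 <= K ^+ 2 by rewrite exprn_ege1.
have KK0 : 0 < K ^+ 2 by lra.
have KKK : K <= K ^+ 2 by rewrite expr2 ler_peMl// ltW.
have [ds ds0 [cs cs0 [Cs Cs0 hslow]]] := subcritical_root hgamma K1.
have [dm dm0 hmid] := intermediate_layer K1.
have h20 : (0 : R) < 2^-1 by rewrite invr_gt0.
have [df df0 hfast] := fast_mode hgamma K1 sK h20.
have K21 : 1 <= 2 * K ^+ 2 by clear -hgamma KK; lra.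
have [del /andP[del0 del1] [Ca Ca0 hamp]] := three_scale_amplitudes K21.
pose cm := (4 * K ^+ 2)^-1; pose Cm := 2 * K ^+ 2.
have cm0 : 0 < cm by rewrite invr_gt0 mulr_gt0.
have Cm0 : 0 < Cm by rewrite mulr_gt0.
pose d1 : R := 2^-1 / 4.
have d10 : 0 < d1 by rewrite divr_gt0.
pose y1 := del * cm / Cs; pose y2 := d1 * cm / K ^+ 2.
have y10 : 0 < y1 by rewrite divr_gt0// mulr_gt0.
have y20 : 0 < y2 by rewrite divr_gt0// mulr_gt0.
pose m := Num.min (Num.min (Num.min ds (Num.min dm df)) (Num.min (dm ^+ 2) (df ^+ 2)))
  (Num.min (Num.min (y1 ^+ 2) (y2 ^+ 2)) (Num.min (Num.min cs del) d1)).
have m0 : 0 < m by rewrite !lt_min ds0 dm0 df0 cs0 del0 d10 !exprn_gt0.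
have [mds mdm mdf mdm2 mdf2] : [/\ m <= ds, m <= dm, m <= df, m <= dm ^+ 2 & m <= df ^+ 2].
  by split; rewrite !ge_min lexx ?orbT.
have [my1 my2 mcs mdel md1] : [/\ m <= y1 ^+ 2, m <= y2 ^+ 2, m <= cs, m <= del & m <= d1].
  by split; rewrite !ge_min lexx ?orbT.
clearbody m.
pose X := 1 + K ^+ 2 / cs + K * (Cs ^+ 2 + K ^+ 2) + K * (Cm ^+ 2 + K ^+ 2) + Cm * (4 * K).
have X1 : 0 <= K ^+ 2 / cs by rewrite divr_ge0 ?ltW.
have X2 : 0 <= K * (Cs ^+ 2 + K ^+ 2).
  by apply: mulr_ge0; [exact: ltW|rewrite addr_ge0 ?sqr_ge0].
have X3 : 0 <= K * (Cm ^+ 2 + K ^+ 2).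
  by apply: mulr_ge0; [exact: ltW|rewrite addr_ge0 ?sqr_ge0].
have X4 : 0 <= Cm * (4 * K) by apply: mulr_ge0; [exact: ltW|rewrite mulr_ge0// ltW].
have [X0 XX1 XX2 XX3 XX4] : [/\ 1 <= X, K ^+ 2 / cs <= X, K * (Cs ^+ 2 + K ^+ 2) <= X,
   K * (Cm ^+ 2 + K ^+ 2) <= X & Cm * (4 * K) <= X].
  by rewrite /X; clear -hgamma X1 X2 X3 X4; split; lra.
clearbody X.
have [d /andP[d0 dle1] hd] := choose X0 m0.
have dm_ : d <= m by have := hd 1 d; rewrite mul1r; apply => //; [rewrite ler01|exact: ltW].
pose C1 := Cs + Cm + 2 * K + Ca * Cs + Ca * (Cs * Cm * (4 * K)).
have CaCs : 0 < Ca * Cs by exact: mulr_gt0.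
have CaCC : 0 < Ca * (Cs * Cm * (4 * K)).
  by apply: mulr_gt0 => //; apply: mulr_gt0; [exact: mulr_gt0|exact: mulr_gt0].
have [C1s C1m C1K C1a C1b] : [/\ Cs <= C1, Cm <= C1, 2 * K <= C1, Ca * Cs <= C1 &
   Ca * (Cs * Cm * (4 * K)) <= C1].
  by rewrite /C1; clear -hgamma Cs0 Cm0 K0 CaCs CaCC; split; lra.
have C10 : 0 < C1 := lt_le_trans Cs0 C1s.
clearbody C1.
pose c1 := Num.min cs (Num.min cm (4 * K)^-1).
have i4K : 0 < (4 * K)^-1 by rewrite invr_gt0 mulr_gt0.
have c10 : 0 < c1 by rewrite !lt_min cs0 cm0.
have [c1s c1m c1K] : [/\ c1 <= cs, c1 <= cm & c1 <= (4 * K)^-1].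
  by split; rewrite !ge_min lexx ?orbT.
clearbody c1.
exists d => //; exists c1 => //; exists C1 => //.
move=> e tau2 tau3 wp e0 n0 ka0 nK pd ed t20 t2E t30 t3E.
have p0 : 0 < p e by rewrite addr_gt0.
have en0 : e != 0 by exact: lt0r_neq0.
have e1 : e <= 1 := le_trans ed dle1.
have eX n : e ^+ n.+1 <= d.
  apply: le_trans ed; rewrite -[leRHS]expr1; apply: ler_wiXn2l => //; exact: ltW.
have e20 : 0 < e ^+ 2 by rewrite exprn_gt0.
have pe6 : p e <= d * e ^+ 6 by rewrite -ler_pdivrMr// exprn_gt0.
have pd' : p e <= d.
  by apply: (le_trans pe6); rewrite ler_piMr ?(ltW d0)// exprn_ile1// ltW.
have nkp : nu S e * kappa S e <= p e ^+ 2.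
  by clear -n0 ka0; have := mulr_gt0 n0 ka0; nra.
have nk0 : 0 < nu S e * kappa S e by exact: mulr_gt0.
have pt3 : 1 <= p e * tau3 ^+ 2.
  by rewrite t3E mulrA -expr2 ler_pdivlMr// mul1r.
have t3d : 1 <= d * tau3 ^+ 2 by apply: (le_trans pt3); rewrite ler_pM2r// exprn_gt0.
have t2d : 1 <= d * (e ^+ 2 * tau2) ^+ 2.
  have -> : d * (e ^+ 2 * tau2) ^+ 2 = d * e ^+ 6 * (tau2 ^+ 2 / e ^+ 2) by field.
  have h : p e * (tau2 ^+ 2 / e ^+ 2) = 1 by rewrite mulrA t2E mulfV// lt0r_neq0.
  by rewrite -h ler_pM2r// divr_gt0// exprn_gt0.
have et0 : 0 < e ^+ 2 * tau2 by exact: mulr_gt0.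
have t23 : tau2 <= e * tau3.
  rewrite -(@ler_pXn2r _ 2) ?nnegrE ?mulr_ge0 ?(ltW t20) ?(ltW e0) ?(ltW t30)//.
  rewrite exprMn -t2E mulrAC -[leLHS]mul1r ler_pM2r// exprn_gt0//.
have [L1 mL1 hL1] := hslow e wp e0 n0 ka0 (le_trans pd (le_trans dm_ mds))
  (le_trans (eX 1%N) (le_trans dm_ mds)).
have h2 := le1_sqr et0 dm0 d0 (le_trans dm_ mdm2) t2d.
have [L2 mL2 hL2] := hmid e tau2 wp e0 n0 ka0 t20 t2E (le_trans (eX 1%N) (le_trans dm_ mdm)) h2.
have h3 := le1_sqr t30 df0 d0 (le_trans dm_ mdf2) t3d.
have [L3 mL3 hL3] := hfast e tau3 wp n0 ka0 t30 t3E (le_trans (eX 1%N) (le_trans dm_ mdf))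
  (le_trans pd' (le_trans dm_ mdf)) h3.
have ie0 : 0 < e ^- 2 by rewrite invr_gt0.
have l1 : layer S e (lift L1 (e ^- 2)).
  apply: (@layer_lift _ S _ _ (cs * (p e / e ^+ 6)) Cs) => //.
    by rewrite mulr_gt0// divr_gt0// exprn_gt0.
  by move=> z /hL1[? /andP[? _] /andP[_ ?]]; split.
have l2 : layer S e (lift L2 tau2).
  by apply: (@layer_lift _ S _ _ cm Cm).
have l3 : layer S e (lift L3 tau3).
  apply: (@layer_lift _ S _ _ (4 * K)^-1 (2 * K)) => //.
  by move=> z /hL3[? [? ?] _ _ _]; split.
exists (lift L1 (e ^- 2)), (lift L2 tau2), (lift L3 tau3); split => // k m' km.
have [disp1 /andP[R1 R1'] /andP[N1 N1']] := hL1 (k, m') km.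
have [disp2 R2 N2'] := hL2 (k, m') km.
have [disp3 [R3 N3'] b3 _ _] := hL3 (k, m') km.
have [_ wpz] := wp _ _ km; have [_ _ w0] := wavepoint_neq0 K1 wp km.
have [/andP[_ kK] _ /andP[wK wK'] [_ wz] _] := wpz.
have N2 := Re_norm R2; have N3 := Re_norm R3.
rewrite /lift; move: N1 N1' R1 R1' N2 N2' N3 N3' b3 disp1; rewrite /=.
set x1 := L1 (k, m'); set x2 := L2 (k, m'); set x3 := L3 (k, m').
set v1 := (e ^- 2)%:C * x1; set v2 := tau2%:C * x2; set v3 := tau3%:C * x3.
set w := omega S k m'; set b := buoyancy0 S w.
move=> N1 N1' R1 R1' N2 N2' N3 N3' b3 disp1.
set g := nu S e / kappa S e in b3 nK *.
have g0 : 0 < g by rewrite divr_gt0.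
have sle : s <= K by apply: le_trans K1; exact: sin_le1.
have [b0 bK] := buoyancy0_bounds K1 s0 sK wK sle wK'.
rewrite -/w -/b in b0 bK.
have V1 : normc v1 = normc x1 / e ^+ 2.
  by rewrite Normc.normcM normc_real gtr0_norm// mulrC.
have V2 : normc v2 = tau2 * normc x2 by rewrite Normc.normcM normc_real gtr0_norm.
have V3 : normc v3 = tau3 * normc x3 by rewrite Normc.normcM normc_real gtr0_norm.
have v1lo : cs / e ^+ 2 <= normc v1 by rewrite V1 ler_pM2r.
have v1hi : normc v1 <= Cs / e ^+ 2 by rewrite V1 ler_pM2r.
have v2lo : cm * tau2 <= normc v2 by rewrite V2 [leRHS]mulrC ler_pM2r.
have v2hi : normc v2 <= Cm * tau2 by rewrite V2 mulrC ler_pM2r.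
have v3lo : (4 * K)^-1 * tau3 <= normc v3 by rewrite V3 [leRHS]mulrC ler_pM2r.
have v3hi : normc v3 <= 2 * K * tau3 by rewrite V3 mulrC ler_pM2r.
have p1 : 0 < normc v1 by apply: lt_le_trans v1lo; exact: divr_gt0.
have p2 : 0 < normc v2 by apply: lt_le_trans v2lo; exact: mulr_gt0.
have p3 : 0 < normc v3 by apply: lt_le_trans v3lo; exact: mulr_gt0.
have gC0 : g%:C != 0 :> R[i] by rewrite fmorph_eq0 lt0r_neq0.
have d1h : d1 <= 2^-1 by rewrite /d1 ler_pdivrMr// ler_pMr// ler1n.
have d14 : 4 * d1 = 2^-1 by rewrite /d1; field.
have kp : kappa S e <= p e by rewrite lerDr ltW.
have slow (v : R[i]) : 0 < normc v -> K ^+ 2 <= d1 * normc v ->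
    K * (p e * (normc v ^+ 2 + K ^+ 2)) <= d1 ->
    normc (bl_b S e k m' v / b - 1) <= 2^-1.
  move=> vp h4 h5; rewrite -d14; apply: (slow_buoyancy K1 s0 sK kK wK) => //.
  - by rewrite -normc_gt0.
  - exact: ltW.
  - apply: le_trans h5; rewrite ler_pM2l// ler_pM2r//.
    by rewrite ltr_wpDl ?sqr_ge0.
have b1 : normc (bl_b S e k m' v1 / b - 1) <= 2^-1.
  apply: slow => //.
    apply: (@le_trans _ _ (d1 * (cs / e ^+ 2))); last by rewrite ler_pM2l.
    rewrite mulrA ler_pdivlMr// -ler_pdivrMr// mulrAC; apply: le_trans md1.
    by apply: hd => //; [rewrite X1 XX1|exact: (ltW e20)].
  apply: (@le_trans _ _ (K * (Cs ^+ 2 + K ^+ 2) * (p e / e ^+ 4))).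
    rewrite -mulrA ler_pM2l// mulrCA ler_pM2l// ler_pdivlMr ?exprn_gt0//.
    rewrite mulrDl; apply: lerD.
      rewrite (_ : e ^+ 4 = (e ^+ 2) ^+ 2); last by rewrite -exprM.
      have n1e : normc v1 * e ^+ 2 <= Cs by rewrite -ler_pdivlMr.
      have n1e0 : 0 <= normc v1 * e ^+ 2 by apply: mulr_ge0; exact: ltW.
      by rewrite -exprMn; apply: lerXn2r; rewrite ?nnegrE// ltW.
    by rewrite ler_piMr ?(ltW KK0)// exprn_ile1// ltW.
  apply: le_trans md1; apply: hd; rewrite ?X2 ?XX2//; last first.
    by apply: divr_ge0; rewrite ?exprn_ge0 ?ltW.
  apply: le_trans pd; rewrite ler_pM2l// lef_pV2 ?posrE ?exprn_gt0//.
  by apply: ler_wiXn2l => //; exact: ltW.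
have b2 : normc (bl_b S e k m' v2 / b - 1) <= 2^-1.
  apply: slow => //.
    apply: (@le_trans _ _ (d1 * (cm * tau2))); last by rewrite ler_pM2l.
    have := le1_sqr et0 y20 d0 (le_trans dm_ my2) t2d.
    rewrite /y2 mulrAC ler_pdivlMr// mul1r => /le_trans; apply.
    rewrite (mulrA d1 cm tau2) ler_pM2l; last exact: mulr_gt0.
    rewrite ler_piMl ?(ltW t20)//.
    by rewrite exprn_ile1// ltW.
  apply: (@le_trans _ _ (K * (Cm ^+ 2 + K ^+ 2) * d)); last first.
    by apply: le_trans md1; apply: hd; rewrite ?X3 ?XX3 ?(ltW d0).
  rewrite -mulrA ler_pM2l// [leLHS]mulrDr [leRHS]mulrDl; apply: lerD.
    apply: (@le_trans _ _ (p e * (Cm * tau2) ^+ 2)).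
      rewrite ler_pM2l//; apply: lerXn2r; rewrite ?nnegrE ?(ltW p2)//.
      exact: le_trans (ltW p2) v2hi.
    by rewrite exprMn mulrCA t2E ler_pM2l ?exprn_gt0// eX.
  by rewrite mulrC ler_pM2l.
have [tr1 tr2] := incident_traces_le K1 wpz.
have v12 : normc v1 <= del * normc v2.
  apply: (le_trans v1hi); apply: (@le_trans _ _ (del * (cm * tau2))); last by rewrite ler_pM2l.
  have := le1_sqr et0 y10 d0 (le_trans dm_ my1) t2d.
  rewrite /y1 mulrAC ler_pdivlMr// mul1r => h4.
  rewrite ler_pdivrMr//; apply: (le_trans h4).
  by rewrite (_ : del * cm * (e ^+ 2 * tau2) = del * (cm * tau2) * e ^+ 2)//; ring.
have v23 : normc v2 <= del * normc v3.
  apply: (le_trans v2hi); apply: (@le_trans _ _ (del * ((4 * K)^-1 * tau3))); last by rewrite ler_pM2l.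
  apply: (@le_trans _ _ (Cm * (e * tau3))); first by rewrite ler_pM2l.
  rewrite !mulrA ler_pM2r// ler_pdivlMr ?mulr_gt0// mulrAC; apply: le_trans mdel.
  by apply: hd; rewrite ?X4 ?XX4 ?(ltW e0).
have v11 : 1 <= normc v1.
  apply: le_trans v1lo; rewrite ler_pdivlMr// mul1r; apply: le_trans mcs; exact: le_trans (eX _) dm_.
have KK2 : K <= 2 * K ^+ 2 by clear -hgamma KKK KK0; lra.
have bK2 : (2 * K ^+ 2)^-1 <= normc b.
  by apply: le_trans bK; rewrite lef_pV2 ?posrE ?mulr_gt0//; clear -hgamma KK0; lra.
have nK2 : (2 * K ^+ 2)^-1 <= g <= 2 * K ^+ 2.
  have /andP[h4 h5] := nK; apply/andP; split; last exact: le_trans h5 KK2.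
  by apply: le_trans h4; rewrite lef_pV2 ?posrE ?mulr_gt0.
have [Dn0 A1 A2 A3] := hamp g b v1 v2 v3 _ _ _ _ _ bK2 nK2 v11 v12 v23 b1 b2 b3 tr1 tr2.
have B1 : b * v1 * (bl_b S e k m' v1 / b) = v1 * bl_b S e k m' v1 by field.
have B2 : b * v2 * (bl_b S e k m' v2 / b) = v2 * bl_b S e k m' v2 by field.
have B3 : - (b * g%:C * v3 * (bl_b S e k m' v3 / (- g%:C * b))) = v3 * bl_b S e k m' v3.
  by field; rewrite gC0 b0.
rewrite B1 B2 B3 in Dn0 A1 A2 A3.
split.
- by apply: (le_trans v1hi); rewrite ler_pM2r ?invr_gt0.
- rewrite /v1 Re_mulc/= mul0r subr0.
  have -> : p e / e ^+ 8 = e ^- 2 * (p e / e ^+ 6) by field.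
  rewrite !(mulrCA _ (e ^- 2)) !ler_pM2l//; apply/andP; split.
    by apply: le_trans R1; rewrite ler_pM2r// divr_gt0// exprn_gt0.
  by apply: (le_trans R1'); rewrite ler_pM2r// divr_gt0// exprn_gt0.
- apply/andP; split; first by apply: le_trans v2lo; rewrite ler_pM2r.
  by apply: (le_trans v2hi); rewrite ler_pM2r.
- apply/andP; split; first by apply: le_trans v3lo; rewrite ler_pM2r.
  by apply: (le_trans v3hi); rewrite ler_pM2r.
have A12 : Ca * normc v1 <= C1 / e ^+ 2.
  apply: (@le_trans _ _ (Ca * (Cs / e ^+ 2))); first by rewrite ler_pM2l.
  by rewrite mulrA ler_pM2r// invr_gt0.
split; first exact: Dn0.
split.
- exact: le_trans A1 A12.
- by rewrite /amplitude layer_det_rot; exact: le_trans A2 A12.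
- rewrite /amplitude -layer_det_rot; apply: (le_trans A3).
  (* The product [|v1| |v2| / |v3|] is of order [e ^ (-2) tau2 / tau3], and [tau2 <= e tau3] gains
     one power of [e]. *)
  apply: (@le_trans _ _ (Ca * (Cs * Cm * (4 * K)) / e)); last first.
    by rewrite ler_pM2r// invr_gt0.
  rewrite -[leRHS]mulrA ler_pM2l// ler_pdivrMr//.
  apply: (@le_trans _ _ (Cs / e ^+ 2 * (Cm * (e * tau3)))).
    apply: ler_pM => //; try exact: ltW.
    by apply: (le_trans v2hi); rewrite ler_pM2l.
  apply: (@le_trans _ _ (Cs * Cm * (4 * K) / e * ((4 * K)^-1 * tau3))).
    rewrite (_ : Cs / e ^+ 2 * _ = Cs * Cm * (4 * K) / e * ((4 * K)^-1 * tau3))//.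
    by field; rewrite en0 lt0r_neq0.
  rewrite ler_pM2l// divr_gt0//; apply: mulr_gt0; [exact: mulr_gt0|exact: mulr_gt0].
Qed.

End three_scale_layers.

(** * From scales to powers of [e]: one small and one large exponent *)

Section two_scale_regimes.
Context {R : realType}.

Lemma powR_small (x d : R) : 0 < x -> 0 < d -> \forall e \near 0^'+, e `^ x <= d.
Proof.
move=> x0 d0; near=> e.
have e0 : 0 < e by near: e; exact: nbhs_right_gt.
have ed : e <= d `^ x^-1 by near: e; apply: nbhs_right_le; exact: powR_gt0.
have -> : d = (d `^ x^-1) `^ x by rewrite -powRrM mulVf ?lt0r_neq0// powRr1// ltW.
by apply: ge0_ler_powR; rewrite ?nnegrE ?powR_ge0// ltW.
Unshelve. all: by end_near. Qed.

Let ratio_bounds (K x y r : R) : 0 < y -> K^-1 <= x -> x + y <= K -> 0 <= r ->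
  r <= 1 -> K^-1 <= x + y * r <= K.
Proof.
move=> y0 Kx xyK r0 r1.
have yr : y * r <= y by rewrite ler_piMr// ltW.
have yr0 : 0 <= y * r by rewrite mulr_ge0// ltW.
by apply/andP; split; lra.
Qed.

Lemma near_le1 (d : R) : 0 < d -> \forall e \near 0^'+, 0 < e <= d.
Proof.
move=> d0; near=> e; apply/andP; split.
  by near: e; exact: nbhs_right_gt.
by near: e; exact: nbhs_right_le.
Unshelve. all: by end_near. Qed.

(** Layers are found for each small [e] separately; choice turns them into functions of [e], with
    the default 0 where none exist. *)
Lemma select_layers (Q : R -> (R -> R -> R[i]) -> (R -> R -> R[i]) ->
    (R -> R -> R[i]) -> Prop) :
  (\forall e \near 0^'+, exists l1 l2 l3, Q e l1 l2 l3) ->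
  exists lam1 lam2 lam3 : R -> R -> R -> R[i],
    \forall e \near 0^'+, Q e (lam1 e) (lam2 e) (lam3 e).
Proof.
move=> h.
have /choice[f hf] : forall e : R, exists l : (R -> R -> R[i]) * (R -> R -> R[i]) *
    (R -> R -> R[i]), (exists l1 l2 l3, Q e l1 l2 l3) -> Q e l.1.1 l.1.2 l.2.
  move=> e; have [[l1 [l2 [l3 hl]]]|nh] := pselect (exists l1 l2 l3, Q e l1 l2 l3).
    by exists (l1, l2, l3).
  by exists (fun _ _ => 0, fun _ _ => 0, fun _ _ => 0) => /nh.
exists (fun e => (f e).1.1), (fun e => (f e).1.2), (fun e => (f e).2).
by apply: filterS h => e /hf.
Qed.

Variable S : setting R.

Lemma of_orderW (f : R -> R -> R -> R) (g : R -> R) (c C : R) : 0 < c ->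
  (\forall e \near 0^'+, forall k m, supp_Ahat S e (k, m) ->
    c * g e <= f e k m <= C * g e) ->
  (\forall e \near 0^'+, forall k m, supp_Ahat S e (k, m) -> 0 <= f e k m) ->
  of_order S f g.
Proof.
move=> c0 h1 h2; exists c, C; split => //.
by apply: filterS2 h1 h2 => e a b k m km; rewrite ger0_norm ?a ?b.
Qed.

Lemma bigO_normc (a : R -> R -> R -> R[i]) (g : R -> R) (C : R) :
  (\forall e \near 0^'+, forall k m, supp_Ahat S e (k, m) ->
    normc (a e k m) <= C * g e) ->
  Defs.bigO S (fun e k m => normc (a e k m)) g.
Proof.
move=> h; exists C; apply: filterS h => e h k m km.
by rewrite ger0_norm ?normc_ge0 ?h.
Qed.

Hypothesis hgamma : 0 < slope S < pi / 2.
Hypothesis hchi : C0_infty (chi S).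
Hypothesis hwave : admissible_wavenumber S.
Hypothesis hcrit : near_critical S.

(** One constant serves the wavenumbers, the slope and a prescribed lower bound [X], into which the
    regimes put [nu0] and [kappa0]. *)
Lemma wave_points_near (X : R) : exists2 K : R, 1 <= K &
  [/\ X <= K, K^-1 <= sin (slope S) & \forall e \near 0^'+, wave_points S K e].
Proof.
have s0 := sin_slope_gt0 hgamma.
have [K K1 hK] := wavepoint_near hgamma hchi hwave hcrit.
have i0 : 0 < (sin (slope S))^-1 by rewrite invr_gt0.
have X0 := normr_ge0 X; have X1 := ler_norm X.
exists (K + `|X| + (sin (slope S))^-1); first by lra.
split.
- by lra.
- rewrite -[leRHS]invrK lef_pV2 ?posrE//; lra.
apply: filterS hK => e h k m /h[w0 wp]; split => //.
by apply: wavepoint_le wp; apply/andP; split; lra.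
Qed.

Variables (nu0 kappa0 a b mu M : R).
Hypotheses (nu0_gt0 : 0 < nu0) (kappa0_gt0 : 0 < kappa0).
Hypothesis ab : (a = mu /\ b = M) \/ (a = M /\ b = mu).
Hypotheses (mu_gt0 : 0 < mu) (mu6 : mu <= 6) (M6 : 6 <= M).
Hypothesis nuE : \forall e \near 0^'+, nu S e = nu0 * e `^ a.
Hypothesis kappaE : \forall e \near 0^'+, kappa S e = kappa0 * e `^ b.

Let eta (e : R) := e `^ (mu / 3).
Let g (e : R) := e `^ (M / 2).

Let powers e : 0 < e <= 1 ->
  [/\ 0 < eta e, 0 < g e, e `^ mu = eta e ^+ 3, e `^ M = g e ^+ 2 &
      [/\ e ^+ 2 <= eta e, g e ^+ 2 <= eta e ^+ 3, e `^ (- (mu / 3)) = (eta e)^-1,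
          e `^ (- (M / 2)) = (g e)^-1 &
          e `^ (M / 2 - mu / 3) = g e / eta e]].
Proof.
move=> /andP[e0 e1]; have en0 : e != 0 by exact: lt0r_neq0.
have mE : e `^ mu = eta e ^+ 3.
  by rewrite -powR_mulrn ?powR_ge0// -powRrM; congr (_ `^ _); field.
have ME : e `^ M = g e ^+ 2.
  by rewrite -powR_mulrn ?powR_ge0// -powRrM; congr (_ `^ _); field.
split => //; rewrite ?powR_gt0//; split.
- rewrite -powR_mulrn ?(ltW e0)//; apply: ger_powR; rewrite ?e0 ?e1//.
  by move: mu6; lra.
- rewrite -mE -ME; apply: ger_powR; rewrite ?e0 ?e1//.
  by move: mu6 M6; lra.
- by rewrite powRN.
- by rewrite powRN.
- by rewrite powRB// en0 implybT.
Qed.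

(** [mu] and [M] are the smaller and the larger of the exponents [a] of [nu] and [b] of [kappa];
    [eta = e ^ (mu / 3)] and [tau] is of order [e ^ (- M / 2)]. The two values of [alpha] come from
    keeping one or the other summand of [1 + eta tau nu / kappa] in the bound of the fast amplitude;
    each regime picks the one it states. *)
Lemma two_scale_solution : exists W1 W2 : R -> wave R,
  [/\ forall alpha, alpha = - (mu / 3) \/ alpha = b - a - 2 * (mu / 3) + M / 2 ->
        bl_wave S (- (M / 2)) alpha W1,
      bl_wave12 S (- (mu / 3)) (- (mu / 3)) W2 &
      consistent_layers S (fun e => addw (W1 e) (W2 e))].
Proof.
have n00 := nu0_gt0; have ka00 := kappa0_gt0.
have nk0 : 0 < nu0 * kappa0 by exact: mulr_gt0.
have [K K1 [KX sK wpK]] := wave_points_near (nu0 + kappa0 + nu0^-1 + kappa0^-1).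
have K0 : 0 < K by lra.
have [in0 ik0] : 0 < nu0^-1 /\ 0 < kappa0^-1 by rewrite !invr_gt0.
have Kn : K^-1 <= nu0.
  by rewrite -[leRHS]invrK lef_pV2 ?posrE//; lra.
have Kk : K^-1 <= kappa0.
  by rewrite -[leRHS]invrK lef_pV2 ?posrE//; lra.
have Knk : nu0 + kappa0 <= K by lra.
have [d d0 [c1 c10 [C1 C10 hlay]]] := two_scale_layers hgamma K1 sK.
(* A common bound for [tau g] and its inverse: [(tau g) ^ 2] is [(nu + kappa) / eta ^ 3] divided by
   [nu0 kappa0]. *)
pose Kt := 1 + K / (nu0 * kappa0) + K * (nu0 * kappa0).
have t1 : 0 < K / (nu0 * kappa0) by exact: divr_gt0.
have t2 : 0 < K * (nu0 * kappa0) by exact: mulr_gt0.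
have Kt1 : 1 <= Kt by rewrite /Kt; lra.
have Kt0 : 0 < Kt by lra.
have KtX : K / (nu0 * kappa0) <= Kt ^+ 2.
  apply: (@le_trans _ _ Kt); first by rewrite /Kt; lra.
  by rewrite expr2 ler_peMl// ltW.
have KtY : K * (nu0 * kappa0) <= Kt ^+ 2.
  apply: (@le_trans _ _ Kt); first by rewrite /Kt; lra.
  by rewrite expr2 ler_peMl// ltW.
clearbody Kt.
pose tau (e : R) := Num.sqrt ((nu S e + kappa S e) / (nu S e * kappa S e)).
have m30 : 0 < mu / 3 by rewrite divr_gt0.
have Mm0 : 0 < M / 2 - mu / 3 by move: mu6 M6; lra.
have dk0 : 0 < d / Kt by exact: divr_gt0.
pose d2 := Num.min 1 (d / (nu0 * kappa0)).
have d20 : 0 < d2 by rewrite lt_min ltr01 divr_gt0.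
have [d21 d22] : d2 <= 1 /\ nu0 * kappa0 * d2 <= d.
  by split; [rewrite ge_min lexx|rewrite mulrC -ler_pdivlMr// ge_min lexx orbT].
clearbody d2.
pose q e := kappa0 / nu0 * e `^ (b - a).
pose good e := [/\ 0 < e <= 1, 0 < nu S e /\ 0 < kappa S e,
  Kt^-1 <= tau e * g e <= Kt, kappa S e / nu S e = q e & wave_points S K e].
have good_near : \forall e \near 0^'+, good e /\
    [/\ 0 < eta e <= d, e ^+ 2 <= eta e,
      K^-1 <= (nu S e + kappa S e) / eta e ^+ 3 <= K,
      nu S e * kappa S e / eta e ^+ 5 <= d &
      [/\ 0 < tau e, tau e ^+ 2 = (nu S e + kappa S e) / (nu S e * kappa S e) &
          1 <= d * (eta e * tau e)]].
  near=> e.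
  have e01 : 0 < e <= 1 by near: e; exact: near_le1.
  have /andP[e0 e1] := e01.
  have nE : nu S e = nu0 * e `^ a by near: e.
  have kE : kappa S e = kappa0 * e `^ b by near: e.
  have wp : wave_points S K e by near: e.
  have [eta0 g0 muE ME [e2 ge _ _ gE]] := powers e01.
  have etad : eta e <= d by near: e; exact: powR_small.
  have gd : g e / eta e <= d / Kt by rewrite -gE; near: e; exact: powR_small.
  have gd2 : g e / eta e <= d2 by rewrite -gE; near: e; exact: powR_small.
  have n0 : 0 < nu S e by rewrite nE mulr_gt0// powR_gt0.
  have k0 : 0 < kappa S e by rewrite kE mulr_gt0// powR_gt0.
  have p0 : 0 < nu S e + kappa S e by exact: addr_gt0.
  have etaN : eta e != 0 by exact: lt0r_neq0.
  have gN : g e != 0 by exact: lt0r_neq0.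
  have nkE : nu S e * kappa S e = nu0 * kappa0 * (eta e ^+ 3 * g e ^+ 2).
    by rewrite nE kE; case: ab => -[-> ->]; rewrite muE ME; ring.
  have ge1 : g e ^+ 2 / eta e ^+ 3 <= 1 by rewrite ler_pdivrMr ?mul1r// exprn_gt0.
  have ge0 : 0 <= g e ^+ 2 / eta e ^+ 3 by rewrite divr_ge0 ?exprn_ge0 ?ltW.
  have pK : K^-1 <= (nu S e + kappa S e) / eta e ^+ 3 <= K.
    have e30 : eta e ^+ 3 != 0 by rewrite expf_neq0.
    rewrite mulrDl nE kE; case: ab => -[-> ->]; rewrite muE ME.
      by rewrite mulfK// -mulrA; exact: ratio_bounds.
    by rewrite mulfK// -mulrA addrC; apply: ratio_bounds; rewrite // addrC.
  have tau2 : tau e ^+ 2 = (nu S e + kappa S e) / (nu S e * kappa S e).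
    by rewrite sqr_sqrtr// divr_ge0 ?mulr_ge0// ltW.
  have tau0 : 0 < tau e by rewrite sqrtr_gt0 divr_gt0// mulr_gt0.
  have tg : Kt^-1 <= tau e * g e <= Kt.
    have tg2 : (tau e * g e) ^+ 2 = (nu S e + kappa S e) / eta e ^+ 3 / (nu0 * kappa0).
      by rewrite exprMn tau2 nkE; field; rewrite etaN gN !lt0r_neq0.
    have /andP[pK1 pK2] := pK; have tg0 := mulr_gt0 tau0 g0; apply/andP; split.
      rewrite -(@ler_pXn2r _ 2) ?nnegrE ?invr_ge0 ?(ltW Kt0) ?(ltW tg0)//.
      rewrite exprVn tg2 ler_pdivlMr//; apply: le_trans pK1.
      by rewrite mulrC ler_pdivrMr ?exprn_gt0// ler_pdivlMl.
    rewrite -(@ler_pXn2r _ 2) ?nnegrE ?(ltW Kt0) ?(ltW tg0)//.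
    by rewrite tg2; apply: le_trans KtX; rewrite ler_pM2r// invr_gt0.
  split.
    split => //; rewrite /q nE kE powRB ?(lt0r_neq0 e0) ?implybT//.
    by field; rewrite !lt0r_neq0// powR_gt0.
  split => //; first by rewrite eta0.
    rewrite nkE (_ : _ / _ = nu0 * kappa0 * ((g e / eta e) * (g e / eta e))); last first.
      by field.
    apply: le_trans d22; rewrite ler_pM2l// -[leRHS]mul1r.
    have x0 : 0 <= g e / eta e by rewrite divr_ge0 ?ltW.
    by apply: ler_pM => //; exact: le_trans gd2 d21.
  split => //; have /andP[tg1 _] := tg.
  have : Kt^-1 * (eta e / g e) <= eta e * tau e.
    rewrite (_ : eta e * tau e = tau e * g e * (eta e / g e)); last by field.
    by rewrite ler_pM2r// divr_gt0.
  move=> /(ler_wpM2l (ltW d0)) hh; apply: (le_trans _ hh); rewrite mulrA.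
  have : g e / eta e * (eta e / g e) <= d / Kt * (eta e / g e).
    by rewrite ler_pM2r// divr_gt0.
  by rewrite (_ : g e / eta e * (eta e / g e) = 1)//; field; rewrite etaN gN.
(* The property to be selected involves the three families at the single value [e], hence the
   constant families [fun=> l1], [fun=> l2], [fun=> l3]. *)
pose bounds e (l1 l2 l3 : R -> R -> R[i]) := good e /\
  [/\ layer S e (fun=> l1), layer S e (fun=> l2), layer S e (fun=> l3) &
    forall k m, supp_Ahat S e (k, m) ->
    [/\ c1 * tau e <= normc (l1 k m) <= C1 * tau e,
        c1 / eta e <= normc (l2 k m) <= C1 / eta e,
        c1 / eta e <= normc (l3 k m) <= C1 / eta e,
        l2 k m != l3 k m &
        layer_det S (fun=> l1) (fun=> l2) (fun=> l3) e k m != 0 /\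
        [/\ normc (amplitude S (fun=> l1) (fun=> l2) (fun=> l3) e k m) <=
              C1 / (eta e * (1 + eta e * tau e * (nu S e / kappa S e))),
            normc (amplitude S (fun=> l2) (fun=> l3) (fun=> l1) e k m) <= C1 / eta e &
            normc (amplitude S (fun=> l3) (fun=> l1) (fun=> l2) e k m) <= C1 / eta e]]].
have [lam1 [lam2 [lam3 hlam]]] : exists lam1 lam2 lam3 : R -> R -> R -> R[i],
    \forall e \near 0^'+, bounds e (lam1 e) (lam2 e) (lam3 e).
  apply: select_layers; apply: filterS good_near => e [ge [h1 h2 h3 h4 [h5 h6 h7]]].
  have [_ [n0 k0] _ _ wp] := ge.
  have [lam1 [lam2 [lam3 [l1 l2 l3 hb]]]] :=
    hlay e (eta e) (tau e) wp n0 k0 h1 h2 h3 h4 h5 h6 h7.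
  by exists (lam1 e), (lam2 e), (lam3 e); split => //; split.
clear good_near hlay.
(* [layer S e lam1] reads [lam1] at [e] only, so it is convertible to the selected statement. *)
have hl : \forall e \near 0^'+, [/\ layer S e lam1, layer S e lam2 & layer S e lam3].
  by apply: filterS hlam => e [_ []].
have hdet : \forall e \near 0^'+, exists M : R, forall k m, supp_Ahat S e (k, m) ->
  layer_det S lam1 lam2 lam3 e k m != 0 /\
  [/\ normc (amplitude S lam1 lam2 lam3 e k m) <= M,
      normc (amplitude S lam2 lam3 lam1 e k m) <= M &
      normc (amplitude S lam3 lam1 lam2 e k m) <= M].
  apply: filterS hlam => e [_ [_ _ _ h]].
  exists (`|C1 / (eta e * (1 + eta e * tau e * (nu S e / kappa S e)))| + `|C1 / eta e|).
  move=> k m /h[_ _ _ _ [h0 [h1 h2 h3]]]; split=> //; split.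
  - by apply: (le_trans h1); apply: (le_trans (ler_norm _)); rewrite lerDl.
  - by apply: (le_trans h2); apply: (le_trans (ler_norm _)); rewrite lerDr.
  - by apply: (le_trans h3); apply: (le_trans (ler_norm _)); rewrite lerDr.
have [w1 w2 w3] := layers_wellformed hgamma hchi hwave hcrit hl hdet.
have cons := layers_consistent hgamma hchi hwave hcrit hl hdet.
exists (bl_packet S lam1 (amplitude S lam1 lam2 lam3)).
exists (fun e => addw (bl_packet S lam2 (amplitude S lam2 lam3 lam1) e)
                      (bl_packet S lam3 (amplitude S lam3 lam1 lam2) e)).
have normc_near (lam : R -> R -> R -> R[i]) : \forall e \near 0^'+,
    forall k m, supp_Ahat S e (k, m) -> 0 <= normc (lam e k m).
  by apply: nearW => e k m _; exact: normc_ge0.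
split; last first.
- rewrite (_ : (fun e => _) = (fun e => layers S e lam1 lam2 lam3))//.
  apply/funext => e; rewrite /layers; congr Wave; do 3 apply/funext => ?;
    by rewrite /= addrA.
- right; exists lam2, lam3, (amplitude S lam2 lam3 lam1), (amplitude S lam3 lam1 lam2).
  split => //.
  + split; apply: (of_orderW c10 (C := C1)) => //; apply: filterS hlam =>
      e [[e01 _ _ _ _] [_ _ _ h]] k m km; have [_ _ _ _ [_ _ -> _ _]] := powers e01;
      by have [_ ? ? _ _] := h k m km.
  + split; apply: (bigO_normc (C := C1)); apply: filterS hlam =>
      e [[e01 _ _ _ _] [_ _ _ h]] k m km; have [_ _ _ _ [_ _ -> _ _]] := powers e01;
      by have [_ _ _ _ [_ []]] := h k m km.
  + by apply: filterS hlam => e [_ [_ _ _ h]] k m /h[].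
move=> alpha halpha; exists lam1, (amplitude S lam1 lam2 lam3); split => //.
  have ck0 : 0 < c1 / Kt by exact: divr_gt0.
  apply: (of_orderW ck0 (C := C1 * Kt)) => //; apply: filterS hlam =>
    e [[e01 _ /andP[tg1 tg2] _ _] [_ _ _ h]] k m km.
  have [_ g0 _ _ [_ _ _ -> _]] := powers e01.
  have [/andP[h1 h2] _ _ _ _] := h k m km.
  have tE : tau e = tau e * g e / g e by rewrite mulfK// lt0r_neq0.
  rewrite tE in h1 h2; apply/andP; split.
    by apply: le_trans h1; rewrite -mulrA ler_pM2l// ler_pM2r// invr_gt0.
  by apply: (le_trans h2); rewrite -[leRHS]mulrA ler_pM2l// ler_pM2r// invr_gt0.
(* The first exponent drops [eta tau nu / kappa] from the denominator; the second, treated after it,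
   drops the 1. *)
case: halpha => ->.
  apply: (bigO_normc (C := C1)); apply: filterS hlam =>
    e [[e01 [n0 k0] /andP[tg1 tg2] _ _] [_ _ _ h]] k m km.
  have [eta0 g0 _ _ [_ _ -> _ _]] := powers e01.
  have [_ _ _ _ [_ [h1 _ _]]] := h k m km.
  have t0 : 0 < tau e by rewrite sqrtr_gt0 divr_gt0 ?mulr_gt0// addr_gt0.
  have X0 : 0 < eta e * tau e * (nu S e / kappa S e).
    by apply: mulr_gt0; [exact: mulr_gt0|exact: divr_gt0].
  apply: (le_trans h1); rewrite ler_pM2l// lef_pV2 ?posrE//.
    by rewrite ler_peMr// ?lerDl ltW.
  by rewrite mulr_gt0// addr_gt0.
apply: (bigO_normc (C := C1 * Kt * (kappa0 / nu0))); apply: filterS hlam =>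
  e [[e01 [n0 k0] /andP[tg1 tg2] qE _] [_ _ _ h]] k m km.
have /andP[e0 _] := e01; have en0 : e != 0 by exact: lt0r_neq0.
have [eta0 g0 _ _ _] := powers e01.
have [_ _ _ _ [_ [h1 _ _]]] := h k m km.
have t0 : 0 < tau e by rewrite sqrtr_gt0 divr_gt0 ?mulr_gt0// addr_gt0.
have X0 : 0 < eta e * tau e * (nu S e / kappa S e).
  by apply: mulr_gt0; [exact: mulr_gt0|exact: divr_gt0].
apply: (le_trans h1).
apply: (@le_trans _ _ (C1 / (eta e * (eta e * tau e * (nu S e / kappa S e))))).
  have Y1 := mulr_gt0 eta0 X0.
  have Y2 := mulr_gt0 eta0 (addr_gt0 ltr01 X0).
  by rewrite ler_pM2l// lef_pV2 ?posrE// ler_pM2l// lerDr.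
have -> : e `^ (b - a - 2 * (mu / 3) + M / 2) = e `^ (b - a) * g e / eta e ^+ 2.
  rewrite powRD ?en0 ?implybT// powRB ?en0 ?implybT//.
  rewrite (_ : e `^ (2 * (mu / 3)) = eta e ^+ 2); first by rewrite mulrAC.
  by rewrite -powR_mulrn ?powR_ge0// -powRrM mulrC.
rewrite (_ : C1 / _ = C1 / (eta e ^+ 2 * tau e) * (kappa S e / nu S e)); last first.
  by field; rewrite !lt0r_neq0.
rewrite qE /q.
rewrite (_ : C1 * Kt * (kappa0 / nu0) * (e `^ (b - a) * g e / eta e ^+ 2) =
  C1 * Kt * g e / eta e ^+ 2 * (kappa0 / nu0 * e `^ (b - a))); last by ring.
rewrite ler_pM2r; last by rewrite mulr_gt0 ?powR_gt0// divr_gt0.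
rewrite (_ : C1 / _ = C1 / eta e ^+ 2 * (tau e)^-1); last first.
  by field; rewrite !lt0r_neq0.
rewrite (_ : C1 * Kt * g e / eta e ^+ 2 = C1 / eta e ^+ 2 * (Kt * g e)); last by ring.
rewrite ler_pM2l; last by rewrite divr_gt0// exprn_gt0.
rewrite -[leLHS]mul1r ler_pdivrMr//.
have : Kt^-1 * Kt <= tau e * g e * Kt by rewrite ler_pM2r.
by rewrite mulVf ?lt0r_neq0// (_ : tau e * g e * Kt = Kt * g e * tau e)//; ring.
Unshelve. all: by end_near. Qed.

End two_scale_regimes.

(** * Diffusivities of the same order *)

Section equal_diffusivities.
Context {R : realType} (S : setting R).
Hypothesis hgamma : 0 < slope S < pi / 2.
Hypothesis hchi : C0_infty (chi S).
Hypothesis hwave : admissible_wavenumber S.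
Hypothesis hcrit : near_critical S.
Variables (nu0 kappa0 beta : R).
Hypotheses (nu0_gt0 : 0 < nu0) (kappa0_gt0 : 0 < kappa0) (beta6 : 6 < beta).
Hypothesis nuE : \forall e \near 0^'+, nu S e = nu0 * e `^ beta.
Hypothesis kappaE : \forall e \near 0^'+, kappa S e = kappa0 * e `^ beta.

Let h (e : R) := e `^ (beta / 2).

Let powers e : 0 < e ->
  [/\ 0 < h e, e `^ beta = h e ^+ 2, e `^ (beta - 8) = h e ^+ 2 / e ^+ 8,
      e `^ (beta - 6) = h e ^+ 2 / e ^+ 6 &
      [/\ e `^ (1 - beta / 2) = e / h e, e `^ (- (beta / 2)) = (h e)^-1,
          e `^ (- 2) = e ^- 2 & e `^ (- 1) = e^-1]].
Proof.
move=> e0; have en0 : e != 0 by exact: lt0r_neq0.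
have hE : e `^ beta = h e ^+ 2.
  by rewrite -powR_mulrn ?powR_ge0// -powRrM; congr (_ `^ _); field.
split => //; rewrite ?powR_gt0//.
- by rewrite powRB ?en0 ?implybT// hE powR_mulrn// ltW.
- by rewrite powRB ?en0 ?implybT// hE powR_mulrn// ltW.
split.
- by rewrite powRB ?en0 ?implybT// powRr1// ltW.
- by rewrite powRN.
- by rewrite powR_invn// ltW.
- by rewrite powR_inv1// ltW.
Qed.

Lemma three_scale_solution : exists W1 W2 W3 : R -> wave R,
  [/\ bl_wave_slow S (- 2) (beta - 8) (- 2) W1,
      bl_wave S (1 - beta / 2) (- 2) W2,
      bl_wave S (- (beta / 2)) (- 1) W3 &
      consistent_layers S (fun e => addw (addw (W1 e) (W2 e)) (W3 e))].
Proof.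
have n00 := nu0_gt0; have ka00 := kappa0_gt0.
pose P0 := nu0 + kappa0.
have P00 : 0 < P0 by exact: addr_gt0.
have nk0 : 0 < nu0 * kappa0 by exact: mulr_gt0.
have [q10 q20] : 0 < nu0 / kappa0 /\ 0 < kappa0 / nu0 by rewrite !divr_gt0.
have [K K1 [KX sK wpK]] := wave_points_near hgamma hchi hwave hcrit
  (nu0 / kappa0 + kappa0 / nu0).
have K0 : 0 < K by lra.
have qK : K^-1 <= nu0 / kappa0 <= K.
  apply/andP; split; last by lra.
  by rewrite -[leRHS]invrK lef_pV2 ?posrE ?invr_gt0// invf_div; lra.
have [d d0 [c1 c10 [C1 C10 hlay]]] := three_scale_layers hgamma K1 sK.
(* [r2] and [r3] solve the scale equations [(nu + kappa) tau2 ^ 2 = e ^ 2] and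
   [tau3 ^ 2 = (nu + kappa) / (nu kappa)] once the powers of [e] are factored out. *)
pose r2 := (Num.sqrt P0)^-1; pose r3 := Num.sqrt (P0 / (nu0 * kappa0)).
have r20 : 0 < r2 by rewrite invr_gt0 sqrtr_gt0.
have r30 : 0 < r3 by rewrite sqrtr_gt0 divr_gt0.
have r2E : r2 ^+ 2 = P0^-1 by rewrite exprVn sqr_sqrtr// ltW.
have r3E : r3 ^+ 2 = P0 / (nu0 * kappa0) by rewrite sqr_sqrtr// divr_ge0// ltW.
clearbody r2 r3.
pose tau2 e := r2 * (e / h e); pose tau3 e := r3 / h e.
pose good e := [/\ 0 < e, nu S e + kappa S e = P0 * h e ^+ 2 & 0 < h e].
have b60 : 0 < beta - 6 by move: beta6; lra.
have dP0 : 0 < d / P0 by exact: divr_gt0.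
pose bounds e (l1 l2 l3 : R -> R -> R[i]) := good e /\
  [/\ layer S e (fun=> l1), layer S e (fun=> l2), layer S e (fun=> l3) &
    forall k m, supp_Ahat S e (k, m) ->
    [/\ normc (l1 k m) <= C1 / e ^+ 2,
        c1 * ((nu S e + kappa S e) / e ^+ 8) <= Re (l1 k m) <=
          C1 * ((nu S e + kappa S e) / e ^+ 8),
        c1 * tau2 e <= normc (l2 k m) <= C1 * tau2 e,
        c1 * tau3 e <= normc (l3 k m) <= C1 * tau3 e &
        layer_det S (fun=> l1) (fun=> l2) (fun=> l3) e k m != 0 /\
        [/\ normc (amplitude S (fun=> l1) (fun=> l2) (fun=> l3) e k m) <= C1 / e ^+ 2,
            normc (amplitude S (fun=> l2) (fun=> l3) (fun=> l1) e k m) <= C1 / e ^+ 2 &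
            normc (amplitude S (fun=> l3) (fun=> l1) (fun=> l2) e k m) <= C1 / e]]].
have [lam1 [lam2 [lam3 hlam]]] : exists lam1 lam2 lam3 : R -> R -> R -> R[i],
    \forall e \near 0^'+, bounds e (lam1 e) (lam2 e) (lam3 e).
  apply: select_layers; near=> e.
  have /andP[e0 ed] : 0 < e <= d by near: e; exact: near_le1.
  have nE : nu S e = nu0 * e `^ beta by near: e.
  have kE : kappa S e = kappa0 * e `^ beta by near: e.
  have wp : wave_points S K e by near: e.
  have [h0 hE _ h6 _] := powers e0.
  have small : e `^ (beta - 6) <= d / P0 by near: e; exact: powR_small.
  have n0 : 0 < nu S e by rewrite nE mulr_gt0// powR_gt0.
  have k0 : 0 < kappa S e by rewrite kE mulr_gt0// powR_gt0.
  have hN : h e != 0 by exact: lt0r_neq0.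
  have pE : nu S e + kappa S e = P0 * h e ^+ 2 by rewrite nE kE hE /P0; ring.
  have nkE : nu S e / kappa S e = nu0 / kappa0.
    by rewrite nE kE hE; field; rewrite hN lt0r_neq0.
  have pd : (nu S e + kappa S e) / e ^+ 6 <= d.
    by rewrite pE -mulrA -h6 mulrC -ler_pdivlMr.
  have t20 : 0 < tau2 e by rewrite mulr_gt0// divr_gt0.
  have t30 : 0 < tau3 e by rewrite divr_gt0.
  have t2E : (nu S e + kappa S e) * tau2 e ^+ 2 = e ^+ 2.
    by rewrite pE exprMn r2E; field; rewrite hN lt0r_neq0.
  have t3E : tau3 e ^+ 2 = (nu S e + kappa S e) / (nu S e * kappa S e).
    by rewrite pE nE kE hE exprMn r3E; field; rewrite hN !lt0r_neq0.
  have qKe : K^-1 <= nu S e / kappa S e <= K by rewrite nkE.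
  have [lam1 [lam2 [lam3 [l1 l2 l3 hb]]]] :=
    hlay e (tau2 e) (tau3 e) wp e0 n0 k0 qKe pd ed t20 t2E t30 t3E.
  by exists (lam1 e), (lam2 e), (lam3 e); split => //; split.
clear hlay.
have hl : \forall e \near 0^'+, [/\ layer S e lam1, layer S e lam2 & layer S e lam3].
  by apply: filterS hlam => e [_ []].
have hdet : \forall e \near 0^'+, exists M : R, forall k m, supp_Ahat S e (k, m) ->
  layer_det S lam1 lam2 lam3 e k m != 0 /\
  [/\ normc (amplitude S lam1 lam2 lam3 e k m) <= M,
      normc (amplitude S lam2 lam3 lam1 e k m) <= M &
      normc (amplitude S lam3 lam1 lam2 e k m) <= M].
  apply: filterS hlam => e [_ [_ _ _ hb]].
  exists (`|C1 / e ^+ 2| + `|C1 / e|).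
  move=> k m /hb[_ _ _ _ [h0 [h1 h2 h3]]]; split=> //; split.
  - by apply: (le_trans h1); apply: (le_trans (ler_norm _)); rewrite lerDl.
  - by apply: (le_trans h2); apply: (le_trans (ler_norm _)); rewrite lerDl.
  - by apply: (le_trans h3); apply: (le_trans (ler_norm _)); rewrite lerDr.
have [w1 w2 w3] := layers_wellformed hgamma hchi hwave hcrit hl hdet.
have cons := layers_consistent hgamma hchi hwave hcrit hl hdet.
exists (bl_packet S lam1 (amplitude S lam1 lam2 lam3)).
exists (bl_packet S lam2 (amplitude S lam2 lam3 lam1)).
exists (bl_packet S lam3 (amplitude S lam3 lam1 lam2)).
have normc_near (lam : R -> R -> R -> R[i]) : \forall e \near 0^'+,
    forall k m, supp_Ahat S e (k, m) -> 0 <= normc (lam e k m).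
  by apply: nearW => e k m _; exact: normc_ge0.
split => //.
- exists lam1, (amplitude S lam1 lam2 lam3); split => //.
  + apply: (bigO_normc (C := C1)); apply: filterS hlam => e [[e0 _ _] [_ _ _ hb]] k m km.
    by have [_ _ _ _ [_ _ -> _]] := powers e0; have [] := hb k m km.
  + have cP : 0 < c1 * P0 by exact: mulr_gt0.
    apply: (of_orderW cP (C := C1 * P0)).
      apply: filterS hlam => e [[e0 pE _] [_ _ _ hb]] k m km.
      have [_ _ -> _ _] := powers e0; have [_ + _ _ _] := hb k m km.
      by rewrite pE -!mulrA.
    apply: filterS hlam => e [[e0 pE _] [_ _ _ hb]] k m km.
    have [_ /andP[+ _] _ _ _] := hb k m km; apply: le_trans; rewrite pE.
    rewrite mulr_ge0 ?(ltW c10)//; apply: divr_ge0; last by rewrite exprn_ge0// ltW.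
    by rewrite mulr_ge0 ?sqr_ge0// ltW.
  + apply: (bigO_normc (C := C1)); apply: filterS hlam => e [[e0 _ _] [_ _ _ hb]] k m km.
    by have [_ _ _ _ [_ _ -> _]] := powers e0; have [_ _ _ _ [_ []]] := hb k m km.
- exists lam2, (amplitude S lam2 lam3 lam1); split => //.
  + have cr : 0 < c1 * r2 by exact: mulr_gt0.
    apply: (of_orderW cr (C := C1 * r2)) => //.
    apply: filterS hlam => e [[e0 _ _] [_ _ _ hb]] k m km.
    have [_ _ _ _ [-> _ _ _]] := powers e0; have [_ _ + _ _] := hb k m km.
    by rewrite -!(mulrA _ r2).
  + apply: (bigO_normc (C := C1)); apply: filterS hlam => e [[e0 _ _] [_ _ _ hb]] k m km.
    by have [_ _ _ _ [_ _ -> _]] := powers e0; have [_ _ _ _ [_ []]] := hb k m km.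
- exists lam3, (amplitude S lam3 lam1 lam2); split => //.
  + have cr : 0 < c1 * r3 by exact: mulr_gt0.
    apply: (of_orderW cr (C := C1 * r3)) => //.
    apply: filterS hlam => e [[e0 _ _] [_ _ _ hb]] k m km.
    have [_ _ _ _ [_ -> _ _]] := powers e0; have [_ _ _ + _] := hb k m km.
    by rewrite -!(mulrA _ r3).
  + apply: (bigO_normc (C := C1)); apply: filterS hlam => e [[e0 _ _] [_ _ _ hb]] k m km.
    by have [_ _ _ _ [_ _ _ ->]] := powers e0; have [_ _ _ _ [_ []]] := hb k m km.
Unshelve. all: by end_near. Qed.

End equal_diffusivities.

(** * The five regimes *)

Section regimes.
Context {R : realType}.

Lemma addwC (V W : wave R) : addw V W = addw W V.
Proof. by congr Wave; do 3 apply/funext => ?; rewrite addrC. Qed.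

Lemma consistent_layersC (S : setting R) (V W : R -> wave R) :
  consistent_layers S (fun e => addw (V e) (W e)) ->
  consistent_layers S (fun e => addw (W e) (V e)).
Proof.
by rewrite (_ : (fun e => addw (W e) (V e)) = (fun e => addw (V e) (W e)))//;
  apply/funext => e; exact: addwC.
Qed.

Let near_eq (f g : R -> R) : f =1 g -> \forall e \near 0^'+, f e = g e.
Proof. by move=> fg; exact: nearW. Qed.

Let six0 : (0 : R) < 6. Proof. by []. Qed.

Let near_expr6 (x0 : R) : \forall e \near 0^'+, x0 * e ^+ 6 = x0 * e `^ 6.
Proof.
by near=> e; rewrite powR_mulrn//; apply: ltW; near: e; exact: nbhs_right_gt.
Unshelve. all: by end_near. Qed.

(** Cases 1 to 4 differ by which of 6 and [beta] is the smaller exponent and by which diffusivity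
    carries it. At the transitions [beta = 9 / 2] and [beta = 8] the two candidate exponents
    coincide, so either branch of the conditional is correct there. *)
Lemma regime_layers (gamma : R) (chi k0 m0 : R -> R) (c : regime)
    (nu0 kappa0 beta : R)
    (S := Setting gamma chi k0 m0
            (regime_nu c nu0 beta) (regime_kappa c kappa0 beta)) :
  0 < gamma < pi / 2 -> C0_infty chi -> admissible_wavenumber S ->
  near_critical S -> 0 < nu0 -> 0 < kappa0 -> regime_range c beta ->
  exists2 WBL : R -> wave R, regime_form S c beta WBL & consistent_layers S WBL.
Proof.
rewrite /S => hgamma hchi; case: c {S} => /= hwave hcrit n0 ka0 hb;
  set S := Setting _ _ _ _ _ _ in hwave hcrit *.
- have /andP[b0 b6] := hb.
  have [W1 [W2 [h1 h2 h3]]] := @two_scale_solution R S hgamma hchi hwave hcrit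
    nu0 kappa0 6 beta beta 6 n0 ka0
    (or_intror (conj erefl erefl)) b0 (ltW b6) (lexx 6) (near_expr6 nu0)
    (near_eq (frefl _)).
  exists (fun e => addw (W1 e) (W2 e)) => //.
  exists W1, W2, (if 9 / 2 < beta then beta / 3 - 3 else - (beta / 3)); split => //.
  + rewrite (_ : - 3 = - (6 / 2)); last by field.
    by case: ifP => _; apply: h1; [right; field|left].
  + by move=> ->.
  + by move=> /ltW; rewrite leNgt => /negbTE ->.
- have [W1 [W2 [h1 h2 h3]]] := @two_scale_solution R S hgamma hchi hwave hcrit
    nu0 kappa0 6 beta 6 beta n0 ka0
    (or_introl (conj erefl erefl)) six0 (lexx 6) (ltW hb) (near_expr6 nu0)
    (near_eq (frefl _)).
  exists (fun e => addw (W2 e) (W1 e)); last exact: consistent_layersC.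
  exists W2, W1; split => //.
  + by rewrite (_ : - 2 = - (6 / 3)); last field.
  + by apply: h1; right; field.
- have /andP[b0 b6] := hb.
  have [W1 [W2 [h1 h2 h3]]] := @two_scale_solution R S hgamma hchi hwave hcrit
    nu0 kappa0 beta 6 beta 6 n0 ka0
    (or_introl (conj erefl erefl)) b0 (ltW b6) (lexx 6) (near_eq (frefl _))
    (near_expr6 kappa0).
  exists (fun e => addw (W2 e) (W1 e)); last exact: consistent_layersC.
  exists W2, W1; split => //.
  rewrite (_ : - 3 = - (6 / 2)); last by field.
  by apply: h1; right; field.
- have [W1 [W2 [h1 h2 h3]]] := @two_scale_solution R S hgamma hchi hwave hcrit
    nu0 kappa0 beta 6 6 beta n0 ka0
    (or_intror (conj erefl erefl)) six0 (lexx 6) (ltW hb) (near_eq (frefl _))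
    (near_expr6 kappa0).
  exists (fun e => addw (W2 e) (W1 e)); last exact: consistent_layersC.
  exists W2, W1, (if beta < 8 then 2 - beta / 2 else - 2); split => //.
  + by rewrite (_ : - 2 = - (6 / 3)); last field.
  + by case: ifP => _; apply: h1; [right; field|left; field].
  + by move=> ->.
  + by move=> /ltW; rewrite leNgt => /negbTE ->.
have [W1 [W2 [W3 [h1 h2 h3 h4]]]] := @three_scale_solution R S hgamma hchi hwave hcrit
  nu0 kappa0 beta n0 ka0 hb (near_eq (frefl _)) (near_eq (frefl _)).
exists (fun e => addw (addw (W1 e) (W2 e)) (W3 e)) => //.
by exists W1, W2, W3.
Qed.

(** For [e <= 1] the power with the smaller exponent dominates, and [regime_rate] is that power in
    each case. *)
Lemma regime_rate_bound (c : regime) (nu0 kappa0 beta : R) : 0 < nu0 -> 0 < kappa0 ->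
  regime_range c beta -> \forall e \near 0^'+,
  [/\ 0 <= regime_nu c nu0 beta e, 0 <= regime_kappa c kappa0 beta e &
      regime_nu c nu0 beta e + regime_kappa c kappa0 beta e <=
      (nu0 + kappa0) * regime_rate c beta e].
Proof.
move=> n0 ka0 hb; near=> e.
have /andP[e0 e1] : 0 < e <= 1 by near: e; exact: near_le1.
have e6 : e ^+ 6 = e `^ 6 by rewrite powR_mulrn// ltW.
have p0 (x : R) := powR_ge0 e x.
have mono (x y : R) : x <= y -> e `^ y <= e `^ x.
  by move=> xy; apply: ger_powR => //; rewrite e0.
case: c hb => /= hb; rewrite ?e6; split;
  rewrite ?mulr_ge0 ?p0 ?(ltW n0) ?(ltW ka0)//; rewrite mulrDl; apply: lerD => //;
  rewrite ler_pM2l// mono//; first [exact: ltW|by case/andP: hb => _ /ltW].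
Unshelve. all: by end_near. Qed.

End regimes.

Theorem proposition3p1 (R : realType) (gamma : R) (chi : R -> R)
    (k0 m0 : R -> R) (c : regime) (nu0 kappa0 beta : R)
    (S := Setting gamma chi k0 m0
            (regime_nu c nu0 beta) (regime_kappa c kappa0 beta))
    (hgamma : 0 < gamma < pi / 2) (hchi : C0_infty chi)
    (hwave : admissible_wavenumber S) (hcrit : near_critical S)
    (hnu0 : 0 < nu0) (hkappa0 : 0 < kappa0) (hbeta : regime_range c beta) :
  exists WBL : R -> wave R,
    let Wapp := fun e => addw (W_inc S e) (WBL e) in
    [/\ regime_form S c beta WBL,
        exists pBL : R -> field R, \forall e \near 0^'+,
          system gamma (nu S e) (kappa S e) (WBL e) (pBL e) /\
          forall t x : R,
            [/\ u_ (WBL e) t x 0 = - u_ (W_inc S e) t x 0,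
                w_ (WBL e) t x 0 = - w_ (W_inc S e) t x 0 &
                dy (b_ (WBL e)) t x 0 = - dy (b_ (W_inc S e)) t x 0] &
        exists (papp : R -> field R) (Rapp : R -> wave R),
          [/\ \forall e \near 0^'+,
                system_rhs gamma (nu S e) (kappa S e)
                  (Wapp e) (papp e) (Rapp e) /\
                boundary_conditions (Wapp e),
              [/\ L2_bigO (fun e => u_ (Rapp e)) (nu S),
                  L2_bigO (fun e => w_ (Rapp e)) (nu S) &
                  L2_bigO (fun e => b_ (Rapp e)) (kappa S)],
              wave_L2_bigO Rapp (fun e => nu S e + kappa S e) &
              wave_L2_bigO Rapp (regime_rate c beta)]].
Proof.
have hrate := regime_rate_bound hnu0 hkappa0 hbeta.
have n0 : \forall e \near 0^'+, 0 <= nu S e by apply: filterS hrate => e [].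
have ka0 : \forall e \near 0^'+, 0 <= kappa S e by apply: filterS hrate => e [].
have [WBL hform [hBL [papp happ]]] :=
  regime_layers hgamma hchi hwave hcrit hnu0 hkappa0 hbeta.
have [Ru Rw Rb RW] := @remainder_bigO R S hgamma hchi hwave hcrit n0 ka0.
(* The layers solve the system exactly, so the remainder is that of the incident packet alone. *)
exists WBL; split => //; exists papp, (W_rem S); split => //.
apply: wave_L2_bigO_le RW; apply: filterS hrate => e [h1 h2 h3].
by apply/andP; split; [exact: addr_ge0|exact: h3].
Qed.
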